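(* Let $(R,\mathfrak{m},\mathbf{k})$ be a complete Noetherian local reduced ring of mixed characteristic $p>0$ with infinite residue field $\mathbf{k}$, let $A\to R$ be a coefficient ring map for a complete discrete valuation ring $(A,\pi_A,\mathbf{k})$, and let $x_0,\ldots,x_d$ be a fixed set of minimal generators of $\mathfrak{m}$. If $R_{\mathfrak{p}}$ satisfies Serre's condition $(R_n)$ (resp. $(S_n)$) for all $\mathfrak{p}\in U(\mathfrak{m})$, then there exists a Zariski dense open subset $U\subseteq\mathbb{P}^d(\mathbf{k})$ such that for every $a=(a_0:\cdots:a_d)\in\operatorname{Sp}_A^{-1}(U)$, the quotient $R_{\mathfrak{p}}/\mathbf{x}_{\widetilde a}R_{\mathfrak{p}}$ satisfies $(R_n)$ (resp. $(S_n)$) for all $\mathfrak{p}\in U(\mathfrak{m})\cap V(\mathbf{x}_{\widetilde a})$, where $\mathbf{x}_{\widetilde a}=\sum_{i=0}^d\widetilde a_ix_i$.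
   Context: $U(\mathfrak{m})=\operatorname{Spec}R\setminus\{\mathfrak{m}\}$ is the punctured spectrum; $V(\mathbf{x}_{\widetilde a})$ is the set of primes containing $\mathbf{x}_{\widetilde a}$. A reduced local ring is of mixed characteristic $p>0$ if every component of its total ring of fractions has characteristic $0$ and its residue field has characteristic $p$. A coefficient ring of $R$ is a complete discrete valuation ring $(A,\pi_A,\mathbf{k})$ with $\pi_AA=pA$ together with an injective ring map $A\hookrightarrow R$ inducing an isomorphism of residue fields. $\mathbb{P}^d(A)$ is the set of classes $(a_0:\cdots:a_d)$ of tuples in $A^{d+1}$ with at least one unit coordinate, modulo simultaneous multiplication by units; a lift $\widetilde a\in A^{d+1}$ of $a$ is a representing tuple (with some unit coordinate). $\operatorname{Sp}_A:\mathbb{P}^d(A)\to\mathbb{P}^d(\mathbf{k})$ is reduction of a lift modulo $\pi_A$. The ideal $\mathbf{x}_{\widetilde a}R$ depends only on $a$. *)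

(* Defs.v *)
From HB Require Import structures.
From mathcomp Require Import all_boot all_algebra ring.
From mathcomp Require Import boolp classical_sets cardinality.
From mathcomp Require Import mpoly.

Set Implicit Arguments.
Unset Strict Implicit.
Unset Printing Implicit Defensive.

Import GRing.Theory.
Local Open Scope classical_set_scope.
Local Open Scope ring_scope.
Local Open Scope quotient_scope.

(* Lets an ideal, coerced to a set, be applied as a predicate.                *)
Identity Coercion set_pred : set >-> Funclass.

(* ring_quotient.idealr only covers proper ideals of nonzero rings.  Below    *)
(* ideals may be the whole ring and rings may be zero, so that quotients and  *)
(* localizations need no side condition to be formed.                         *)
Record ideal (R : comPzRingType) := Ideal {
  ideal_set :> set R;
  ideal0 : ideal_set 0;
  idealD : forall a b, ideal_set a -> ideal_set b -> ideal_set (a + b);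
  idealM : forall a b, ideal_set b -> ideal_set (a * b)
}.

Record spec (R : comPzRingType) := Spec {
  spec_ideal :> ideal R;
  spec_proper : ~ spec_ideal 1;
  spec_prime : forall a b,
    spec_ideal (a * b) -> spec_ideal a \/ spec_ideal b
}.

Record mulset (R : comPzRingType) := Mulset {
  mulset_set :> set R;
  mulset1 : mulset_set 1;
  mulsetM : forall a b, mulset_set a -> mulset_set b -> mulset_set (a * b)
}.

Section Ideals.
Variable R : comPzRingType.
Implicit Types (I J : ideal R) (P : spec R) (S : set R).

Definition gen_set S : set R := [set x | forall I, S `<=` I -> I x].

Lemma gen_set0 S : gen_set S 0.
Proof. by move=> I _; exact: ideal0. Qed.

Lemma gen_setD S a b : gen_set S a -> gen_set S b -> gen_set S (a + b).
Proof. by move=> Sa Sb I SI; apply: idealD; [exact: Sa|exact: Sb]. Qed.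

Lemma gen_setM S a b : gen_set S b -> gen_set S (a * b).
Proof. by move=> Sb I SI; apply: idealM; exact: Sb. Qed.

Definition gen S : ideal R := Ideal (@gen_set0 S) (@gen_setD S) (@gen_setM S).

Definition princ (a : R) : ideal R := gen [set a].

Definition ideal_mul I J : ideal R :=
  gen [set z | exists a b, [/\ I a, J b & z = a * b]].

Fixpoint ideal_exp I (n : nat) : ideal R :=
  if n is n'.+1 then ideal_mul I (ideal_exp I n') else gen [set 1].

Definition maximal_ideal I : Prop :=
  ~ I 1 /\ forall J, I `<=` J -> ~ J 1 -> J = I :> set R.

Definition local_ring (m : ideal R) : Prop :=
  maximal_ideal m /\ forall J, maximal_ideal J -> J = m :> set R.

Definition noetherian : Prop :=
  forall I, exists s : seq R, I = gen [set` s] :> set R.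

Definition reduced : Prop := forall (a : R) (n : nat), a ^+ n = 0 -> a = 0.

(* The canonical map from R to the limit of the R/I^n is bijective. *)
Definition adic_complete I : Prop :=
  (forall a, (forall n, ideal_exp I n a) -> a = 0) /\
  (forall u : nat -> R, (forall n, ideal_exp I n (u n.+1 - u n)) ->
     exists l, forall n, ideal_exp I n (u n - l)).

Definition minimal_prime P : Prop :=
  forall Q : spec R, Q `<=` P -> Q = P :> set R.

(* Only the values c 0, ..., c n matter. *)
Definition prime_chain (c : nat -> spec R) (n : nat) : Prop :=
  forall i, (i < n)%N -> (c i : set R) `<` (c i.+1 : set R).

Definition has_krull_dim (n : nat) : Prop :=
  (exists c, prime_chain c n) /\
  (forall c k, prime_chain c k -> (k <= n)%N).

Definition regular_seq (s : seq R) : Prop :=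
  (forall i a, (i < size s)%N ->
     gen [set` take i s] (s`_i * a) -> gen [set` take i s] a) /\
  ~ gen [set` s] 1.

Definition has_depth (m : ideal R) (n : nat) : Prop :=
  (exists s, [/\ regular_seq s, [set` s] `<=` m & size s = n]) /\
  (forall s, regular_seq s -> [set` s] `<=` m -> (size s <= n)%N).

Definition regular_local : Prop :=
  noetherian /\
  exists (m : ideal R) (s : seq R),
    [/\ local_ring m, gen [set` s] = m :> set R & has_krull_dim (size s)].

Definition minimal_generators (m : ideal R) (d : nat) (x : 'I_d -> R) : Prop :=
  gen (range x) = m :> set R /\
  forall i, gen (x @` [set j | j != i]) <> m :> set R.

Definition punctured_spec (m : ideal R) : set (spec R) :=
  [set P | (P : set R) <> m].

Definition primes_over (a : R) : set (spec R) := [set P | P a].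

End Ideals.

Section QuotientRing.
Variables (R : comPzRingType) (I : ideal R).

Definition ideal_pred : {pred R} := [pred x | `[< I x >]].

Fact ideal_pred_zmod : zmod_closed ideal_pred.
Proof.
split; first by apply/asboolP; exact: ideal0.
move=> a b /asboolP Ia /asboolP Ib; apply/asboolP; apply: idealD => //.
by rewrite -mulN1r; exact: idealM.
Qed.

HB.instance Definition _ := GRing.isZmodClosed.Build R ideal_pred
  ideal_pred_zmod.

Definition quo := @Quotient.quot R ideal_pred.

HB.instance Definition _ := EqQuotient.on quo.
HB.instance Definition _ := Choice.on quo.
HB.instance Definition _ := GRing.Zmodule.on quo.

Let eq_quo (a b : R) : (\pi_quo a = \pi_quo b) <-> I (a - b).
Proof.
rewrite (rwP eqP) -Quotient.idealrBE; split => [/asboolP //|Iab].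
exact/asboolP.
Qed.

Definition quo1 : quo := \pi_quo 1.
Definition quoM := lift_op2 quo *%R.

Let quoME a b : quoM (\pi_quo a) (\pi_quo b) = \pi_quo (a * b).
Proof.
have Ir c : I (repr (\pi_quo c) - c) by apply/eq_quo; rewrite reprK.
unlock quoM; apply/eq_quo; set a' := repr _; set b' := repr _.
have -> : a' * b' - a * b = b' * (a' - a) + a * (b' - b).
  by rewrite !mulrBr mulrC [b' * a]mulrC addrA subrK.
by apply: idealD; apply: idealM; exact: Ir.
Qed.

Fact quoMA : associative quoM.
Proof.
by elim/quotW=> a; elim/quotW=> b; elim/quotW=> c; rewrite !quoME mulrA.
Qed.

Fact quoMC : commutative quoM.
Proof. by elim/quotW=> a; elim/quotW=> b; rewrite !quoME mulrC. Qed.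

Fact quo1M : left_id quo1 quoM.
Proof. by elim/quotW=> a; rewrite quoME mul1r. Qed.

Fact quoMD : left_distributive quoM +%R.
Proof.
have piD a b : \pi_quo a + \pi_quo b = \pi_quo (a + b).
  by rewrite (@Quotient.pi_add R ideal_pred).
elim/quotW=> a; elim/quotW=> b; elim/quotW=> c.
by rewrite piD !quoME piD mulrDl.
Qed.

HB.instance Definition _ :=
  GRing.Zmodule_isComPzRing.Build quo quoMA quoMC quo1M quoMD.

End QuotientRing.

Section Localization.
Variables (R : comPzRingType) (S : mulset R).

Definition den : pred R := fun s => `[< S s >].

Definition frac := (R * {s : R | den s})%type.

Fact denP (x : frac) : S (sval x.2). Proof. exact: (asboolW (svalP x.2)). Qed.

Definition mkfrac a s (Ss : S s) : frac := (a, exist _ s (asboolT Ss : den s)).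

Definition frac_eq (x y : frac) : bool :=
  `[< exists2 u, S u & u * (x.1 * sval y.2) = u * (y.1 * sval x.2) >].

Let frac_eqP x y : reflect
  (exists2 u, S u & u * (x.1 * sval y.2) = u * (y.1 * sval x.2)) (frac_eq x y).
Proof. exact: asboolP. Qed.

Fact frac_eq_equiv : equiv_class_of frac_eq.
Proof.
split=> [x|x y|y x z].
- by apply/frac_eqP; exists 1 => //; exact: mulset1.
- by apply/frac_eqP/frac_eqP => -[u Su e]; exists u.
move=> /frac_eqP[u Su e1] /frac_eqP[v Sv e2]; apply/frac_eqP.
exists (u * v * sval y.2); first by do !apply: mulsetM => //; exact: denP.
have -> : u * v * sval y.2 * (x.1 * sval z.2)
        = v * sval z.2 * (u * (x.1 * sval y.2)) by ring.
have -> : u * v * sval y.2 * (z.1 * sval x.2)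
        = u * sval x.2 * (v * (z.1 * sval y.2)) by ring.
by rewrite e1 -e2; ring.
Qed.

Canonical frac_equiv := EquivRelPack frac_eq_equiv.

Definition loc := {eq_quot frac_eq}.

HB.instance Definition _ := EqQuotient.on loc.
HB.instance Definition _ := Choice.on loc.

Let eq_loc (x y : frac) : (\pi_loc x = \pi_loc y) <->
  (exists2 u, S u & u * (x.1 * sval y.2) = u * (y.1 * sval x.2)).
Proof. by rewrite (rwP eqP) eqmodE (rwP (frac_eqP x y)). Qed.

Let rep_loc (x : frac) : let y := repr (\pi_loc x) in
  exists2 u, S u & u * (y.1 * sval x.2) = u * (x.1 * sval y.2).
Proof. by move=> y; apply/eq_loc; rewrite reprK. Qed.

Definition fracD (x y : frac) : frac :=
  mkfrac (x.1 * sval y.2 + y.1 * sval x.2) (mulsetM (denP x) (denP y)).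
Definition fracN (x : frac) : frac := (- x.1, x.2).
Definition fracM (x y : frac) : frac :=
  mkfrac (x.1 * y.1) (mulsetM (denP x) (denP y)).

Definition loc_map (a : R) : loc := \pi_loc (mkfrac a (mulset1 S)).
Definition locD := lift_op2 loc fracD.
Definition locN := lift_op1 loc fracN.
Definition locM := lift_op2 loc fracM.

Let locDE x y : locD (\pi_loc x) (\pi_loc y) = \pi_loc (fracD x y).
Proof.
unlock locD; apply/eq_loc.
have [u Su eu] := rep_loc x; have [v Sv ev] := rep_loc y.
exists (u * v); first exact: mulsetM.
move: (repr (\pi_loc x)) (repr (\pi_loc y)) eu ev => x' y' eu ev /=.
transitivity (u * (x'.1 * sval x.2) * (v * sval y'.2 * sval y.2)
            + v * (y'.1 * sval y.2) * (u * sval x'.2 * sval x.2)).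
  by ring.
by rewrite eu ev; ring.
Qed.

Let locNE x : locN (\pi_loc x) = \pi_loc (fracN x).
Proof.
unlock locN; apply/eq_loc; have [u Su eu] := rep_loc x; exists u => //=.
by rewrite !mulNr !mulrN eu.
Qed.

Let locME x y : locM (\pi_loc x) (\pi_loc y) = \pi_loc (fracM x y).
Proof.
unlock locM; apply/eq_loc.
have [u Su eu] := rep_loc x; have [v Sv ev] := rep_loc y.
exists (u * v); first exact: mulsetM.
move: (repr (\pi_loc x)) (repr (\pi_loc y)) eu ev => x' y' eu ev /=.
transitivity (u * (x'.1 * sval x.2) * (v * (y'.1 * sval y.2))); first by ring.
by rewrite eu ev; ring.
Qed.

Let eq_frac (x y : frac) :
  x.1 * sval y.2 = y.1 * sval x.2 -> \pi_loc x = \pi_loc y.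
Proof. by move=> e; apply/eq_loc; exists 1; [exact: mulset1|rewrite e]. Qed.

Fact locDA : associative locD.
Proof.
elim/quotW=> x; elim/quotW=> y; elim/quotW=> z; rewrite !locDE.
by apply: eq_frac => /=; ring.
Qed.

Fact locDC : commutative locD.
Proof.
by elim/quotW=> x; elim/quotW=> y; rewrite !locDE; apply: eq_frac => /=; ring.
Qed.

Fact loc0D : left_id (loc_map 0) locD.
Proof. by elim/quotW=> x; rewrite locDE; apply: eq_frac => /=; ring. Qed.

Fact locND : left_inverse (loc_map 0) locN locD.
Proof.
by elim/quotW=> x; rewrite locNE locDE; apply: eq_frac => /=; ring.
Qed.

HB.instance Definition _ := GRing.isZmodule.Build loc locDA locDC loc0D locND.

Fact locMA : associative locM.
Proof.
elim/quotW=> x; elim/quotW=> y; elim/quotW=> z; rewrite !locME.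
by apply: eq_frac => /=; ring.
Qed.

Fact locMC : commutative locM.
Proof.
by elim/quotW=> x; elim/quotW=> y; rewrite !locME; apply: eq_frac => /=; ring.
Qed.

Fact loc1M : left_id (loc_map 1) locM.
Proof. by elim/quotW=> x; rewrite locME; apply: eq_frac => /=; ring. Qed.

Fact locMDl : left_distributive locM locD.
Proof.
elim/quotW=> x; elim/quotW=> y; elim/quotW=> z; rewrite locDE !locME locDE.
by apply: eq_frac => /=; ring.
Qed.

HB.instance Definition _ :=
  GRing.Zmodule_isComPzRing.Build loc locMA locMC loc1M locMDl.

End Localization.

Section Serre.
Variable R : comPzRingType.

Fact prime_compl1 (P : spec R) : (~` P) 1. Proof. exact: spec_proper. Qed.

Fact prime_complM (P : spec R) a b : (~` P) a -> (~` P) b -> (~` P) (a * b).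
Proof. by move=> Pa Pb /spec_prime[]. Qed.

Definition prime_compl (P : spec R) : mulset R :=
  Mulset (@prime_compl1 P) (@prime_complM P).

Definition loc_at (P : spec R) := loc (prime_compl P).

HB.instance Definition _ (P : spec R) := GRing.ComPzRing.on (loc_at P).

(* The ring R_P / a R_P. *)
Definition loc_quo (P : spec R) (a : R) :=
  quo (princ (loc_map (prime_compl P) a)).

HB.instance Definition _ (P : spec R) (a : R) :=
  GRing.ComPzRing.on (loc_quo P a).

Definition nonzerodivisors : set R := [set s | forall a, s * a = 0 -> a = 0].

Fact nzd1 : nonzerodivisors 1. Proof. by move=> a; rewrite mul1r. Qed.

Fact nzdM a b :
  nonzerodivisors a -> nonzerodivisors b -> nonzerodivisors (a * b).
Proof. by move=> na nb c; rewrite -mulrA => /na /nb. Qed.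

Definition total_fractions := loc (Mulset nzd1 nzdM).

HB.instance Definition _ := GRing.ComPzRing.on total_fractions.

Definition serreR (n : nat) : Prop :=
  forall (Q : spec R) (h : nat),
    has_krull_dim (loc_at Q) h -> (h <= n)%N -> regular_local (loc_at Q).

(* depth R_Q >= min (n, dim R_Q); for Noetherian R both numbers are finite. *)
Definition serreS (n : nat) : Prop :=
  forall Q : spec R, exists (m : ideal (loc_at Q)) (h e : nat),
    [/\ local_ring m, has_krull_dim (loc_at Q) h, has_depth m e
      & (minn n h <= e)%N].

End Serre.

Definition residue_map (R : comPzRingType) (m : ideal R) (k : fieldType)
    (res : {rmorphism R -> k}) : Prop :=
  (forall c, exists a, res a = c) /\ (forall a, res a = 0 <-> m a).

(* The components of the total ring of fractions are its quotients by its     *)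
(* minimal primes; for reduced Noetherian R it is the product of these.       *)
Definition mixed_characteristic (R : comPzRingType) (k : fieldType) (p : nat)
    : Prop :=
  [/\ reduced R,
      forall M : spec (total_fractions R),
        minimal_prime M -> forall n, n%:R = 0 :> quo M -> n = 0%N
    & p \in [pchar k]].

Definition is_dvr (A : idomainType) (pi : A) : Prop :=
  [/\ forall I : ideal A, exists a, I = princ a :> set A,
      local_ring (princ pi) & pi != 0].

(* The residue fields of A and of R are identified with the same field k, via *)
(* resA and resR; phi then induces the identity of k.                         *)
Definition coefficient_ring (R : comNzRingType) (k : fieldType)
    (resR : {rmorphism R -> k}) (p : nat) (A : idomainType) (piA : A)
    (resA : {rmorphism A -> k}) (phi : {rmorphism A -> R}) : Prop :=
  [/\ is_dvr piA /\ adic_complete (princ piA),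
      residue_map (princ piA) resA,
      princ piA = princ (p%:R : A) :> set A,
      injective phi
    & forall a, resR (phi a) = resA a].

Section ProjectiveSpace.
Variables (K : comUnitRingType) (d : nat).

Definition plift := {v : 'rV[K]_d.+1 | [exists i, v 0 i \is a GRing.unit]}.

Definition lift_eq (v w : plift) : bool :=
  `[< exists2 u : K, u \is a GRing.unit & val w = u *: val v >].

Fact lift_eq_equiv : equiv_class_of lift_eq.
Proof.
split=> [v|v w|w v z].
- by apply/asboolP; exists 1; rewrite ?unitr1 ?scale1r.
- apply/asboolP/asboolP => -[u Uu e]; exists u^-1; rewrite ?unitrV //.
    by rewrite e scalerA mulVr // scale1r.
  by rewrite e scalerA mulVr // scale1r.
move=> /asboolP[u Uu e1] /asboolP[t Ut e2]; apply/asboolP.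
by exists (t * u); rewrite ?unitrMl // e2 e1 scalerA.
Qed.

Canonical lift_equiv := EquivRelPack lift_eq_equiv.

Definition proj := {eq_quot lift_eq}.

HB.instance Definition _ := EqQuotient.on proj.
HB.instance Definition _ := Choice.on proj.

Definition lift_of (v : plift) (a : proj) : Prop := \pi_proj v = a.

End ProjectiveSpace.

Section Specialization.
Variables (A K : comUnitRingType) (res : {rmorphism A -> K}) (d : nat).

Fact lift_res_subproof (v : plift A d) :
  [exists i, map_mx res (val v) 0 i \is a GRing.unit].
Proof.
have /existsP[i Ui] := valP v.
by apply/existsP; exists i; rewrite mxE rmorph_unit.
Qed.

Definition lift_res (v : plift A d) : plift K d :=
  exist _ (map_mx res (val v)) (lift_res_subproof v).

Definition Sp (a : proj A d) : proj K d := \pi_(proj K d) (lift_res (repr a)).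

Lemma Sp_pi (v : plift A d) :
  Sp (\pi_(proj A d) v) = \pi_(proj K d) (lift_res v).
Proof.
apply/eqmodP/asboolP.
have /eqmodP/asboolP[u Uu e] : repr (\pi_(proj A d) v) = v %[mod proj A d].
  by rewrite reprK.
by exists (res u); rewrite ?rmorph_unit //= e map_mxZ.
Qed.

End Specialization.

Arguments Sp {A K} res {d} a.

Section Zariski.
Variables (k : fieldType) (d : nat).

Definition vanishes (f : {mpoly k[d.+1]}) (a : proj k d) : Prop :=
  forall v, lift_of v a -> f.@[fun i => val v 0 i] = 0.

Definition zariski_open (U : set (proj k d)) : Prop :=
  exists F : set {mpoly k[d.+1]},
    (forall f, F f -> exists e, f \is e.-homog) /\
    ~` U = [set a | forall f, F f -> vanishes f a].

Definition zariski_dense (U : set (proj k d)) : Prop :=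
  forall V, zariski_open V -> V !=set0 -> (V `&` U) !=set0.

End Zariski.

Definition lincomb (A R : comNzRingType) (phi : A -> R) (d : nat)
    (x : 'I_d.+1 -> R) (v : 'rV[A]_d.+1) : R :=
  \sum_(i < d.+1) phi (v 0 i) * x i.

(* Main.v *)
(** The hyperplane [x_a = 0] can destroy (R_n) or (S_n) at a prime [Q] only in
    two ways: [Q] already lies in a bad locus, or [x_a] lies in [Q^(2)].  By
    Noetherian induction on [Spec R] it is enough to control, for each prime
    [P <> m], the primes [Q] in a neighbourhood of [P] in [V(P)].

    Near [P] the ring [R/P] is regular: by Cohen, [R] is a quotient of a power
    series ring over [A], and [R/P] is a quotient of one over [A] or [k];
    Weierstrass preparation presents it by successive simple algebraic
    extensions, and openness of the regular locus reduces to finding enough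
    derivations.  In characteristic [p] these exist because an element of the
    fraction field that is killed by all derivations with bounded denominators
    is a [p]-th power.  Hence (R_n) and (S_n) behave well near [P].

    The Jacobian matrix at [P] gives [t >= dim R/P] derivations with values in
    [R/P], independent at [P] (if [p] is not in [P], the last one is only the
    tautological row [(x_i)]), such that [x_a] in [Q^(2)] forces [t] linear
    forms in [a] to lie in [Q].  By a height count in [R[T_0, ..., T_d]]
    this does not happen for generic [a], and then [x_a] is part of a minimal
    generating set of [Q R_Q].  The exceptional polynomials multiply to a single
    nonzero one over [k], whose homogeneous components define the open set. *)
Require Import Defs.
From HB Require Import structures.
From mathcomp Require Import all_boot all_algebra ring zify.
From mathcomp Require Import boolp classical_sets cardinality.
From mathcomp Require Import mpoly.

Set Implicit Arguments.
Unset Strict Implicit.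
Unset Printing Implicit Defensive.

Import GRing.Theory.
Local Open Scope classical_set_scope.
Local Open Scope ring_scope.

(** * Ideals, localization and Noetherian induction *)

(** Two points shape the proof. First, only the residues of the coordinates matter, because an
    element of [R] with nonzero residue is a unit and avoids every prime. So for each [P] it is
    enough to find a polynomial over [R], outside the extension of the maximal ideal, whose value at
    [a] must lie in [Q] whenever [x_a] is in [Q^(2)] and [Q] is near [P]. It exists because [t]
    independent linear forms have height at least [t] over [P] away from a minor: a prime strictly
    inside the extended maximal ideal that contained them there would give the latter height more
    than [t] over [P].

    Second, if [p] is not in [P] the count of derivations is one short: power series over [A] in d+1
    variables have dimension d+2, and there is no derivative along [p]. The row [(x_i)] fills the
    gap, since its form takes the value [x_a], which is in [Q] anyway. It is independent of the
    others because [p] is a combination of the [x_i]: otherwise [P] would be stable under the Euler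
    operator, which isolates the constant term [p] of that relation and forces [p] into [P]. *)

HB.instance Definition _ (R : comPzRingType) := gen_eqMixin (spec R).

Section IdealBasics.
Variable R : comPzRingType.
Implicit Types (I J K : ideal R) (P Q : spec R) (s : seq R) (a b c x y t : R).

Lemma ideal_eqP I J : I `<=` J -> J `<=` I -> I = J.
Proof.
case: I J => [I i1 i2 i3] [J j1 j2 j3] /= IJ JI.
have E : I = J by apply/seteqP.
by subst J; congr Ideal; exact: Prop_irrelevance.
Qed.

Lemma idealN I a : I a -> I (- a).
Proof. by rewrite -mulN1r; exact: idealM. Qed.

Lemma idealB I a b : I a -> I b -> I (a - b).
Proof. by move=> Ia Ib; apply: idealD => //; exact: idealN. Qed.

Lemma idealMr I a b : I a -> I (a * b).
Proof. by rewrite mulrC; exact: idealM. Qed.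

Lemma idealBr I a b : I (a - b) -> I b -> I a.
Proof. by move=> Iab Ib; rewrite -(subrK b a); exact: idealD. Qed.

Lemma idealBl I a b : I (a - b) -> I a -> I b.
Proof.
by move=> Iab Ia; apply: (idealBr _ Ia); rewrite -opprB; exact: idealN.
Qed.

Lemma icast I a b : I a -> b = a -> I b. Proof. by move=> Ia ->. Qed.

Lemma ideal_sum (T : Type) I (r : seq T) (p : pred T) (F : T -> R) :
  (forall i, p i -> I (F i)) -> I (\sum_(i <- r | p i) F i).
Proof. by move=> IF; elim/big_ind: _ => //; [exact: ideal0|exact: idealD]. Qed.

Lemma ideal_top I : I 1 -> forall a, I a.
Proof. by move=> I1 a; rewrite -[a]mulr1; exact: idealM. Qed.

Lemma primeX P a n : P (a ^+ n) -> P a.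
Proof.
elim: n => [|n IH]; first by rewrite expr0 => /spec_proper.
by rewrite exprS => /spec_prime[].
Qed.

Lemma primeNM P a b : ~ P a -> ~ P b -> ~ P (a * b).
Proof. by move=> Pa Pb /spec_prime[]. Qed.

Lemma primeNX P a n : ~ P a -> ~ P (a ^+ n).
Proof. by move=> Pa /primeX. Qed.

Lemma primeMl P a b : ~ P a -> P (a * b) -> P b.
Proof. by move=> Pa /spec_prime[]. Qed.

Lemma prime_prod P (T : eqType) (r : seq T) (F : T -> R) :
  (forall i, i \in r -> ~ P (F i)) -> ~ P (\prod_(i <- r) F i).
Proof.
move=> PF; rewrite big_seq; elim/big_ind: _ => //; first exact: spec_proper.
by move=> ? ?; exact: primeNM.
Qed.

Definition itop : ideal R :=
  @Ideal R setT (Logic.I : setT 0) (fun _ _ _ _ => Logic.I) (fun _ _ _ => Logic.I).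

Fact izero0 : [set (0 : R)] 0. Proof. by []. Qed.
Fact izeroD a b : [set (0 : R)] a -> [set (0 : R)] b -> [set (0 : R)] (a + b).
Proof. by move=> -> ->; rewrite addr0. Qed.
Fact izeroM a b : [set (0 : R)] b -> [set (0 : R)] (a * b).
Proof. by move=> ->; rewrite mulr0. Qed.
Definition izero : ideal R := Ideal izero0 izeroD izeroM.

Lemma izero_sub I : izero `<=` I. Proof. by move=> a ->; exact: ideal0. Qed.

Definition adjp_set I K x : set R := [set a | exists2 c, K c & I (a - c * x)].
Fact adjp0 I K x : adjp_set I K x 0.
Proof. by exists 0; rewrite ?mul0r ?subr0; exact: ideal0. Qed.
Fact adjpD I K x a b :
  adjp_set I K x a -> adjp_set I K x b -> adjp_set I K x (a + b).
Proof.
move=> [c Kc Ic] [d Kd Id]; exists (c + d); first exact: idealD.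
have -> : a + b - (c + d) * x = (a - c * x) + (b - d * x) by ring.
exact: idealD.
Qed.
Fact adjpM I K x a b : adjp_set I K x b -> adjp_set I K x (a * b).
Proof.
move=> [c Kc Ic]; exists (a * c); first exact: idealM.
by rewrite -mulrA -mulrBr; exact: idealM.
Qed.
Definition adjp I K x : ideal R := Ideal (@adjp0 I K x) (@adjpD I K x) (@adjpM I K x).

Definition adj I x := adjp I itop x.
Definition adjs I s := foldl adj I s.
Definition adjps I K s := foldl (fun N x => adjp N K x) I s.

Lemma adjpP I K x a b : I b -> K a -> adjp I K x (b + a * x).
Proof. by move=> Ib Ka; exists a => //; rewrite addrK. Qed.

Lemma sub_adjp I K x : I `<=` adjp I K x.
Proof.
by move=> a Ia; exists 0; rewrite ?mul0r ?subr0 //; exact: ideal0.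
Qed.

Lemma sub_adj I x : I `<=` adj I x. Proof. exact: sub_adjp. Qed.

Lemma adj_in I x : adj I x x.
Proof. by exists 1 => //; rewrite mul1r subrr; exact: ideal0. Qed.

Lemma adj_min I J x : I `<=` J -> J x -> adj I x `<=` J.
Proof.
by move=> IJ Jx a [c _ /IJ Jc]; apply: (idealBr Jc); exact: idealM.
Qed.

Lemma adj_mono I J x : I `<=` J -> adj I x `<=` adj J x.
Proof. by move=> IJ a [c Kc /IJ Jc]; exists c. Qed.

Lemma sub_adjs I s : I `<=` adjs I s.
Proof.
elim: s I => [I a //|x s IH I a Ia /=]; apply: IH; exact: sub_adj.
Qed.

Lemma adjs_in I s x : x \in s -> adjs I s x.
Proof.
elim: s I => //= y s IH I; rewrite inE => /orP[/eqP ->|/IH h]; last exact: h.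
by apply: sub_adjs; exact: adj_in.
Qed.

Lemma adjs_min I J s : I `<=` J -> (forall x, x \in s -> J x) -> adjs I s `<=` J.
Proof.
elim: s I => [I IJ _ //|x s IH I IJ Js /=]; apply: IH.
  by apply: adj_min => //; apply: Js; rewrite inE eqxx.
by move=> y ys; apply: Js; rewrite inE ys orbT.
Qed.

Lemma adjs_mono I J s : I `<=` J -> adjs I s `<=` adjs J s.
Proof.
by move=> IJ; apply: adjs_min => [a /IJ|x]; [exact: sub_adjs|exact: adjs_in].
Qed.

Lemma adjs_cat I s1 s2 : adjs I (s1 ++ s2) = adjs (adjs I s1) s2.
Proof. exact: foldl_cat. Qed.

Lemma adjs_rcons I s x : adjs I (rcons s x) = adj (adjs I s) x.
Proof. by rewrite -cats1 adjs_cat. Qed.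

Lemma adj_adjs I s x : adj (adjs I s) x = adjs (adj I x) s.
Proof.
apply: ideal_eqP.
  apply: adj_min; last by apply: sub_adjs; exact: adj_in.
  by apply: adjs_mono; exact: sub_adj.
apply: adjs_min => [|y ys]; first by apply: adj_mono; exact: sub_adjs.
by apply: sub_adj; exact: adjs_in.
Qed.

Lemma adjC I x y : adj (adj I x) y = adj (adj I y) x.
Proof. exact: (adj_adjs I [:: x] y). Qed.

Lemma gen_min (S : set R) I : S `<=` I -> gen S `<=` I.
Proof. by move=> SI a; apply. Qed.

Lemma sub_gen (S : set R) : S `<=` gen S.
Proof. by move=> a Sa I; apply. Qed.

Lemma gen_adjs s : gen [set` s] = adjs izero s.
Proof.
apply: ideal_eqP; first by apply: gen_min => x /=; exact: adjs_in.
by apply: adjs_min => [|x xs]; [exact: izero_sub|exact: sub_gen].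
Qed.

Fact colon0 I t : [set a | I (t * a)] 0.
Proof. by rewrite /= mulr0; exact: ideal0. Qed.
Fact colonD I t a b : [set a | I (t * a)] a -> [set a | I (t * a)] b ->
  [set a | I (t * a)] (a + b).
Proof. by rewrite /= mulrDr; exact: idealD. Qed.
Fact colonM I t a b : [set a | I (t * a)] b -> [set a | I (t * a)] (a * b).
Proof. by rewrite /= mulrCA; exact: idealM. Qed.
Definition colon I t : ideal R := Ideal (@colon0 I t) (@colonD I t) (@colonM I t).

(* Local properties at [Q] are expressed inside [R]: [sat Q I] is the contraction
   of [I R_Q].  Accordingly, below, [regs I Q s] says that [s] is a regular
   sequence on [(R/I)_Q], [gens_at I Q s] that [s] generates the maximal ideal of
   [(R/I)_Q], [hge I Q h] that [ht (Q/I) >= h], and [reg I Q] that [(R/I)_Q] is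
   regular. *)
Definition sat_set Q I : set R := [set a | exists2 t, ~ Q t & I (t * a)].
Fact sat0 Q I : sat_set Q I 0.
Proof. by exists 1; [exact: spec_proper|rewrite mulr0; exact: ideal0]. Qed.
Fact satD Q I a b : sat_set Q I a -> sat_set Q I b -> sat_set Q I (a + b).
Proof.
move=> [t Qt It] [u Qu Iu]; exists (t * u); first exact: primeNM.
have -> : t * u * (a + b) = u * (t * a) + t * (u * b) by ring.
by apply: idealD; exact: idealM.
Qed.
Fact satM Q I a b : sat_set Q I b -> sat_set Q I (a * b).
Proof. by move=> [t Qt It]; exists t => //; rewrite mulrCA; exact: idealM. Qed.
Definition sat Q I : ideal R := Ideal (@sat0 Q I) (@satD Q I) (@satM Q I).

Lemma sub_sat Q I : I `<=` sat Q I.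
Proof. by move=> a Ia; exists 1; [exact: spec_proper|rewrite mul1r]. Qed.

Lemma sat_mono Q I J : I `<=` J -> sat Q I `<=` sat Q J.
Proof. by move=> IJ a [t Qt /IJ Jt]; exists t. Qed.

Lemma sat_cancel Q I t a : ~ Q t -> sat Q I (t * a) -> sat Q I a.
Proof.
move=> Qt [u Qu Iu]; exists (u * t); first exact: primeNM.
by rewrite -mulrA.
Qed.

Lemma sat_idem Q I a : sat Q (sat Q I) a -> sat Q I a.
Proof. by move=> [t Qt]; exact: sat_cancel. Qed.

Lemma sat_prime Q P : P `<=` Q -> sat Q P `<=` P.
Proof. by move=> PQ a [t Qt /spec_prime[/PQ|]]. Qed.

Lemma sat_weak Q P I : P `<=` Q -> sat Q I `<=` sat P I.
Proof. by move=> PQ a [t Qt It]; exists t => // /PQ. Qed.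

Lemma spec_eqP P Q : P `<=` Q -> Q `<=` P -> P = Q.
Proof.
case: P Q => [P p1 p2] [Q q1 q2] /= PQ QP.
have E := ideal_eqP PQ QP; subst Q.
by congr Spec; exact: Prop_irrelevance.
Qed.

End IdealBasics.

Section Noetherian.
Variable R : comPzRingType.
Hypothesis nR : noetherian R.
Implicit Types (I J K : ideal R) (P Q : spec R) (s : seq R) (a b c x y t : R).

Lemma noeth_fg I : exists s, I = adjs (izero R) s.
Proof.
have [s Es] := nR I; exists s; rewrite -gen_adjs.
by apply: ideal_eqP => a; rewrite Es.
Qed.

(** An ideal where [Pr] fails would start a strictly increasing sequence of such ideals, and a
    finite generating set of the union already lies in one member. *)
Lemma noeth_ind (Pr : ideal R -> Prop) :
  (forall I, (forall J, I `<=` J -> ~ J `<=` I -> Pr J) -> Pr I) ->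
  forall I, Pr I.
Proof.
move=> H I0; apply: contrapT => N0.
have step (I : {I | ~ Pr I}) :
    exists J : {I | ~ Pr I}, sval I `<=` sval J /\ ~ sval J `<=` sval I.
  case: I => I NI /=; apply: contrapT => N; apply: NI; apply: H => J IJ NJI.
  by apply: contrapT => NJ; apply: N; exists (exist _ J NJ).
have [f fP] := choice step.
pose u n := sval (iter n f (exist _ I0 N0)).
have uS n : u n `<=` u n.+1 by have [] := fP (iter n f (exist _ I0 N0)).
have uN n : ~ u n.+1 `<=` u n by have [] := fP (iter n f (exist _ I0 N0)).
have um m n : (m <= n)%N -> u m `<=` u n.
  elim: n => [|n IH]; first by rewrite leqn0 => /eqP ->.
  rewrite leq_eqVlt => /orP[/eqP -> //|]; rewrite ltnS => /IH h a /h.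
  exact: uS.
pose U : set R := [set a | exists n, u n a].
have U0 : U 0 by exists 0%N; exact: ideal0.
have UD a b : U a -> U b -> U (a + b).
  move=> [n ua] [k ub]; exists (maxn n k); apply: idealD.
    by apply: um ua; exact: leq_maxl.
  by apply: um ub; exact: leq_maxr.
have UM a b : U b -> U (a * b) by move=> [n ub]; exists n; exact: idealM.
have [s Es] := noeth_fg (Ideal U0 UD UM).
have /= Us x : x \in s -> U x.
  by move=> xs; rewrite -[U]/(ideal_set (Ideal U0 UD UM)) Es; exact: adjs_in.
have [n un] : exists n, forall x, x \in s -> u n x.
  have {Es} : forall x, x \in s -> U x by [].
  elim: s {Us} => [|x s IH] Us; first by exists 0%N.
  have [|n un] := IH; first by move=> y ys; apply: Us; rewrite inE ys orbT.
  have [|k uk] := Us x; first by rewrite inE eqxx.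
  exists (maxn n k) => y; rewrite inE => /orP[/eqP ->|/un].
    by apply: um uk; exact: leq_maxr.
  by apply: um; exact: leq_maxl.
apply: (uN n) => a ua.
have : (Ideal U0 UD UM) a by exists n.+1.
rewrite Es; exact: adjs_min (@izero_sub _ _) un a.
Qed.

Lemma noeth_max (Pr : ideal R -> Prop) I : Pr I ->
  exists J, [/\ I `<=` J, Pr J & forall K, Pr K -> J `<=` K -> K `<=` J].
Proof.
move: I; apply: noeth_ind => I IH PI.
have [[J [PJ IJ NJ]]|N] := pselect (exists J, [/\ Pr J, I `<=` J & ~ J `<=` I]).
  have [K [JK PK Km]] := IH J IJ NJ PJ.
  by exists K; split => // a /IJ /JK.
exists I; split => // K PK IK; apply: contrapT => NK; apply: N.
by exists K.
Qed.

(** Finitely many generators have a common denominator; this turns a statement at [Q] into one on a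
    neighbourhood of [Q]. *)
Lemma sat_fg Q I J : J `<=` sat Q I -> exists2 t, ~ Q t & J `<=` colon I t.
Proof.
move=> JI; have [s Es] := noeth_fg J.
have Js x : x \in s -> sat Q I x by move=> xs; apply: JI; rewrite Es; exact: adjs_in.
suff [t Qt Ht] : exists2 t, ~ Q t & forall x, x \in s -> I (t * x).
  by exists t => //; rewrite Es; apply: adjs_min => //; exact: izero_sub.
elim: s Js {Es} => [|x s IH] Js; first by exists 1 => //; exact: spec_proper.
have [|t Qt Ht] := IH; first by move=> y ys; apply: Js; rewrite inE ys orbT.
have [|u Qu Hu] := Js x; first by rewrite inE eqxx.
exists (u * t); first exact: primeNM.
move=> y; rewrite inE => /orP[/eqP ->|/Ht h].
  by rewrite mulrAC; exact: idealMr.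
by rewrite -mulrA; exact: idealM.
Qed.

(** An ideal maximal among those disjoint from [M] is prime: enlarging it by [a] and by [b] catches
    two elements of [M], whose product would lie in the ideal if [a * b] did. *)
Lemma prime_avoiding (M : mulset R) I : (forall a, M a -> ~ I a) ->
  exists P : spec R, I `<=` P /\ forall a, M a -> ~ P a.
Proof.
move=> MI.
have [J [IJ MJ Jm]] := @noeth_max (fun J => forall a, M a -> ~ J a) I MI.
have Jx x : ~ J x -> exists2 m, M m & adj J x m.
  move=> NJ; apply: contrapT => N; apply: NJ.
  apply: (Jm (adj J x)) (adj_in J x) => [a Ma Ja|]; last exact: sub_adj.
  by apply: N; exists a.
have J1 : ~ J 1 by apply: MJ; exact: mulset1.
have JP a b : J (a * b) -> J a \/ J b.
  move=> Jab; apply: contrapT => /not_orP[/Jx[m Mm [c _ Jc]] /Jx[n Mn [d _ Jd]]].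
  apply: (MJ (m * n)); first exact: mulsetM.
  have -> : m * n = n * (m - c * a) + c * a * (n - d * b) + c * d * (a * b) by ring.
  by apply: idealD; [apply: idealD|]; exact: idealM.
by exists (Spec J1 JP).
Qed.

(** If [a * b] is in [I] but neither factor is, a prime over [I] lies over [adj I a] or over
    [adj I b]. *)
Lemma primes_below I : exists ps : seq (spec R),
  (forall P, P \in ps -> I `<=` P) /\
  (forall Q, I `<=` Q -> exists2 P, P \in ps & P `<=` Q).
Proof.
move: I; apply: noeth_ind => I IH.
have [I1|I1] := pselect (I 1).
  by exists [::]; split => // Q IQ; case: (@spec_proper _ Q); exact: IQ.
have [IP|] := pselect (forall a b, I (a * b) -> I a \/ I b).
  exists [:: Spec I1 IP]; split => [P|Q IQ]; first by rewrite inE => /eqP ->.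
  by exists (Spec I1 IP); rewrite ?inE.
move=> /existsNP[a /existsNP[b /not_implyP[Iab /not_orP[Ia Ib]]]].
have [] := IH (adj I a) _ _; first exact: sub_adj.
  by move=> /(_ a) h; apply: Ia; apply: h; exact: adj_in.
move=> ps [ps1 ps2].
have [] := IH (adj I b) _ _; first exact: sub_adj.
  by move=> /(_ b) h; apply: Ib; apply: h; exact: adj_in.
move=> qs [qs1 qs2].
exists (ps ++ qs); split => [P|Q IQ].
  rewrite mem_cat => /orP[/ps1|/qs1] h c Ic; apply: h; exact: sub_adj.
have [Qa|Qb] : Q a \/ Q b by apply: spec_prime; exact: IQ.
  have [P Pps PQ] := ps2 Q (adj_min IQ Qa).
  by exists P; rewrite // mem_cat Pps.
have [P Pps PQ] := qs2 Q (adj_min IQ Qb).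
by exists P; rewrite // mem_cat Pps orbT.
Qed.

Lemma prime_avoidance J (ps : seq (spec R)) :
  (forall P, P \in ps -> ~ J `<=` P) ->
  exists2 z, J z & forall P, P \in ps -> ~ P z.
Proof.
have [n] := ubnP (size ps); elim: n ps => // n IH [|P ps] /=.
  by exists 0 => //; exact: ideal0.
rewrite ltnS => sz Jps.
(* A member contained in [P] is redundant, and dropping it shortens the list. *)
have [[Q Qps QP]|N] := pselect (exists2 Q, Q \in ps & Q `<=` P).
  have [] := IH (P :: [seq q <- ps | q != Q]).
  - rewrite /= size_filter (leq_trans _ sz) // ltnS.
    rewrite -(count_predC (pred1 Q) ps) -[X in (X <= _)%N]add1n leq_add2r.
    by rewrite -has_count has_pred1.
  - move=> P'; rewrite inE => /orP[/eqP ->|]; first by apply: Jps; rewrite inE eqxx.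
    by rewrite mem_filter => /andP[_ h]; apply: Jps; rewrite inE h orbT.
  move=> z Jz zP; exists z => // P'; rewrite inE => /orP[/eqP ->|h].
    by apply: zP; rewrite inE eqxx.
  have [->|nPQ] := eqVneq P' Q.
    by move=> /QP; apply: zP; rewrite inE eqxx.
  by apply: zP; rewrite inE mem_filter nPQ h orbT.
have [||z Jz zps] := IH ps; first exact: sz.
  by move=> Q Qps; apply: Jps; rewrite inE Qps orbT.
have [Pz|Pz] := pselect (P z); last first.
  by exists z => // Q; rewrite inE => /orP[/eqP ->|/zps].
have [j Jj Pj] : exists2 j, J j & ~ P j.
  apply: contrapT => N'; apply: (Jps P); first by rewrite inE eqxx.
  by move=> a Ja; apply: contrapT => Pa; apply: N'; exists a.
(* [w] lies in all the other primes but not in [P]: adding [j * w] moves [z] out of [P] and changes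
   nothing modulo the others. *)
have [w Pw wps] : exists2 w, ~ P w & forall Q, Q \in ps -> Q w.
  have {IH sz Jps zps} : forall Q, Q \in ps -> exists2 a, Q a & ~ P a.
    move=> Q Qps; apply: contrapT => N'; apply: N; exists Q => // a Qa.
    by apply: contrapT => Pa; apply: N'; exists a.
  elim: (ps) => [|Q l IHl] h; first by exists 1 => //; exact: spec_proper.
  have [|w Pw wl] := IHl; first by move=> Q' h'; apply: h; rewrite inE h' orbT.
  have [|a Qa Pa] := h Q; first by rewrite inE eqxx.
  exists (a * w); first exact: primeNM.
  move=> Q'; rewrite inE => /orP[/eqP ->|/wl]; first exact: idealMr.
  exact: idealM.
exists (z + j * w); first by apply: idealD => //; exact: idealMr.
move=> Q; rewrite inE => /orP[/eqP ->|Qps] h.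
  apply: (@primeNM _ P j w) => //; rewrite -[j * w](addKr z) addrC.
  exact: idealB.
apply: (zps Q Qps); rewrite -[z](addrK (j * w)); apply: idealB => //.
by apply: idealM; exact: wps.
Qed.

End Noetherian.

(** * Associated primes, regular sequences and chains of primes *)

HB.instance Definition _ (R : comPzRingType) := gen_eqMixin (ideal R).

Section HeightTheory.
Variable R : comPzRingType.
Hypothesis nR : noetherian R.
Implicit Types (I J K M N : ideal R) (P Q : spec R) (s : seq R) (a b c x y z t : R).

Definition ass I P := exists b, forall c, P c <-> I (b * c).

(** Among the ideals [colon I b] with [b] nonzero in [(R/I)_Q], a maximal one is prime, and it lies
    in [Q] because no element outside [Q] kills such a [b]. *)
Lemma ass_above Q I a : ~ sat Q I a ->
  exists P, [/\ ass I P, P `<=` Q & colon I a `<=` P].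
Proof.
move=> Na.
have [|K [aK [b [Nb EK]] Km]] := @noeth_max R nR
  (fun K => exists b, ~ sat Q I b /\ K = colon I b) (colon I a).
  by exists a.
subst K.
have K1 : ~ colon I b 1 by rewrite /= mulr1 => /(@sub_sat _ Q).
have KP c d : colon I b (c * d) -> colon I b c \/ colon I b d.
  move=> /= Icd; have [[t Qt It]|Nbd] := pselect (sat Q I (b * d)).
    right; apply: (Km (colon I (t * b))).
    - exists (t * b); split => // -[u Qu Iu]; apply: Nb.
      by exists (u * t); [exact: primeNM|rewrite -mulrA].
    - by move=> e /= Ie; rewrite -mulrA; exact: idealM.
    - by rewrite /= -mulrA.
  left; apply: (Km (colon I (b * d))).
  - by exists (b * d).
  - by move=> e /= Ie; rewrite mulrAC; exact: idealMr.
  - by rewrite /= -mulrA [d * c]mulrC.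
exists (Spec K1 KP); split => //; first by exists b.
by move=> c /= Ic; apply: contrapT => Qc; apply: Nb; exists c; rewrite // mulrC.
Qed.

(** If the prime [P0] is the annihilator of [b] modulo [I], then [b] generates a copy of [R/P0] in
    [R/I], and every other associated prime of [I] is one of [adj I b]. *)
Lemma ass_finite I : exists ps : seq (spec R), forall P, ass I P -> P \in ps.
Proof.
move: I; apply: (noeth_ind nR) => I IH.
have [I1|I1] := pselect (I 1).
  exists [::] => P [b Pb]; case: (@spec_proper _ P).
  by apply/Pb; exact: ideal_top.
have [|Q [IQ _]] := @prime_avoiding R nR
    (@Mulset _ [set 1] erefl (fun a b ha hb => etrans (congr2 *%R ha hb) (mulr1 1))) I.
  by move=> a ->.
have [|P0 [[b Pb] _ _]] := @ass_above Q I 1.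
  by move=> [t Qt]; rewrite mulr1 => /IQ.
have [||ps psP] := IH (adj I b); first exact: sub_adj.
  move=> /(_ b (adj_in _ _)); rewrite -[b]mulr1 => /Pb.
  exact: spec_proper.
exists (P0 :: ps) => P [b1 Pb1]; rewrite inE.
(* If the copy of [R/P] generated by [b1] meets the copy of [R/P0] generated by [b], a common
   nonzero element has both primes as annihilator. If not, [P] is associated to [adj I b]. *)
have [[r [h1 h2]]|N] := pselect (exists r, adj I b (b1 * r) /\ ~ I (b1 * r)).
  have Pr : ~ P r by move=> /Pb1.
  have [c _ Ic] := h1.
  have E d : I (d * (b1 * r)) <-> I (d * (c * b)).
    split => h.
      by apply: (idealBl _ h); rewrite -mulrBr; exact: idealM.
    by apply: (idealBr _ h); rewrite -mulrBr; exact: idealM.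
  have P0c : ~ P0 c.
    by move=> /Pb h; apply: h2; apply: (idealBr Ic); rewrite mulrC.
  apply/orP; left; apply/eqP; apply: spec_eqP => d.
    move=> /Pb1 h; apply: (primeMl P0c); apply/Pb.
    have /E h' : I (d * (b1 * r)) by apply: (icast (idealM r h)); ring.
    by apply: (icast h'); ring.
  move=> /Pb h; apply: (primeMl Pr); apply/Pb1.
  have /E h' : I (d * (c * b)) by apply: (icast (idealM c h)); ring.
  by apply: (icast h'); ring.
apply/orP; right; apply: psP; exists b1 => c; split => [/Pb1|h].
  exact: sub_adj.
by apply/Pb1; apply: contrapT => h2; apply: N; exists c.
Qed.

Definition nzd_at I Q x := forall a, I (x * a) -> sat Q I a.

(** The associated primes contained in [Q] are finitely many and different from [Q], so prime
    avoidance gives one element that is regular for the whole list. *)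
Lemma nzd_avoid (Is : seq (ideal R)) Q : (forall I, I \in Is -> ~ ass I Q) ->
  exists2 z, Q z & forall I, I \in Is -> nzd_at I Q z.
Proof.
move=> H.
have [ps psP] : exists ps : seq (spec R),
    forall I P, I \in Is -> ass I P -> P \in ps.
  elim: Is {H} => [|I Is [ps psP]]; first by exists [::].
  have [qs qsP] := ass_finite I; exists (qs ++ ps) => J P.
  rewrite inE mem_cat => /orP[/eqP ->|JIs] h; first by rewrite qsP.
  by rewrite (psP J) ?orbT.
pose good P := `[< P `<=` Q /\ exists2 I, I \in Is & ass I P >].
have [|z Qz zP] := @prime_avoidance R Q [seq P <- ps | good P].
  move=> P; rewrite mem_filter => /andP[/asboolP[PQ [I IIs aP]] _] QP.
  by apply: (H I IIs); rewrite (spec_eqP QP PQ).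
exists z => // I IIs a Ia; apply: contrapT => /ass_above[P [aP PQ aIP]].
apply: (zP P); last by apply: aIP; rewrite /= mulrC.
rewrite mem_filter (psP I) // andbT; apply/asboolP; split => //.
by exists I.
Qed.

Lemma nzd_at_sat I Q x a : nzd_at I Q x -> sat Q I (x * a) -> sat Q I a.
Proof.
move=> nx [t Qt It]; apply: (sat_cancel Qt); apply: nx.
by rewrite mulrCA.
Qed.

Fixpoint regs I Q s : Prop :=
  if s is x :: s' then [/\ Q x, nzd_at I Q x & regs (adj I x) Q s'] else True.

Lemma nzd_at_nass I Q x : Q x -> nzd_at I Q x -> ~ ass I Q.
Proof.
move=> Qx nx [b Qb].
have [|t Qt It] := nx b; first by rewrite mulrC; apply/Qb.
by apply: Qt; apply/Qb; rewrite mulrC.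
Qed.

Lemma nzd_at_swap I Q y z : nzd_at I Q y -> nzd_at (adj I y) Q z ->
  nzd_at (adj I z) Q y.
Proof.
move=> ny nz a [c _ Ic].
have [|t Qt [d _ Id]] := nz c.
  by exists a => //; rewrite -opprB; apply: idealN; rewrite [a * y]mulrC [z * c]mulrC.
have [|u Qu Iu] := ny (t * a - d * z).
  have -> : y * (t * a - d * z) = t * (y * a - c * z) + z * (t * c - d * y) by ring.
  by apply: idealD; exact: idealM.
exists (u * t); first exact: primeNM.
exists (u * d) => //.
by have -> : u * t * a - u * d * z = u * (t * a - d * z) by ring.
Qed.

(** Depth drops by at most one modulo any nonzerodivisor, not only modulo the first term of the
    given sequence. An element [z] regular modulo [I], [adj I x] and [adj I y] mediates: the
    induction hypothesis is used modulo [y] to bring in [z], then modulo [z] to bring in [x]. *)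
Lemma regs_exchange n s I Q x y : size s = n -> regs I Q (y :: s) -> Q x ->
  nzd_at I Q x -> exists2 s', size s' = n & regs (adj I x) Q s'.
Proof.
elim: n s I x y => [|n IH] [|y2 s2] //= I x y; first by exists [::].
move=> [sz] [Qy ny [Qy2 ny2 rs2]] Qx nx.
have NI : ~ ass I Q by exact: nzd_at_nass nx.
have Ny : ~ ass (adj I y) Q by exact: nzd_at_nass ny2.
(* Otherwise [b] is a socle element of [R/(I, x)] at [Q]. The element [w] with [b y = w x] modulo
   [I] is then killed by [Q] in [R/(I, y)], where [y2] is regular; so [w] vanishes there, and then
   [b] vanishes too. *)
have Nx : ~ ass (adj I x) Q.
  move=> [b Qb].
  have [w _ Iw] : adj I x (b * y) by apply/Qb.
  have h q : Q q -> sat Q (adj I y) (w * q).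
    move=> /Qb[v _ Iv].
    have [|t Qt It] := nx (w * q - v * y).
      have -> : x * (w * q - v * y) = y * (b * q - v * x) - q * (b * y - w * x) by ring.
      by apply: idealB; exact: idealM.
    exists t => //; exists (t * v) => //.
    by have -> : t * (w * q) - t * v * y = t * (w * q - v * y) by ring.
  have [t Qt [v _ Iv]] : sat Q (adj I y) w.
    by apply: (@nzd_at_sat _ _ y2 w ny2); rewrite mulrC; exact: h.
  have [|u Qu Iu] := ny (t * b - v * x).
    have -> : y * (t * b - v * x) = t * (b * y - w * x) + x * (t * w - v * y) by ring.
    by apply: idealD; exact: idealM.
  apply: (primeNM Qu Qt); apply/Qb; exists (u * v) => //.
  by have -> : b * (u * t) - u * v * x = u * (t * b - v * x) by ring.
have [z Qz zP] : exists2 z, Q z &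
    forall J, J \in [:: I; adj I x; adj I y] -> nzd_at J Q z.
  apply: nzd_avoid => J; rewrite !inE.
  by move=> /or3P[] /eqP ->.
have nzI : nzd_at I Q z by apply: zP; rewrite inE eqxx.
have nzx : nzd_at (adj I x) Q z by apply: zP; rewrite !inE eqxx orbT.
have nzy : nzd_at (adj I y) Q z by apply: zP; rewrite !inE eqxx !orbT.
have [s3 sz3 r3] := IH s2 (adj I y) z y2 sz (And3 Qy2 ny2 rs2) Qz nzy.
have [||s4 sz4 r4] := IH s3 (adj I z) x y sz3 _ Qx.
  - by split => //=; first exact: nzd_at_swap; rewrite adjC.
  - exact: nzd_at_swap.
by exists (z :: s4); rewrite /= ?sz4 //; split => //; rewrite adjC.
Qed.

Fixpoint hge I Q h : Prop :=
  if h is h'.+1 then exists Q', [/\ Q' `<=` Q, ~ Q `<=` Q' & hge I Q' h']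
  else I `<=` Q.

Lemma hge_sub I Q h : hge I Q h -> I `<=` Q.
Proof.
elim: h Q => //= h IH Q [Q' [Q'Q _ /IH IQ']] a /IQ'; exact: Q'Q.
Qed.

Lemma hge_mono I J Q h : I `<=` J -> hge J Q h -> hge I Q h.
Proof.
move=> IJ; elim: h Q => [Q /= JQ a /IJ /JQ //|h IH Q /= [Q' [h1 h2 /IH h3]]].
by exists Q'.
Qed.

Lemma hge_up I Q Q' h : Q `<=` Q' -> hge I Q h -> hge I Q' h.
Proof.
move=> QQ'; case: h => [/= IQ a /IQ /QQ' //|h /= [P [PQ QP hP]]].
exists P; split => // [a /PQ /QQ' //|Q'P]; apply: QP => a /QQ'; exact: Q'P.
Qed.

Lemma hge_cat I P Q h k : hge I P h -> hge P Q k -> hge I Q (h + k).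
Proof.
move=> hP; elim: k Q => [Q /= PQ|k IH Q /= [Q' [h1 h2 h3]]].
  by rewrite addn0; exact: hge_up hP.
by rewrite addnS; exists Q'; split => //; exact: IH.
Qed.

Definition mul_pow_set Q x : set R := [set a | exists t n, ~ Q t /\ a = t * x ^+ n].
Fact mul_pow1 Q x : mul_pow_set Q x 1.
Proof. by exists 1, 0%N; rewrite mul1r; split => //; exact: spec_proper. Qed.
Fact mul_powM Q x a b : mul_pow_set Q x a -> mul_pow_set Q x b ->
  mul_pow_set Q x (a * b).
Proof.
move=> [s [n [Qs ->]]] [t [m [Qt ->]]]; exists (s * t), (n + m)%N.
by split; [exact: primeNM|rewrite exprD mulrACA].
Qed.
Definition mul_pow Q x := Mulset (@mul_pow1 Q x) (@mul_powM Q x).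

Lemma prime_below I Q x : (forall t n, ~ Q t -> ~ I (t * x ^+ n)) ->
  exists P, [/\ I `<=` P, P `<=` Q & ~ P x].
Proof.
move=> H; have [|P [IP MP]] := @prime_avoiding R nR (mul_pow Q x) I.
  by move=> a [t [n [Qt ->]]]; exact: H.
exists P; split => // [a Pa|].
  apply: contrapT => Qa; apply: (MP a) => //.
  by exists a, 0%N; rewrite mulr1.
by apply: MP; exists 1, 1%N; rewrite mul1r; split => //; exact: spec_proper.
Qed.

(** A nonzerodivisor lies in no minimal prime, so a chain over [adj I x] can be prolonged downwards
    by a prime over [I] that avoids [x]. *)
Lemma hge_nzd I Q Q' x h : Q' `<=` Q -> nzd_at I Q x -> hge (adj I x) Q' h ->
  hge I Q' h.+1.
Proof.
move=> Q'Q nx; elim: h Q' Q'Q => [|h IH] Q' Q'Q /=.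
  move=> IQ'; have [|P [IP PQ' Px]] := @prime_below I Q' x.
    move=> t n Q't It.
    have H k : sat Q I (t * x ^+ k) -> sat Q I t.
      elim: k => [|k IHk]; first by rewrite mulr1.
      by rewrite exprS mulrCA => /(nzd_at_sat nx).
    have [u Qu /(@sub_adj _ I x) /IQ' /spec_prime[/Q'Q|]//] := H n (@sub_sat _ Q I _ It).
  exists P; split => //.
  by move=> Q'P; apply/Px/Q'P/IQ'; exact: adj_in.
by move=> [P [PQ' Q'P hP]]; exists P; split => //; apply: IH => // a /PQ' /Q'Q.
Qed.

Lemma regs_hge I Q s : I `<=` Q -> regs I Q s -> hge I Q (size s).
Proof.
elim: s I => [|x s IH] I //= IQ [Qx nx rs].
by apply: (@hge_nzd I Q Q x) => //; apply: IH => //; exact: adj_min.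
Qed.

Lemma regs_weak I P Q s : P `<=` Q -> (forall x, x \in s -> P x) ->
  regs I Q s -> regs I P s.
Proof.
move=> PQ; elim: s I => //= x s IH I sP [Qx nx rs]; split.
- by apply: sP; rewrite inE eqxx.
- by move=> a /nx; exact: sat_weak.
- by apply: IH => // y ys; apply: sP; rewrite inE ys orbT.
Qed.

Lemma regs_cat I Q s1 s2 :
  regs I Q (s1 ++ s2) <-> regs I Q s1 /\ regs (adjs I s1) Q s2.
Proof.
elim: s1 I => [|x s1 IH] I /=; first by split => [|[]].
split=> [[Qx nx /IH[r1 r2]] //|[[Qx nx r1] r2]].
by split => //; apply/IH.
Qed.

(* The first hypothesis makes [(R/I)_P] Artinian. *)
Lemma dcc P I :
  (forall J, I `<=` J -> sat P J `<=` J -> ~ J 1 ->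
     exists b, ~ J b /\ forall c, P c -> J (c * b)) ->
  sat P I `<=` I ->
  forall J : nat -> ideal R, (forall n, I `<=` J n) ->
    (forall n, sat P (J n) `<=` J n) -> (forall n, J n.+1 `<=` J n) ->
  exists n, forall k, (n <= k)%N -> J n `<=` J k.
Proof.
move: I; apply: (noeth_ind nR) => I IH HI sI J IJ sJ dJ.
have [I1|I1] := pselect (I 1).
  by exists 0%N => k _ a _; apply: IJ; exact: ideal_top.
have dm n k : (n <= k)%N -> J k `<=` J n.
  elim: k => [|k IHk]; first by rewrite leqn0 => /eqP ->.
  rewrite leq_eqVlt => /orP[/eqP -> //|]; rewrite ltnS => /IHk h a /dJ; exact: h.
have [b [Ib Pb]] := HI I (fun a h => h) sI I1.
pose I' := sat P (adj I b).
have II' : I `<=` I' by move=> a Ia; apply: sub_sat; exact: sub_adj.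
have I'b : I' b by apply: sub_sat; exact: adj_in.
have NI' : ~ I' `<=` I by move=> /(_ b I'b).
have sI' : sat P I' `<=` I' by move=> a; exact: sat_idem.
have HI' K : I' `<=` K -> sat P K `<=` K -> ~ K 1 ->
    exists b, ~ K b /\ forall c, P c -> K (c * b).
  by move=> I'K; apply: HI => a /II' /I'K.
have [Jb|/existsNP[n1 Jb]] := pselect (forall n, J n b).
  apply: (IH I') => // n a [t Pt It]; apply: (sJ _); exists t => //.
  by apply: adj_min It.
(* [b] spans a copy of the residue field. The chain enlarged by [b] stabilizes by induction. If [b]
   is missing from [J n1], nothing is lost by the enlargement: a relation putting [c * b] into [J k]
   with [c] outside [P] would put [b] there. *)
have [|||n0 Hn0] := IH I' II' NI' HI' sI' (fun n => sat P (adj (J n) b)).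
- by move=> n; apply: sat_mono; exact: adj_mono.
- by move=> n a; exact: sat_idem.
- by move=> n; apply: sat_mono; exact: adj_mono.
exists (maxn n0 n1) => k kn a Ja.
have : sat P (adj (J k) b) a.
  apply: Hn0; first by apply: leq_trans kn; exact: leq_maxl.
  by apply/sub_sat/sub_adj; apply: dm Ja; exact: leq_maxl.
move=> [t Pt [c _ Jc]]; apply: (sJ _); exists t => //.
apply: (idealBr Jc).
have Jcb : J (maxn n0 n1) (c * b).
  by apply: (idealBl (dm _ _ kn _ Jc)); exact: idealM.
have [Pc|Pc] := pselect (P c); first by apply: IJ; exact: Pb.
case: Jb; apply: dm (leq_maxr n0 n1) _ _.
by apply: (sJ _); exists c.
Qed.

End HeightTheory.

(** * Heights *)

Section PrincipalIdeal.
Variable R : comPzRingType.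
Hypothesis nR : noetherian R.
Implicit Types (I J K M N : ideal R) (P Q : spec R) (s : seq R) (a b c x y z t : R).

Lemma adjp_adjps N K s x : adjps (adjp N K x) K s = adjp (adjps N K s) K x.
Proof.
elim: s N => //= y s IH N; rewrite -IH; congr adjps.
by apply: ideal_eqP => a [c Kc [d Kd h]]; exists d => //; exists c => //;
  apply: (icast h); ring.
Qed.

Lemma adjps_min N K J s : N `<=` J ->
  (forall x, x \in s -> forall c, K c -> J (c * x)) -> adjps N K s `<=` J.
Proof.
elim: s N => [N NJ _ //|x s IH] N NJ Ks /=; apply: IH.
  by move=> a [c Kc /NJ h]; apply: (idealBr h); apply: Ks; rewrite ?inE ?eqxx.
by move=> y ys; apply: Ks; rewrite inE ys orbT.
Qed.

Lemma sub_adjps N K s : N `<=` adjps N K s.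
Proof.
elim: s N => [N a //|x s IH] N a Na /=; apply: IH; exact: sub_adjp.
Qed.

Lemma adjps_in N K s x c : x \in s -> K c -> adjps N K s (c * x).
Proof.
elim: s N => //= y s IH N; rewrite inE => /orP[/eqP ->|xs] Kc; last exact: IH.
apply: sub_adjps; rewrite -[c * y]add0r; apply: adjpP => //; exact: ideal0.
Qed.

(** The generators are removed one by one: modulo the others [t * x] equals [c * x] with [t] outside
    [Q] and [c] in [K], and [t - c] is again outside [Q]. *)
Lemma nakayama_seq Q N K s : K `<=` Q ->
  (forall a, a \in s -> sat Q (adjps N K s) a) ->
  forall a, a \in s -> sat Q N a.
Proof.
move=> KQ; elim: s => //= x s IH H.
pose M := adjps N K s.
have E : adjps (adjp N K x) K s = adjp M K x by exact: adjp_adjps.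
have Mx : sat Q M x.
  have [|t Qt] := H x; first by rewrite inE eqxx.
  rewrite E => -[c Kc Mc]; exists (t - c); last by rewrite mulrBl.
  by move=> /idealBr/(_ (KQ _ Kc)).
have Ns y : y \in s -> sat Q N y.
  move: y; apply: IH => y ys.
  have [|t Qt] := H y; first by rewrite inE ys orbT.
  rewrite E => -[c Kc Mc]; apply: (sat_cancel Qt).
  by apply: (idealBr (@sub_sat _ Q _ _ Mc)); exact: idealM.
move=> y; rewrite inE => /orP[/eqP ->|/Ns //].
apply: sat_idem; case: Mx => t Qt Mt; exists t => //.
apply: adjps_min Mt; first exact: sub_sat.
by move=> z /Ns Nz c _; exact: idealM.
Qed.

Fact isum0 I J : [set z | exists a b, [/\ I a, J b & z = a + b]] 0.
Proof. by exists 0, 0; rewrite addr0; split => //; exact: ideal0. Qed.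
Fact isumD I J a b : [set z | exists a b, [/\ I a, J b & z = a + b]] a ->
  [set z | exists a b, [/\ I a, J b & z = a + b]] b ->
  [set z | exists a b, [/\ I a, J b & z = a + b]] (a + b).
Proof.
move=> [c [d [Ic Jd ->]]] [e [f [Ie Jf ->]]]; exists (c + e), (d + f).
by split; [exact: idealD|exact: idealD|ring].
Qed.
Fact isumM I J a b : [set z | exists a b, [/\ I a, J b & z = a + b]] b ->
  [set z | exists a b, [/\ I a, J b & z = a + b]] (a * b).
Proof.
move=> [c [d [Ic Jd ->]]]; exists (a * c), (a * d).
by split; [exact: idealM|exact: idealM|ring].
Qed.
Definition isum I J : ideal R := Ideal (@isum0 I J) (@isumD I J) (@isumM I J).

Lemma isum_l I J : I `<=` isum I J.
Proof. by move=> a Ia; exists a, 0; rewrite addr0; split => //; exact: ideal0. Qed.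
Lemma isum_r I J : J `<=` isum I J.
Proof. by move=> a Ja; exists 0, a; rewrite add0r; split => //; exact: ideal0. Qed.
Lemma isum_min I J K : I `<=` K -> J `<=` K -> isum I J `<=` K.
Proof. by move=> IK JK a [b [c [/IK Kb /JK Kc ->]]]; exact: idealD. Qed.

Lemma imul_in I J a b : I a -> J b -> ideal_mul I J (a * b).
Proof. by move=> Ia Jb; apply: sub_gen; exists a, b. Qed.
Lemma imul_min I J K : (forall a b, I a -> J b -> K (a * b)) ->
  ideal_mul I J `<=` K.
Proof. by move=> H; apply: gen_min => z [a [b [Ia Jb ->]]]; exact: H. Qed.

Lemma nakayama Q N K M : K `<=` Q ->
  M `<=` sat Q (isum N (ideal_mul K M)) -> M `<=` sat Q N.
Proof.
move=> KQ H; have [s Es] := noeth_fg nR M.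
have Ms x : x \in s -> M x by move=> xs; rewrite Es; exact: adjs_in.
have sN := @nakayama_seq Q N K s KQ.
rewrite Es; apply: adjs_min => [|x xs]; first exact: izero_sub.
apply: sN xs => a /Ms /H; apply: sat_mono.
apply: isum_min; first exact: sub_adjps.
apply: imul_min => c d Kc; rewrite Es => Md.
have : colon (adjps N K s) c d; last exact.
apply: adjs_min Md; first exact: izero_sub.
by move=> y ys /=; exact: adjps_in.
Qed.

Definition minover I P := I `<=` P /\
  forall Q, I `<=` Q -> Q `<=` P -> P `<=` Q.

Lemma minover_rad I P a : minover I P -> P a ->
  exists t n, ~ P t /\ I (t * a ^+ n).
Proof.
move=> [IP mP] Pa; apply: contrapT => N.
have [|Q [IQ QP Qa]] := @prime_below R nR I P a.
  by move=> t n Pt It; apply: N; exists t, n.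
exact/Qa/mP.
Qed.

(** Contraction to [R] of the [n]-th power of the maximal ideal of [(R/Q0)_Q]. *)
Fixpoint symb Q0 Q n : ideal R :=
  if n is n'.+1 then sat Q (isum Q0 (ideal_mul Q (symb Q0 Q n'))) else itop R.

(* Krull's principal ideal theorem, by means of the symbolic powers of [Q]. *)
Lemma principal_ideal_theorem Q0 Q P x : minover (adj Q0 x) P -> Q0 `<=` Q -> ~ Q `<=` Q0 ->
  Q `<=` P -> ~ P `<=` Q -> False.
Proof.
move=> mP Q0Q QQ0 QP PQ; have [IP mP'] := mP.
have Px : P x by apply: IP; exact: adj_in.
have Qx : ~ Q x.
  by move=> Qx; apply: PQ; apply: mP' => //; exact: adj_min.
pose S := symb Q0 Q.
have sS n : sat Q (S n) `<=` S n by case: n => [//|n] a; exact: sat_idem.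
have sSP n : sat P (S n) `<=` S n.
  by move=> a h; apply: sS; exact: sat_weak h.
have S0 n : Q0 `<=` S n.
  by case: n => [//|n] a h; apply: sub_sat; exact: isum_l.
have dS n : S n.+1 `<=` S n.
  elim: n => // n IH; apply: sat_mono; apply: isum_min; first exact: isum_l.
  apply: imul_min => a b Qa Sb; apply: isum_r; apply: imul_in => //.
  exact: IH.
pose J n := sat P (adj (S n) x).
have [|||||n Hn] := @dcc R nR P (sat P (adj Q0 x)) _ _ J.
- move=> K IK sK K1.
  have [|P1 [[b Pb] P1P KP1]] := @ass_above R nR P K 1.
    by move=> /sK.
  exists b; split.
    by move=> Kb; apply: (@spec_proper _ P1); apply/Pb; rewrite mulr1.
  move=> c Pc; rewrite mulrC; apply/Pb; apply: mP' Pc => // a Ia.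
  by apply: KP1; rewrite /= mul1r; apply/IK/sub_sat.
- by move=> a; exact: sat_idem.
- by move=> n; apply: sat_mono; apply: adj_mono.
- by move=> n a; exact: sat_idem.
- by move=> n; apply: sat_mono; apply: adj_mono; exact: dS.
(* In the Artinian ring [R/(Q0, x)] at [P] the images of the symbolic powers stabilize. As [x] is
   outside [Q], this puts [S n] into [S n.+1 + x S n] at [P], and Nakayama's lemma removes the last
   term. *)
have H1 : S n `<=` sat P (S n.+1).
  apply: (@nakayama P (S n.+1) (adj (izero R) x)).
    by apply: adj_min => //; exact: izero_sub.
  move=> a Sa; have [t Pt [c _ Sc]] : J n.+1 a.
    by apply: (Hn n.+1 (leqnSn n)); apply/sub_sat/sub_adj.
  exists t => //; have Sn : S n c.
    apply: sS; exists x => //; rewrite mulrC; apply: (idealBl (dS n _ Sc)).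
    exact: idealM.
  exists (t * a - c * x), (x * c); split => //; last by ring.
  by apply: imul_in => //; exact: adj_in.
(* Now [S n] is contained in [Q0 + Q S n] at [Q], so a second use of Nakayama's lemma puts it into
   [Q0]; but it contains [a ^+ n] for every [a] in [Q]. *)
have H2 : S n `<=` sat Q Q0.
  apply: (@nakayama Q Q0 Q (S n)) => // a /H1 /sSP; exact.
have QS k a : Q a -> S k (a ^+ k).
  move=> Qa; elim: k => // k IH; apply: sub_sat; apply: isum_r.
  by rewrite exprS; exact: imul_in.
apply: QQ0 => a Qa; apply: (@primeX _ _ _ n).
by apply: sat_prime Q0Q _ _; apply: H2; exact: QS.
Qed.

Lemma adjs_perm I s1 s2 : perm_eq s1 s2 -> adjs I s1 `<=` adjs I s2.
Proof.
move=> /perm_mem E; apply: adjs_min; first exact: sub_adjs.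
by move=> x; rewrite E; exact: adjs_in.
Qed.

(** Krull's height theorem, by induction on the length of [s]. Let [Q] be a prime directly below [P]
    and [x] a generator outside [Q]. Every other generator has a power that lies in [Q] modulo [x],
    up to a factor outside [P]. The elements of [Q] obtained in this way have [Q] as a minimal
    prime, by the principal ideal theorem. *)
Lemma height_le I s P h : minover (adjs I s) P -> hge I P h -> (h <= size s)%N.
Proof.
have [n] := ubnP (size s); elim: n s P h => // n IH s P [//|h].
rewrite ltnS => szn mP [Q' [Q'P PQ' hQ']].
have [|K [Q'K [Q [EK QP PQ]] Km]] := @noeth_max R nR
  (fun K => exists Q : spec R, [/\ K = Q, Q `<=` P & ~ P `<=` Q]) Q'.
  by exists Q'.
subst K; have hQ : hge I Q h by exact: hge_up hQ'.
have {}Km (P2 : spec R) : Q `<=` P2 -> P2 `<=` P -> ~ P2 `<=` Q -> P `<=` P2.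
  move=> h1 h2 h3; apply: contrapT => h4; apply: h3; apply: Km => //.
  by exists P2.
have [IP mP'] := mP; have IQ := hge_sub hQ.
have [x xs Qx] : exists2 x, x \in s & ~ Q x.
  apply: contrapT => N; apply: PQ; apply: mP' => //; apply: adjs_min => // x xs.
  by apply: contrapT => Qx; apply: N; exists x.
have Px : P x by apply: IP; exact: adjs_in.
pose s' := rem x s.
have Ps' y : y \in s' -> P y by move=> /mem_rem h'; apply: IP; exact: adjs_in.
have mPQ : minover (adj Q x) P.
  split; first exact: adj_min.
  move=> P2 h1 h2; apply: Km => // [a Qa|h3].
    by apply: h1; exact: sub_adj.
  by apply/Qx/h3/h1; exact: adj_in.
have /choice[f fP] y : exists z, P y ->
    Q z /\ exists t e c, ~ P t /\ z = t * y ^+ e - c * x.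
  have [Py|] := pselect (P y); last by exists 0.
  have [t [e [Pt [c _ Qc]]]] := minover_rad mPQ Py.
  by exists (t * y ^+ e - c * x) => _; split => //; exists t, e, c.
have szs : size s = (size s').+1.
  by rewrite size_rem // prednK //; case: (s) xs.
suff : (h <= size (map f s'))%N by rewrite size_map szs ltnS.
apply: (IH _ Q) => //; first by rewrite size_map -ltnS -szs.
split; first by apply: adjs_min => // z /mapP[y /Ps' /fP[Qz _] ->].
move=> Q2 IQ2 Q2Q; apply: contrapT => QQ2.
apply: (@principal_ideal_theorem Q2 Q P x) => //; split.
  by apply: adj_min => // a /Q2Q /QP.
move=> P2 IP2 P2P; apply: mP' => //.
have P2x : P2 x by apply: IP2; exact: adj_in.
apply: (subset_trans (@adjs_perm I s (x :: s') (perm_to_rem xs))) => /=.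
apply: adjs_min => [|y ys'].
  apply: adj_min => // a Ia; apply: IP2; apply: sub_adj; apply: IQ2.
  exact: sub_adjs.
have [_ [t [e [c [Pt Ef]]]]] := fP y (Ps' y ys').
have : P2 (f y).
  apply: IP2; apply: sub_adj; apply: IQ2; apply: adjs_in; exact: map_f.
rewrite Ef => /idealBr/(_ (idealM c P2x)).
by move=> /spec_prime[/P2P|/primeX].
Qed.

(** A system of parameters. An element [z] of [P] outside the listed primes that do not contain [P]
    lets every chain over [adj I z] below [P] be prolonged at the bottom, so the bound on heights
    drops by one. *)
Lemma sop_exists I P n : I `<=` P -> (forall h, hge I P h -> (h <= n)%N) ->
  exists s, [/\ (size s <= n)%N, forall z, z \in s -> P z & minover (adjs I s) P].
Proof.
elim: n I => [|n IH] I IP Hh.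
  exists [::]; split => //; split => // Q IQ QP; apply: contrapT => PQ.
  by have := Hh 1%N (ex_intro _ Q (And3 QP PQ IQ)).
have [mP|] := pselect (minover I P); first by exists [::].
move=> /not_andP[//|/existsNP[Q /not_implyP[IQ /not_implyP[QP PQ]]]].
have [ps [psI psQ]] := primes_below nR I.
have [|z Pz zP] := @prime_avoidance R P [seq p : spec R <- ps | `[< ~ P `<=` p >]].
  by move=> p; rewrite mem_filter => /andP[/asboolP].
have H h Q' : Q' `<=` P -> ~ P `<=` Q' -> hge (adj I z) Q' h -> hge I Q' h.+1.
  elim: h Q' => [|h IHh] Q' Q'P PQ' /=.
    move=> IQ'; have [|p pps pQ'] := psQ Q'.
      by move=> a Ia; apply: IQ'; exact: sub_adj.
    exists p; split => //; last exact: psI.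
    move=> Q'p; have npz : ~ p z.
      apply: zP; rewrite mem_filter pps andbT; apply/asboolP => Pp.
      by apply: PQ' => a /Pp; exact: pQ'.
    by apply/npz/Q'p/IQ'; exact: adj_in.
  move=> [Q2 [h1 h2 h3]]; exists Q2; split => //; apply: IHh => //.
    by move=> a /h1 /Q'P.
  by move=> PQ2; apply: h2 => b /Q'P; exact: PQ2.
have [||s [sz sP ms]] := IH (adj I z).
- exact: adj_min.
- case=> [//|h] [Q' [Q'P PQ' hQ']].
  by rewrite -ltnS; apply: Hh; exists Q'; split => //; exact: H.
exists (z :: s); split => //= y; rewrite inE => /orP[/eqP ->//|]; exact: sP.
Qed.

Definition gens_at I Q s := (forall z, z \in s -> Q z) /\ Q `<=` sat Q (adjs I s).

Lemma gens_minover I Q s : I `<=` Q -> gens_at I Q s -> minover (adjs I s) Q.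
Proof.
move=> IQ [sQ Qs]; split; first exact: adjs_min.
by move=> P IP PQ a /Qs[t Qt /IP /spec_prime[/PQ|]].
Qed.

Lemma gens_height I Q s h : gens_at I Q s -> hge I Q h -> (h <= size s)%N.
Proof.
by move=> gs hQ; apply: (height_le _ hQ); apply: gens_minover => //; exact: hge_sub hQ.
Qed.

Definition is_height I Q h := hge I Q h /\ forall k, hge I Q k -> (k <= h)%N.

Lemma height_bounded I Q : exists n, forall h, hge I Q h -> (h <= n)%N.
Proof.
have [s Es] := noeth_fg nR Q.
exists (size s) => h; apply: gens_height; split.
  by move=> z zs; rewrite Es; exact: adjs_in.
move=> a; rewrite {1}Es => h'; apply: sub_sat; apply: adjs_mono h'; exact: izero_sub.
Qed.

Lemma max_exists (p : nat -> Prop) n : p 0%N -> (forall k, p k -> (k <= n)%N) ->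
  exists h, p h /\ forall k, p k -> (k <= h)%N.
Proof.
move=> p0 pn; have ex : exists i, `[< p i >] by exists 0%N; apply/asboolP.
have ub i : `[< p i >] -> (i <= n)%N by move=> /asboolP /pn.
case: (ex_maxnP ex ub) => h /asboolP ph hm; exists h; split => // k pk.
by apply: hm; apply/asboolP.
Qed.

Lemma height_exists I Q : I `<=` Q -> exists h, is_height I Q h.
Proof.
by move=> IQ; have [n Hn] := height_bounded I Q; exact: (@max_exists (hge I Q) n).
Qed.

(** A generating system and a regular sequence of equal length squeeze embedding dimension,
    dimension and depth together. In this form the two halves can be carried separately through
    Weierstrass presentations. *)
Definition reg I Q := I `<=` Q /\
  exists s1 s2, [/\ gens_at I Q s1, regs I Q s2 & size s1 = size s2].

(** Parameters modulo [x] together with [x] are parameters, so the dimension drops by at most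
    one. *)
Lemma height_adj I Q x h : Q x -> is_height (adj I x) Q h ->
  forall k, hge I Q k -> (k <= h.+1)%N.
Proof.
move=> Qx [h1 h2] k hk.
have [|s [sz sP ms]] := @sop_exists (adj I x) Q h _ h2; first exact: hge_sub h1.
by apply: leq_trans (@height_le I (x :: s) Q k ms hk) _.
Qed.

(* A filtration of [R/J] near [P] with all quotients isomorphic to [R/P]. *)
Lemma filtration P J : minover J P \/ ~ J `<=` P ->
  exists s g, ~ P g /\ adjs J s g /\
    forall i, (i < size s)%N -> forall c, adjs J (take i s) (c * s`_i) <-> P c.
Proof.
move: J; apply: (noeth_ind nR) => J IH HJ.
have [JP|/existsNP[g /not_implyP[Jg Pg]]] := pselect (J `<=` P); last first.
  by exists [::], g.
have {HJ}mP : minover J P by case: HJ.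
have [|P' [[b Pb] P'P JP']] := @ass_above R nR P J 1.
  by move=> [t Pt]; rewrite mulr1 => /JP.
have E : P' = P.
  apply: spec_eqP => //; apply: (mP.2) => // a Ja.
  by apply: JP'; rewrite /= mul1r.
subst P'.
have Jb : ~ J b by rewrite -[b]mulr1 => /Pb; exact: spec_proper.
have [|||s [g [Pg [sg sP]]]] := IH (adj J b); first exact: sub_adj.
- by move=> /(_ b (adj_in _ _)).
- have [JbP|] := pselect (adj J b `<=` P); last by right.
  left; split => // Q JQ; apply: (mP.2) => a Ja; apply: JQ; exact: sub_adj.
exists (b :: s), g; split => //; split => // -[|i] /= ilt c; last exact: sP.
by rewrite mulrC; split => /Pb.
Qed.

(** [R/J] is an extension of [R/(J, b)] by a copy of [R/P]; a sequence regular on both outer terms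
    is regular on the middle one. *)
Lemma nzd_step P J b Q s : P `<=` Q ->
  (forall c, J (c * b) <-> P c) -> regs P Q s ->
  regs (adj J b) Q s -> regs J Q s.
Proof.
move=> PQ Jb.
(* The induction divides all three terms by an element of the sequence, so [P] is replaced by an
   ideal [K] that agrees with the annihilator of [b] modulo [J'] only up to localization at [Q]. *)
suff H J' K s' : (forall r, J' (r * b) -> sat Q K r) ->
    (forall r, K r -> J' (r * b)) -> regs K Q s' ->
    regs (adj J' b) Q s' -> regs J' Q s'.
  by apply: H => r /Jb // Pr; exact: sub_sat.
elim: s' J' K => //= c s' IH J' K H1 H2 [Qc nK rK] [_ nJ rJ].
split => //.
- move=> a Ja; have [|t Qt [r _ Jr]] := nJ a; first exact: sub_adj.
  have J1 : J' (c * r * b).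
    have -> : c * r * b = t * (c * a) - c * (t * a - r * b) by ring.
    by apply: idealB; exact: idealM.
  have [u Qu Pu] := nzd_at_sat nK (H1 _ J1).
  exists (u * t); first exact: primeNM.
  have -> : u * t * a = u * (t * a - r * b) + u * r * b by ring.
  by apply: idealD; [exact: idealM|exact: H2].
- apply: (IH _ (adj K c)) => //; last by rewrite adjC.
    move=> r [a _ Ja].
    have [|t Qt [d _ Jd]] := nJ a.
      by exists r => //; rewrite -opprB; apply: idealN; rewrite [c * a]mulrC.
    have J1 : J' ((t * r - c * d) * b).
      have -> : (t * r - c * d) * b = t * (r * b - a * c) + c * (t * a - d * b) by ring.
      by apply: idealD; exact: idealM.
    have [u Qu Pu] := H1 _ J1.
    exists (u * t); first exact: primeNM.
    by exists (u * d) => //; apply: (icast Pu); ring.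
  move=> r [a _ Pa]; exists (a * b) => //.
  by apply: (icast (H2 _ Pa)); ring.
Qed.

Lemma regs_in I Q s : regs I Q s -> forall x, x \in s -> Q x.
Proof.
elim: s I => //= x s IH I [Qx _ /IH h] y.
by rewrite inE => /orP[/eqP ->|/h].
Qed.

Lemma regs_filtration P J Q s g r : P `<=` Q -> ~ Q g -> adjs J s g ->
  (forall i, (i < size s)%N -> forall c, adjs J (take i s) (c * s`_i) <-> P c) ->
  regs P Q r -> regs J Q r.
Proof.
move=> PQ Qg; elim: s J => [|b s IH] J /= Jg HJ rP.
  (* At the end of the filtration the ideal contains [g], which is outside [Q]: the localized
     quotient is zero and every sequence in [Q] is regular on it. *)
  have := regs_in rP.
  elim: (r) J Jg {HJ rP} => //= x r' IHr J Jg rQ; split.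
  - by apply: rQ; rewrite inE eqxx.
  - by move=> a _; exists g => //; exact: idealMr.
  - apply: IHr; first exact: sub_adj.
    by move=> y h; apply: rQ; rewrite inE h orbT.
apply: (@nzd_step P J b) => //; first exact: (HJ 0%N).
by apply: IH => // i ilt; exact: (HJ i.+1).
Qed.

End PrincipalIdeal.

(** * Transfer along quotients and localizations *)

Section SatEquality.
Variable R : comPzRingType.
Implicit Types (I J : ideal R) (P Q : spec R) (s : seq R) (a b c x y z t : R).

Lemma sat_adj Q I J x : sat Q I `<=` sat Q J -> sat Q (adj I x) `<=` sat Q (adj J x).
Proof.
move=> IJ a [t Qt [c _ Ic]].
have [u Qu Ju] := IJ _ (@sub_sat _ Q I _ Ic).
exists (u * t); first exact: primeNM.
by exists (u * c) => //; apply: (icast Ju); ring.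
Qed.

Lemma sat_adjs Q I J s : sat Q I `<=` sat Q J -> sat Q (adjs I s) `<=` sat Q (adjs J s).
Proof. by elim: s I J => //= x s IH I J IJ; apply: IH; exact: sat_adj. Qed.

Lemma nzd_at_congr Q I J x : sat Q I `<=` sat Q J -> sat Q J `<=` sat Q I ->
  nzd_at I Q x -> nzd_at J Q x.
Proof.
move=> IJ JI nx a /(@sub_sat _ Q) /JI [t Qt It]; apply: IJ.
by apply: (sat_cancel Qt); apply: nx; rewrite mulrCA.
Qed.

Lemma regs_congr Q I J s : sat Q I `<=` sat Q J -> sat Q J `<=` sat Q I ->
  regs I Q s -> regs J Q s.
Proof.
elim: s I J => //= x s IH I J IJ JI [Qx nx rs]; split => //.
  exact: nzd_at_congr nx.
by apply: IH rs; exact: sat_adj.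
Qed.

Lemma gens_congr Q I J s : sat Q I `<=` sat Q J -> gens_at I Q s -> gens_at J Q s.
Proof. by move=> IJ [sQ Qs]; split => // a /Qs; exact: sat_adjs. Qed.

End SatEquality.

Definition isunit (R : comPzRingType) (a : R) := exists u, u * a = 1.

Lemma isunit_notin (R : comPzRingType) (a : R) (Q : spec R) : isunit a -> ~ Q a.
Proof. by move=> [u ua] Qa; apply: (@spec_proper _ Q); rewrite -ua; exact: idealM. Qed.

Lemma isunitM (R : comPzRingType) (a b : R) : isunit a -> isunit b -> isunit (a * b).
Proof.
by move=> [u ua] [v vb]; exists (u * v); rewrite mulrACA ua vb mulr1.
Qed.

Section Preimage.
Variables (R L : comPzRingType) (f : {rmorphism R -> L}).

Section PreimageIdeal.
Variable J : ideal L.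
Fact preim0 : (f @^-1` J) 0. Proof. by rewrite /= rmorph0; exact: ideal0. Qed.
Fact preimD a b : (f @^-1` J) a -> (f @^-1` J) b -> (f @^-1` J) (a + b).
Proof. by rewrite /= rmorphD; exact: idealD. Qed.
Fact preimM a b : (f @^-1` J) b -> (f @^-1` J) (a * b).
Proof. by rewrite /= rmorphM; exact: idealM. Qed.
Definition preim := Ideal preim0 preimD preimM.
End PreimageIdeal.

Section PreimageSpec.
Variable Q : spec L.
Fact preim_proper : ~ preim Q 1.
Proof. by rewrite /= rmorph1; exact: spec_proper. Qed.
Fact preim_prime a b : preim Q (a * b) -> preim Q a \/ preim Q b.
Proof. by rewrite /= rmorphM; exact: spec_prime. Qed.
Definition pre := Spec preim_proper preim_prime.
End PreimageSpec.

(* Both quotient maps and localization maps have this property. *)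
Hypothesis lf : forall l, exists s a, isunit (f s) /\ f s * l = f a.
Implicit Types (J : ideal L) (Q : spec L).

Lemma unit_notin Q s : isunit (f s) -> ~ pre Q s.
Proof. by move=> us /=; exact: isunit_notin. Qed.

Lemma pre_sat Q J a : sat (pre Q) (preim J) a <-> sat Q J (f a).
Proof.
split=> [[t Qt]|[l Ql Jl]].
  by rewrite /= rmorphM; exists (f t).
have [s [b [us E]]] := lf l; exists b.
  by move=> /=; rewrite -E; apply: primeNM => //; exact: isunit_notin.
by rewrite /= rmorphM -E -mulrA; exact: idealM.
Qed.

Lemma pre_nzd Q J x : nzd_at (preim J) (pre Q) x <-> nzd_at J Q (f x).
Proof.
split=> [nx l Jl|nx a Ja]; last by apply/pre_sat/nx; rewrite -rmorphM; exact: Ja.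
have [s [b [us E]]] := lf l.
apply: (@sat_cancel _ _ _ (f s)); first exact: isunit_notin.
by rewrite E; apply/pre_sat/nx; rewrite /= rmorphM -E mulrCA; exact: idealM.
Qed.

Lemma pre_adj Q J x :
  sat (pre Q) (preim (adj J (f x))) `<=` sat (pre Q) (adj (preim J) x) /\
  sat (pre Q) (adj (preim J) x) `<=` sat (pre Q) (preim (adj J (f x))).
Proof.
split; last first.
  apply: sat_mono; apply: adj_min => [a /= Ja|/=]; first exact: sub_adj.
  exact: adj_in.
move=> a h; apply: sat_idem; case: h => t Qt [l _ Jl].
exists t => //; have [s [b [us E]]] := lf l.
exists s; first exact: unit_notin.
exists b => //=; rewrite rmorphB !rmorphM -E.
by apply: (icast (idealM (f s) Jl)); rewrite rmorphM; ring.
Qed.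

Lemma pre_regs Q J s : regs (preim J) (pre Q) s <-> regs J Q (map f s).
Proof.
elim: s J => //= x s IH J; have [h1 h2] := pre_adj Q J x.
split=> -[Qx /pre_nzd nx rs]; split => //; first by apply/IH; apply: regs_congr rs.
by move/IH: rs; exact: regs_congr.
Qed.

Lemma pre_adjs Q J s :
  sat (pre Q) (preim (adjs J (map f s))) `<=` sat (pre Q) (adjs (preim J) s) /\
  sat (pre Q) (adjs (preim J) s) `<=` sat (pre Q) (preim (adjs J (map f s))).
Proof.
elim: s J => [|x s IH] J /=; first by split.
have [h1 h2] := pre_adj Q J x; have [h3 h4] := IH (adj J (f x)); split.
  by apply: subset_trans h3 _; exact: sat_adjs.
by apply: subset_trans h4; exact: sat_adjs.
Qed.

Lemma pre_gens Q J s : gens_at (preim J) (pre Q) s <-> gens_at J Q (map f s).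
Proof.
have [h1 h2] := pre_adjs Q J s.
split=> -[sQ Qs]; split.
- by move=> z /mapP[y ys ->]; exact: (sQ y).
- move=> l Ql; have [t [a [us E]]] := lf l.
  apply: (@sat_cancel _ _ _ (f t)); first exact: isunit_notin.
  rewrite E; apply/pre_sat/h2/Qs => /=.
  by rewrite -E; exact: idealM.
- by move=> z zs; apply: sQ; exact: map_f.
- by move=> a Qa; apply/h1/pre_sat; exact: Qs.
Qed.

Section ImageSpec.
Variable P : spec R.
Hypothesis kP : forall a, f a = 0 -> P a.
Hypothesis uP : forall s, isunit (f s) -> ~ P s.
Definition img_set : set L := [set l | exists s a, [/\ isunit (f s), P a & f s * l = f a]].

Fact img_in a : img_set (f a) <-> P a.
Proof.
split=> [[s [b [us Pb E]]]|Pa]; last first.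
  by exists 1, a; split => //; [exists 1; rewrite rmorph1 mulr1|rewrite rmorph1 mul1r].
apply: (primeMl (uP us)); apply: (idealBr _ Pb); apply: kP.
by rewrite rmorphB rmorphM E subrr.
Qed.
Fact img0 : img_set 0. Proof. by rewrite -(rmorph0 f) img_in; exact: ideal0. Qed.
Fact imgD a b : img_set a -> img_set b -> img_set (a + b).
Proof.
move=> [s [c [us Pc E]]] [t [d [ut Pd F]]]; exists (s * t), (t * c + s * d).
split; first by rewrite rmorphM; exact: isunitM.
  by apply: idealD; exact: idealM.
by rewrite rmorphD !rmorphM -E -F; ring.
Qed.
Fact imgM a b : img_set b -> img_set (a * b).
Proof.
move=> [s [c [us Pc E]]]; have [t [d [ut F]]] := lf a.
exists (t * s), (d * c); split; first by rewrite rmorphM; exact: isunitM.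
  exact: idealM.
by rewrite !rmorphM -E -F; ring.
Qed.
Definition img_ideal := Ideal img0 imgD imgM.
Fact img_proper : ~ img_ideal 1.
Proof. by rewrite -(rmorph1 f) => /img_in; exact: spec_proper. Qed.
Fact img_prime a b : img_ideal (a * b) -> img_ideal a \/ img_ideal b.
Proof.
have [s [c [us E]]] := lf a; have [t [d [ut F]]] := lf b.
move=> /(imgM (f s * f t)).
have -> : f s * f t * (a * b) = f (c * d) by rewrite rmorphM -E -F; ring.
move=> /img_in /spec_prime[Pc|Pd]; [left; exists s, c|right; exists t, d];
  by split.
Qed.
Definition img := Spec img_proper img_prime.
Lemma pre_img : pre img = P.
Proof. by apply: spec_eqP => a /=; rewrite -[img_set _]/(img_set (f a)) img_in. Qed.
End ImageSpec.

Lemma pre_sub Q Q' : pre Q' `<=` pre Q -> Q' `<=` Q.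
Proof.
move=> QQ' l Ql; have [s [a [us E]]] := lf l.
have : pre Q a by apply: QQ' => /=; rewrite -E; exact: idealM.
by rewrite /= -E => /spec_prime[/isunit_notin|].
Qed.

Lemma pre_sub' Q Q' : Q' `<=` Q -> pre Q' `<=` pre Q.
Proof. by move=> QQ' a /=; exact: QQ'. Qed.

Lemma pre_hge Q J h : hge (preim J) (pre Q) h <-> hge J Q h.
Proof.
elim: h Q => [|h IH] Q /=.
  split=> [H l Jl|H a /= /H //]; have [s [a [us E]]] := lf l.
  have : pre Q a by apply: H => /=; rewrite -E; exact: idealM.
  by rewrite /= -E => /spec_prime[/isunit_notin|].
split=> [[P [PQ QP hP]]|[Q' [Q'Q QQ' hQ']]]; last first.
  exists (pre Q'); split; last exact/IH.
    exact: pre_sub'.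
  by move=> /pre_sub.
have kP a : f a = 0 -> P a.
  by move=> fa; apply: (hge_sub hP) => /=; rewrite fa; exact: ideal0.
have uP s : isunit (f s) -> ~ P s by move=> us /PQ; exact: unit_notin.
exists (img kP uP); split.
- by apply: pre_sub; rewrite pre_img.
- by move=> h'; apply: QP; rewrite -(pre_img kP uP); exact: pre_sub'.
- by apply/IH; rewrite pre_img.
Qed.

Lemma adj_unit J x u : isunit u -> adj J (u * x) = adj J x.
Proof.
move=> [v vu]; apply: ideal_eqP; apply: adj_min; try exact: sub_adj.
  by apply: idealM; exact: adj_in.
by apply: (icast (idealM v (adj_in J (u * x)))); rewrite mulrA vu mul1r.
Qed.

Lemma lift_seq J Q ls : exists s : seq R, [/\ size s = size ls,
  adjs J (map f s) = adjs J ls, (forall z, z \in ls -> Q z) ->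
    (forall z, z \in map f s -> Q z) & regs J Q ls -> regs J Q (map f s)].
Proof.
elim: ls J => [|l ls IH] J; first by exists [::].
have [t [a [ut E]]] := lf l; have [s [h1 h2 h3 h4]] := IH (adj J l).
have Ea : adj J (f a) = adj J l by rewrite -E adj_unit.
exists (a :: s); split; rewrite /= ?Ea //; first by rewrite h1.
  move=> H z; rewrite inE => /orP[/eqP ->|].
    by rewrite -E; apply: idealM; apply: H; rewrite inE eqxx.
  by apply: h3 => y ys; apply: H; rewrite inE ys orbT.
move=> [Ql nl rl]; split; last exact: h4.
  by rewrite -E; exact: idealM.
move=> b; rewrite -E -mulrA; case: ut => v vt /(idealM v).
by rewrite mulrA vt mul1r => /nl.
Qed.

Lemma pre_reg Q J : reg (preim J) (pre Q) <-> reg J Q.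
Proof.
split=> -[IQ [s1 [s2 [g1 r2 sz]]]].
  split; first exact: (pre_hge Q J 0).1 IQ.
  exists (map f s1), (map f s2); rewrite !size_map.
  by split => //; [exact/pre_gens|exact/pre_regs].
split; first exact: (pre_hge Q J 0).2 IQ.
have [t1 [z1 e1 q1 _]] := lift_seq J Q s1.
have [t2 [z2 _ _ q2]] := lift_seq J Q s2.
exists t1, t2; rewrite z1 z2; split => //; last by apply/pre_regs/q2.
by apply/pre_gens; case: g1 => h1 h2; split; [exact: q1|rewrite e1].
Qed.

Lemma noeth_image : noetherian R -> noetherian L.
Proof.
move=> nR J; have [s Es] := noeth_fg nR (preim J).
exists (map f s); rewrite gen_adjs; apply/seteqP; split => [l Jl|].
  have [t [a [[u ut] E]]] := lf l.
  have : preim J a by rewrite /= -E; exact: idealM.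
  rewrite Es => h; have : preim (adjs (izero L) (map f s)) a.
    apply: adjs_min h => [b ->|x xs /=]; first exact: ideal0.
    by apply: adjs_in; exact: map_f.
  by rewrite /= -E => /(idealM u); rewrite mulrA ut mul1r.
apply: adjs_min => [l ->|_ /mapP[x xs ->]]; first exact: ideal0.
by have : preim J x by rewrite Es; exact: adjs_in.
Qed.

End Preimage.

Section LocalRing.
Variables (L : comPzRingType) (M : spec L).
Hypothesis lM : forall l, ~ M l -> isunit l.

Lemma local_ringP : local_ring M.
Proof.
have mM : maximal_ideal M.
  split=> [|J MJ J1]; first exact: spec_proper.
  apply/seteqP; split => // l Jl; apply: contrapT => /lM[u ul].
  by apply: J1; rewrite -ul; exact: idealM.
split => // J [J1 Jm].
have JM : J `<=` M.
  move=> l Jl; apply: contrapT => /lM[u ul].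
  by apply: J1; rewrite -ul; exact: idealM.
by rewrite -(Jm M JM (@spec_proper _ M)).
Qed.

Lemma local_ring_uniq (m : ideal L) : local_ring m -> m = M.
Proof.
move=> [mm _]; have [_ h] := local_ringP.
by have E := h m mm; apply: ideal_eqP => a; rewrite E.
Qed.

Lemma sat_local (I : ideal L) : sat M I `<=` I.
Proof.
move=> a [t /lM[u ut] It]; rewrite -[a]mul1r -ut -mulrA; exact: idealM.
Qed.

Lemma chain_hge (c : nat -> spec L) n : prime_chain c n -> hge (izero L) (c n) n.
Proof.
elim: n => [|n IH] H /=; first exact: izero_sub.
have [le ne] := H n (ltnSn n).
by exists (c n); split => //; apply: IH => i h; apply: H; exact: ltnW.
Qed.

Lemma hge_chain Q n : hge (izero L) Q n -> exists c, prime_chain c n /\ c n = Q.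
Proof.
elim: n Q => [|n IH] Q /=; first by exists (fun=> Q).
move=> [Q' [Q'Q QQ' /IH[c [Hc cn]]]].
exists (fun i => if (i <= n)%N then c i else Q); split; last by rewrite ltnn.
move=> i; rewrite ltnS => ile; rewrite ile.
case: ltnP => h; first exact: Hc.
have -> : i = n by apply/eqP; rewrite eqn_leq ile.
by rewrite cn; split.
Qed.

Lemma krull_dimP h : has_krull_dim L h <-> is_height (izero L) M h.
Proof.
have up (c : nat -> spec L) n : prime_chain c n -> hge (izero L) M n.
  move=> Hc; have hc := chain_hge Hc; apply: hge_up hc => l cl; apply: contrapT => /lM ul.
  exact: (isunit_notin ul) cl.
split=> -[h1 h2]; split.
- by case: h1 => c /up.
- by move=> k /hge_chain[c [Hc _]]; exact: h2 Hc.
- by have [c [Hc _]] := hge_chain h1; exists c.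
- by move=> c k /up; exact: h2.
Qed.

Lemma gen_regs s : [set` s] `<=` M ->
  (regular_seq s <-> regs (izero L) M s).
Proof.
move=> sM; have H I r : (forall z, z \in r -> M z) ->
    ((forall i a, (i < size r)%N -> adjs I (take i r) (r`_i * a) ->
      adjs I (take i r) a) <-> regs I M r).
  elim: r I => //= x r IH I rM; split=> [H|[Mx nx rr] [|i] a /=].
  - split; first by apply: rM; rewrite inE eqxx.
      by move=> a Ia; apply: sub_sat; exact: (H 0%N).
    apply/IH; first by move=> z zr; apply: rM; rewrite inE zr orbT.
    by move=> i a ilt; exact: (H i.+1).
  - by move=> _ Ia; apply: sat_local; exact: nx.
  - rewrite ltnS; apply/IH: i a => //.
    by move=> z zr; apply: rM; rewrite inE zr orbT.
split=> [[h _]|/(H _ _ sM) h].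
  by apply/(H _ _ sM) => i a; have := h i a; rewrite !gen_adjs.
split=> [i a|]; first by rewrite !gen_adjs; exact: h.
by move=> /(gen_min sM); exact: spec_proper.
Qed.

Lemma depthP e : has_depth M e <->
  (exists s, regs (izero L) M s /\ size s = e) /\
  (forall s, regs (izero L) M s -> (size s <= e)%N).
Proof.
have sM s : regs (izero L) M s -> [set` s] `<=` M by move=> /regs_in.
split=> -[h1 h2]; split.
- by case: h1 => s [/gen_regs h hM sz]; exists s; split => //; exact: h.
- by move=> s rs; apply: h2; [apply/gen_regs => //; exact: sM|exact: sM].
- case: h1 => s [rs sz]; exists s; split => //; last exact: sM.
  by apply/gen_regs => //; exact: sM.
- by move=> s /gen_regs h hM; apply: h2; exact: h.
Qed.

Lemma regular_localP : noetherian L -> (regular_local L <-> exists s,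
  gens_at (izero L) M s /\ is_height (izero L) M (size s)).
Proof.
move=> nL; split=> [[_ [m [s [/local_ring_uniq -> E hd]]]]|[s [[sM Ms] hs]]].
  exists s; split; last exact/krull_dimP.
  split=> [z zs|a]; first by rewrite -E; exact: sub_gen.
  by rewrite -E gen_adjs; exact: sub_sat.
split => //; exists M, s; split; [exact: local_ringP| |exact/krull_dimP].
rewrite gen_adjs; apply/seteqP; split; last by move=> a /Ms /sat_local.
by apply: adjs_min => //; exact: izero_sub.
Qed.

End LocalRing.

Section QuotientMap.
Local Open Scope quotient_scope.
Variables (R : comPzRingType) (I : ideal R).

Definition qmap (a : R) : quo I := \pi_(quo I) a.

Lemma qmap_eq a b : qmap a = qmap b <-> I (a - b).
Proof.
rewrite /qmap (rwP eqP) -Quotient.idealrBE; split => [/asboolP //|Iab].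
exact/asboolP.
Qed.

Fact qmapB : zmod_morphism qmap.
Proof.
have D a b : qmap a + qmap b = qmap (a + b).
  by rewrite /qmap (@Quotient.pi_add R (ideal_pred I)).
by move=> a b; apply: (addIr (qmap b)); rewrite D !subrK.
Qed.

Fact qmapM : monoid_morphism qmap.
Proof.
split => // a b.
have Ir c : I (repr (\pi_(quo I) c) - c) by apply/qmap_eq; rewrite /qmap reprK.
rewrite /GRing.mul /= /quoM; unlock; apply/qmap_eq; rewrite -opprB; apply: idealN.
set a' := repr _; set b' := repr _.
have -> : a' * b' - a * b = b' * (a' - a) + a * (b' - b) by ring.
by apply: idealD; apply: idealM; exact: Ir.
Qed.

HB.instance Definition _ := GRing.isZmodMorphism.Build R (quo I) qmap qmapB.
HB.instance Definition _ := GRing.isMonoidMorphism.Build R (quo I) qmap qmapM.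

Lemma qmap_surj (l : quo I) : exists a, qmap a = l.
Proof. by exists (repr l); rewrite /qmap reprK. Qed.

Lemma qmap_ker a : qmap a = 0 <-> I a.
Proof. by rewrite -(rmorph0 qmap) qmap_eq subr0. Qed.

End QuotientMap.

Section LocMap.
Local Open Scope quotient_scope.
Variables (R : comPzRingType) (S : mulset R).

Lemma loc_eq (x y : Defs.frac S) : (\pi_(loc S) x = \pi_(loc S) y) <->
  (exists2 u, S u & u * (x.1 * sval y.2) = u * (y.1 * sval x.2)).
Proof.
rewrite (rwP eqP) eqmodE /=; split => [/asboolP //|h]; exact/asboolP.
Qed.

Lemma loc_rep (x : Defs.frac S) : let y := repr (\pi_(loc S) x) in
  exists2 u, S u & u * (y.1 * sval x.2) = u * (x.1 * sval y.2).
Proof. by move=> y; apply/loc_eq; rewrite reprK. Qed.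

Lemma loc_addE (x y : Defs.frac S) :
  \pi_(loc S) x + \pi_(loc S) y = \pi_(loc S) (fracD x y).
Proof.
rewrite /GRing.add /= /locD; unlock; apply/loc_eq.
have [u Su eu] := loc_rep x; have [v Sv ev] := loc_rep y.
exists (u * v); first exact: mulsetM.
move: (repr (\pi_(loc S) x)) (repr (\pi_(loc S) y)) eu ev => x' y' eu ev /=.
transitivity (u * (x'.1 * sval x.2) * (v * sval y'.2 * sval y.2)
            + v * (y'.1 * sval y.2) * (u * sval x'.2 * sval x.2)).
  by ring.
by rewrite eu ev; ring.
Qed.

Lemma loc_mulE (x y : Defs.frac S) :
  \pi_(loc S) x * \pi_(loc S) y = \pi_(loc S) (fracM x y).
Proof.
rewrite /GRing.mul /= /locM; unlock; apply/loc_eq.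
have [u Su eu] := loc_rep x; have [v Sv ev] := loc_rep y.
exists (u * v); first exact: mulsetM.
move: (repr (\pi_(loc S) x)) (repr (\pi_(loc S) y)) eu ev => x' y' eu ev /=.
transitivity (u * (x'.1 * sval x.2) * (v * (y'.1 * sval y.2))); first by ring.
by rewrite eu ev; ring.
Qed.

Lemma loc_map_eq a b : loc_map S a = loc_map S b <-> exists2 u, S u & u * a = u * b.
Proof. by rewrite loc_eq /= !mulr1. Qed.

Fact loc_mapD : nmod_morphism (loc_map S).
Proof.
split=> // a b; rewrite loc_addE; apply/loc_eq; exists 1; first exact: mulset1.
by rewrite /=; ring.
Qed.

Fact loc_mapM : monoid_morphism (loc_map S).
Proof.
split=> // a b; rewrite loc_mulE; apply/loc_eq; exists 1; first exact: mulset1.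
by rewrite /=; ring.
Qed.

HB.instance Definition _ := GRing.isNmodMorphism.Build R (loc S) (loc_map S) loc_mapD.
HB.instance Definition _ := GRing.isMonoidMorphism.Build R (loc S) (loc_map S) loc_mapM.

Lemma loc_map_unit s : S s -> isunit (loc_map S s).
Proof.
move=> Ss; exists (\pi_(loc S) (mkfrac 1 Ss)); rewrite loc_mulE.
by apply/loc_eq; exists 1; [exact: mulset1|rewrite /=; ring].
Qed.

Lemma loc_map_frac l : exists s a, S s /\ loc_map S s * l = loc_map S a.
Proof.
elim/quotW: l => -[a [s Ss]]; exists s, a; split; first exact: asboolW.
by rewrite loc_mulE; apply/loc_eq; exists 1; [exact: mulset1|rewrite /=; ring].
Qed.

Lemma loc_map_ker a : loc_map S a = 0 <-> exists2 u, S u & u * a = 0.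
Proof.
rewrite -(rmorph0 (loc_map S)) loc_map_eq.
by split=> -[u Su E]; exists u; rewrite // mulr0 in E *.
Qed.

End LocMap.

(** Says that [L] is a localization of [R/I], without naming a multiplicative set. It holds for
    [loc_at] with [I] zero and for [loc_quo] with [I] principal, so that both are treated at
    once. *)
Definition gloc (R L : comPzRingType) (f : {rmorphism R -> L}) (I : ideal R) :=
  (forall l, exists s a, isunit (f s) /\ f s * l = f a) /\
  (forall a, f a = 0 <-> exists s, isunit (f s) /\ I (s * a)).

Definition lmap (R : comPzRingType) (P : spec R) : {rmorphism R -> loc_at P} :=
  loc_map (prime_compl P).

Lemma gloc_id (R : comPzRingType) (P : spec R) :
  gloc (lmap P) (izero R).
Proof.
split=> [l|a].
  have [s [a [Ss E]]] := loc_map_frac l; exists s, a; split => //.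
  exact: loc_map_unit.
split=> [/loc_map_ker[u Su E]|[s [[u us] E]]].
  by exists u; split => //; exact: loc_map_unit.
by rewrite -[LHS]mul1r -us -mulrA -rmorphM E rmorph0 mulr0.
Qed.

Lemma princ_adj (R : comPzRingType) (a : R) : princ a = adj (izero R) a.
Proof.
apply: ideal_eqP; first by apply: gen_min => b ->; exact: adj_in.
by apply: adj_min; [exact: izero_sub|exact: sub_gen].
Qed.

Lemma gloc_quo (R L : comPzRingType) (f : {rmorphism R -> L}) (x : R) :
  gloc f (izero R) -> gloc (qmap (princ (f x)) \o f) (adj (izero R) x).
Proof.
move=> [lf kf].
have uq s : isunit (f s) -> isunit (qmap (princ (f x)) (f s)).
  by move=> [u us]; exists (qmap _ u); rewrite -rmorphM us rmorph1.
have prE l : princ (f x) l <-> exists c, l = c * f x.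
  split=> [|[c ->]]; last by apply: idealM; exact: sub_gen.
  have -> : princ (f x) = adj (izero _) (f x) by exact: princ_adj.
  by move=> [c _ /eqP]; rewrite subr_eq0 => /eqP ->; exists c.
split=> [l|a] /=.
  have [l' <-] := qmap_surj l; have [s [a [us E]]] := lf l'.
  by exists s, a; split; [exact: uq|rewrite -rmorphM E].
split=> [/qmap_ker/prE[c E]|[s [[u us] [c _ /eqP]]]].
  have [s [b [us F]]] := lf c.
  have /kf[t [ut /= tE]] : f (s * a - b * x) = 0.
    by rewrite rmorphB !rmorphM E mulrA F subrr.
  exists (t * s); split; first by apply: uq; rewrite rmorphM; exact: isunitM.
  by exists (t * b) => //=; rewrite -[RHS]tE; ring.
rewrite subr_eq0 => /eqP E; rewrite -[LHS]mul1r -us -mulrA -!rmorphM E.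
rewrite rmorphM rmorphM /=; have -> : qmap (princ (f x)) (f x) = 0.
  by apply/qmap_ker; exact: sub_gen.
by rewrite !mulr0.
Qed.

Section LocalizedQuotient.
Variables (R R' : comPzRingType) (f : {rmorphism R -> R'}) (I : ideal R).
Hypotheses (nR : noetherian R) (gf : gloc f I).
Variable Q' : spec R'.
Let lm := lmap Q'.
Let Q := pre f Q'.

Let llm l : exists s a, isunit (lm s) /\ lm s * l = lm a.
Proof. by have [h _] := gloc_id Q'; exact: h. Qed.

Let kP a : lm a = 0 -> Q' a.
Proof.
move=> /loc_map_ker[u Qu E]; apply: contrapT => Qa.
by apply: (@primeNM _ Q' u a) => //; rewrite E; exact: ideal0.
Qed.

Let uP s : isunit (lm s) -> ~ Q' s.
Proof.
move=> [l ls] Qs; have [t [a [ut E]]] := loc_map_frac l.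
have /kP : lm (a * s - t) = 0.
  by rewrite rmorphB rmorphM -[lm a]E -mulrA ls mulr1 subrr.
by move=> /idealBl/(_ (idealM a Qs)) /ut.
Qed.

Let M := img llm kP uP.

Let lM l : ~ M l -> isunit l.
Proof.
move=> Ml; have [s [a [Ss E]]] := loc_map_frac l.
have [v vE] : isunit (lm a).
  apply: loc_map_unit => Qa; apply: Ml; exists s, a; split => //.
  exact: loc_map_unit.
exists (v * lm s); by rewrite -mulrA [lm s * l]E.
Qed.

Let g : {rmorphism R -> loc_at Q'} := lm \o f.

Let lg l : exists s a, isunit (g s) /\ g s * l = g a.
Proof.
have [s [b [us E]]] := llm l; have [lf _] := gf.
have [t [s' [[t1 ut] E1]]] := lf s; have [t' [b' [[t1' ut'] E2]]] := lf b.
have ul c d : d * c = 1 -> isunit (lm c).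
  by move=> dc; exists (lm d); rewrite -rmorphM dc rmorph1.
exists (t' * s'), (t * b'); rewrite /g /= !rmorphM /=; split.
  apply: isunitM; first exact: (ul _ _ ut').
  by rewrite -E1 rmorphM; apply: isunitM => //; exact: (ul _ _ ut).
by rewrite -E1 -E2 !rmorphM -E; ring.
Qed.

Let gM : pre g M = Q.
Proof.
have E : pre lm M = Q' by exact: pre_img.
have {}E (a : R') : M (lm a) <-> Q' a.
  by have := congr1 (fun P : spec R' => P a) E => /= ->.
by apply: spec_eqP => a /=; [move/E|move=> h; apply/E].
Qed.

Let gker a : preim g (izero _) a <-> sat Q I a.
Proof.
have [lf kf] := gf; split=> [/loc_map_ker[u Qu E]|[s Qs Is]].
  have [t [b [ut F]]] := lf u.
  have /kf[s [us Is]] : f (b * a) = 0 by rewrite rmorphM -F -mulrA E mulr0.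
  exists (s * b); last by rewrite -mulrA.
  apply: primeNM; first exact: unit_notin.
  by rewrite /= -F => /spec_prime[/isunit_notin|].
apply/loc_map_ker; exists (f s); first exact.
rewrite -rmorphM; apply/kf; exists 1; rewrite mul1r; split => //.
by exists 1; rewrite rmorph1 mulr1.
Qed.

Let s12 : sat Q (preim g (izero _)) `<=` sat Q I.
Proof. by move=> a [t Qt /gker h]; apply: sat_idem; exists t. Qed.
Let s21 : sat Q I `<=` sat Q (preim g (izero _)).
Proof. by move=> a h; apply: sub_sat; exact/gker. Qed.

Let hgeE h : I `<=` Q -> (hge (izero (loc_at Q')) M h <-> hge I Q h).
Proof.
move=> IQ; split=> [/(pre_hge lg)|hI]; first rewrite gM.
  by apply: hge_mono => a Ia; apply/gker; exact: sub_sat.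
apply/(pre_hge lg); rewrite gM.
have : Q `<=` Q by [].
elim: h {1 2 4}Q hI => [|h IH] P /=.
  by move=> IP PQ a /gker[t Qt /IP /spec_prime[/PQ|]].
move=> [P' [P'P PP' hP]] PQ; exists P'; split => //; apply: IH => // a /P'P.
exact: PQ.
Qed.

Hypothesis IQ : I `<=` Q.

Let heightE h : is_height (izero (loc_at Q')) M h <-> is_height I Q h.
Proof.
split=> -[h1 h2]; split=> [|k hk].
- exact/(hgeE h IQ).
- by apply: h2; exact/(hgeE k IQ).
- exact/(hgeE h IQ).
- by apply: h2; exact/(hgeE k IQ).
Qed.

Let nL : noetherian (loc_at Q'). Proof. exact: (noeth_image lg nR). Qed.

Lemma locq_krull_dim h : has_krull_dim (loc_at Q') h <-> is_height I Q h.
Proof. exact: (iff_trans (krull_dimP lM h) (heightE h)). Qed.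

Lemma locq_regular : regular_local (loc_at Q') <->
  exists s, gens_at I Q s /\ is_height I Q (size s).
Proof.
apply: (iff_trans (regular_localP lM nL)); split=> -[s [gs hs]].
  have [t [zt et qt _]] := lift_seq lg (izero _) M s.
  exists t; rewrite zt; split; last exact/heightE.
  have : gens_at (izero _) M (map g t).
    by case: gs => h1 h2; split; [exact: qt|rewrite et].
  by move=> /(pre_gens lg); rewrite gM; exact: gens_congr.
exists (map g s); rewrite size_map; split; last exact/heightE.
by apply/(pre_gens lg); rewrite gM; exact: gens_congr gs.
Qed.

Lemma locq_local : exists M : ideal (loc_at Q'), local_ring M /\
  forall e, has_depth M e <-> (exists s, regs I Q s /\ size s = e) /\
    forall s, regs I Q s -> (size s <= e)%N.
Proof.
exists M; split; first exact: (local_ringP lM).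
move=> e; apply: (iff_trans (depthP lM e)).
have down s : regs (izero _) M s -> exists2 t, regs I Q t & size t = size s.
  move=> rs; have [t [zt _ _ qt]] := lift_seq lg (izero _) M s.
  exists t => //; move/(pre_regs lg): (qt rs); rewrite gM; exact: regs_congr.
have upw s : regs I Q s -> regs (izero _) M (map g s).
  by move=> rs; apply/(pre_regs lg); rewrite gM; exact: regs_congr rs.
split=> -[[s [rs sz]] H]; split.
- by have [t rt zt] := down s rs; exists t; rewrite zt.
- by move=> t /upw /H; rewrite size_map.
- by exists (map g s); rewrite size_map; split => //; exact: upw.
- by move=> t /down[u /H + zu]; rewrite zu.
Qed.

End LocalizedQuotient.

Definition is_depth (R : comPzRingType) (I : ideal R) (Q : spec R) (e : nat) :=
  (exists s, regs I Q s /\ size s = e) /\ forall s, regs I Q s -> (size s <= e)%N.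

Section SerreAtPrimes.
Variable R : comPzRingType.
Hypothesis nR : noetherian R.

(** Serre's conditions for [R_Q] speak of the localizations of [R_Q]; a prime of it lying over [Q]
    itself gives back the statement at [Q]. *)
Let self (Q : spec R) : exists Q' : spec (loc_at Q), pre (lmap Q) Q' = Q.
Proof.
have [lf kf] := gloc_id Q.
have kP a : lmap Q a = 0 -> Q a.
  move=> /loc_map_ker[u Qu E]; apply: (primeMl Qu); rewrite E; exact: ideal0.
have uP s : isunit (lmap Q s) -> ~ Q s.
  move=> [l ls] Qs; have [t [a [Qt E]]] := loc_map_frac l; apply: Qt.
  apply: (idealBl _ (idealM a Qs)); apply: kP.
  have {}E : lmap Q t * l = lmap Q a := E.
  by rewrite rmorphB rmorphM -E -mulrA ls mulr1 subrr.
by exists (img lf kP uP); exact: pre_img.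
Qed.

Lemma serreR_at (Q : spec R) n h : serreR (loc_at Q) n ->
  is_height (izero R) Q h -> (h <= n)%N ->
  exists s, gens_at (izero R) Q s /\ is_height (izero R) Q (size s).
Proof.
have [Q' E] := self Q => sR hQ hn.
have IQ : izero R `<=` pre (lmap Q) Q' by exact: izero_sub.
rewrite -E; apply/(locq_regular nR (gloc_id Q) IQ).
apply: (sR Q' h) => //; apply: (locq_krull_dim (gloc_id Q) IQ h).2.
by rewrite E.
Qed.

Lemma serreS_at (Q : spec R) n : serreS (loc_at Q) n ->
  exists h e, [/\ is_height (izero R) Q h, is_depth (izero R) Q e & (minn n h <= e)%N].
Proof.
have [Q' E] := self Q => sS.
have IQ : izero R `<=` pre (lmap Q) Q' by exact: izero_sub.
have [m [h [e [lm hd dp le]]]] := sS Q'.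
have [M [lM dM]] := locq_local (gloc_id Q) Q'.
exists h, e; rewrite -E; split => //.
  exact/(locq_krull_dim (gloc_id Q) IQ).
apply/dM; suff <- : m = M by [].
have [mm _] := lm; have [_ /(_ m mm) F] := lM.
by apply: ideal_eqP => a; rewrite F.
Qed.

Lemma quo_prime (P : spec R) (x : R) (Q' : spec (loc_quo P x)) :
  let f := qmap (princ (lmap P x)) \o lmap P in
  pre f Q' `<=` P /\ adj (izero R) x `<=` pre f Q'.
Proof.
move=> f; split=> [a Qa|].
  apply: contrapT => Pa; have /= [u ua] := @loc_map_unit R (prime_compl P) a Pa.
  apply: (@spec_proper _ Q'); rewrite -(rmorph1 (qmap _)) -ua rmorphM.
  exact: idealM.
apply: adj_min; first exact: izero_sub.
rewrite /= /f /=; suff -> : qmap (princ (lmap P x)) (lmap P x) = 0 by exact: ideal0.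
by apply/qmap_ker; exact: sub_gen.
Qed.

Lemma serreR_quo (P : spec R) (x : R) n :
  (forall (Q : spec R) h, Q `<=` P -> Q x -> is_height (adj (izero R) x) Q h ->
     (h <= n)%N -> exists s, gens_at (adj (izero R) x) Q s /\
       is_height (adj (izero R) x) Q (size s)) ->
  serreR (loc_quo P x) n.
Proof.
move=> H Q' h; have [QP IQ] := quo_prime Q'.
have g := gloc_quo x (gloc_id P).
move=> /(locq_krull_dim g IQ) hQ hn; apply/(locq_regular nR g IQ).
by apply: (H _ h) => //; apply: IQ; exact: adj_in.
Qed.

Lemma serreS_quo (P : spec R) (x : R) n :
  (forall Q : spec R, Q `<=` P -> Q x ->
     exists h e, [/\ is_height (adj (izero R) x) Q h,
       is_depth (adj (izero R) x) Q e & (minn n h <= e)%N]) ->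
  serreS (loc_quo P x) n.
Proof.
move=> H Q'; have [QP IQ] := quo_prime Q'.
have g := gloc_quo x (gloc_id P).
have [|h [e [hh he le]]] := H _ QP; first by apply: IQ; exact: adj_in.
have [M [lM dM]] := locq_local g Q'.
exists M, h, e; split => //; first exact/(locq_krull_dim g IQ).
exact/dM.
Qed.

End SerreAtPrimes.

(** * Formal power series *)

Record ps (T : Type) := PS { pc : nat -> T }.

HB.instance Definition _ (T : Type) := gen_eqMixin (ps T).
HB.instance Definition _ (T : Type) := gen_choiceMixin (ps T).

Lemma psP (T : Type) (u v : ps T) : (forall i, pc u i = pc v i) -> u = v.
Proof. by case: u v => [u] [v] /= h; congr PS; apply/funext. Qed.

Section PowerSeries.
Variable T : comNzRingType.
Implicit Types (u v w : ps T) (i j n N : nat).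

Definition ps_add u v := PS (fun i => pc u i + pc v i).
Definition ps_opp u := PS (fun i => - pc u i).
Definition ps_zero : ps T := PS (fun=> 0).
Definition ps_mul u v := PS (fun n => \sum_(i < n.+1) pc u i * pc v (n - i)).
Definition ps_one : ps T := PS (fun i => (i == 0%N)%:R).

Fact ps_addA : associative ps_add.
Proof. by move=> u v w; apply: psP => i /=; rewrite addrA. Qed.
Fact ps_addC : commutative ps_add.
Proof. by move=> u v; apply: psP => i /=; rewrite addrC. Qed.
Fact ps_add0 : left_id ps_zero ps_add.
Proof. by move=> u; apply: psP => i /=; rewrite add0r. Qed.
Fact ps_addN : left_inverse ps_zero ps_opp ps_add.
Proof. by move=> u; apply: psP => i /=; rewrite addNr. Qed.

HB.instance Definition _ := GRing.isZmodule.Build (ps T) ps_addA ps_addC ps_add0 ps_addN.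

Definition trunc n u : {poly T} := \poly_(i < n) pc u i.

Lemma coef_trunc n u i : (i < n)%N -> (trunc n u)`_i = pc u i.
Proof. by rewrite coef_poly => ->. Qed.

(** Reduces the ring axioms to those of polynomials. *)
Lemma ps_mul_trunc n u v i : (i < n)%N -> pc (ps_mul u v) i = (trunc n u * trunc n v)`_i.
Proof.
move=> lt; rewrite coefM /=; apply: eq_bigr => j _.
rewrite !coef_trunc //; first exact: leq_ltn_trans (leq_subr _ _) lt.
by apply: leq_ltn_trans lt; rewrite -ltnS.
Qed.

Fact ps_mulC : commutative ps_mul.
Proof.
by move=> u v; apply: psP => i; rewrite !(@ps_mul_trunc i.+1) // mulrC.
Qed.
Fact ps_mulA : associative ps_mul.
Proof.
have H u v w i : pc (ps_mul u (ps_mul v w)) i =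
    (trunc i.+1 u * (trunc i.+1 v * trunc i.+1 w))`_i.
  rewrite coefM; apply: eq_bigr => j _ /=.
  by rewrite coef_trunc // -(@ps_mul_trunc i.+1) // ltnS leq_subr.
move=> u v w; apply: psP => i.
by rewrite H (ps_mulC (ps_mul u v)) H mulrA mulrC.
Qed.
Fact ps_mul1 : left_id ps_one ps_mul.
Proof.
move=> u; apply: psP => i /=; rewrite big_ord_recl /= mul1r subn0 big1 ?addr0 //.
by move=> j _; rewrite mul0r.
Qed.
Fact ps_mulD : left_distributive ps_mul ps_add.
Proof.
move=> u v w; apply: psP => i /=; rewrite -big_split; apply: eq_bigr => j _ /=.
exact: mulrDl.
Qed.
Fact ps_1neq0 : ps_one != 0.
Proof. by apply/eqP => /(congr1 (fun u => pc u 0)) /eqP; rewrite oner_eq0. Qed.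

HB.instance Definition _ :=
  GRing.Zmodule_isComNzRing.Build (ps T) ps_mulA ps_mulC ps_mul1 ps_mulD ps_1neq0.

Lemma pcD u v i : pc (u + v) i = pc u i + pc v i. Proof. by []. Qed.
Lemma pcB u v i : pc (u - v) i = pc u i - pc v i. Proof. by []. Qed.
Lemma pc0 i : pc (0 : ps T) i = 0. Proof. by []. Qed.
Lemma pc1 i : pc (1 : ps T) i = (i == 0%N)%:R. Proof. by []. Qed.
Lemma pcM u v n : pc (u * v) n = \sum_(i < n.+1) pc u i * pc v (n - i).
Proof. by []. Qed.
Lemma pc_sum (I : Type) (r : seq I) (P : pred I) (f : I -> ps T) i :
  pc (\sum_(j <- r | P j) f j) i = \sum_(j <- r | P j) pc (f j) i.
Proof. exact: (big_morph (fun u => pc u i) (fun u v => pcD u v i) (pc0 i)). Qed.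

Definition psp (p : {poly T}) : ps T := PS (fun i => p`_i).

Fact psp_zmod : zmod_morphism psp.
Proof. by move=> p q; apply: psP => i; rewrite /= coefB. Qed.
Fact psp_monoid : monoid_morphism psp.
Proof.
split; first by apply: psP => i; rewrite /= coef1.
by move=> p q; apply: psP => i; rewrite /= coefM.
Qed.
HB.instance Definition _ := GRing.isZmodMorphism.Build {poly T} (ps T) psp psp_zmod.
HB.instance Definition _ := GRing.isMonoidMorphism.Build {poly T} (ps T) psp psp_monoid.

Definition psC (a : T) : ps T := psp a%:P.
Fact psC_zmod : zmod_morphism psC.
Proof. by move=> a b; rewrite /psC !rmorphB. Qed.
Fact psC_monoid : monoid_morphism psC.
Proof. by split => [|a b]; rewrite /psC ?rmorph1 ?rmorphM. Qed.
HB.instance Definition _ := GRing.isZmodMorphism.Build T (ps T) psC psC_zmod.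
HB.instance Definition _ := GRing.isMonoidMorphism.Build T (ps T) psC psC_monoid.

Definition psX : ps T := psp 'X.

Lemma pc_psC a i : pc (psC a) i = if i == 0%N then a else 0.
Proof. by rewrite /= coefC. Qed.

Lemma psCM a u i : pc (psC a * u) i = a * pc u i.
Proof.
rewrite pcM big_ord_recl subn0 pc_psC big1 ?addr0 // => j _.
by rewrite pc_psC mul0r.
Qed.

Lemma psXnM n u i : pc (psX ^+ n * u) i = if (i < n)%N then 0 else pc u (i - n).
Proof.
rewrite (@ps_mul_trunc i.+1) // /psX -rmorphXn.
have E : (trunc i.+1 (psp 'X^n) * trunc i.+1 u)`_i = ('X^n * trunc i.+1 u)`_i.
  rewrite !coefM; apply: eq_bigr => j _; congr (_ * _).
  by rewrite coef_trunc.
rewrite E coefXnM; case: ltnP => // le; rewrite coef_trunc // ltnS.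
exact: leq_subr.
Qed.

Lemma psXM u i : pc (psX * u) i = if i is j.+1 then pc u j else 0.
Proof. by rewrite -[psX]expr1 psXnM; case: i => // i; rewrite subn1. Qed.

Definition shift n u : ps T := PS (fun i => pc u (i + n)).

Lemma ps_split n u : u = psp (trunc n u) + psX ^+ n * shift n u.
Proof.
apply: psP => i; rewrite pcD psXnM /= coef_poly.
by case: ltnP => h; rewrite ?addr0 // add0r subnK.
Qed.

Lemma psp_sum p : psp p = \sum_(i < size p) psC p`_i * psX ^+ i.
Proof.
rewrite -{1}[p]coefK poly_def rmorph_sum; apply: eq_bigr => i _.
by rewrite -mul_polyC rmorphM rmorphXn.
Qed.

Lemma psX_dvd n u : (forall i, (i < n)%N -> pc u i = 0) -> exists v, u = psX ^+ n * v.
Proof.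
move=> h; exists (shift n u); rewrite {1}(ps_split n u).
suff -> : trunc n u = 0 by rewrite rmorph0 add0r.
by apply/polyP => i; rewrite coef0 coef_poly; case: ltnP => // /h.
Qed.

End PowerSeries.

Section MapPs.
Variables (S T : comNzRingType) (f : {rmorphism S -> T}).
Definition map_ps (u : ps S) : ps T := PS (fun i => f (pc u i)).
Fact map_ps_zmod : zmod_morphism map_ps.
Proof. by move=> u v; apply: psP => i; rewrite /= rmorphB. Qed.
Fact map_ps_monoid : monoid_morphism map_ps.
Proof.
split; first by apply: psP => i; rewrite /= rmorph_nat.
move=> u v; apply: psP => i; rewrite /= rmorph_sum; apply: eq_bigr => j _.
exact: rmorphM.
Qed.
HB.instance Definition _ := GRing.isZmodMorphism.Build (ps S) (ps T) map_ps map_ps_zmod.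
HB.instance Definition _ := GRing.isMonoidMorphism.Build (ps S) (ps T) map_ps map_ps_monoid.

Lemma map_psC a : map_ps (psC a) = psC (f a).
Proof. by apply: psP => i; rewrite /= !coefC; case: ifP => // _; rewrite rmorph0. Qed.
Lemma map_psX : map_ps (psX S) = psX T.
Proof. by apply: psP => i; rewrite /= !coefX rmorph_nat. Qed.
End MapPs.

Section Filtration.
Variables (T : comNzRingType) (F : nat -> set T).

(** Abstracts a complete adic topology. The instances are the powers of an ideal, the trivial
    filtration of a ring, and what these induce on power series. *)
Record compfil : Prop := CompFil {
  fil0 : forall a, F 0%N a;
  filZ : forall n, F n 0;
  filD : forall n a b, F n a -> F n b -> F n (a + b);
  filI : forall n a b, F n b -> F n (a * b);
  filS : forall n, F n.+1 `<=` F n;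
  filM : forall n m a b, F n a -> F m b -> F (n + m)%N (a * b);
  fil_sep : forall a, (forall n, F n a) -> a = 0;
  fil_comp : forall u : nat -> T, (forall n, F n (u n.+1 - u n)) ->
    exists l, forall n, F n (u n - l)
}.

Hypothesis cF : compfil.

Lemma filN n a : F n a -> F n (- a).
Proof. by rewrite -mulN1r; exact: filI. Qed.

Lemma filB n a b : F n a -> F n b -> F n (a - b).
Proof. by move=> Fa Fb; apply: filD => //; exact: filN. Qed.

Lemma fil_le n m : (n <= m)%N -> F m `<=` F n.
Proof.
elim: m => [|m IH]; first by rewrite leqn0 => /eqP ->.
rewrite leq_eqVlt => /orP[/eqP -> //|]; rewrite ltnS => /IH h a /(filS cF); exact: h.
Qed.

Lemma filX n a : F 1%N a -> F n (a ^+ n).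
Proof.
move=> Fa; elim: n => [|n IH]; first exact: (fil0 cF).
by rewrite exprS -add1n; exact: (filM cF).
Qed.

Lemma fil_eq a b : (forall n, F n (a - b)) -> a = b.
Proof. by move=> /(fil_sep cF) /eqP; rewrite subr_eq0 => /eqP. Qed.

(** The inverse is the limit of the geometric series. *)
Lemma fil_unit x : F 1%N x -> isunit (1 - x).
Proof.
move=> Fx; have [n|l Hl] := fil_comp cF (u := fun n => \sum_(i < n) x ^+ i).
  by rewrite /= big_ord_recr /= addrAC subrr add0r; exact: filX.
exists l; apply: fil_eq => n.
have -> : l * (1 - x) - 1 = - (1 - x) * (\sum_(i < n) x ^+ i - l) - x ^+ n.
  have := subrX1 x n; set s := \sum_(i < n) x ^+ i => E.
  by have -> : x ^+ n = (x - 1) * s + 1; [rewrite -E subrK|ring].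
by apply: filB; [apply: (filI cF)|exact: filX].
Qed.

Lemma fil_sum n (I : Type) (r : seq I) (P : pred I) (f : I -> T) :
  (forall i, P i -> F n (f i)) -> F n (\sum_(i <- r | P i) f i).
Proof. by move=> h; elim/big_ind: _ => //; [exact: filZ|exact: filD]. Qed.

(** The variable has weight one, as for the powers of [(m, X)]. By truncated subtraction the
    coefficients of degree at least [n] are only required to be in [F 0], which is everything. *)
Definition psF n : set (ps T) := [set u | forall i, F (n - i)%N (pc u i)].

End Filtration.

Lemma ps_compfil (T : comNzRingType) (F : nat -> set T) : compfil F -> compfil (psF F).
Proof.
move=> cF; split.
- by move=> u i; rewrite sub0n; exact: (fil0 cF).
- by move=> n i; exact: (filZ cF).
- by move=> n u v Fu Fv i; exact: (filD cF).
- move=> n u v Fv i; rewrite pcM; apply: (fil_sum cF) => j _.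
  by apply: (filI cF); apply: (fil_le cF) (Fv _); rewrite leq_sub2l // leq_subr.
- by move=> n u Fu i; apply: (fil_le cF) (Fu i); rewrite leq_sub2r.
- move=> n m u v Fu Fv i; rewrite pcM; apply: (fil_sum cF) => j _.
  apply: (fil_le cF) (filM cF (Fu j) (Fv _)).
  have ji : (j <= i)%N by rewrite -ltnS.
  by lia.
- move=> u Fu; apply: psP => i; apply: (fil_sep cF) => n.
  by have := Fu (n + i)%N i; rewrite addnK.
- move=> u Fu.
  have /choice[l Hl] i : exists l, forall n, F n (pc (u (n + i)%N) i - l).
    apply: (fil_comp cF) => n; have := Fu (n + i)%N i.
    by rewrite addnK addSn.
  exists (PS l) => n i; rewrite pcB /=; case: (leqP i n) => h.
    by have := Hl i (n - i)%N; rewrite subnK.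
  by rewrite (eqP (ltnW h : (n - i)%N == 0%N)); exact: (fil0 cF).
Qed.

Lemma ps_unit (T : comNzRingType) (F : nat -> set T) : compfil F ->
  (forall a, ~ F 1%N a -> isunit a) -> forall u : ps T, ~ psF F 1%N u -> isunit u.
Proof.
move=> cF uF u Fu.
have [c cu] : isunit (pc u 0).
  apply: uF => F1; apply: Fu => -[|i]; first by rewrite subn0.
  by rewrite subSS sub0n; exact: (fil0 cF).
have [|v vE] := @fil_unit (ps T) (psF F) (ps_compfil cF) (1 - psC c * u).
  move=> [|i]; last by rewrite subSS sub0n; exact: (fil0 cF).
  by rewrite pcB psCM cu subrr; exact: (filZ cF).
by exists (v * psC c); rewrite -mulrA -[RHS]vE opprB addrC subrK.
Qed.

Section Evaluation.
Variables (S T : comNzRingType) (G : nat -> set T).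
Hypothesis cG : compfil G.
Variables (psi : {rmorphism S -> T}) (y : T).
Hypothesis Gy : G 1%N y.

Definition pev n (u : ps S) := (map_poly psi (trunc n u)).[y].

Lemma pevE n u : pev n u = \sum_(i < n) psi (pc u i) * y ^+ i.
Proof.
rewrite /pev horner_coef (big_ord_widen n (fun i => (map_poly psi (trunc n u))`_i * y ^+ i)).
  rewrite big_mkcond; apply: eq_bigr => i _; rewrite coef_map coef_trunc //.
  case: ltnP => // h; have : (map_poly psi (trunc n u))`_i = 0 by apply: nth_default.
  by rewrite coef_map coef_trunc //= => ->; rewrite mul0r.
exact: leq_trans (size_poly _ _) (size_poly _ _).
Qed.

Lemma pev_lim (u : ps S) : exists l, forall n, G n (pev n u - l).
Proof.
apply: (fil_comp cG) => n; rewrite !pevE big_ord_recr /= addrAC subrr add0r.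
by apply: (filI cG); exact: (filX cG).
Qed.

Definition ps_ev u : T := sval (cid (pev_lim u)).

Lemma ps_evP u n : G n (pev n u - ps_ev u).
Proof. by rewrite /ps_ev; case: cid. Qed.

Lemma ps_ev_uniq u l : (forall n, G n (pev n u - l)) -> ps_ev u = l.
Proof.
move=> h; apply: (fil_eq cG) => n.
have -> : ps_ev u - l = (pev n u - l) - (pev n u - ps_ev u) by ring.
by apply: (filB cG) => //; exact: ps_evP.
Qed.

Fact ps_ev_zmod : zmod_morphism ps_ev.
Proof.
move=> u v; apply: ps_ev_uniq => n.
have -> : pev n (u - v) = pev n u - pev n v.
  by rewrite !pevE -sumrB; apply: eq_bigr => i _; rewrite rmorphB mulrBl.
have -> : pev n u - pev n v - (ps_ev u - ps_ev v) =
  (pev n u - ps_ev u) - (pev n v - ps_ev v) by ring.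
by apply: (filB cG); exact: ps_evP.
Qed.

Lemma pevM n u v : G n (pev n u * pev n v - pev n (u * v)).
Proof.
rewrite /pev -hornerM -rmorphM -hornerN -hornerD -rmorphB.
set p := _ - _; have p0 i : (i < n)%N -> p`_i = 0.
  by move=> h; rewrite /p coefB coef_trunc // -[pc _ _]/(pc (ps_mul u v) i)
    (ps_mul_trunc _ _ h) subrr.
rewrite -(poly_take_drop n p); have -> : take_poly n p = 0.
  by apply/polyP => i; rewrite coef_take_poly coef0; case: ltnP => // /p0.
rewrite add0r rmorphM /= map_polyXn hornerM hornerXn.
by apply: (filI cG); exact: (filX cG).
Qed.

Fact ps_ev_monoid : monoid_morphism ps_ev.
Proof.
split; last first.
  move=> u v; apply: ps_ev_uniq => n.
  have -> : pev n (u * v) - ps_ev u * ps_ev v =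
      pev n u * (pev n v - ps_ev v) + ps_ev v * (pev n u - ps_ev u)
      - (pev n u * pev n v - pev n (u * v)) by ring.
  apply: (filB cG); last exact: pevM.
  by apply: (filD cG); apply: (filI cG); exact: ps_evP.
apply: ps_ev_uniq => -[|n]; first exact: (fil0 cG).
rewrite pevE big_ord_recl /= rmorph1 mul1r big1 ?addr0 ?subrr; first exact: (filZ cG).
by move=> i _; rewrite rmorph0 mul0r.
Qed.

HB.instance Definition _ := GRing.isZmodMorphism.Build (ps S) T ps_ev ps_ev_zmod.
HB.instance Definition _ := GRing.isMonoidMorphism.Build (ps S) T ps_ev ps_ev_monoid.

Lemma ps_evC a : ps_ev (psC a) = psi a.
Proof.
apply: ps_ev_uniq => -[|n]; first exact: (fil0 cG).
rewrite pevE big_ord_recl /= coefC mulr1 big1 ?addr0 ?subrr; first exact: (filZ cG).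
by move=> i _; rewrite coefC rmorph0 mul0r.
Qed.

Lemma ps_evX : ps_ev (psX S) = y.
Proof.
apply: ps_ev_uniq => -[|[|n]]; first exact: (fil0 cG).
  by rewrite pevE big_ord1 /= coefX rmorph0 mul0r sub0r; exact: (filN cG).
rewrite pevE 2!big_ord_recl /= !coefX rmorph0 rmorph1 mul0r mul1r add0r.
rewrite big1 ?addr0 ?expr1 ?subrr; first exact: (filZ cG).
by move=> i _; rewrite coefX rmorph0 mul0r.
Qed.

(** No continuity is assumed: the tail of a series is divisible by a power of the variable, so its
    two images lie in [G n]. *)
Lemma ps_hom_eq (f g : {rmorphism ps S -> T}) :
  (forall a, f (psC a) = g (psC a)) -> f (psX S) = g (psX S) ->
  G 1%N (f (psX S)) -> f =1 g.
Proof.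
move=> fC fX GX u; apply: (fil_eq cG) => n.
rewrite (ps_split n u) !rmorphD !rmorphM !rmorphXn psp_sum !rmorph_sum /=.
have -> : \sum_(i < size (trunc n u)) f (psC (trunc n u)`_i * psX S ^+ i) =
   \sum_(i < size (trunc n u)) g (psC (trunc n u)`_i * psX S ^+ i).
  by apply: eq_bigr => i _; rewrite !rmorphM !rmorphXn fC fX.
rewrite opprD addrACA subrr add0r -fX -mulrBr mulrC.
by apply: (filI cG); exact: (filX cG).
Qed.

End Evaluation.

(** * Cohen's theorem and Noetherian power series rings *)

Section Cohen.
Variable R : comPzRingType.
Implicit Types (I J K : ideal R) (s : seq R).

Lemma adjs_sumP I s a : adjs I s a <->
  exists c : nat -> R, I (a - \sum_(i < size s) c i * s`_i).
Proof.
elim: s I a => [|x s IH] I a /=.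
  split=> [Ia|[c]]; last by rewrite big_ord0 subr0.
  by exists (fun=> 0); rewrite big_ord0 subr0.
split=> [/IH[c [d _ Id]]|[c Ic]].
  exists (fun i => if i is j.+1 then c j else d).
  by rewrite big_ord_recl /=; apply: (icast Id); ring.
apply/IH; exists (fun i => c i.+1); exists (c 0%N) => //.
by apply: (icast Ic); rewrite big_ord_recl /=; ring.
Qed.

Definition fg I := exists s, I = adjs (izero R) s.

Lemma fg_max I : ~ fg I -> exists J, [/\ I `<=` J, ~ fg J &
  forall K, J `<=` K -> ~ fg K -> K `<=` J].
Proof.
move=> NI; pose T := {J : ideal R | I `<=` J /\ ~ fg J}.
pose le (J K : T) := `[< sval J `<=` sval K >].
have [||||t tm] := @Zorn T le.
- by move=> J; apply/asboolP.
- by move=> J K L /asboolP h1 /asboolP h2; apply/asboolP => a /h1 /h2.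
- move=> [J [? ?]] [K [? ?]] /asboolP /= h1 /asboolP /= h2.
  by have E := ideal_eqP h1 h2; subst K; congr exist; exact: Prop_irrelevance.
- move=> A tA; have [[J0 AJ0]|N] := pselect (exists t : T, A t); last first.
    by exists (exist _ I (conj (fun a h => h) NI)) => s As; case: N; exists s.
  pose U : set R := [set a | exists t : T, A t /\ sval t a].
  have U0 : U 0 by exists J0; split => //; exact: ideal0.
  have UD a b : U a -> U b -> U (a + b).
    move=> [J [AJ Ja]] [K [AK Kb]].
    have [/asboolP h|/asboolP h] := tA J K AJ AK.
      by exists K; split => //; apply: idealD => //; exact: h.
    by exists J; split => //; apply: idealD => //; exact: h.
  have UM a b : U b -> U (a * b).
    by move=> [J [AJ Jb]]; exists J; split => //; exact: idealM.
  pose UI := Ideal U0 UD UM.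
  have IU : I `<=` UI.
    by move=> a Ia; exists J0; split => //; exact: (proj1 (svalP J0)).
  have NU : ~ fg UI.
    move=> [s Es].
    have [J [AJ Js]] : exists t : T, A t /\ forall x, x \in s -> sval t x.
      have {Es} : forall x, x \in s -> UI x.
        by move=> x xs; rewrite Es; exact: adjs_in.
      elim: s => [|x s IH] Us; first by exists J0.
      have [|J [AJ Js]] := IH; first by move=> y ys; apply: Us; rewrite inE ys orbT.
      have [|K [AK Kx]] := Us x; first by rewrite inE eqxx.
      have [/asboolP h|/asboolP h] := tA J K AJ AK.
        exists K; split => // y; rewrite inE => /orP[/eqP -> //|/Js]; exact: h.
      exists J; split => // y; rewrite inE => /orP[/eqP ->|/Js //]; exact: h.
    case: (proj2 (svalP J)); exists s; apply: ideal_eqP.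
      by rewrite -Es => a Ja; exists J.
    by apply: adjs_min => //; exact: izero_sub.
  exists (exist _ UI (conj IU NU)) => J AJ; apply/asboolP => a /= Ja.
  by exists J.
exists (sval t); have [h1 h2] := svalP t; split => // K tK NK.
have IK : I `<=` K by move=> a /h1 /tK.
have := tm (exist _ K (conj IK NK)) (asboolT tK).
by move=> /(congr1 sval) /= -> .
Qed.

(** An ideal [J] maximal among those not finitely generated is prime. If [a * b] were in [J] with
    both factors outside, [adj J a] and [colon J a] would be finitely generated, and [J] is
    generated by elements lifting generators of the first together with [a] times generators of the
    second. *)
Lemma cohen : (forall P : spec R, fg P) -> noetherian R.
Proof.
move=> H I; apply: contrapT => N.
have /fg_max[J [_ NJ Jm]] : ~ fg I.
  by move=> [s Es]; apply: N; exists s; rewrite gen_adjs -Es.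
have Jx x : ~ J x -> fg (adj J x).
  move=> Jx; apply: contrapT => /Jm h; apply: Jx; apply: h; last exact: adj_in.
  exact: sub_adj.
have J1 : ~ J 1.
  move=> J1; apply/NJ; exists [:: 1]; apply: ideal_eqP => a _; last exact: ideal_top.
  by apply: ideal_top; exact: adj_in.
apply/NJ; suff JP a b : J (a * b) -> J a \/ J b by exact: (H (Spec J1 JP)).
move=> Jab; apply: contrapT => /not_orP[Ja Jb].
have [s Es] := Jx a Ja.
have [t Et] : fg (colon J a).
  apply: contrapT => /Jm h; apply: Jb; apply: h => // c Jc /=; exact: idealM.
have [s' [sJ s's]] : exists s', (forall x, x \in s' -> J x) /\
    forall x, x \in s -> adj (adjs (izero R) s') a x.
  have {Es} : forall x, x \in s -> adj J a x by move=> x xs; rewrite Es; exact: adjs_in.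
  elim: s => [|x s IH] h; first by exists [::].
  have [|s' [h1 h2]] := IH; first by move=> y ys; apply: h; rewrite inE ys orbT.
  have [|c _ Jc] := h x; first by rewrite inE eqxx.
  exists (x - c * a :: s'); split=> y; rewrite inE => /orP[/eqP ->//|].
  - exact: h1.
  - by exists c => //; apply: adjs_in; rewrite inE eqxx.
  - move=> /h2; apply: adj_mono => /=; apply: adjs_mono; exact: izero_sub.
apply/NJ; exists (s' ++ [seq a * x | x <- t]); apply: ideal_eqP; last first.
  apply: adjs_min => [|x]; first exact: izero_sub.
  rewrite mem_cat => /orP[/sJ //|/mapP[y yt ->]].
  by have : colon J a y by rewrite Et; exact: adjs_in.
move=> x Jx'; rewrite adjs_cat.
have [c _ h] : adj (adjs (izero R) s') a x.
  have : adj J a x by exact: sub_adj.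
  by rewrite Es => h; apply: adjs_min h => //; exact: izero_sub.
have Jca : J (c * a).
  apply: (idealBl _ Jx'); apply: adjs_min h => //; exact: izero_sub.
apply: (idealBr (sub_adjs _ h)); rewrite mulrC.
have : colon J a c by rewrite /= mulrC.
rewrite Et => h'; suff : colon (adjs (adjs (izero R) s') [seq a * x | x <- t]) a c by [].
apply: adjs_min h' => [|y yt /=]; first exact: izero_sub.
by apply: adjs_in; exact: map_f.
Qed.

End Cohen.

Section PsNoetherian.
Variable T : comNzRingType.
Hypothesis nT : noetherian T.

Fact pc_zero_zmod : zmod_morphism (fun u : ps T => pc u 0).
Proof. by []. Qed.
Fact pc_zero_monoid : monoid_morphism (fun u : ps T => pc u 0).
Proof. by split => // u v; rewrite pcM big_ord1. Qed.
Definition cst_coef (u : ps T) := pc u 0.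
HB.instance Definition _ := GRing.isZmodMorphism.Build (ps T) T cst_coef pc_zero_zmod.
HB.instance Definition _ := GRing.isMonoidMorphism.Build (ps T) T cst_coef pc_zero_monoid.

(** By Cohen's theorem only primes [P] matter, and their constant coefficients form a finitely
    generated ideal. If the variable is not in [P], what remains after matching the constant
    coefficient is the variable times an element of [P] again, and the division can be repeated for
    ever. *)
Lemma ps_noetherian : noetherian (ps T).
Proof.
apply: cohen => P.
pose L : set T := [set a | exists2 u, P u & pc u 0 = a].
have L0 : L 0 by exists 0 => //; exact: ideal0.
have LD a b : L a -> L b -> L (a + b).
  by move=> [u Pu <-] [v Pv <-]; exists (u + v) => //; exact: idealD.
have LM a b : L b -> L (a * b).
  by move=> [u Pu <-]; exists (psC a * u); rewrite ?psCM //; exact: idealM.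
have [s Es] := noeth_fg nT (Ideal L0 LD LM).
have [us [Pus Eus]] : exists us : seq (ps T), (forall u, u \in us -> P u) /\
    [seq pc u 0 | u <- us] = s.
  have {Es} : forall a, a \in s -> L a.
    move=> a as_; rewrite -[L]/(ideal_set (Ideal L0 LD LM)) Es; exact: adjs_in.
  elim: s => [|a s IH] h; first by exists [::].
  have [|us [h1 h2]] := IH; first by move=> y ys; apply: h; rewrite inE ys orbT.
  have [|u Pu Eu] := h a; first by rewrite inE eqxx.
  exists (u :: us); rewrite /= h2 Eu; split => // v.
  by rewrite inE => /orP[/eqP ->|/h1].
have step u : P u -> exists (c : nat -> T) v,
    u = \sum_(i < size us) psC (c i) * us`_i + psX T * v.
  move=> Pu; have : (Ideal L0 LD LM) (pc u 0) by exists u.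
  rewrite Es -Eus => /adjs_sumP[c /= /eqP]; rewrite subr_eq0 size_map => /eqP E.
  exists c; have [|v Ev] := @psX_dvd T 1 (u - \sum_(i < size us) psC (c i) * us`_i).
    move=> [|//] _; rewrite pcB pc_sum E; apply/eqP; rewrite subr_eq0; apply/eqP.
    by apply: eq_bigr => i _; rewrite psCM (nth_map 0).
  by exists v; rewrite -[psX T]expr1 -Ev addrC subrK.
have sumP c : P (\sum_(i < size us) psC (c (nat_of_ord i)) * us`_i).
  by apply: ideal_sum => i _; apply: idealM; apply: Pus; exact: mem_nth.
have [PX|PX] := pselect (P (psX T)).
  exists (psX T :: us); apply: ideal_eqP; last first.
    apply: adjs_min => [|u]; first exact: izero_sub.
    by rewrite inE => /orP[/eqP ->|/Pus].
  move=> u /step[c [v ->]]; apply: idealD; last first.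
    by apply: idealMr; apply: adjs_in; rewrite inE eqxx.
  apply: ideal_sum => i _; apply: idealM; apply: adjs_in.
  by rewrite inE mem_nth ?orbT.
have /choice[g gP] (u : {u | P u}) : exists cv : (nat -> T) * {u | P u},
    sval u = \sum_(i < size us) psC (cv.1 i) * us`_i + psX T * sval cv.2.
  case: u => u Pu; have [c [v E]] := step u Pu.
  have Pv : P v.
    apply: (primeMl PX); rewrite -[_ * v](addKr (\sum_(i < size us) psC (c i) * us`_i)).
    by rewrite -E addrC; exact: idealB.
  by exists (c, exist _ v Pv).
exists us; apply: ideal_eqP; last first.
  by apply: adjs_min => //; exact: izero_sub.
move=> u Pu; pose w k := iter k (fun v => (g v).2) (exist _ u Pu).
(* The constants used at the successive divisions are the coefficients of the required
   multipliers. *)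
pose d j := PS (fun i => (g (w i)).1 j).
apply/adjs_sumP; exists d => /=; apply/eqP; rewrite subr_eq0; apply/eqP.
have H N : exists v, u - \sum_(i < size us) d i * us`_i = psX T ^+ N * v.
  exists (sval (w N) - \sum_(i < size us) shift N (d i) * us`_i).
  have E : u = \sum_(i < size us) psp (trunc N (d i)) * us`_i + psX T ^+ N * sval (w N).
    elim: N => [|N IH].
      rewrite big1 ?add0r ?mul1r // => i _.
      suff -> : trunc 0 (d i) = 0 by rewrite rmorph0 mul0r.
      by apply/polyP => j; rewrite coef_poly coef0.
    rewrite {1}IH {1}(gP (w N)) mulrDr mulrA -exprSr addrA; congr (_ + _).
    rewrite mulr_sumr -big_split; apply: eq_bigr => i _ /=.
    rewrite mulrA -mulrDl; congr (_ * _); apply: psP => j.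
    rewrite pcD psXnM /= !coef_poly ltnS.
    case: ltngtP => h; rewrite ?addr0 ?add0r //=.
      by rewrite coefC subn_eq0 leqNgt h.
    by rewrite -h subnn coefC.
  have E2 : \sum_(i < size us) d i * us`_i = \sum_(i < size us) psp (trunc N (d i)) * us`_i
      + psX T ^+ N * \sum_(i < size us) shift N (d i) * us`_i.
    rewrite mulr_sumr -big_split; apply: eq_bigr => i _ /=.
    by rewrite {1}(ps_split N (d i)); ring.
  by rewrite E2 {1}E mulrBr opprD addrACA subrr add0r.
apply/eqP; rewrite -subr_eq0; apply/eqP; apply: psP => i.
by have [v ->] := H i.+1; rewrite psXnM ltnSn pc0.
Qed.

End PsNoetherian.

Section UniformFiltration.
Variables (T : comNzRingType) (F : nat -> set T).
Hypothesis cF : compfil F.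

(** Coefficientwise filtration, in which the variable is not small. For this one Weierstrass
    division is a contraction, because the low coefficients of [f] lie in [F 1]. *)
Definition psU n : set (ps T) := [set u | forall i, F n (pc u i)].

Lemma psU_compfil : compfil psU.
Proof.
split.
- by move=> u i; exact: (fil0 cF).
- by move=> n i; exact: (filZ cF).
- by move=> n u v Fu Fv i; exact: (filD cF).
- by move=> n u v Fv i; rewrite pcM; apply: (fil_sum cF) => j _; exact: (filI cF).
- by move=> n u Fu i; exact: (filS cF).
- by move=> n m u v Fu Fv i; rewrite pcM; apply: (fil_sum cF) => j _; exact: (filM cF).
- by move=> u Fu; apply: psP => i; apply: (fil_sep cF) => n; exact: Fu.
- move=> u Fu.
  have /choice[l Hl] i : exists l, forall n, F n (pc (u n) i - l).
    by apply: (fil_comp cF) => n; exact: Fu.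
  by exists (PS l) => n i; exact: Hl.
Qed.

Lemma fil_fixpoint (phi : T -> T) :
  (forall n a b, F n (a - b) -> F n.+1 (phi a - phi b)) -> exists a, phi a = a.
Proof.
move=> H; pose u n := iter n phi 0.
have [n|l Hl] := fil_comp cF (u := u).
  elim: n => [|n IH]; [exact: (fil0 cF)|exact: H].
exists l; apply: (fil_eq cF) => n.
have -> : phi l - l = (u n.+1 - l) - (phi (u n) - phi l) by rewrite /u /=; ring.
by apply: (filB cF); apply: (fil_le cF (leqnSn n)); [exact: Hl|exact: H].
Qed.

End UniformFiltration.

(** * Weierstrass division *)

Section Weierstrass.
Variables (T : comNzRingType) (F : nat -> set T).
Hypothesis cF : compfil F.
Hypothesis uF : forall a, ~ F 1%N a -> isunit a.
Variables (f : ps T) (s : nat).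
Hypothesis f_low : forall i, (i < s)%N -> F 1%N (pc f i).
Hypothesis f_s : ~ F 1%N (pc f s).

Let U := shift s f.
Let lo := psp (trunc s f).

Lemma wei_unit : isunit U.
Proof.
apply: (ps_unit cF uF) => /(_ 0%N); rewrite subn0 /= add0n; exact: f_s.
Qed.

Let lo1 n v : psU F n v -> psU F n.+1 (shift s (lo * v)).
Proof.
move=> Fv i; rewrite -[pc _ i]/(pc (lo * v) (i + s)) pcM; apply: (fil_sum cF) => j _.
rewrite -add1n; apply: (filM cF) (Fv _).
by rewrite /= coef_poly; case: ifP => [/f_low //|_]; exact: (filZ cF).
Qed.

Lemma shiftB n (u v : ps T) : shift n (u - v) = shift n u - shift n v.
Proof. exact: psP. Qed.

Lemma shiftD n (u v : ps T) : shift n (u + v) = shift n u + shift n v.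
Proof. exact: psP. Qed.

Lemma shift_low n (u : ps T) : shift n u = 0 -> u = psp (trunc n u).
Proof. by move=> h; rewrite {1}(ps_split n u) h mulr0 addr0. Qed.

Let shift_f v : shift s (f * v) = shift s (lo * v) + U * v.
Proof.
rewrite {1}(ps_split s f) mulrDl shiftD; congr (_ + _).
apply: psP => i; rewrite -[LHS]/(pc (psX T ^+ s * U * v) (i + s)).
by rewrite -mulrA psXnM ltnNge leq_addl addnK.
Qed.

(** The quotient has to satisfy [U v = shift s u - shift s (lo v)], which says that [u - f v] has no
    terms of degree [s] or more. Since [U] is a unit, [v] is the fixed point of a contraction. *)
Lemma wei_div u : exists v (r : {poly T}), (size r <= s)%N /\ u = f * v + psp r.
Proof.
have [w wU] := wei_unit.
have [n a b h|v Ev] := @fil_fixpoint _ _ (psU_compfil cF)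
    (fun v => w * (shift s u - shift s (lo * v))).
  rewrite -mulrBr opprD addrACA subrr add0r opprK addrC -shiftB -mulrBr.
  apply: (filI (psU_compfil cF)); apply: lo1.
  by rewrite -opprB; exact: (filN (psU_compfil cF)).
have EU : U * v = shift s u - shift s (lo * v).
  by rewrite -{1}Ev mulrA [U * w]mulrC wU mul1r.
exists v, (trunc s (u - f * v)); split; first exact: size_poly.
have <- : u - f * v = psp (trunc s (u - f * v)).
  apply: shift_low; rewrite shiftB shift_f EU; move: (shift s u) (shift s _) => a b.
  by rewrite addrCA subrr addr0 subrr.
by rewrite addrC subrK.
Qed.

Lemma wei_uniq v (r : {poly T}) : (size r <= s)%N -> f * v + psp r = 0 ->
  v = 0 /\ r = 0.
Proof.
move=> sr E; have [w wU] := wei_unit.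
have r0 : shift s (psp r) = 0.
  by apply: psP => i /=; rewrite nth_default // (leq_trans sr) // leq_addl.
have Ev : v = - (w * shift s (lo * v)).
  have : shift s (f * v) = 0.
    have -> : f * v = 0 - psp r by rewrite -E addrK.
    by rewrite shiftB r0 subr0; exact: psP.
  rewrite shift_f => /eqP; rewrite addr_eq0 => /eqP ->.
  by rewrite mulrN opprK mulrA wU mul1r.
have v0 : v = 0.
  apply: (fil_sep (psU_compfil cF)) => n; elim: n => [|n IH].
    exact: (fil0 (psU_compfil cF)).
  rewrite Ev; apply: (filN (psU_compfil cF)); apply: (filI (psU_compfil cF)).
  exact: lo1.
split => //; move: E; rewrite v0 mulr0 add0r => E.
by apply/polyP => i; rewrite coef0 -[LHS]/(pc (psp r) i) E.
Qed.

End Weierstrass.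

Arguments map_ps {S T} f u : simpl never.
Arguments psC {T} a : simpl never.

Definition is_domain (T : comNzRingType) := forall a b : T, a * b = 0 -> a = 0 \/ b = 0.

Lemma ps_order (T : comNzRingType) (u : ps T) : u <> 0 ->
  exists n v, u = psX T ^+ n * v /\ pc v 0 <> 0.
Proof.
move=> u0; have ex : exists n, pc u n != 0.
  apply: contrapT => N; apply: u0; apply: psP => i; apply/eqP.
  by apply: contrapT => /negP h; apply: N; exists i.
case: (ex_minnP ex) => n un nm; exists n, (shift n u); split; last exact/eqP.
have [i lt|v Ev] := @psX_dvd T n u.
  by apply/eqP; apply: contraTT lt => /nm; rewrite -leqNgt.
rewrite {1}Ev; congr (_ * _); apply: psP => i.
by rewrite /= Ev psXnM ltnNge leq_addl addnK.
Qed.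

Lemma ps_domain (T : comNzRingType) : is_domain T -> is_domain (ps T).
Proof.
move=> dT u v uv; apply: contrapT => /not_orP[/ps_order[n [u' [Eu u0]]]].
move=> /ps_order[m [v' [Ev v0]]].
have : pc (u * v) (n + m) = pc u' 0 * pc v' 0.
  have -> : u * v = psX T ^+ (n + m) * (u' * v') by rewrite Eu Ev exprD; ring.
  by rewrite psXnM ltnn subnn pcM big_ord1.
by rewrite uv pc0 => /esym /dT[].
Qed.

Lemma psp_trunc (T : comNzRingType) n (u : ps T) :
  psp (trunc n u) = \sum_(i < n) psC (pc u i) * psX T ^+ i.
Proof.
rewrite /trunc poly_def rmorph_sum; apply: eq_bigr => i _.
by rewrite -mul_polyC rmorphM rmorphXn.
Qed.

(** * Changes of variables that make a power series regular in the last variable *)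

Section TwoVariables.
Variables (T : comNzRingType) (F : nat -> set T).
Hypothesis cF : compfil F.

Lemma hom_coef (S S' : comNzRingType) (th : {rmorphism ps S -> ps S'}) (e : S') :
  th (psX S) = psC e * psX S' ->
  forall u b, pc (th u) b = \sum_(i < b.+1) e ^+ i * pc (th (psC (pc u i))) (b - i).
Proof.
move=> thX u b; rewrite {1}(ps_split b.+1 u) rmorphD rmorphM rmorphXn thX pcD.
have -> w : pc ((psC e * psX S') ^+ b.+1 * w) b = 0.
  by rewrite exprMn [psC e ^+ _ * _]mulrC -mulrA psXnM ltnSn.
rewrite addr0 psp_trunc rmorph_sum pc_sum; apply: eq_bigr => i _.
rewrite rmorphM rmorphXn thX.
set a := th _; have -> : a * (psC e * psX S') ^+ i = psC (e ^+ i) * (psX S' ^+ i * a).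
  by rewrite exprMn rmorphXn; ring.
by rewrite psCM psXnM ltnNge -ltnS ltn_ord.
Qed.

Let S := ps T.
Let G := psF (psF F).
Let cG : compfil G. Proof. exact/ps_compfil/ps_compfil. Qed.

Let y1 (c : T) : ps S := psC (psX T) + psC (psC c) * psX S.
Let Gy1 c : G 1%N (y1 c).
Proof.
apply: (filD cG) => [i j|].
  rewrite pc_psC; case: i => [|i] /=; last first.
    by rewrite subSS sub0n; exact: (fil0 cF).
  rewrite coefX; case: j => [|j] /=; first exact: (filZ cF).
  by rewrite subn0 subSS; exact: (fil0 cF).
apply: (filI cG) => i; case: i => [|i]; last first.
  by rewrite subSS sub0n; exact: (fil0 (ps_compfil cF)).
by rewrite /= coefX; exact: (filZ (ps_compfil cF)).
Qed.
Let GX : G 1%N (psX S).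
Proof.
move=> i; case: i => [|i]; last first.
  by rewrite subSS sub0n; exact: (fil0 (ps_compfil cF)).
by rewrite /= coefX; exact: (filZ (ps_compfil cF)).
Qed.

Definition shear_C c : {rmorphism S -> ps S} :=
  ps_ev cG (@psC S \o @psC T) (Gy1 c).
Definition shear c : {rmorphism ps S -> ps S} := ps_ev cG (shear_C c) GX.

Lemma shearX c : shear c (psX S) = psX S. Proof. exact: ps_evX. Qed.
Lemma shearY c : shear c (psC (psX T)) = y1 c.
Proof. by rewrite /shear /= ps_evC /= ps_evX. Qed.
Lemma shearC c a : shear c (psC (psC a)) = psC (psC a).
Proof. by rewrite /shear /= ps_evC /= ps_evC. Qed.

Lemma shearK c : cancel (shear c) (shear (- c)).
Proof.
move=> u; apply: (@ps_hom_eq S (ps S) G cG (shear (- c) \o shear c) idfun);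
  rewrite /= ?shearX // => v.
apply: (@ps_hom_eq T (ps S) G cG (shear (- c) \o shear c \o @psC S) (@psC S)) => [a||] /=.
- by rewrite !shearC.
- rewrite shearY /y1 rmorphD rmorphM shearY shearX shearC /y1.
  by rewrite !rmorphN mulNr addrNK.
- rewrite shearY /y1 rmorphD rmorphM shearY shearX shearC /y1.
  rewrite !rmorphN mulNr addrNK.
  have := Gy1 0; rewrite /y1 !rmorph0 mul0r addr0; exact.
Qed.

(** The right side is the part of degree [b] of [u] evaluated at 1 for the outer variable and [c]
    for the inner one: [shear c] adds [c] times the outer variable to the inner one, and then the
    inner one is set to zero. *)
Lemma shear_coef c u b : pc (pc (shear c u) b) 0 =
  \sum_(i < b.+1) pc (pc u i) (b - i) * c ^+ (b - i).
Proof.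
pose th : {rmorphism ps S -> ps T} := map_ps (@cst_coef T) \o shear c.
have thX : th (psX S) = psC 1 * psX T.
  by rewrite /th /= shearX map_psX rmorph1 mul1r.
rewrite -[LHS]/(pc (th u) b) (hom_coef thX); apply: eq_bigr => i _.
rewrite expr1n mul1r; move: (pc u i) (b - i)%N => v j.
pose hh : {rmorphism ps T -> ps T} := th \o @psC S.
have thY : hh (psX T) = psC c * psX T.
  rewrite -[LHS]/(map_ps (@cst_coef T) (shear c (psC (psX T)))) shearY /y1.
  rewrite rmorphD rmorphM /= !map_psC map_psX /=.
  by rewrite coefX coefC rmorph0 add0r.
have thC a : hh (psC a) = psC a.
  rewrite -[LHS]/(map_ps (@cst_coef T) (shear c (psC (psC a)))) shearC map_psC /=.
  by rewrite coefC.
rewrite -[LHS]/(pc (hh v) j); clearbody hh; rewrite (hom_coef thY) big_ord_recr /= big1 ?add0r.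
  by rewrite subnn thC pc_psC mulrC.
by move=> l _; rewrite thC pc_psC subn_eq0 leqNgt ltn_ord mulr0.
Qed.

End TwoVariables.

Fixpoint PSn (C : comNzRingType) n : comNzRingType :=
  if n is m.+1 then ps (PSn C m) else C.

Fixpoint Fn (C : comNzRingType) (F : nat -> set C) n : nat -> set (PSn C n) :=
  if n is m.+1 then psF (@Fn C F m) else F.

Fixpoint resn (C k : comNzRingType) (res : {rmorphism C -> k}) n :
    {rmorphism PSn C n -> k} :=
  if n is m.+1 then resn res m \o @cst_coef (PSn C m) else res.

Fixpoint cstn (C : comNzRingType) n : {rmorphism C -> PSn C n} :=
  if n is m.+1 then @psC (PSn C m) \o cstn C m else idfun.

Fixpoint mapn (C k : comNzRingType) (res : {rmorphism C -> k}) n :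
    {rmorphism PSn C n -> PSn k n} :=
  if n is m.+1 then map_ps (mapn res m) else res.

Lemma resn_cst (C k : comNzRingType) (res : {rmorphism C -> k}) n c : resn res n (cstn C n c) = res c.
Proof. by elim: n => //= n IH; rewrite /cst_coef /= coefC. Qed.

Section CoefficientRing.
Variables (C : comNzRingType) (k : fieldType) (res : {rmorphism C -> k}).
Variable F : nat -> set C.

(** Covers both base rings: the complete discrete valuation ring [A], filtered by the powers of its
    maximal ideal, and the field [k] with the trivial filtration. *)
Record coefring : Prop := CoefRing {
  cr_fil : compfil F;
  cr_res : forall a, res a = 0 <-> F 1%N a;
  cr_unit : forall a, res a <> 0 -> isunit a;
  cr_surj : forall c, exists a, res a = c;
  cr_noeth : noetherian C;
  cr_dom : is_domain C;
  cr_inf : infinite_set [set: k]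
}.

Hypothesis cr : coefring.

Lemma Fn_compfil n : compfil (Fn F (n := n)).
Proof. by elim: n => [|n IH]; [exact: (cr_fil cr)|exact: ps_compfil]. Qed.

Lemma resnP n u : resn res n u = 0 <-> Fn F (n := n) 1%N u.
Proof.
elim: n u => [|n IH] u /=; first exact: (cr_res cr).
split=> [/IH h [|i]|/(_ 0%N) h]; first by rewrite subn0.
  by rewrite subSS sub0n; exact: (fil0 (Fn_compfil n)).
by apply/IH; rewrite /= subn0 in h *.
Qed.

Lemma PSn_unit n (u : PSn C n) : ~ Fn F 1%N u -> isunit u.
Proof.
elim: n u => [|n IH] u; first by move=> h; apply: (cr_unit cr) => /(cr_res cr).
exact: (ps_unit (Fn_compfil n)).
Qed.

Lemma PSn_noeth n : noetherian (PSn C n).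
Proof. by elim: n => [|n IH]; [exact: (cr_noeth cr)|exact: ps_noetherian]. Qed.

Lemma PSn_domain n : is_domain (PSn C n).
Proof. by elim: n => [|n IH]; [exact: (cr_dom cr)|exact: ps_domain]. Qed.

Lemma infinite_new (s : seq k) : exists c, c \notin s.
Proof.
apply: contrapT => N; apply: (cr_inf cr).
apply: (@sub_finite_set _ _ [set` s]); last exact: finite_seq.
by move=> c _ /=; apply/negPn/negP => h; apply: N; exists c.
Qed.

Lemma poly_nonroot (p : {poly k}) : p != 0 -> exists c, p.[c] != 0.
Proof.
move=> p0; apply: contrapT => N.
have Hr c : root p c by apply/negPn/negP => h; apply: N; exists c.
have [s [us sz]] : exists s : seq k, uniq s /\ size s = size p.
  elim: (size p) => [|n [s [us <-]]]; first by exists [::].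
  by have [c cs] := infinite_new s; exists (c :: s); rewrite /= cs us.
have := max_poly_roots p0 _ us; rewrite sz ltnn => h.
by apply: notF; apply: h; apply/allP.
Qed.

(** Some coefficient of [u] has nonzero reduction, and by induction it contains, after a change of
    variables, a pure power of its own last variable. A shear mixing the last two variables produces
    a pure power of the last one, provided [c] avoids the roots of a nonzero polynomial over the
    infinite field [k]. *)
Lemma straighten n (u : PSn C n.+1) : mapn res n.+1 u <> 0 ->
  exists (th ti : {rmorphism PSn C n.+1 -> PSn C n.+1}) s,
    [/\ cancel th ti, cancel ti th, resn res n (pc (th u) s) <> 0
      & forall c, ti (cstn C n.+1 c) = cstn C n.+1 c].
Proof.
elim: n u => [|n IH] u u0.
  have [i ui] : exists i, res (pc u i) <> 0.
    apply: contrapT => N; apply: u0; apply: psP => i; apply: contrapT => h.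
    by apply: N; exists i.
  by exists idfun, idfun, i.
have [i ui] : exists i, mapn res n.+1 (pc u i) <> 0.
  apply: contrapT => N; apply: u0; apply: psP => i; apply: contrapT => h.
  by apply: N; exists i.
have [th [ti [l [thK tiK ul tiC]]]] := IH _ ui.
pose u1 : ps (ps (PSn C n)) := map_ps th u.
have u1i : pc u1 i = th (pc u i) by [].
(* The part of degree [i + l] of [u1] in the last two variables, the others being set to zero and
   the coefficients reduced to [k]. Its coefficient of degree [l] is nonzero by the choice of
   [l]. *)
pose p := \poly_(j < (i + l).+1) resn res n (pc (pc u1 (i + l - j)) j).
have [|c0 pc0] := @poly_nonroot p.
  apply/eqP => /polyP/(_ l); rewrite coef0 coef_poly ltnS leq_addl addnK u1i.
  exact: ul.
have [c Ec] := cr_surj cr c0.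
pose cn := cstn C n c.
pose cT := Fn_compfil n.
have K1 := shearK cT cn; have K2 := shearK cT (- cn); rewrite opprK in K2.
exists (shear cT cn \o map_ps th), (map_ps ti \o shear cT (- cn)), (i + l)%N; split.
- by move=> v /=; rewrite K1; apply: psP => j /=; rewrite thK.
- move=> v /=; set w := shear _ _ v; have -> : map_ps th (map_ps ti w) = w.
    by apply: psP => j /=; rewrite tiK.
  by rewrite /w K2.
- rewrite /= -/u1 /cst_coef shear_coef rmorph_sum => E; case/eqP: pc0.
  rewrite /p -[RHS]E horner_poly (reindex_inj rev_ord_inj) /=; apply: eq_bigr => j _.
  by rewrite rmorphM rmorphXn resn_cst Ec subSS subKn // -ltnS.
move=> c'; rewrite -[LHS]/(map_ps ti (shear cT (- cn) (psC (psC (cstn C n c'))))).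
by rewrite shearC map_psC; congr psC; exact: tiC.
Qed.

End CoefficientRing.

(** * Primes of power series rings *)

Section MinimalPolynomial.
Variable E : comNzRingType.
Implicit Types (q : spec {poly E}) (p u H : {poly E}).

Fact coefI0 q : [set p : {poly E} | forall i, q (p`_i)%:P] 0.
Proof. by move=> i; rewrite coef0 polyC0; exact: ideal0. Qed.
Fact coefID q p u : [set p : {poly E} | forall i, q (p`_i)%:P] p ->
  [set p : {poly E} | forall i, q (p`_i)%:P] u ->
  [set p : {poly E} | forall i, q (p`_i)%:P] (p + u).
Proof. by move=> h1 h2 i; rewrite coefD polyCD; exact: idealD. Qed.
Fact coefIM q p u : [set p : {poly E} | forall i, q (p`_i)%:P] u ->
  [set p : {poly E} | forall i, q (p`_i)%:P] (p * u).
Proof.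
move=> h i; rewrite coefM rmorph_sum; apply: ideal_sum => j _.
by rewrite rmorphM; apply: idealM; exact: h.
Qed.
(** The extension to [{poly E}] of the contraction of [q] to [E]. *)
Definition coefI q : ideal {poly E} := Ideal (@coefI0 q) (@coefID q) (@coefIM q).

Lemma coefI_in (I : ideal {poly E}) p : (forall i, I (p`_i)%:P) -> I p.
Proof.
move=> h; rewrite -[p]coefK poly_def; apply: ideal_sum => i _.
by rewrite -mul_polyC; apply: idealMr; exact: h.
Qed.

(* The minimal polynomial of the class of ['X] over the fraction field of the
   contraction of [q], with denominators cleared. *)
Definition minpol q H := [/\ q H, ~ q (lead_coef H)%:P &
  forall u, q u -> (size u < size H)%N -> coefI q u].

(** Leading terms with coefficient in [q] are dropped, and shorter elements of [q] outside [coefI q]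
    are preferred, until neither is possible. *)
Lemma minpol_exists q h : q h -> ~ coefI q h -> exists2 H, minpol q H & (size H <= size h)%N.
Proof.
have [n] := ubnP (size h); elim: n h => // n IH h; rewrite ltnS => szn qh Nh.
have h0 : h <> 0 by move=> h0; apply: Nh; rewrite h0; exact: ideal0.
have [ql|ql] := pselect (q (lead_coef h)%:P).
  pose l := (lead_coef h)%:P * 'X^((size h).-1).
  have ql' : coefI q l.
    by apply: idealMr => i; rewrite coefC; case: eqP => _ //; exact: ideal0.
  have szl : (size (h - l)%R < size h)%N.
    have : (size (h - l)%R <= (size h).-1)%N.
      apply/leq_sizeP => i le; rewrite coefB coefCM coefXn.
      case: ltngtP le => // [lt _|<- _]; last by rewrite mulr1 subrr.
      rewrite mulr0 subr0 nth_default //; move: lt; case: (size h) => //.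
    by move=> h'; apply: leq_ltn_trans h' _; rewrite ltn_predL lt0n size_poly_eq0; apply/eqP.
  have [|||H mH sH] := IH (h - l).
  - exact: leq_trans szl szn.
  - apply: idealB => //; exact: coefI_in ql'.
  - by move=> h'; apply: Nh; exact: idealBr h' ql'.
  by exists H => //; apply: leq_trans sH (ltnW szl).
have [[u [qu su Nu]]|N] := pselect (exists u, [/\ q u, (size u < size h)%N & ~ coefI q u]).
  have [|//|//|H mH sH] := IH u; first exact: leq_trans su szn.
  by exists H => //; apply: leq_trans sH (ltnW su).
exists h => //; split => // u qu su; apply: contrapT => Nu; apply: N.
by exists u.
Qed.

Lemma pdiv H u : H != 0 -> exists j w (r : {poly E}), (size r < size H)%N /\
  (lead_coef H ^+ j)%:P * u = w * H + r.
Proof.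
move=> H0; exists (Pdiv.Ring.rscalp u H), (Pdiv.Ring.rdivp u H), (Pdiv.Ring.rmodp u H).
split; first exact: Pdiv.Ring.ltn_rmodpN0.
by rewrite mul_polyC; exact: Pdiv.ComRing.rdivp_eq.
Qed.

Lemma minpol_neq0 q H : minpol q H -> H != 0.
Proof.
case=> _ h _; apply/eqP => H0; apply: h; rewrite H0 lead_coef0 polyC0; exact: ideal0.
Qed.

Lemma minpol_mod q H u : minpol q H -> q u -> exists j w,
  coefI q ((lead_coef H ^+ j)%:P * u - w * H).
Proof.
move=> mH qu; have [qH ql qm] := mH.
have [j [w [r [sr E0]]]] := pdiv u (minpol_neq0 mH).
exists j, w; rewrite E0 addrAC subrr add0r; apply: qm => //.
by rewrite -[r](addKr (w * H)) -E0 addrC; apply: idealB; exact: idealM.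
Qed.

Lemma adjs_map (A B : comPzRingType) (g : {rmorphism A -> B}) (I : ideal A)
    (J : ideal B) s a : (forall c, I c -> J (g c)) -> adjs I s a -> adjs J (map g s) (g a).
Proof.
move=> IJ; have : adjs I s `<=` preim g (adjs J (map g s)); last by apply.
apply: adjs_min => [c /IJ h|x xs]; first exact: sub_adjs.
by apply: adjs_in; exact: map_f.
Qed.

Lemma gens_poly q H (I : ideal E) (J : ideal {poly E}) s : minpol q H ->
  (forall c, I c -> J c%:P) -> gens_at I (pre (@polyC E) q) s ->
  gens_at J q (map (@polyC E) s ++ [:: H]).
Proof.
move=> mH IJ [sq qs]; have [qH ql qm] := mH; split.
  move=> z; rewrite mem_cat => /orP[/mapP[x /sq h -> //]|].
  by rewrite inE => /eqP ->.
set K := adjs J _; have KH : K H by apply: adjs_in; rewrite mem_cat inE eqxx orbT.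
have Kc c : q c%:P -> sat q K c%:P.
  move=> /(qs c)[t qt /(adjs_map IJ)]; rewrite rmorphM => h.
  exists t%:P => //; rewrite /K adjs_cat; exact: sub_adjs.
move=> u /(minpol_mod mH)[j [w h]].
apply: (@sat_cancel _ _ _ (lead_coef H ^+ j)%:P); first by rewrite rmorphXn; exact: primeNX.
apply: (@idealBr _ _ _ (w * H)); last by apply: sub_sat; exact: idealM.
by apply: coefI_in => i; apply: Kc; exact: h.
Qed.

End MinimalPolynomial.

(** Only the induced map on [A/I] has to be a derivation. The map on [A] may thus be obtained by
    choosing preimages, as happens for derivations coming from a fraction field. *)
Definition deriv_mod (A : comPzRingType) (I : ideal A) (d : A -> A) :=
  [/\ forall a b, I (d (a + b) - d a - d b),
      forall a b, I (d (a * b) - a * d b - b * d a) & forall a, I a -> I (d a)].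

Lemma drop_generator_coef (A : comPzRingType) (I : ideal A) (Q : spec A) s h t
    (c : nat -> A) j :
  gens_at I Q s -> ~ Q t -> I (t * h - \sum_(i < size s) c i * s`_i) ->
  (j < size s)%N -> ~ Q (c j) ->
  exists s', (size s').+1 = size s /\ gens_at (adj I h) Q s'.
Proof.
move=> [sQ Qs] Qt Ic jlt Qcj.
pose s' := take j s ++ drop j.+1 s.
have Es : perm_eq s (s`_j :: s').
  rewrite -{1}(cat_take_drop j s) (drop_nth 0) //.
  by rewrite perm_catC /= perm_cons perm_catC.
exists s'; split; first by have := perm_size Es => /= ->.
split; first by move=> z zs; apply: sQ; rewrite (perm_mem Es) inE zs orbT.
set K := adjs (adj I h) s'; have KS x : x \in s' -> K x by exact: adjs_in.
have IK : I `<=` K by move=> a Ia; apply: sub_adjs; exact: sub_adj.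
have Ksj : sat Q K s`_j.
  exists (c j) => //.
  have E : \sum_(i < size s) c i * s`_i =
      c j * s`_j + \sum_(i < size s | i != Ordinal jlt) c i * s`_i.
    by rewrite (bigD1 (Ordinal jlt)).
  apply: (icast (a := t * h - (\sum_(i < size s | i != Ordinal jlt) c i * s`_i)
    - (t * h - \sum_(i < size s) c i * s`_i))); last by rewrite E; ring.
  apply: idealB; last exact: IK.
  apply: idealB; first by apply: idealM; apply: sub_adjs; exact: adj_in.
  apply: ideal_sum => i ij; apply: idealM; apply: KS.
  have ij' : nat_of_ord i != j by apply: contraNN ij => /eqP e; apply/eqP/val_inj.
  rewrite mem_cat; case: ltngtP ij' => // lt _.
    by apply/orP; left; rewrite -(nth_take 0 lt); apply: mem_nth; rewrite size_take jlt.
  apply/orP; right; have -> : s`_i = (drop j.+1 s)`_(i - j.+1) by rewrite nth_drop subnKC.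
  by apply: mem_nth; rewrite size_drop ltn_sub2r // (leq_ltn_trans lt).
move=> a /Qs h'; apply: sat_idem; apply: sat_mono h' => //.
apply: adjs_min => [b /IK|x]; first exact: sub_sat.
by rewrite (perm_mem Es) inE => /orP[/eqP ->|/KS /(@sub_sat _ Q)].
Qed.

(** A derivation maps [Q^2] into [Q], so [h] is not in [Q^2] at [Q]; it has a unit coefficient on
    some generator and can replace it. *)
Lemma drop_generator (A : comPzRingType) (I : ideal A) (Q : spec A) (d : A -> A) s h :
  deriv_mod I d -> I `<=` Q -> gens_at I Q s -> Q h -> ~ Q (d h) ->
  exists s', (size s').+1 = size s /\ gens_at (adj I h) Q s'.
Proof.
move=> [dD dM dI] IQ [sQ Qs] Qh Qdh.
have QD a b : Q (d a) -> Q (d b) -> Q (d (a + b)).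
  move=> Qa Qb; have := IQ _ (dD a b) => /idealBr/(_ Qb) /idealBr; exact.
have QM a b : Q a -> Q b -> Q (d (a * b)).
  move=> Qa Qb; have := IQ _ (dM a b) => /idealBr h'; apply: (idealBr (h' _)).
    exact: idealMr.
  exact: idealMr.
have [t Qt /adjs_sumP[c Ic]] := Qs h Qh.
have [j jlt Qcj] : exists2 j, (j < size s)%N & ~ Q (c j).
  apply: contrapT => N; have Qc j : (j < size s)%N -> Q (c j).
    by move=> jlt; apply: contrapT => h'; apply: N; exists j.
  have : Q (d (t * h)).
    rewrite -(subrK (\sum_(i < size s) c i * s`_i) (t * h)); apply: (QD _ _).
      by apply: IQ; exact: dI.
    elim/big_ind: _ => [||i _]; [|exact: QD|].
      by apply/IQ/dI; exact: ideal0.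
    by apply: QM; [exact: Qc|apply: sQ; exact: mem_nth].
  move=> Qdth; have := IQ _ (dM t h) => h'.
  have : Q (t * d h).
    have -> : t * d h = d (t * h) - h * d t - (d (t * h) - t * d h - h * d t) by ring.
    by apply: idealB => //; apply: idealB => //; exact: idealMr.
  by move=> /spec_prime[].
exact: (drop_generator_coef (conj sQ Qs) Qt Ic jlt Qcj).
Qed.

Lemma drop_generator_sq (A : comPzRingType) (I : ideal A) (Q : spec A) s h :
  gens_at I Q s -> Q h -> ~ sat Q (isum I (ideal_mul Q Q)) h ->
  exists s', (size s').+1 = size s /\ gens_at (adj I h) Q s'.
Proof.
move=> gs Qh Nh; have [sQ Qs] := gs; have [t Qt /adjs_sumP[c Ic]] := Qs h Qh.
have [j jlt Qcj] : exists2 j, (j < size s)%N & ~ Q (c j).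
  apply: contrapT => N; apply: Nh; exists t => //.
  rewrite -(subrK (\sum_(i < size s) c i * s`_i) (t * h)).
  apply: idealD; first exact: isum_l.
  apply: ideal_sum => i _; apply: isum_r; apply: imul_in; last by apply: sQ; exact: mem_nth.
  by apply: contrapT => h'; apply: N; exists i.
exact: (drop_generator_coef gs Qt Ic jlt Qcj).
Qed.

Section FreeExtension.
Variables (E S : comPzRingType) (g : {rmorphism E -> S}) (Q : spec S).
Variables (l : E) (m : nat) (e : nat -> S).
Hypothesis Ql : ~ Q (g l).
Let q := pre g Q.

(** Together with [indep] this says that at [Q], where [l] is invertible, [S/J] is free over [E/I]
    with basis [e]. *)
Definition spans (J : ideal S) := forall u, exists j (r : nat -> E),
  J (g (l ^+ j) * u - \sum_(i < m) g (r i) * e i).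
Definition indep (I : ideal E) (J : ideal S) := forall r : nat -> E,
  J (\sum_(i < m) g (r i) * e i) -> forall i, (i < m)%N -> sat q I (r i).

(** Free extensions are flat and keep regular sequences; here coordinates in the basis [e] are
    compared directly. Both properties survive adjoining an element of [E] to the two ideals, which
    drives the induction. *)
Lemma regs_free I J s : spans J -> indep I J -> (forall c, I c -> J (g c)) ->
  regs I q s -> regs J Q (map g s).
Proof.
elim: s I J => //= a s IH I J sJ iJ IJ [qa na rs].
have scale (r : nat -> E) c u : J (g c * u - \sum_(i < m) g (r i) * e i) -> forall b,
    J (g (b * c) * u - \sum_(i < m) g (b * r i) * e i).
  move=> h b; apply: (icast (idealM (g b) h)).
  rewrite mulrBr rmorphM mulrA mulr_sumr; congr (_ - _); apply: eq_bigr => i _.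
  by rewrite rmorphM mulrA.
have lj j : ~ Q (g (l ^+ j)) by rewrite rmorphXn; exact: primeNX.
split => //.
  move=> u Ju; have [j [r Jr]] := sJ u.
  have Jar : J (\sum_(i < m) g (a * r i) * e i).
    apply: (idealBl (scale _ _ _ Jr a)); rewrite rmorphM mulrAC; exact: idealMr.
  have Hr i : (i < m)%N -> sat q I (r i).
    by move=> lt; apply: (nzd_at_sat na); exact: (iJ (fun i => a * r i) Jar).
  have [t [qt Ht]] : exists t, ~ q t /\ forall i, (i < m)%N -> I (t * r i).
    elim: (m) Hr => [|n IHn] Hr; first by exists 1; split => //; exact: spec_proper.
    have [|t [qt Ht]] := IHn; first by move=> i lt; apply: Hr; exact: ltnW.
    have [v qv Iv] := Hr n (ltnSn n).
    exists (t * v); split; first exact: primeNM.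
    move=> i; rewrite ltnS leq_eqVlt => /orP[/eqP ->|/Ht h].
      by rewrite -mulrA; exact: idealM.
    by rewrite mulrAC; exact: idealMr.
  exists (g (t * l ^+ j)); first by rewrite rmorphM; apply: primeNM => //; exact: lj.
  apply: (idealBr (scale _ _ _ Jr t)); apply: ideal_sum => i _.
  by apply: idealMr; apply: IJ; exact: Ht.
apply: (IH (adj I a)) => //.
- by move=> u; have [j [r Jr]] := sJ u; exists j, r; exact: sub_adj.
- move=> r [y _ Jy] i lt.
  have [j [t Jt]] := sJ y.
  have : J (\sum_(i < m) g (l ^+ j * r i - a * t i) * e i).
    have -> : \sum_(i < m) g (l ^+ j * r i - a * t i) * e i =
       g (l ^+ j) * (\sum_(i < m) g (r i) * e i - y * g a) +
       g a * (g (l ^+ j) * y - \sum_(i < m) g (t i) * e i).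
      have -> : \sum_(i < m) g (l ^+ j * r i - a * t i) * e i =
         g (l ^+ j) * (\sum_(i < m) g (r i) * e i) - g a * \sum_(i < m) g (t i) * e i.
        rewrite !mulr_sumr -sumrB; apply: eq_bigr => i' _.
        by rewrite rmorphB !rmorphM; ring.
      by ring.
    by apply: idealD; exact: idealM.
  move=> /(iJ (fun i => l ^+ j * r i - a * t i)) /(_ i lt) h; apply: (@sat_cancel _ _ _ (l ^+ j)); first exact: lj.
  apply: (idealBr (b := a * t i)); first by apply: sat_mono h; exact: sub_adj.
  by apply: sub_sat; apply: idealMr; exact: adj_in.
- move=> c [y _ Iy]; exists (g y) => //.
  by have := IJ _ Iy; rewrite rmorphB rmorphM.
Qed.

End FreeExtension.

Section WeierstrassPrime.
Variables (T : comNzRingType) (F : nat -> set T).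
Hypothesis cF : compfil F.
Hypothesis uF : forall a, ~ F 1%N a -> isunit a.
Hypothesis nF : ~ F 1%N 1.
Hypothesis dT : is_domain T.
Variables (f : ps T) (s : nat).
Hypothesis f_low : forall i, (i < s)%N -> F 1%N (pc f i).
Hypothesis f_s : ~ F 1%N (pc f s).

(** Weierstrass preparation, by dividing [psX T ^+ s] by [f]: the coefficient of degree [s], read
    modulo [F 1], shows that the quotient is a unit. *)
Lemma wei_poly : exists G v w, [/\ G \is monic, psp G = f * v & f = w * psp G].
Proof.
have [v [r [sr E]]] := wei_div cF uF f_low f_s (psX T ^+ s).
have Fv : ~ F 1%N (pc v 0).
  move=> Fv; apply: nF.
  have : pc (psX T ^+ s) s = 1.
    by rewrite -[psX T ^+ s]mulr1 psXnM ltnn subnn pc1.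
  have Er : pc (psp r) s = 0 by rewrite /= nth_default.
  rewrite E pcD Er addr0 pcM big_ord_recr /= subnn => <-.
  apply: (filD cF); last exact: (filI cF).
  by apply: (fil_sum cF) => i _; rewrite mulrC; apply: (filI cF); exact: f_low.
have [w wv] : isunit v by apply: (ps_unit cF uF) => /(_ 0%N); rewrite subn0.
have EG : psp ('X^s - r) = f * v.
  by rewrite rmorphB rmorphXn -[X in X - _]/(psX T ^+ s) E addrK.
exists ('X^s - r), v, w; split => //; last first.
  by rewrite EG mulrCA wv mulr1.
rewrite monicE lead_coefDl ?lead_coefXn // size_polyXn size_polyN ltnS.
exact: sr.
Qed.

Variable Q : spec (ps T).
Hypothesis Qf : Q f.
Let q : spec {poly T} := pre (@psp T) Q.
Let q' : spec T := pre (@psC T) Q.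

Lemma wei_minpol : exists H, minpol q H.
Proof.
have [G [v [w [mG EG _]]]] := wei_poly.
have [||H mH _] := @minpol_exists T q G.
- by have : Q (psp G) by rewrite EG; exact: idealMr.
- move=> /(_ (size G).-1); rewrite -[_`_ _]/(lead_coef G) (monicP mG).
  exact: spec_proper.
by exists H.
Qed.

(** Division by [f] leaves a polynomial in [Q] as remainder, and [f] itself is a multiple of a
    polynomial. *)
Lemma gens_lift (Jp : ideal {poly T}) (J : ideal (ps T)) l :
  (forall r, Jp r -> J (psp r)) -> gens_at Jp q l -> gens_at J Q (map (@psp T) l).
Proof.
move=> JJ [lq ql]; split; first by move=> z /mapP[y /lq h ->].
have Hr r : q r -> sat Q (adjs J (map (@psp T) l)) (psp r).
  move=> /ql[t qt /(adjs_map JJ)]; rewrite rmorphM => h.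
  by exists (psp t).
have [G [v [w [mG EG Ef]]]] := wei_poly.
move=> u Qu; have [v' [r [sr E]]] := wei_div cF uF f_low f_s u.
have Qr : q r.
  have : Q (psp r); last by [].
  by rewrite -[psp r](addKr (f * v')) -E addrC; apply: idealB => //; exact: idealMr.
rewrite E; apply: idealD; last exact: Hr.
rewrite Ef -mulrA mulrCA; apply: idealMr; apply: Hr.
by have : Q (psp G) by rewrite EG; exact: idealMr.
Qed.

Lemma spans_f : spans (@psC T) 1 s (fun i => psX T ^+ i) (adj (izero _) f).
Proof.
move=> u; have [v [r [sr E]]] := wei_div cF uF f_low f_s u.
exists 0%N, (fun i => r`_i); exists v => //=.
rewrite expr0 rmorph1 mul1r E.
have -> : psp r = \sum_(i < s) psC r`_i * psX T ^+ i.
  have -> : r = trunc s (psp r).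
    apply/polyP => i; rewrite coef_poly; case: ltnP => // le.
    by rewrite nth_default // (leq_trans sr).
  rewrite psp_trunc; apply: eq_bigr => i _; rewrite coef_poly ltn_ord //.
by ring.
Qed.

Lemma sum_psp m (r : nat -> T) :
  \sum_(i < m) psC (r i) * psX T ^+ i = psp (\poly_(i < m) r i).
Proof.
rewrite poly_def rmorph_sum; apply: eq_bigr => i _.
by rewrite -mul_polyC rmorphM rmorphXn.
Qed.

Lemma indep_f : indep (@psC T) Q s (fun i => psX T ^+ i) (izero T) (adj (izero _) f).
Proof.
move=> r [v _ /eqP]; rewrite subr_eq0 sum_psp => /eqP E i lt; apply: sub_sat.
have [||_ E0] := @wei_uniq _ _ cF uF _ _ f_low f_s (- v) (\poly_(i < s) r i).
- exact: size_poly.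
- by rewrite E; ring.
by move/polyP/(_ i): E0; rewrite coef_poly lt coef0.
Qed.

Lemma regs_wei l : regs (izero T) q' l -> regs (izero _) Q (f :: map (@psC T) l).
Proof.
move=> rl; split => //.
  move=> a /(ps_domain dT)[f0|->]; last exact: ideal0.
  by case: f_s; rewrite f0; exact: (filZ cF).
apply: (regs_free _ spans_f indep_f _ rl); last by move=> c ->; rewrite rmorph0; exact: ideal0.
by rewrite rmorph1; exact: spec_proper.
Qed.

(** Compared with the contraction of [Q] to [T], one generator is gained, the minimal polynomial
    [H], and one regular element, [f]: modulo [f] the power series ring is free over [T]. *)
Lemma reg_wei : reg (izero T) q' -> reg (izero _) Q.
Proof.
move=> [_ [s1 [s2 [g1 r2 sz]]]]; split; first exact: izero_sub.
have [H mH] := wei_minpol.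
have IJ c : izero T c -> izero {poly T} c%:P by move=> ->.
exists (map (@psp T) (map (@polyC T) s1 ++ [:: H])), (f :: map (@psC T) s2); split.
- apply: gens_lift (gens_poly mH IJ g1).
  by move=> r ->; rewrite rmorph0.
- exact: regs_wei.
- by rewrite /= !size_map size_cat !size_map addn1 sz.
Qed.

End WeierstrassPrime.

Section WeierstrassOver.
Variables (T : comNzRingType) (F : nat -> set T).
Hypothesis cF : compfil F.
Hypothesis uF : forall a, ~ F 1%N a -> isunit a.
Hypothesis nF : ~ F 1%N 1.
Variables (f : ps T) (s : nat).
Hypothesis f_low : forall i, (i < s)%N -> F 1%N (pc f i).
Hypothesis f_s : ~ F 1%N (pc f s).
Variables (Q Q1 : spec (ps T)).
Hypothesis Qf : Q f.
Hypothesis QQ1 : Q `<=` Q1.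
Let q : spec {poly T} := pre (@psp T) Q.
Let q' : spec T := pre (@psC T) Q.
Variable H : {poly T}.
Hypothesis mH : minpol q H.
Hypothesis Q1l : ~ Q1 (psC (lead_coef H)).

Let m := (size H).-1.

Lemma spans_Q : spans (@psC T) (lead_coef H) m (fun i => psX T ^+ i) Q.
Proof.
move=> u; have [v [r [sr E]]] := wei_div cF uF f_low f_s u.
have [j [w [r' [sr' E']]]] := pdiv r (minpol_neq0 mH).
exists j, (fun i => r'`_i); rewrite sum_psp.
have -> : \poly_(i < m) r'`_i = r'.
  apply/polyP => i; rewrite coef_poly; case: ltnP => // le.
  by rewrite nth_default // (leq_trans _ le) // /m -ltnS (ltn_predK sr').
have -> : psC (lead_coef H ^+ j) * u - psp r' =
    psC (lead_coef H ^+ j) * v * f + psp w * psp H.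
  have : psp ((lead_coef H ^+ j)%:P * r) = psp (w * H + r') by rewrite E'.
  rewrite rmorphM rmorphD rmorphM -[X in X * _ = _]/(psC (lead_coef H ^+ j)) => E2.
  by rewrite E mulrDr E2; ring.
by apply: idealD; apply: idealM => //; case: mH.
Qed.

Lemma indep_Q : indep (@psC T) Q1 m (fun i => psX T ^+ i) q' Q.
Proof.
move=> r; rewrite sum_psp => Qr i lt; apply: sub_sat.
have [_ _ hm] := mH; have := hm (\poly_(i < m) r i) Qr.
have -> : (size (\poly_(i < m) r i) < size H)%N.
  apply: leq_ltn_trans (size_poly _ _) _.
  by rewrite ltn_predL lt0n size_poly_eq0 (minpol_neq0 mH).
by move=> /(_ isT) /(_ i); rewrite coef_poly lt.
Qed.

(** Modulo [Q] the ring is free over [T/q'] at [Q1], so regular sequences are inherited from [T]. At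
    [Q1] there is one generator too many, but [H] is in [Q] and [d H] is outside [Q1], so one of
    them is redundant modulo [Q]. *)
Lemma reg_over d : deriv_mod (coefI q) d -> ~ Q1 (psp (d H)) ->
  reg q' (pre (@psC T) Q1) -> reg Q Q1.
Proof.
move=> dd Q1d [q'q1 [s1 [s2 [g1 r2 sz]]]]; split => //.
have Q1f : Q1 f by exact: QQ1.
have [H1 mH1] := wei_minpol cF uF nF f_low f_s Q1f.
have IJ c : q' c -> coefI q c%:P.
  by move=> qc i; rewrite coefC; case: eqP => _ //; rewrite polyC0; exact: ideal0.
have qH : pre (@psp T) Q1 H by apply: QQ1; case: mH.
have cI : coefI q `<=` pre (@psp T) Q1.
  by move=> p hp; apply: QQ1; exact: (@coefI_in _ q p hp).
have [s' [zs gs]] := drop_generator dd cI (gens_poly mH1 IJ g1) qH Q1d.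
exists (map (@psp T) s'), (map (@psC T) s2); split.
- apply: (gens_lift cF uF nF f_low f_s Q1f _ gs).
  move=> r [c _ hr]; have : q (r - c * H) by exact: coefI_in hr.
  rewrite /q /= => h; have : Q (psp (r - c * H)) := h.
  rewrite rmorphB => /idealBr; apply; rewrite rmorphM; apply: idealM.
  by case: mH.
- exact: (regs_free Q1l spans_Q indep_Q (fun c h => h) r2).
- by rewrite !size_map -sz; apply: succn_inj; rewrite zs size_cat size_map addn1.
Qed.

End WeierstrassOver.

Section PrimesOfPSn.
Variables (C : comNzRingType) (k : fieldType) (res : {rmorphism C -> k}).
Variable F : nat -> set C.
Hypothesis cr : coefring res F.
Variable pi : C.
Hypothesis res_pi : res pi = 0.
Hypothesis pi_gen : forall a, res a = 0 -> exists b, a = pi * b.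

(** Over a field every prime is good; over a discrete valuation ring these are the primes without
    the uniformizer. *)
Definition good n (Q : spec (PSn C n)) := forall c, c <> 0 -> ~ Q (cstn C n c).

Let cFn n := Fn_compfil cr n.

Lemma mapn_eq0 n (u : PSn C n) : mapn res n u = 0 -> exists v, u = cstn C n pi * v.
Proof.
elim: n u => [|n IH] u; first exact: pi_gen.
move=> h; have /choice[v vP] i : exists v, pc u i = cstn C n pi * v.
  by apply: IH; exact: (congr1 (fun w => pc w i) h).
by exists (PS v); apply: psP => i; rewrite /= -[RHS]/(pc (psC _ * PS v) i) psCM vP.
Qed.

Lemma PSn_factor n (u : PSn C n) : u <> 0 ->
  exists c v, [/\ c <> 0, u = cstn C n c * v & mapn res n v <> 0].
Proof.
move=> u0; apply: contrapT => N.
have H c v : c <> 0 -> u = cstn C n c * v -> exists w, v = cstn C n pi * w.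
  move=> c0 E; apply: mapn_eq0; apply: contrapT => h; apply: N.
  by exists c, v.
have [w0 E0] := H 1 u (fun h => elimN eqP (oner_neq0 C) h) (esym (etrans (congr1 (fun x => x * u) (rmorph1 (cstn C n))) (mul1r u))).
have pi0 : pi <> 0.
  by move=> pi0; apply: u0; rewrite E0 pi0 rmorph0 mul0r.
have piX j : pi ^+ j <> 0.
  elim: j => [|j IH]; first by apply/eqP; rewrite expr0 oner_neq0.
  by rewrite exprS => /(cr_dom cr)[].
have Hj j : exists v, u = cstn C n (pi ^+ j) * v.
  elim: j => [|j [v Ev]]; first by exists u; rewrite rmorph1 mul1r.
  have [w Ew] := H _ v (piX j) Ev.
  by exists w; rewrite exprSr rmorphM -mulrA -Ew.
apply: u0; apply: (fil_sep (cFn n)) => j; have [v ->] := Hj j.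
rewrite mulrC; apply: (filI (cFn n)); rewrite rmorphXn; apply: (filX (cFn n)).
by apply/(resnP cr); rewrite resn_cst.
Qed.

Lemma good_min (Q : spec (PSn C 0)) : good Q -> Q `<=` izero _.
Proof.
move=> gQ a Qa; apply: contrapT => a0; exact: (gQ a a0).
Qed.

Lemma good_pre n (Q : spec (ps (PSn C n))) : @good n.+1 Q ->
  @good n (pre (@psC (PSn C n)) Q).
Proof. by move=> gQ c c0; exact: (gQ c c0). Qed.

(** Since [Q] contains no nonzero constant, the content of an element can be divided out, which
    leaves an element of [Q] that is nonzero modulo [pi]. Taking [s] minimal makes all lower
    coefficients non-units. *)
Lemma good_straight n (Q : spec (ps (PSn C n))) : @good n.+1 Q -> ~ Q `<=` izero _ ->
  exists (ti th : {rmorphism ps (PSn C n) -> ps (PSn C n)}) f s,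
   [/\ cancel ti th, cancel th ti,
     forall Q' : spec (ps (PSn C n)), @good n.+1 Q' -> @good n.+1 (pre ti Q') & [/\ pre ti Q f,
       forall i, (i < s)%N -> Fn F (n := n) 1%N (pc f i) & ~ Fn F (n := n) 1%N (pc f s)]].
Proof.
move=> gQ NQ.
have [u Qu u0] : exists2 u, Q u & u <> 0.
  by apply: contrapT => N; apply: NQ => u Qu; apply: contrapT => u0; apply: N; exists u.
have [c [v [c0 Eu v0]]] := @PSn_factor n.+1 u u0.
have Qv : Q v by apply: (primeMl (gQ c c0)); rewrite -Eu.
have [th [ti [s [thK tiK rs tiC]]]] := straighten cr v0.
have ex : exists s, resn res n (pc (th v) s) != 0 by exists s; exact/eqP.
case: (ex_minnP ex) => s0 /eqP rs0 ms0.
exists ti, th, (th v), s0; split => //.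
  by move=> Q' gQ' c' c'0 h; apply: (gQ' c' c'0); rewrite -tiC; exact: h.
split; first by rewrite /= thK.
- move=> i lt; apply/(resnP cr); apply/eqP; apply: contraTT lt => /ms0.
  by rewrite -leqNgt.
- by move=> /(resnP cr).
Qed.

Lemma bij_lf (A B : comPzRingType) (f : {rmorphism A -> B}) (g : B -> A) :
  cancel g f -> forall l, exists s a, isunit (f s) /\ f s * l = f a.
Proof.
move=> gK l; exists 1, (g l); rewrite rmorph1 mul1r gK; split => //.
by exists 1; rewrite mulr1.
Qed.

Let uFn n (a : PSn C n) : ~ Fn F (n := n) 1%N a -> isunit a := PSn_unit cr (u := a).
Let nFn n : ~ Fn F (n := n) 1%N 1.
Proof. by move=> /(resnP cr)/eqP; rewrite rmorph1 oner_eq0. Qed.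

Lemma reg_izero (A : comPzRingType) (I : ideal A) (Q : spec A) :
  I `<=` Q -> Q `<=` I -> reg I Q.
Proof.
move=> IQ QI; split => //; exists [::], [::]; split => //; split => //.
by move=> a /QI Ia /=; exact: sub_sat.
Qed.

Theorem PSn_regular n (Q : spec (PSn C n)) : good Q -> reg (izero _) Q.
Proof.
elim: n Q => [|n IH] Q gQ.
  by apply: reg_izero; [exact: izero_sub|exact: good_min].
have [Q0|NQ] := pselect (Q `<=` izero _).
  by apply: reg_izero => //; exact: izero_sub.
have [ti [th [f [s [tiK thK gti [Qf flow fs]]]]]] := good_straight gQ NQ.
have := reg_wei (cFn n) (@uFn n) (@nFn n) (@PSn_domain _ _ _ _ cr n) flow fs Qf
  (IH _ (good_pre (gti _ gQ))).
have E : izero (ps (PSn C n)) = preim ti (izero _).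
  apply: ideal_eqP => [a -> /=|a /= /(congr1 th)]; first exact: rmorph0.
  by rewrite tiK rmorph0.
by move=> h; apply/(pre_reg (bij_lf thK)); rewrite -E.
Qed.

(** For regularity, the characteristic enters only here. The hypothesis is met by the formal
    derivative in characteristic zero ([deriv_char0]) and by [deriv_pchar] over [k]. *)
Hypothesis der : forall n (q : spec {poly PSn C n}) H, good (pre (@polyC _) q) ->
  minpol q H -> exists2 d, deriv_mod (coefI q) d & ~ q (d H).

(* After a change of variables and Weierstrass division, [Q] is generated over a
   prime in one variable fewer by the polynomial [H]; near [Q] regularity passes
   from the smaller ring as soon as some derivation [d] has [d H] outside [Q]. *)
Theorem PSn_generic_regular n (Q : spec (PSn C n)) : good Q ->
  exists2 g, ~ Q g & forall Q1 : spec (PSn C n), good Q1 -> Q `<=` Q1 -> ~ Q1 g ->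
    reg Q Q1.
Proof.
elim: n Q => [|n IH] Q gQ.
  exists 1; first exact: spec_proper.
  move=> Q1 gQ1 QQ1 _; apply: reg_izero => // a /(good_min gQ1) ->; exact: ideal0.
have [Q0|NQ] := pselect (Q `<=` izero _).
  exists 1; first exact: spec_proper.
  move=> Q1 gQ1 QQ1 _; have -> : spec_ideal Q = izero _.
    by apply: ideal_eqP => //; exact: izero_sub.
  exact: PSn_regular.
have [ti [th [f [s [tiK thK gti [Qf flow fs]]]]]] := good_straight gQ NQ.
set Q2 := pre ti Q in Qf; have gQ2 : @good n.+1 Q2 by exact: gti.
have [H mH] := wei_minpol (cFn n) (@uFn n) (@nFn n) flow fs Qf.
have gq : good (pre (@polyC _) (pre (@psp _) Q2)).
  by move=> c c0; exact: (gQ2 c c0).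
have [d dd Qd] := der gq mH.
have [g' Qg' Hg'] := IH _ (good_pre gQ2).
exists (ti (psC (g' * lead_coef H) * psp (d H))).
  have : ~ Q2 (psC (g' * lead_coef H) * psp (d H)); last by [].
  apply: primeNM; last exact: Qd.
  by rewrite rmorphM; apply: primeNM; [exact: Qg'|case: mH].
move=> Q1 gQ1 QQ1 Q1g.
have sQ : Q2 `<=` pre ti Q1 by move=> a; exact: QQ1.
have gQ12 : @good n.+1 (pre ti Q1) by exact: gti.
have : reg Q2 (pre ti Q1).
  have {}Q1g : ~ pre ti Q1 (psC (g' * lead_coef H) * psp (d H)) by [].
  have N1 : ~ pre ti Q1 (psC g').
    by move=> h; apply: Q1g; apply: idealMr; rewrite rmorphM; exact: idealMr.
  apply: (reg_over (cFn n) (@uFn n) (@nFn n) flow fs Qf sQ mH _ dd).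
  - by move=> h; apply: Q1g; apply: idealMr; rewrite rmorphM; exact: idealM.
  - by move=> h; apply: Q1g; apply: idealM.
  - apply: Hg'; [|by move=> c; exact: sQ|exact: N1].
    by move=> c c0; exact: (gQ12 c c0).
by move/(pre_reg (bij_lf thK)).
Qed.

End PrimesOfPSn.

(** The derivative of [H] is shorter than [H] and has leading coefficient [(size H).-1] times that
    of [H], which is outside [q]; so minimality keeps it out of [q]. *)
Lemma deriv_char0 (E : comNzRingType) (q : spec {poly E}) H :
  (forall n, (0 < n)%N -> ~ q (n%:R)%:P) -> minpol q H ->
  deriv_mod (coefI q) (@deriv E) /\ ~ q H^`().
Proof.
move=> ch [qH ql qm]; split.
  split=> [a b|a b|a h i].
  - have -> : (a + b)^`() - a^`() - b^`() = 0 by rewrite derivD; ring.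
    exact: ideal0.
  - have -> : (a * b)^`() - a * b^`() - b * a^`() = 0 by rewrite derivM; ring.
    exact: ideal0.
  - by rewrite coef_deriv -mulr_natl rmorphM; apply: idealM; exact: h.
have s1 : (1 < size H)%N.
  rewrite ltnNge; apply/negP => /size1_polyC E1; apply: ql.
  by rewrite E1 lead_coefC -E1.
move=> qd; have H0 : H != 0 by rewrite -size_poly_gt0 ltnW.
have := qm _ qd (lt_size_deriv H0) (size H).-2.
rewrite coef_deriv prednK ?ltn_predRL // -[H`_ _]/(lead_coef H) -mulr_natl rmorphM.
move=> /spec_prime[|//]; apply: ch; by rewrite ltn_predRL.
Qed.

Section ResidueField.
Variables (R : comPzRingType) (P : spec R).

Let lfP := (gloc_id P).1.
Let kP a : lmap P a = 0 -> P a.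
Proof. by move=> /loc_map_ker[u Qu E]; apply: (primeMl Qu); rewrite E; exact: ideal0. Qed.
Let uP s : isunit (lmap P s) -> ~ P s.
Proof.
move=> [l ls] Qs; have [t [a [Qt E]]] := loc_map_frac l; apply: Qt.
apply: (idealBl _ (idealM a Qs)); apply: kP.
have {}E : lmap P t * l = lmap P a := E.
by rewrite rmorphB rmorphM -E -mulrA ls mulr1 subrr.
Qed.
Let M := img lfP kP uP.

Definition kappa := quo M.
HB.instance Definition _ := GRing.ComPzRing.on kappa.

Definition kmap : {rmorphism R -> kappa} := qmap M \o lmap P.

Lemma kmap_ker a : kmap a = 0 <-> P a.
Proof.
rewrite /kmap /=; apply: (iff_trans (qmap_ker _ _)).
have E : pre (lmap P) M = P by exact: pre_img.
by have := congr1 (fun P' : spec R => P' a) E => /= ->.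
Qed.

Lemma kmap_frac x : exists a b, [/\ ~ P b & kmap b * x = kmap a].
Proof.
have [l <-] := qmap_surj x; have [s [a [us E]]] := lfP l.
by exists a, s; split; [exact: uP us|rewrite /kmap /= -rmorphM E].
Qed.

Lemma kappa_unit a : ~ P a -> exists y, y * kmap a = 1.
Proof.
move=> Pa; have /= [u ua] := @loc_map_unit R (prime_compl P) a Pa.
by exists (qmap M u); rewrite /kmap /= -rmorphM [u * _]ua rmorph1.
Qed.

Fact kappa_neq0 : (1 : kappa) != 0.
Proof.
apply/eqP; rewrite -(rmorph1 kmap) => /kmap_ker; exact: spec_proper.
Qed.

Lemma kappa_inverse (x : kappa) : x != 0 -> exists y, y * x = 1.
Proof.
move=> /eqP x0; have [a [b [Pb E]]] := kmap_frac x.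
have [|y ya] := @kappa_unit a.
  move=> /kmap_ker a0; apply: x0; have [z zb] := kappa_unit Pb.
  by rewrite -[x]mul1r -zb -mulrA E a0 mulr0.
by exists (y * kmap b); rewrite -mulrA E.
Qed.

Definition kappa_inv (x : kappa) : kappa :=
  if pselect (x != 0) is left h then sval (cid (kappa_inverse h)) else 0.

Fact kappa_mulVf x : x != 0 -> kappa_inv x * x = 1.
Proof. by move=> x0; rewrite /kappa_inv; case: pselect => // h; case: cid. Qed.
Fact kappa_inv0 : kappa_inv 0 = 0.
Proof. by rewrite /kappa_inv; case: pselect => // h; have := h; rewrite eqxx. Qed.

HB.instance Definition _ := GRing.PzSemiRing_isNonZero.Build kappa kappa_neq0.
HB.instance Definition _ := GRing.ComNzRing_isField.Build kappa kappa_mulVf kappa_inv0.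

End ResidueField.

(** * Derivations and p-th powers *)

Section RingDerivations.
Variable F : comNzRingType.
Implicit Types (d : F -> F).

Definition isder d := (forall a b, d (a + b) = d a + d b) /\
  (forall a b, d (a * b) = a * d b + b * d a).

Section Basic.
Variable d : F -> F.
Hypothesis dd : isder d.

Lemma der0 : d 0 = 0.
Proof. by have := dd.1 0 0; rewrite addr0 => /eqP; rewrite -subr_eq0 opprD addNKr oppr_eq0 => /eqP. Qed.
Lemma der1 : d 1 = 0.
Proof. by have /eqP := dd.2 1 1; rewrite mulr1 mul1r -subr_eq0 opprD addNKr oppr_eq0 => /eqP. Qed.
Lemma derN a : d (- a) = - d a.
Proof. by apply/eqP; rewrite -addr_eq0 -dd.1 addNr der0. Qed.
Lemma derB a b : d (a - b) = d a - d b.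
Proof. by rewrite dd.1 derN. Qed.
Lemma der_sum (I : Type) (r : seq I) (P : pred I) (f : I -> F) :
  d (\sum_(i <- r | P i) f i) = \sum_(i <- r | P i) d (f i).
Proof. exact: (big_morph d dd.1 der0). Qed.
Lemma derX a n : d (a ^+ n) = n%:R * a ^+ n.-1 * d a.
Proof.
elim: n => [|n IH]; first by rewrite expr0 der1 !mul0r.
rewrite exprS dd.2 IH /= -[n.+1%:R]natr1; case: n {IH} => [|n]; first by rewrite expr0; ring.
by rewrite exprS /=; ring.
Qed.
Lemma derXp p a : p \in [pchar F] -> d (a ^+ p) = 0.
Proof. by move=> cp; rewrite derX pcharf0 // !mul0r. Qed.
Lemma der_natM n a : d (n%:R * a) = n%:R * d a.
Proof. by rewrite !mulr_natl; elim: n => [|n IH]; rewrite ?mulr0n ?der0 // !mulrS dd.1 IH. Qed.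

Lemma iter_derD n a b : iter n d (a + b) = iter n d a + iter n d b.
Proof. by elim: n a b => //= n IH a b; rewrite IH dd.1. Qed.

Lemma iter_der0 n : iter n d 0 = 0.
Proof. by elim: n => //= n ->; exact: der0. Qed.

Lemma iter_natM n m a : iter n d (m%:R * a) = m%:R * iter n d a.
Proof. by elim: n a => //= n IH a; rewrite IH der_natM. Qed.

Lemma iter_derN n a : iter n d (- a) = - iter n d a.
Proof. by elim: n a => //= n IH a; rewrite IH derN. Qed.

Lemma iter_leibniz n a b : iter n d (a * b) =
  \sum_(i < n.+1) 'C(n, i)%:R * (iter i d a * iter (n - i) d b).
Proof.
elim: n => [|n IH]; first by rewrite big_ord1 /= mul1r.
rewrite iterS IH der_sum.
have -> : \sum_(i < n.+1) d ('C(n, i)%:R * (iter i d a * iter (n - i) d b)) =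
  \sum_(i < n.+1) 'C(n, i)%:R * (iter i d a * iter (n.+1 - i) d b) +
  \sum_(i < n.+1) 'C(n, i)%:R * (iter i.+1 d a * iter (n - i) d b).
  rewrite -big_split; apply: eq_bigr => i _ /=.
  have ile : (i <= n)%N by rewrite -ltnS.
  by rewrite der_natM dd.2 mulrDr subSn //= [iter (n - i) d b * _]mulrC.
rewrite big_ord_recl [X in _ + X]big_ord_recr /= [RHS]big_ord_recl [X in _ = _ + X]big_ord_recr /=.
rewrite !bin0 /bump /= !add1n subSS !binn -addrA; congr (_ + _).
rewrite addrA -big_split; congr (_ + _); apply: eq_bigr => i _ /=.
by rewrite !add1n add0n subSS -mulrDl -natrD -binS.
Qed.

(** The inner binomial coefficients of the Leibniz formula are divisible by [p]. *)
Lemma iter_der p : p \in [pchar F] -> isder (iter p d).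
Proof.
move=> cp; split=> [a b|a b]; first exact: iter_derD.
have pp := pcharf_prime cp.
rewrite iter_leibniz; case: p cp pp => // p cp pp.
rewrite big_ord_recl big_ord_recr /= big1 ?add0r; last first.
  move=> i _; rewrite /bump /= add1n.
  have : (p.+1 %| 'C(p.+1, i.+1))%N by apply: prime_dvd_bin => //=; rewrite ltnS ltn_ord.
  by move=> /dvdnP[m ->]; rewrite natrM (pcharf0 cp) mulr0 mul0r.
by rewrite bin0 /bump /= !add1n !add0n binn subnn /=; ring.
Qed.
End Basic.

End RingDerivations.

Section FieldDerivations.
Variable F : fieldType.
Implicit Types (d : F -> F) (E : set F).

Record fracring E : Prop := FracRing {
  fr1 : E 1;
  frB : forall a b, E a -> E b -> E (a - b);
  frM : forall a b, E a -> E b -> E (a * b);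
  fr_frac : forall x, exists a b, [/\ E a, E b, b != 0 & x = a / b]
}.

(* [d] restricts to a derivation of the subring [E] up to a denominator. *)
Definition bounded E d := exists s, [/\ E s, s != 0 & forall a, E a -> E (s * d a)].
Definition bder E d := isder d /\ bounded E d.
(** Boundedness is imposed because such derivations, multiplied by a fixed element, act on [E]
    itself; this is how they return from the fraction field to the ring. *)
Definition constants_powers p E := forall u, (forall d, bder E d -> d u = 0) -> exists v, u = v ^+ p.

Section Bounded.
Variable E : set F.
Hypothesis fE : fracring E.

Lemma frD a b : E a -> E b -> E (a + b).
Proof.
move=> Ea Eb; have -> : a + b = a - ((1 - 1) - b) by ring.
by do !apply: (frB fE) => //; exact: (fr1 fE).
Qed.

Lemma boundedB d1 d2 : bounded E d1 -> bounded E d2 -> bounded E (fun a => d1 a - d2 a).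
Proof.
move=> [s [Es s0 H]] [t [Et t0 K]]; exists (s * t); split; first exact: (frM fE).
  by rewrite mulf_neq0.
move=> a Ea; rewrite mulrBr; apply: (frB fE).
  by rewrite mulrAC mulrC; apply: (frM fE) => //; exact: H.
by rewrite -mulrA; apply: (frM fE) => //; exact: K.
Qed.

Lemma boundedZ d x : bounded E d -> bounded E (fun a => x * d a).
Proof.
move=> [s [Es s0 H]]; have [a [b [Ea Eb b0 ->]]] := fr_frac fE x.
exists (s * b); split; [exact: (frM fE)|by rewrite mulf_neq0|].
move=> c Ec; have -> : s * b * (a / b * d c) = a * (s * d c) by field.
by apply: (frM fE) => //; exact: H.
Qed.

Lemma bounded_comp d1 d2 : isder d1 -> bounded E d1 -> bounded E d2 ->
  bounded E (fun a => d1 (d2 a)).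
Proof.
move=> dd1 [s [Es s0 H]] [t [Et t0 K]]; exists (s * t * t); split.
- by do !apply: (frM fE).
- by rewrite !mulf_neq0.
move=> a Ea; have -> : s * t * t * d1 (d2 a) = t * (s * d1 (t * d2 a)) - (s * d1 t) * (t * d2 a).
  have -> : d1 (t * d2 a) = t * d1 (d2 a) + d2 a * d1 t by exact: dd1.2.
  by ring.
by apply: (frB fE); apply: (frM fE) => //; try exact: H; [apply: H; exact: K|exact: K].
Qed.

Lemma bounded_iter d n : isder d -> bounded E d -> bounded E (iter n d).
Proof.
move=> dd bd; elim: n => [|n IH]; last exact: (bounded_comp dd bd IH).
by exists 1; split; [exact: (fr1 fE)|exact: oner_neq0|move=> a Ea; rewrite mul1r].
Qed.

Variable p : nat.
Hypothesis cp : p \in [pchar F].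

(* Normalize a derivation [d0] by [d0 c = 1].  It preserves the elements that are
   killed by all derivations killing [c], and [iter p d0] annihilates them, so
   that they are polynomials in [c] over constants of [d0]. *)
Lemma killed_by_annihilator c u : constants_powers p E -> (forall v, c <> v ^+ p) ->
  (forall d, bder E d -> d c = 0 -> d u = 0) ->
  exists w : nat -> F, u = \sum_(i < p) w i ^+ p * c ^+ i.
Proof.
move=> sE Nc Hu.
have [d1 [dd1 bd1] d1c] : exists2 d1, bder E d1 & d1 c <> 0.
  apply: contrapT => N; have [|v] := sE c; last exact: Nc.
  by move=> d bd; apply: contrapT => h; apply: N; exists d.
pose d0 a := (d1 c)^-1 * d1 a.
have b0 : bder E d0.
  split; last exact: boundedZ.
  by split=> a b; rewrite /d0 ?dd1.1 ?dd1.2; ring.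
have [dd0 bd0] := b0.
have d0c : d0 c = 1 by rewrite /d0 mulVf //; apply/eqP.
have pp := pcharf_prime cp.
pose C v := forall d, bder E d -> d c = 0 -> d v = 0.
have C0 v : C v -> C (d0 v).
  move=> Cv d [dd bd] dc.
  (* The commutator with [d0] is a bounded derivation that kills [c], since [d c] is 0 and [d0 c] is
     1. *)
  have /Cv : bder E (fun a => d (d0 a) - d0 (d a)).
    split; last by apply: boundedB; exact: bounded_comp.
    by split=> a b; rewrite ?dd0.1 ?dd.1 ?dd0.2 ?dd.2 ?dd0.1 ?dd.1 ?dd0.2 ?dd.2; ring.
  rewrite d0c dc (der1 dd) (der0 dd0) subrr => /(_ erefl) /eqP.
  by rewrite (Cv d) // (der0 dd0) subr0 => /eqP.
have CB v w : C v -> C w -> C (v - w).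
  by move=> Cv Cw d bd dc; rewrite (derB bd.1) Cv ?Cw ?subrr.
have CM v w : C v -> C w -> C (v * w).
  by move=> Cv Cw d bd dc; rewrite bd.1.2 Cv ?Cw ?mulr0 ?addr0.
have Cc : C c by [].
have CX v n : C v -> C (v ^+ n).
  by move=> Cv d bd dc; rewrite (derX bd.1) Cv ?mulr0.
have Cn n v : C v -> C (iter n d0 v) by move=> Cv; elim: n => //= n IH; exact: C0.
have top v : C v -> iter p d0 v = 0.
  move=> Cv; apply: Cv; first by split; [exact: iter_der|exact: bounded_iter].
  have -> : p = p.-2.+2 by case: (p) pp => [|[|]].
  by rewrite -addn2 iterD /= d0c (der1 dd0) iter_der0.
(* Subtracting [d c] times [d0] from a derivation [d] gives one that kills [c]; so [v] is killed by
   every bounded [d]. *)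
have root v : C v -> d0 v = 0 -> exists y, v = y ^+ p.
  move=> Cv d0v; apply: sE => d [dd bd].
  have /Cv : bder E (fun a => d a - d c * d0 a).
    split; last by apply: boundedB => //; exact: boundedZ.
    by split=> a b; rewrite ?dd0.1 ?dd.1 ?dd0.2 ?dd.2; ring.
  rewrite d0c mulr1 subrr d0v mulr0 subr0; exact.
have iX j : iter j d0 (c ^+ j) = (j`!)%:R.
  elim: j => [|j IH]; first by rewrite fact0.
  rewrite iterSr (derX dd0) d0c mulr1 /=.
  by rewrite (iter_natM dd0) IH -natrM factS.
(* Taylor expansion in [c]. The term removed has coefficient [iter j d0 v] divided by the factorial
   of [j], which is invertible below [p] and equal to its own [p]-th power. *)
have main j v : (j <= p)%N -> C v -> iter j d0 v = 0 ->
    exists w : nat -> F, v = \sum_(i < j) w i ^+ p * c ^+ i.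
  elim: j v => [|j IH] v; first by move=> _ _ /= ->; exists (fun=> 0); rewrite big_ord0.
  move=> jp Cv hv; have [y Ey] := root _ (Cn j v Cv) hv.
  have jf : (j`!)%:R != 0 :> F.
    rewrite -(dvdn_pcharf cp); elim: (j) jp => [|n IHn] lt; first by rewrite dvdn1 -(negbK (p == 1%N)) neq_ltn prime_gt1 ?orbT.
    by rewrite factS Euclid_dvdM // negb_or IHn ?(ltnW lt) // gtnNdvd.
  have Ejf : (j`!)%:R ^+ p = (j`!)%:R :> F.
    by rewrite -(pFrobenius_autE cp) pFrobenius_aut_nat.
  pose x := y / (j`!)%:R.
  have Ex : x ^+ p = iter j d0 v / (j`!)%:R by rewrite /x expr_div_n Ejf Ey.
  have cx : d0 (x ^+ p) = 0 by rewrite (derXp dd0 _ cp).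
  have [|||w Ew] := IH (v - x ^+ p * c ^+ j).
  - exact: ltnW.
  - apply: CB => //; apply: CM; last exact: CX.
    by move=> d bd _; rewrite (derXp bd.1 _ cp).
  - have H n a : iter n d0 (x ^+ p * a) = x ^+ p * iter n d0 a.
      by elim: n => //= n ->; rewrite dd0.2 cx mulr0 addr0.
    have -> : v - x ^+ p * c ^+ j = v + x ^+ p * - c ^+ j by ring.
    rewrite iter_derD // H.
    by rewrite (iter_derN dd0) iX Ex mulrN divfK // subrr.
  exists (fun i => if (i < j)%N then w i else x).
  rewrite big_ord_recr /= ltnn -[v in LHS](subrK (x ^+ p * c ^+ j)) Ew; congr (_ + _).
  by apply: eq_bigr => i _; rewrite ltn_ord.
by apply: main => //; exact: top.
Qed.

End Bounded.
End FieldDerivations.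

(** * Constants and p-th powers in simple algebraic extensions *)

Section SimpleExtension.
Variables (F K : fieldType) (j : {rmorphism F -> K}) (z : K).
Implicit Types (q r m : {poly F}) (E : set F) (d : F -> F).

Definition evz q : K := (map_poly j q).[z].
Fact evz_zmod : zmod_morphism evz.
Proof. by move=> q r; rewrite /evz rmorphB !hornerE. Qed.
Fact evz_monoid : monoid_morphism evz.
Proof. by split=> [|q r]; rewrite /evz ?rmorph1 ?rmorphM !hornerE. Qed.
HB.instance Definition _ := GRing.isZmodMorphism.Build {poly F} K evz evz_zmod.
HB.instance Definition _ := GRing.isMonoidMorphism.Build {poly F} K evz evz_monoid.

Lemma evzC a : evz a%:P = j a.
Proof. by rewrite /evz map_polyC hornerC. Qed.
Lemma evzX : evz 'X = z.
Proof. by rewrite /evz map_polyX hornerX. Qed.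

Definition adjoined E : set K :=
  [set x | exists2 q : {poly F}, (forall i, E q`_i) & x = evz q].

Record minimal_poly m : Prop := MinimalPoly {
  mp_monic : m \is monic;
  mp_root : evz m = 0;
  mp_min : forall q, evz q = 0 -> (size q < size m)%N -> q = 0
}.

Lemma minimal_poly_exists q : q != 0 -> evz q = 0 ->
  exists2 m, minimal_poly m & (size m <= size q)%N.
Proof.
move=> q0 qz.
have ex : exists n, `[< exists r, [/\ r != 0, evz r = 0 & size r = n] >].
  by exists (size q); apply/asboolP; exists q.
case: (ex_minnP ex) => n /asboolP[r [r0 rz sr]] mn.
have lr : (lead_coef r)^-1 != 0 by rewrite invr_eq0 lead_coef_eq0.
exists ((lead_coef r)^-1 *: r); last first.
  by rewrite size_scale // sr; apply: mn; apply/asboolP; exists q.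
split.
- by rewrite monicE lead_coefZ mulVf ?lead_coef_eq0.
- by rewrite -mul_polyC rmorphM /= rz mulr0.
move=> q' q'z; rewrite size_scale // sr => lt; apply/eqP; apply: contraTT lt => q'0.
by rewrite -leqNgt; apply: mn; apply/asboolP; exists q'.
Qed.

Variable m : {poly F}.
Hypothesis mm : minimal_poly m.
Let m0 : m != 0. Proof. exact: monic_neq0 (mp_monic mm). Qed.

Lemma mp_dvd q : (evz q = 0) <-> m %| q.
Proof.
split=> [qz|/dvdpP[w ->]]; last by rewrite rmorphM /= (mp_root mm) mulr0.
apply/eqP; apply: (mp_min mm); last by rewrite ltn_modp.
have := qz; rewrite {1}(divp_eq q m) rmorphD rmorphM /= (mp_root mm) mulr0 add0r; exact.
Qed.

Lemma mp_size : (1 < size m)%N.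
Proof.
rewrite ltnNge; apply/negP => h; have := mp_root mm.
move/eqP: m0; rewrite (size1_polyC h) evzC => mc0 /eqP.
by rewrite fmorph_eq0 => /eqP E; apply: mc0; rewrite E.
Qed.

Lemma evz_mod q : evz (q %% m) = evz q.
Proof. by rewrite [in RHS](divp_eq q m) rmorphD rmorphM /= (mp_root mm) mulr0 add0r. Qed.

Hypothesis gen_z : forall x, exists q : {poly F}, x = evz q.

Lemma evz_small x : exists2 q : {poly F}, (size q < size m)%N & x = evz q.
Proof. by have [q ->] := gen_z x; exists (q %% m); rewrite ?ltn_modp ?evz_mod. Qed.

Lemma fracring_adjoined E : fracring E -> fracring (adjoined E).
Proof.
move=> fE; have E0 : E 0 by rewrite -(subrr 1); apply: (frB fE); exact: (fr1 fE).
have Esum (I : Type) (r : seq I) (P : pred I) (f : I -> F) :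
    (forall i, P i -> E (f i)) -> E (\sum_(i <- r | P i) f i).
  by move=> h; apply: big_ind => // a b; exact: frD.
split.
- exists 1; last by rewrite rmorph1.
  by move=> i; rewrite coef1; case: (i == 0%N) => //; exact: (fr1 fE).
- move=> a b [q qE ->] [r rE ->]; exists (q - r); last by rewrite rmorphB.
  by move=> i; rewrite coefB; apply: (frB fE).
- move=> a b [q qE ->] [r rE ->]; exists (q * r); last by rewrite rmorphM.
  by move=> i; rewrite coefM; apply: Esum => l _; apply: (frM fE).
move=> x; have [q ->] := gen_z x.
have [b [Eb b0 h]] : exists b, [/\ E b, b != 0 & forall i, E (b * q`_i)].
  elim/poly_ind: q => [|q c [b [Eb b0 IH]]].
    by exists 1; split=> [||i]; [exact: (fr1 fE)|exact: oner_neq0|rewrite coef0 mulr0].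
  have [a [b' [Ea Eb' b'0 ->]]] := fr_frac fE c.
  exists (b * b'); split; [exact: (frM fE)|by rewrite mulf_neq0|].
  move=> i; rewrite coefD coefMX coefC; case: i => [|i] /=.
    by rewrite add0r -mulrA [b' * _]mulrC divfK //; apply: (frM fE).
  by rewrite addr0 mulrAC mulrC; apply: (frM fE).
exists (evz (b%:P * q)), (evz b%:P); split.
- by exists (b%:P * q) => // i; rewrite coefCM.
- by exists b%:P => // i; rewrite coefC; case: (i == 0%N).
- by rewrite evzC fmorph_eq0.
- by rewrite rmorphM /= mulrC mulKf // evzC fmorph_eq0.
Qed.

Lemma map_derM d q r : isder d ->
  map_poly d (q * r) = q * map_poly d r + r * map_poly d q.
Proof.
move=> dd; have d0 := der0 dd; apply/polyP => i.
rewrite coefD [r * _]mulrC !coefM coef_map_id0 // coefM (der_sum dd) -big_split /=.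
by apply: eq_bigr => l _; rewrite !coef_map_id0 // dd.2; ring.
Qed.

Lemma map_derD d q r : isder d -> map_poly d (q + r) = map_poly d q + map_poly d r.
Proof.
move=> dd; have d0 := der0 dd; apply/polyP => i.
by rewrite coefD !coef_map_id0 // coefD dd.1.
Qed.

Section DerivationExtension.
Variables (d : F -> F) (t : K).
Hypothesis dd : isder d.
Hypothesis compat : evz (map_poly d m) + evz m^`() * t = 0.

Let D q : K := evz (map_poly d q) + evz q^`() * t.
Let DD q r : D (q + r) = D q + D r.
Proof. by rewrite /D map_derD // derivD !rmorphD /=; ring. Qed.
Let DM q r : D (q * r) = evz q * D r + evz r * D q.
Proof. by rewrite /D map_derM // derivM !rmorphD !rmorphM /=; ring. Qed.
Let Dker q r : evz q = evz r -> D q = D r.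
Proof.
move=> h; have : m %| q - r by apply/mp_dvd; rewrite rmorphB /= h subrr.
move=> /dvdpP[w E]; rewrite -(subrK r q) E DD DM (mp_root mm).
by rewrite [D m]compat !(mulr0, mul0r, add0r).
Qed.

(** The extension of [d] with value [t] at [z]. The hypothesis [compat] says that it annihilates the
    relation [m], so the choice of a polynomial does not matter. *)
Definition der_ext (x : K) : K := D (sval (cid (gen_z x))).

Lemma der_extE q : der_ext (evz q) = D q.
Proof. by rewrite /der_ext; case: cid => r /= h; exact/esym/Dker. Qed.

Lemma der_ext_der : isder der_ext.
Proof.
split=> a b; have [q ->] := gen_z a; have [r ->] := gen_z b.
  by rewrite -rmorphD !der_extE DD.
by rewrite -rmorphM !der_extE DM.
Qed.

Lemma der_extC a : der_ext (j a) = j (d a).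
Proof.
rewrite -evzC der_extE /D derivC rmorph0 mul0r addr0 -evzC; congr evz.
by apply/polyP => i; rewrite coef_map_id0 ?(der0 dd) // !coefC; case: (i == 0%N); rewrite ?(der0 dd).
Qed.

Lemma der_ext_bounded E : fracring E -> bounded E d -> bounded (adjoined E) der_ext.
Proof.
move=> fE [s [Es s0 H]]; have f1 := fracring_adjoined fE.
have E0 : E 0 by rewrite -(subrr 1); apply: (frB fE); exact: (fr1 fE).
have En n a : E a -> E (a *+ n).
  by move=> Ea; elim: n => [//|n IH]; rewrite mulrS; exact: frD.
have cE a : E a -> adjoined E (j a).
  by move=> Ea; exists a%:P; rewrite ?evzC // => i; rewrite coefC; case: (i == 0%N).
have [a [b [Ea Eb b0 Et]]] := fr_frac f1 t.
exists (j s * b); split; first by apply: (frM f1) => //; exact: cE.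
  by rewrite mulf_neq0 // fmorph_eq0.
move=> x [q qE ->]; rewrite der_extE /D Et.
have -> : j s * b * (evz (map_poly d q) + evz q^`() * (a / b)) =
    b * evz (s%:P * map_poly d q) + j s * (a * evz q^`()).
  by rewrite rmorphM /= evzC; field.
apply: (frD f1); apply: (frM f1) => //; [|exact: cE|apply: (frM f1) => //].
  by exists (s%:P * map_poly d q) => // i; rewrite coefCM coef_map_id0 ?(der0 dd) //; exact: H.
by exists q^`() => // i; rewrite coef_deriv; exact: En.
Qed.

Lemma der_ext_bder E : fracring E -> bounded E d -> bder (adjoined E) der_ext.
Proof. by move=> fE bE; split; [exact: der_ext_der|exact: der_ext_bounded]. Qed.
End DerivationExtension.

Variable p : nat.
Hypothesis cp : p \in [pchar F].
Let cpK : p \in [pchar K]. Proof. by rewrite (fmorph_pchar j). Qed.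
Let pp : prime p := pcharf_prime cp.

Lemma deriv_compXp q : (q \Po 'X^p)^`() = 0.
Proof. by rewrite deriv_comp derivXn -mulr_natr -polyC_natr (pcharf0 cp) !mulr0. Qed.

(** If [m ^+ i] divides [g] with [0 < i < p] and quotient [w], then the vanishing of the derivative
    leaves [i w m'] divisible by [m]; as [m'] is nonzero at [z], the quotient vanishes at [z] and
    another factor [m] appears. *)
Lemma sep_pow g : evz m^`() != 0 -> g^`() = 0 -> m %| g -> m ^+ p %| g.
Proof.
move=> sm g0 mg.
have H i : (i <= p)%N -> m ^+ i %| g.
  elim: i => [|i IH] ip; first by rewrite expr0 dvd1p.
  have [-> //|i0] := eqVneq i 0%N.
  have /dvdpP[w Ew] := IH (ltnW ip).
  have iF : i%:R != 0 :> F.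
    by rewrite -(dvdn_pcharf cp) gtnNdvd // lt0n.
  have E : m ^+ i.-1 * ((w * m^`()) * i%:R + m * w^`()) = 0.
    rewrite -g0 Ew derivM deriv_exp -mulr_natr.
    rewrite -{3}(prednK (n := i)) ?lt0n // exprS; ring.
  have {}E : (w * m^`()) * i%:R + m * w^`() = 0.
    by apply/eqP; move/eqP: E; rewrite mulf_eq0 expf_eq0 (negPf m0) andbF.
  have wz : evz w = 0.
    have /eqP := congr1 evz E; rewrite rmorphD !rmorphM /= (mp_root mm) mul0r addr0 rmorph0.
    rewrite !mulf_eq0 (negPf sm) orbF rmorph_nat => /orP[/eqP//|].
    by rewrite -(rmorph_nat j) fmorph_eq0 (negPf iF).
  have /mp_dvd/dvdpP[v Ev] := wz.
  by rewrite Ew Ev exprS -mulrA dvdp_mull.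
exact: H.
Qed.

Lemma frob_sum (L : comNzRingType) (I : Type) (r : seq I) (P : pred I) (f : I -> L) :
  p \in [pchar L] -> (\sum_(i <- r | P i) f i) ^+ p = \sum_(i <- r | P i) f i ^+ p.
Proof.
move=> cL; rewrite -(pFrobenius_autE cL) rmorph_sum.
by apply: eq_bigr => i _; exact: pFrobenius_autE.
Qed.

Let D := (size m).-1.
Let sD : size m = D.+1. Proof. by rewrite prednK // ltnW // mp_size. Qed.

Lemma evz_compXp q : evz (q \Po 'X^p) = \sum_(i < size q) j q`_i * (z ^+ i) ^+ p.
Proof.
rewrite comp_polyE rmorph_sum; apply: eq_bigr => i _.
by rewrite -mul_polyC rmorphM !rmorphXn /= evzC evzX -!exprM mulnC.
Qed.

Lemma compXp_indep q : evz m^`() != 0 -> (size q <= D)%N -> evz (q \Po 'X^p) = 0 -> q = 0.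
Proof.
move=> sm sq /mp_dvd /(sep_pow sm (deriv_compXp _)) dv; apply/eqP; apply: contraTT sq => q0.
have c0 : q \Po 'X^p != 0 by rewrite comp_poly_eq0 // size_polyXn ltnS prime_gt0.
have := dvdp_leq c0 dv; rewrite -ltnNge.
have : ((size (m ^+ p)).-1 = D * p)%N by rewrite size_exp sD.
have := size_comp_poly q 'X^p; rewrite size_polyXn /=.
have : (0 < size q)%N by rewrite size_poly_gt0.
case: (size q) => // n _ /= Ec Em le; rewrite ltnS.
by rewrite -(leq_pmul2r (prime_gt0 pp)) -Ec -Em -!subn1 leq_sub2r.
Qed.

(** For separable [z] the first [D] powers of [z ^+ p] are independent, hence a basis: [z ^+ p]
    already generates the extension. *)
Lemma compXp_span x : evz m^`() != 0 ->
  exists2 q : {poly F}, (size q <= D)%N & x = evz (q \Po 'X^p).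
Proof.
move=> sm.
pose M : 'M[F]_D := \matrix_(i < D) poly_rV ('X^(p * i) %% m).
have rM (v : 'rV[F]_D) : evz (rVpoly (v *m M)) = evz (rVpoly v \Po 'X^p).
  rewrite mulmx_sum_row linear_sum rmorph_sum [rVpoly v]poly_def.
  rewrite [in RHS]raddf_sum rmorph_sum /=; apply: eq_bigr => i _.
  rewrite linearZ /= rowK poly_rV_K; last by rewrite -ltnS -sD ltn_modp.
  rewrite -!mul_polyC rmorphM /= evz_mod comp_polyM comp_polyC comp_Xn_poly -exprM rmorphM.
  by rewrite insubT //= => h; rewrite [Sub _ _](_ : _ = i) //; apply: val_inj.
have fM : row_free M.
  rewrite -kermx_eq0; apply/eqP/row_matrixP => i; rewrite row0.
  set v := row i _.
  have vM : v *m M = 0 by apply/sub_kermxP; exact: row_sub.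
  apply: (can_inj rVpolyK); rewrite linear0; apply: compXp_indep => //.
    exact: size_poly.
  by rewrite -rM vM linear0 rmorph0.
have [q sq ->] := evz_small x.
exists (rVpoly (poly_rV q *m invmx M)); first exact: size_poly.
rewrite -rM mulmxKV ?poly_rV_K //; last by rewrite -row_free_unit.
by rewrite -ltnS -sD.
Qed.

(** Write [u] in the powers of [z ^+ p]. By separability every derivation of [F] extends, and the
    extension kills [z ^+ p]; so it kills the coefficients of [u], which are therefore [p]-th
    powers. *)
Theorem constants_powers_sep E : fracring E -> evz m^`() != 0 -> constants_powers p E -> constants_powers p (adjoined E).
Proof.
move=> fE sm sE u Hu; have [c sc Eu] := compXp_span u sm.
have Hc i : exists v, c`_i = v ^+ p.
  apply: sE => d [dd bd].
  pose t := - evz (map_poly d m) / evz m^`().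
  have ct : evz (map_poly d m) + evz m^`() * t = 0.
    by rewrite /t mulrC divfK // subrr.
  have := Hu _ (der_ext_bder dd ct fE bd).
  rewrite Eu der_extE // deriv_compXp rmorph0 mul0r addr0.
  have -> : map_poly d (c \Po 'X^p) = map_poly d c \Po 'X^p.
    apply/polyP => l; rewrite coef_map_id0 ?(der0 dd) // !coef_comp_poly_Xn ?prime_gt0 //.
    by case: ifP => _; rewrite ?coef_map_id0 ?(der0 dd).
  move=> /(compXp_indep sm) h; have := congr1 (fun r : {poly F} => r`_i) (h _).
  rewrite coef_map_id0 ?(der0 dd) // coef0; apply.
  by apply: leq_trans sc; exact: size_poly.
have [v Hv] := choice Hc.
exists (\sum_(i < size c) j (v i) * z ^+ i).
rewrite frob_sum // Eu evz_compXp; apply: eq_bigr => i _.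
by rewrite Hv rmorphXn exprMn.
Qed.

(** The derivation along [z] that is zero on [F] forces [u] into [F]. Derivations of [F] that kill
    [c] extend by zero at [z], so [killed_by_annihilator] writes [u] as a polynomial in [c = z ^+ p]
    whose coefficients are [p]-th powers. *)
Theorem constants_powers_root E c : fracring E -> m = 'X^p - c%:P -> constants_powers p E -> constants_powers p (adjoined E).
Proof.
move=> fE Em sE u Hu.
have p0 := prime_gt0 pp; have p1 := prime_gt1 pp.
have zp : z ^+ p = j c.
  have := mp_root mm; rewrite Em rmorphB rmorphXn /= evzX evzC => /eqP.
  by rewrite subr_eq0 => /eqP.
have [q sq Eu] := evz_small u.
have sm : size m = p.+1 by rewrite Em size_XnsubC.
have dm : m^`() = 0.
  by rewrite Em derivB derivXn derivC subr0 -mulr_natr -polyC_natr (pcharf0 cp) mulr0.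
have d0 : isder (fun=> 0 : F) by split=> a b; rewrite ?mulr0 addr0.
have m0' (d : F -> F) : isder d -> d c = 0 -> map_poly d m = 0.
  move=> dd dc; apply/polyP => i; rewrite coef0 coef_map_id0 ?(der0 dd) // Em.
  rewrite coefB coefXn coefC (derB dd); case: (i == p); case: (i == 0%N);
  by rewrite /= ?(der1 dd) ?(der0 dd) ?dc subr0.
have q'0 : q^`() = 0.
  have c1 : evz (map_poly (fun=> 0 : F) m) + evz m^`() * 1 = 0.
    by rewrite m0' // dm rmorph0 mul0r addr0.
  have b1 : bounded E (fun=> 0 : F).
    exists 1; split; [exact: (fr1 fE)|exact: oner_neq0|move=> a Ea].
    by rewrite mulr0 -(subrr 1); apply: (frB fE); exact: (fr1 fE).
  have := Hu _ (der_ext_bder d0 c1 fE b1); rewrite Eu der_extE // mulr1.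
  have -> : map_poly (fun=> 0 : F) q = 0.
    by apply/polyP => i; rewrite coef0 coef_map_id0.
  rewrite rmorph0 add0r => /(mp_min mm); apply.
  have [->|q0] := eqVneq q 0; first by rewrite derivC size_poly0 sm.
  exact: ltn_trans (lt_size_deriv q0) sq.
have [b Eq] : exists b, q = b%:P.
  exists q`_0; apply/polyP => i; rewrite coefC; case: i => [//|i] /=.
  have := congr1 (fun r : {poly F} => r`_i) q'0; rewrite coef_deriv coef0 -mulr_natr => /eqP.
  rewrite mulf_eq0 -(dvdn_pcharf cp) => /orP[/eqP //|di].
  by apply: nth_default; apply: leq_trans (dvdn_leq (ltn0Sn i) di); rewrite -ltnS -sm.
have Hb d : bder E d -> d c = 0 -> d b = 0.
  move=> [dd bd] dc.
  have c1 : evz (map_poly d m) + evz m^`() * 0 = 0 by rewrite m0' // mulr0 rmorph0 addr0.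
  have := Hu _ (der_ext_bder dd c1 fE bd); rewrite Eu Eq evzC der_extC // => /eqP.
  by rewrite fmorph_eq0 => /eqP.
have Nc v : c <> v ^+ p.
  move=> Ec; have : evz ('X - v%:P) = 0.
    rewrite rmorphB /= evzX evzC; apply/eqP; rewrite subr_eq0; apply/eqP.
    have : pFrobenius_aut cpK (z - j v) = 0.
      rewrite rmorphB -[LHS]/(z ^+ p - j v ^+ p).
      by rewrite zp Ec rmorphXn subrr.
    by move=> /eqP; rewrite pFrobenius_autE expf_eq0 p0 subr_eq0 => /eqP.
  move=> /(mp_min mm); rewrite size_XsubC sm ltnS p1 => /(_ isT) /eqP.
  by rewrite polyXsubC_eq0.
have [w Ew] := killed_by_annihilator fE cp sE Nc Hb.
exists (\sum_(i < p) j (w i) * z ^+ i).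
rewrite frob_sum // Eu Eq evzC Ew rmorph_sum; apply: eq_bigr => i _.
by rewrite rmorphM !rmorphXn exprMn -zp -!exprM mulnC.
Qed.
End SimpleExtension.

Record subfield (K : fieldType) := Subfield {
  sf_set :> set K;
  sf_div : divring_closed (fun x => `[< sf_set x >])
}.

Section SubfieldType.
Variables (K : fieldType) (S : subfield K).

Definition sf_pred : {pred K} := fun x => `[< S x >].
HB.instance Definition _ := GRing.isDivringClosed.Build K sf_pred (sf_div S).
Definition sft := {x : K | x \in sf_pred}.
HB.instance Definition _ := SubType.on sft.
HB.instance Definition _ := Choice.on sft.
HB.instance Definition _ := [SubChoice_isSubIntegralDomain of sft by <:].
HB.instance Definition _ := [SubIntegralDomain_isSubField of sft by <:].

Lemma sftP (x : sft) : S (val x). Proof. by have /asboolP := valP x. Qed.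

Section Corestriction.
Variables (F : comNzRingType) (j : {rmorphism F -> K}).
Hypothesis Sj : forall a, S (j a).
Definition corestr (a : F) : sft := Sub (j a) (asboolT (Sj a)).
Fact corestr_zmod : zmod_morphism corestr.
Proof. by move=> a b; apply: val_inj; rewrite rmorphB /= rmorphB. Qed.
Fact corestr_monoid : monoid_morphism corestr.
Proof.
split=> [|a b]; apply: val_inj; first by rewrite !rmorph1 /= rmorph1.
by rewrite rmorphM /= rmorphM.
Qed.
HB.instance Definition _ := GRing.isZmodMorphism.Build F sft corestr corestr_zmod.
HB.instance Definition _ := GRing.isMonoidMorphism.Build F sft corestr corestr_monoid.
End Corestriction.
End SubfieldType.

Section AlgebraicElement.
Variables (F K : fieldType) (j : {rmorphism F -> K}) (y : K).

Lemma evz_inv (m q : {poly F}) : minimal_poly j y m -> evz j y q != 0 ->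
  exists r : {poly F}, evz j y r * evz j y q = 1.
Proof.
move=> mm qy; have /coprimepP cop : coprimep m q.
  apply/coprimepP => g /dvdpP[h Eh] gq.
  have gy : evz j y g != 0.
    by apply: contraNneq qy => gy; have /dvdpP[w ->] := gq; rewrite rmorphM /= gy mulr0.
  have /(mp_dvd mm) mh : evz j y h = 0.
    have /eqP := mp_root mm; rewrite Eh rmorphM /= mulf_eq0 (negPf gy) orbF; exact: eqP.
  have m0 : m != 0 := monic_neq0 (mp_monic mm).
  have h0 : h != 0 by apply: contraNneq m0 => h0; rewrite Eh h0 mul0r.
  have g0 : g != 0 by apply: contraNneq m0 => g0; rewrite Eh g0 mulr0.
  have := dvdp_leq h0 mh; rewrite {1}Eh size_mul // => le.
  rewrite -size_poly_eq1 eqn_leq size_poly_gt0 g0 andbT.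
  by have : (0 < size h)%N; [rewrite size_poly_gt0|lia].
have /Bezout_eq1_coprimepP[[u v] /= E] : coprimep m q by apply/coprimepP.
exists v; have := congr1 (evz j y) E.
by rewrite rmorphD !rmorphM /= (mp_root mm) mulr0 add0r rmorph1.
Qed.

Lemma range_subfield (m : {poly F}) : minimal_poly j y m ->
  divring_closed (fun x => `[< range (evz j y) x >]).
Proof.
move=> mm; split; first by apply/asboolP; exists 1; rewrite ?rmorph1.
  move=> _ _ /asboolP[q _ <-] /asboolP[r _ <-]; apply/asboolP.
  by exists (q - r); rewrite ?rmorphB.
move=> _ _ /asboolP[q _ <-] /asboolP[r _ <-]; apply/asboolP.
have [->|r0] := eqVneq (evz j y r) 0; first by exists 0; rewrite ?rmorph0 ?invr0 ?mulr0.
have [v Ev] := evz_inv mm r0; exists (q * v) => //.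
by rewrite rmorphM /= -[in LHS](mulfK r0 (evz j y v)) Ev mul1r.
Qed.
End AlgebraicElement.

Lemma evz_map (F L K : fieldType) (f : {rmorphism F -> L}) (g : {rmorphism L -> K})
  (j : {rmorphism F -> K}) y q : (forall a, g (f a) = j a) ->
  g (evz f y q) = evz j (g y) q.
Proof.
move=> h; rewrite /evz -horner_map -map_poly_comp; congr _.[_].
by apply: eq_map_poly => a /=.
Qed.

Lemma evz_comp (F K : fieldType) (j : {rmorphism F -> K}) z p (q : {poly F}) :
  evz j z (q \Po 'X^p) = evz j (z ^+ p) q.
Proof. by rewrite /evz map_comp_poly map_polyXn horner_comp hornerXn. Qed.

Lemma frobenius_root_min (L K : fieldType) (g : {rmorphism L -> K}) b p (y : L) m :
  p \in [pchar L] -> minimal_poly g b m -> b ^+ p = g y -> evz g b m^`() = 0 ->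
  m = 'X^p - y%:P.
Proof.
move=> cL mm Eb d2; have pp := pcharf_prime cL; have p0 := prime_gt0 pp.
have zy : evz g b ('X^p - y%:P) = 0 by rewrite rmorphB rmorphXn /= evzX evzC Eb subrr.
have Xy : 'X^p - y%:P != 0 by rewrite -size_poly_gt0 size_XnsubC.
have sm : (size m <= p.+1)%N.
  by rewrite -(size_XnsubC y p0); apply: dvdp_leq => //; apply/(mp_dvd mm).
have m0 : m != 0 := monic_neq0 (mp_monic mm).
have {}d2 : m^`() = 0 by apply: (mp_min mm) => //; exact: lt_size_deriv.
have s2 : size m = p.+1.
  have s1 := mp_size mm.
  have := congr1 (fun r : {poly L} => r`_(size m).-2) d2.
  rewrite coef_deriv coef0 prednK ?ltn_predRL // -[m`_ _]/(lead_coef m).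
  rewrite (monicP (mp_monic mm)) => /eqP; rewrite -(dvdn_pcharf cL) => di.
  apply/eqP; rewrite eqn_leq sm -(prednK (n := size m)) ?(ltnW s1) // ltnS.
  by apply: dvdn_leq => //; rewrite ltn_predRL.
apply/eqP; rewrite -subr_eq0; apply/eqP; apply: (mp_min mm).
  by apply/eqP; rewrite rmorphB subr_eq0; apply/eqP; exact: etrans (mp_root mm) (esym zy).
rewrite s2 ltnS; apply/leq_sizeP => i pi; rewrite coefB.
case: (ltngtP p i) pi => // [lt _|<- _].
  by rewrite !nth_default ?subr0 ?size_XnsubC ?s2.
have -> : m`_p = 1 by rewrite -(monicP (mp_monic mm)) lead_coefE s2.
by rewrite coefB coefXn eqxx coefC (gtn_eqF p0) subr0 subrr.
Qed.

Lemma frobenius_root_sep (L K : fieldType) (g : {rmorphism L -> K}) b p (y : L) m :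
  p \in [pchar L] -> minimal_poly g b m -> b ^+ p = g y -> evz g b m^`() != 0 ->
  exists x, b = g x.
Proof.
move=> cL mm Eb dm; have pp := pcharf_prime cL; have p0 := prime_gt0 pp.
have zy : evz g b ('X^p - y%:P) = 0 by rewrite rmorphB rmorphXn /= evzX evzC Eb subrr.
have Xy : 'X^p - y%:P != 0 by rewrite -size_poly_gt0 size_XnsubC.
have dX : ('X^p - y%:P)^`() = 0.
  by rewrite derivB derivXn derivC subr0 -mulr_natr -polyC_natr (pcharf0 cL) mulr0.
have := dvdp_leq Xy (sep_pow mm cL dm dX (proj1 (mp_dvd mm _) zy)).
rewrite size_XnsubC // => le.
have s2 : size m = 2%N.
  apply/eqP; rewrite eqn_leq (mp_size mm) andbT -[size m]prednK ?(ltnW (mp_size mm)) // ltnS.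
  have := size_exp m p; rewrite -(leq_pmul2r p0) mul1n => <-.
  by rewrite -subn1 leq_subLR add1n.
exists (- m`_0); have := mp_root mm.
have -> : m = 'X + (m`_0)%:P.
  apply/polyP => i; rewrite coefD coefX coefC; case: i => [|[|i]] /=; rewrite ?add0r ?addr0 //.
    by rewrite -(monicP (mp_monic mm)) lead_coefE s2.
  by rewrite nth_default ?s2 //=.
rewrite rmorphD /= evzX evzC coefD coefX coefC /= add0r => /eqP.
by rewrite addr_eq0 rmorphN => /eqP.
Qed.

(** If [z] is inseparable, its minimal polynomial is a polynomial in ['X^p], so the field [L]
    generated by [z ^+ p] has smaller degree and falls under the induction hypothesis. From [L]
    upwards the extension is separable or adjoins a [p]-th root. *)
Theorem constants_powers_alg (F K : fieldType) (j : {rmorphism F -> K}) z m p (E : set F) :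
  p \in [pchar F] -> minimal_poly j z m ->
  (forall x, exists q : {poly F}, x = evz j z q) -> fracring E -> constants_powers p E ->
  constants_powers p (adjoined j z E).
Proof.
move: {2}(size m).+1 (ltnSn (size m)) => N; elim: N => // N IH in F K j z m E *.
rewrite ltnS => smN cp mm gz fE sE.
have pp := pcharf_prime cp; have p0 := prime_gt0 pp; have p1 := prime_gt1 pp.
have [dm|dm] := eqVneq (evz j z m^`()) 0; last exact: (constants_powers_sep mm gz cp).
have m0 : m != 0 := monic_neq0 (mp_monic mm).
have {}dm : m^`() = 0 by apply: (mp_min mm) => //; exact: lt_size_deriv.
pose G := \poly_(i < size m) m`_(i * p).
have EG : m = G \Po 'X^p.
  apply/polyP => i; rewrite coef_comp_poly_Xn //; case: ifP => di.
    rewrite coef_poly divnK //; case: ltnP => // h; apply: nth_default.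
    by apply: leq_trans h _; exact: leq_div.
  case: i di => [|i] di; first by rewrite dvdn0 in di.
  have := congr1 (fun r : {poly F} => r`_i) dm; rewrite coef_deriv coef0 -mulr_natr => /eqP.
  by rewrite mulf_eq0 -(dvdn_pcharf cp) di orbF => /eqP.
have G0 : G != 0 by apply: contraNneq m0 => G0; rewrite EG G0 comp_poly0.
have sG : (size G < size m)%N.
  have := mp_size mm; have := size_comp_poly G 'X^p; rewrite -EG size_polyXn /=.
  move: G0; rewrite -size_poly_gt0; case: (size G) => // a _ /=.
  case: (size m) => [|[|b]] //= Eb _; rewrite Eb; case: a Eb => [//|a] _.
  by rewrite ltnS -[X in (X < _)%N]muln1 ltn_pmul2l.
pose y := z ^+ p.
have Gy : evz j y G = 0 by rewrite -evz_comp -EG (mp_root mm).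
have [n mn sn] := minimal_poly_exists G0 Gy.
pose L := Subfield (range_subfield mn).
have Lj a : L (j a) by exists a%:P; rewrite ?evzC.
have Ly : L y by exists 'X; rewrite ?evzX.
pose j' : {rmorphism F -> sft L} := corestr Lj.
pose y' : sft L := Sub y (asboolT Ly).
pose g : {rmorphism sft L -> K} := val.
have gj a : g (j' a) = j a by [].
have mn' : minimal_poly j' y' n.
  split; [exact: mp_monic mn| |].
    by apply: val_inj; rewrite -[LHS]/(g _) (evz_map _ _ gj) (mp_root mn) rmorph0.
  move=> q qy; apply: (mp_min mn).
  by rewrite -[y]/(g y') -(evz_map _ _ gj) qy rmorph0.
have gy' (x : sft L) : exists q : {poly F}, x = evz j' y' q.
  have [q _ Eq] := sftP x; exists q; apply: val_inj; rewrite -[RHS]/(g _).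
  by rewrite (evz_map _ _ gj) -Eq.
have sL : constants_powers p (adjoined j' y' E).
  by apply: (IH _ _ _ _ n) => //; apply: leq_ltn_trans sn _; apply: leq_trans sG _.
have fL := fracring_adjoined gy' fE.
have cL : p \in [pchar sft L] by rewrite (fmorph_pchar j').
have gz' (x : K) : exists q : {poly sft L}, x = evz g z q.
  have [q ->] := gz x; exists (map_poly j' q).
  by rewrite /evz -map_poly_comp.
have zy : evz g z ('X^p - y'%:P) = 0 by rewrite rmorphB rmorphXn /= evzX evzC subrr.
have Xy : 'X^p - y'%:P != 0 by rewrite -size_poly_gt0 size_XnsubC.
have [m2 mm2 sm2] := minimal_poly_exists Xy zy.
have sK : constants_powers p (adjoined g z (adjoined j' y' E)).
  have [d2|d2] := eqVneq (evz g z m2^`()) 0; last exact: (constants_powers_sep mm2 gz' cL fL d2 sL).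
  exact: (constants_powers_root mm2 gz' cL fL (frobenius_root_min cL mm2 (erefl : z ^+ p = g y') d2) sL).
have fK := fracring_adjoined gz fE.
(* Adjoining [z] to [E] at once or after [z ^+ p] gives the same ring, so the same notion of bounded
   derivation. *)
have -> : adjoined j z E = adjoined g z (adjoined j' y' E); last by [].
have zE : adjoined j z E z.
  exists 'X; last by rewrite evzX.
  move=> i; rewrite coefX; case: (i == 1%N); first exact: (fr1 fE).
  by rewrite mulr0n -(subrr 1); apply: (frB fE); exact: (fr1 fE).
have K0 : adjoined j z E 0 by rewrite -(subrr 1); apply: (frB fK); exact: (fr1 fK).
have zXE i : adjoined j z E (z ^+ i).
  elim: i => [|i IHi]; first exact: (fr1 fK).
  by rewrite exprS; apply: (frM fK).
apply/seteqP; split=> _ [q qE ->].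
  exists (map_poly j' q); last by rewrite /evz -map_poly_comp.
  move=> i; rewrite coef_map; exists (q`_i)%:P; last by rewrite evzC.
  move=> l; rewrite coefC; case: (l == 0%N) => //.
  by rewrite -(subrr 1); apply: (frB fE); exact: (fr1 fE).
rewrite /evz horner_coef; apply: big_ind => // [a b|i _]; first exact: (frD fK).
apply: (frM fK) => //; rewrite coef_map; have [r rE ->] := qE i.
rewrite -[X in adjoined _ _ _ X]/(g (evz j' y' r)) (evz_map _ _ gj) -[g y']/y -evz_comp.
exists (r \Po 'X^p) => // l; rewrite coef_comp_poly_Xn //; case: ifP => // _.
by rewrite -(subrr 1); apply: (frB fE); exact: (fr1 fE).
Qed.

(** * Derivations of fields and power series rings of characteristic p *)

Section Base.
Variables (k : fieldType) (p : nat).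
Hypothesis cp : p \in [pchar k].
Let pp := pcharf_prime cp.
Let p0 := prime_gt0 pp.

Lemma range_pow_div : divring_closed (fun x : k => `[< exists v, x = v ^+ p >]).
Proof.
split; first by apply/asboolP; exists 1; rewrite expr1n.
  move=> _ _ /asboolP[v ->] /asboolP[w ->]; apply/asboolP; exists (v - w).
  have := rmorphB (pFrobenius_aut cp) v w.
  by rewrite -[LHS]/((v - w) ^+ p) => ->.
move=> _ _ /asboolP[v ->] /asboolP[w ->]; apply/asboolP; exists (v / w).
by rewrite expr_div_n.
Qed.

(* A subfield [A] that is maximal among those containing [k^p] but not [c]
   satisfies [k = A(c)], so that the derivation d/dc of k over A exists. *)
Lemma derivation_pbasis (c : k) : (forall v, c <> v ^+ p) ->
  exists2 d : k -> k, isder d & d c <> 0.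
Proof.
(* Adding the [p]-th powers to [X] makes the union of the empty chain acceptable to Zorn's lemma as
   well. *)
move=> Nc; pose W (X : set k) : set k := [set x | X x \/ exists v, x = v ^+ p].
pose Z (X : set k) := divring_closed (fun x => `[< W X x >]) /\ ~ W X c.
have [D1 DB DV] := range_pow_div.
have [|X [[ZX NX] maxX]] := @Zorn_bigcup _ Z.
  move=> Fs FZ tot; split; last first.
    by move=> [[Y FY Yc]|[v /Nc //]]; apply: (FZ Y FY).2; left.
  have two x y : W (\bigcup_(Y in Fs) Y) x -> W (\bigcup_(Y in Fs) Y) y ->
      (exists Y, [/\ Fs Y, W Y x & W Y y]) \/
      ((exists v, x = v ^+ p) /\ (exists v, y = v ^+ p)).
    move=> [[Y FY Yx]|hx] [[Y' FY' Yy]|hy].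
    - have [h|h] := tot _ _ FY FY'; left.
        by exists Y'; split => //; left => //; exact: h.
      by exists Y; split => //; left => //; exact: h.
    - by left; exists Y; split => //; [left|right].
    - by left; exists Y'; split => //; [right|left].
    - by right.
  have up Y x : Fs Y -> W Y x -> W (\bigcup_(Y in Fs) Y) x.
    by move=> FY [Yx|h]; [left; exists Y|right].
  split; first by apply/asboolP; right; exists 1; rewrite expr1n.
    move=> x y /asboolP Wx /asboolP Wy; apply/asboolP.
    have [[Y [FY Yx Yy]]|[hx hy]] := two _ _ Wx Wy; last by right; apply/asboolP; apply: DB; apply/asboolP.
    have [[_ h _] _] := FZ _ FY; apply: (up Y) => //.
    by apply/asboolP; apply: h; apply/asboolP.
  move=> x y /asboolP Wx /asboolP Wy; apply/asboolP.
  have [[Y [FY Yx Yy]]|[hx hy]] := two _ _ Wx Wy; last by right; apply/asboolP; apply: DV; apply/asboolP.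
  have [[_ _ h] _] := FZ _ FY; apply: (up Y) => //.
  by apply/asboolP; apply: h; apply/asboolP.
pose A := Subfield ZX; pose g : {rmorphism sft A -> k} := val.
have cA : p \in [pchar sft A] by rewrite -(fmorph_pchar g).
have Ap (x : k) : A (x ^+ p) by right; exists x.
pose pw (x : k) : sft A := Sub (x ^+ p) (asboolT (Ap x)).
have gpw x : x ^+ p = g (pw x) by [].
have gA x : A x -> exists y, x = g y by move=> Ax; exists (Sub x (asboolT Ax)).
have Xc y : c <> g y by move=> E; apply: NX; rewrite E; exact: (sftP y).
have mp x : exists m, minimal_poly g x m.
  have [||m mm _] := @minimal_poly_exists _ _ g x ('X^p - (pw x)%:P).
  - by rewrite -size_poly_gt0 size_XnsubC.
  - by rewrite rmorphB rmorphXn /= evzX evzC subrr.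
  by exists m.
have deg x m : minimal_poly g x m -> (forall y, x <> g y) -> evz g x m^`() = 0.
  move=> mm Nx; apply/eqP; apply: contrapT => /negP h.
  by have [y /Nx] := frobenius_root_sep cA mm (gpw x) h.
(* If [b] is outside [A(c)], maximality of [A] puts [c] into [A(b)], so [c] is a polynomial [q1] in
   [b] over [A] of degree below [p]. But [b] also has degree [p] over [A(c)], so [q1 - c] vanishes
   identically and [c] lies in [A]. *)
have gen_c b : exists q : {poly sft A}, b = evz g c q.
  have [mc mmc] := mp c; apply: contrapT => Nb.
  have Nb' y : b <> g y by move=> E; apply: Nb; exists y%:P; rewrite evzC.
  have [mb mmb] := mp b.
  pose B := range_subfield mmb; pose C := Subfield (range_subfield mmc).
  have AB x : W X x -> range (evz g b) x.
    by move=> /gA[y ->]; exists y%:P; rewrite ?evzC.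
  have [q _ Eq] : range (evz g b) c.
    apply: contrapT => Nr; apply: (maxX (range (evz g b))).
      split=> [x Xx|h]; first by apply: AB; left.
      have [y /Nb'] : exists y, b = g y; last by [].
      by apply: gA; left; apply: h; exists 'X; rewrite ?evzX.
    have EW : W (range (evz g b)) = range (evz g b).
      by apply/seteqP; split=> [x [//|h]|x]; [apply: AB; right|left].
    by split; rewrite EW.
  pose f : {rmorphism sft C -> k} := val.
  have Cg a : C (g a) by exists a%:P; rewrite ?evzC.
  pose j : {rmorphism sft A -> sft C} := corestr Cg.
  have fj a : f (j a) = g a by [].
  have cC : p \in [pchar sft C] by rewrite -(fmorph_pchar f).
  have [||m mm _] := @minimal_poly_exists _ _ f b ('X^p - (j (pw b))%:P).
  - by rewrite -size_poly_gt0 size_XnsubC.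
  - by rewrite rmorphB rmorphXn /= evzX evzC fj subrr.
  have Cc : C c by exists 'X; rewrite ?evzX.
  pose c' : sft C := Sub c (asboolT Cc).
  have Eb : b ^+ p = f (j (pw b)) by [].
  have [dm|dm] := eqVneq (evz f b m^`()) 0; last first.
    have [y Ey] := frobenius_root_sep cC mm Eb dm.
    have [r _ Er] := sftP y; apply: Nb; exists r; rewrite Er; exact: Ey.
  have sm : size m = p.+1 by rewrite (frobenius_root_min cC mm Eb dm) size_XnsubC.
  have smb : size mb = p.+1 by rewrite (frobenius_root_min cA mmb (gpw b) (deg _ _ mmb Nb')) size_XnsubC.
  pose q1 := q %% mb.
  have q1b : evz g b q1 = c by rewrite (evz_mod mmb).
  have sq1 : (size q1 < size m)%N.
    by rewrite sm -smb ltn_modp; exact: monic_neq0 (mp_monic mmb).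
  have := @mp_min _ _ _ _ _ mm (map_poly j q1 - c'%:P).
  rewrite rmorphB /= evzC -[f c']/c.
  have -> : evz f b (map_poly j q1) = c by rewrite -q1b /evz -map_poly_comp.
  rewrite subrr => /(_ erefl) H.
  have {}H : map_poly j q1 = c'%:P.
    apply/eqP; rewrite -subr_eq0; apply/eqP; apply: H.
    apply: leq_ltn_trans (size_polyD _ _) _; rewrite gtn_max size_polyN size_map_poly sq1 /=.
    by apply: leq_ltn_trans (size_polyC_leq1 _) _; exact: mp_size mm.
  have := congr1 (fun r : {poly sft C} => r`_0) H.
  rewrite coef_map coefC /= => E; exact: (Xc q1`_0 (esym (congr1 f E))).
have [m mm] := mp c; have dm := deg _ _ mm Xc.
have d0 : isder (fun=> 0 : sft A) by split=> a b; rewrite ?mulr0 addr0.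
have ct : evz g c (map_poly (fun=> 0 : sft A) m) + evz g c m^`() * 1 = 0.
  rewrite dm mul0r addr0; have -> : map_poly (fun=> 0 : sft A) m = 0; last exact: rmorph0.
  by apply/polyP => i; rewrite coef0 coef_map_id0.
exists (der_ext gen_c (fun=> 0) 1); first exact: (der_ext_der mm).
have -> : der_ext gen_c (fun=> 0) 1 c = 1; last by apply/eqP; rewrite oner_eq0.
have /= := der_extE mm gen_c d0 ct 'X.
rewrite evzX derivX rmorph1 mulr1 => ->.
have -> : map_poly (fun=> 0 : sft A) ('X : {poly sft A}) = 0; last by rewrite rmorph0 add0r.
by apply/polyP => i; rewrite coef0 coef_map_id0.
Qed.
End Base.

Section PowerSeriesDerivations.
Variables (T : comNzRingType) (p : nat).
Hypothesis cp : p \in [pchar T].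
Let p0 := prime_gt0 (pcharf_prime cp).

Lemma pchar_ps : p \in [pchar ps T].
Proof.
rewrite inE (pcharf_prime cp) /=; apply/eqP.
by rewrite -(rmorph_nat (@psC T)) (pcharf0 cp) rmorph0.
Qed.

Definition ps_deriv (u : ps T) : ps T := PS (fun i => i.+1%:R * pc u i.+1).

Lemma pc_Frobenius (u : ps T) i :
  pc (u ^+ p) i = if (p %| i)%N then pc u (i %/ p) ^+ p else 0.
Proof.
have Fr (a b : ps T) : (a + b) ^+ p = a ^+ p + b ^+ p.
  have := frob_sum (index_enum bool) xpredT (fun x : bool => if x then a else b) pchar_ps.
  by rewrite !big_bool.
rewrite {1}(ps_split i.+1 u) Fr pcD exprMn -exprM psXnM.
have -> : (i < i.+1 * p)%N by exact: leq_trans (ltnSn i) (leq_pmulr _ p0).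
rewrite addr0 psp_trunc (frob_sum _ _ _ pchar_ps).
under eq_bigr => l _ do rewrite exprMn -exprM -(rmorphXn (@psC T)).
rewrite pc_sum.
have E (l : 'I_i.+1) : pc (psC (pc u l ^+ p) * psX T ^+ (l * p)) i =
    if (l * p == i)%N then pc u l ^+ p else 0.
  rewrite psCM -[psX T ^+ _]mulr1 psXnM pc1 subn_eq0.
  by case: (ltngtP (l * p) i) => _; rewrite ?mulr1 ?mulr0.
under eq_bigr => l _ do rewrite E.
rewrite -big_mkcond /=; case: ifP => di.
  have li : (i %/ p < i.+1)%N by rewrite ltnS leq_div.
  rewrite (big_pred1 (Ordinal li)) // => l /=; rewrite -val_eqE /=.
  by rewrite -[in RHS](eqn_pmul2r p0) divnK.
rewrite big_pred0 // => l; apply: contraFF di => /eqP <-; exact: dvdn_mull.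
Qed.
End PowerSeriesDerivations.

Lemma isder_map_ps (T : comNzRingType) (d : T -> T) : isder d ->
  isder (fun u : ps T => PS (fun i => d (pc u i))).
Proof.
move=> dd; split=> a b; apply: psP => i.
  by rewrite /= dd.1.
rewrite -[LHS]/(d (pc (a * b) i)) pcD [b * _]mulrC !pcM (der_sum dd) -big_split; apply: eq_bigr => l _ /=.
by rewrite dd.2; ring.
Qed.

Lemma isder_ps_deriv (T : comNzRingType) : isder (@ps_deriv T).
Proof.
have E (u : ps T) n i : (i < n)%N -> pc (ps_deriv u) i = ((trunc n.+1 u)^`())`_i.
  by move=> lt; rewrite coef_deriv coef_trunc // -mulr_natl.
split=> a b; apply: psP => i; first by rewrite /= mulrDr.
rewrite (E _ i.+1) // pcD.
have M (u v : ps T) : pc (u * ps_deriv v) i = ((trunc i.+2 u) * (trunc i.+2 v)^`())`_i.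
  rewrite pcM coefM; apply: eq_bigr => l _.
  have lt : (l < i.+1)%N by [].
  by rewrite coef_trunc ?(ltn_trans lt) // (E _ i.+1) // ltnS leq_subr.
rewrite !M coef_deriv coef_trunc //.
rewrite -[a * b]/(ps_mul a b) (ps_mul_trunc _ _ (n := i.+2)) // -coef_deriv derivM coefD addrC.
by congr (_ + _); rewrite mulrC.
Qed.

Section CharP.
Variables (k : fieldType) (p : nat).
Hypothesis cp : p \in [pchar k].
Let T n := PSn k n.

Lemma pchar_PSn n : p \in [pchar T n].
Proof. by elim: n => [//|n IH]; exact: pchar_ps. Qed.

(** Derivations acting on the coefficients show that these are [p]-th powers, down to
    [derivation_pbasis] over [k]; the derivative in the last variable shows that only exponents
    divisible by [p] occur. *)
Lemma PSn_const n (w : T n) : (forall d : T n -> T n, isder d -> d w = 0) ->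
  exists v, w = v ^+ p.
Proof.
elim: n w => [|n IH] w Hw.
  apply: contrapT => N; have [v E|d dd dw] := derivation_pbasis cp (c := w).
    by apply: N; exists v.
  by apply: dw; exact: Hw.
have [v Hv] : {v | forall i, (p %| i)%N -> pc w i = v i ^+ p}.
  apply: cid; suff /choice[v Hv] : forall i, exists v, (p %| i)%N -> pc w i = v ^+ p.
    by exists v.
  move=> i; have [v ->] : exists v, pc w i = v ^+ p; last by exists v.
  apply: IH => d dd; have := Hw _ (isder_map_ps dd).
  by move=> /(congr1 (fun u => pc u i)).
exists (PS (fun i => v (i * p)%N)); apply: psP => i.
rewrite (pc_Frobenius (pchar_PSn n)) /=; case: ifP => di.
  by rewrite divnK // Hv.
case: i di => [|i] di; first by rewrite dvdn0 in di.
have := congr1 (fun u => pc u i) (Hw _ (@isder_ps_deriv (T n))).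
rewrite /= => E; have [a b Eab _] := egcdnP p (ltn0Sn i).
have cop : (gcdn i.+1 p = 1)%N.
  by apply/eqP; rewrite -/(coprime _ _) coprime_sym prime_coprime ?di // (pcharf_prime cp).
have : (a * i.+1)%:R * pc w i.+1 = (b * p + 1)%:R * pc w i.+1 by rewrite Eab cop.
by rewrite natrD !natrM (pcharf0 (pchar_PSn n)) mulr0 add0r mul1r -mulrA E mulr0.
Qed.
End CharP.

Section FractionDerivation.
Variables (T : comNzRingType) (K : fieldType) (f : {rmorphism T -> K}).
Hypothesis f_inj : forall a, f a = 0 -> a = 0.
Hypothesis fr : fracring (range f).

Lemma frac_repr x : exists ab : T * T, f ab.2 != 0 /\ x = f ab.1 / f ab.2.
Proof.
have [_ [_ [[a _ <-] [b _ <-] b0 ->]]] := fr_frac fr x.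
by exists (a, b).
Qed.

Variable d : T -> T.
Hypothesis dd : isder d.
Let q (ab : T * T) : K := (f ab.2 * f (d ab.1) - f ab.1 * f (d ab.2)) / f ab.2 ^+ 2.

Definition frac_der (x : K) : K := q (sval (cid (frac_repr x))).

Lemma frac_derE a b : f b != 0 -> frac_der (f a / f b) = q (a, b).
Proof.
move=> b0; rewrite /frac_der; case: cid => -[a' b'] /= [b'0 /eqP].
rewrite eqr_div // -!rmorphM => /eqP E.
have {}E : a * b' = a' * b.
  by apply/eqP; rewrite -subr_eq0; apply/eqP; apply: f_inj; rewrite rmorphB E subrr.
have E1 : f a * f b' = f a' * f b by rewrite -!rmorphM E.
have := congr1 f (congr1 d E); rewrite !dd.2 !rmorphD !rmorphM /= => E2.
rewrite /q /=; apply/eqP; rewrite eqr_div ?expf_neq0 //; apply/eqP.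
apply/eqP; rewrite -subr_eq0; apply/eqP.
transitivity ((f a' * f (d b) + f b * f (d a') - (f a * f (d b') + f b' * f (d a))) * (f b * f b')
   + (f a * f b' - f a' * f b) * (f b * f (d b') + f b' * f (d b))); first by ring.
by rewrite E2 E1 !subrr !mul0r addr0.
Qed.

Lemma frac_derC a : frac_der (f a) = f (d a).
Proof.
have := frac_derE a (b := 1); rewrite rmorph1 divr1 => ->; last exact: oner_neq0.
by rewrite /q /= rmorph1 (der1 dd) rmorph0 mulr0 subr0 mul1r expr1n divr1.
Qed.

Lemma frac_der_bder : bder (range f) frac_der.
Proof.
split; last first.
  exists 1; split; [by exists 1; rewrite ?rmorph1|exact: oner_neq0|].
  by move=> _ [a _ <-]; rewrite frac_derC mul1r; exists (d a).
split=> x y; have [[a b] /= [b0 ->]] := frac_repr x; have [[c e] /= [e0 ->]] := frac_repr y.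
  have -> : f a / f b + f c / f e = f (a * e + c * b) / f (b * e).
    by rewrite rmorphD !rmorphM; field; rewrite b0 e0.
  rewrite !frac_derE //; last by rewrite rmorphM mulf_neq0.
  rewrite /q /= dd.1 !dd.2 !(rmorphD, rmorphM) /=; field; by rewrite b0 e0.
have -> : f a / f b * (f c / f e) = f (a * c) / f (b * e).
  by rewrite !rmorphM; field; rewrite b0 e0.
rewrite !frac_derE //; last by rewrite rmorphM mulf_neq0.
rewrite /q /= !dd.2 !(rmorphD, rmorphM) /=; field; by rewrite b0 e0.
Qed.
End FractionDerivation.

Definition triv_fil (C : comNzRingType) (n : nat) : set C := [set a | n = 0%N \/ a = 0].

Lemma triv_compfil (C : comNzRingType) : compfil (@triv_fil C).
Proof.
split=> [a|n|n a b|n a b|n a|n m a b|a h|u h].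
- by left.
- by right.
- by move=> [->|->]; [left|move=> [->|->]; [left|right; rewrite addr0]].
- by move=> [->|->]; [left|right; rewrite mulr0].
- by move=> [//|->]; right.
- by move=> [->|->]; [move=> [->|->]; [left|right; rewrite mulr0]|right; rewrite mul0r].
- by have [] := h 1%N.
exists (u 1%N) => n; case: n => [|n]; first by left.
right; elim: n => [|n IH]; first by rewrite subrr.
by have [//|] := h n.+1; rewrite -{2}(subrK (u n.+1) (u n.+2)) -addrA IH addr0.
Qed.

Lemma field_coefring (k : fieldType) : infinite_set [set: k] ->
  coefring (@idfun k) (@triv_fil k).
Proof.
move=> ik; split => //; first exact: triv_compfil.
- by move=> a; split=> [/= ->|[//|]]; [right|].
- by move=> a /= /eqP a0; exists a^-1; rewrite mulVf.
- by move=> c; exists c.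
- move=> I; have [[a Ia a0]|N] := pselect (exists2 a, I a & a <> 0).
    exists [:: 1]; apply/seteqP; split=> x Ix; last first.
      have I1 : I 1 by have := idealM a^-1 Ia; rewrite mulVf //; apply/eqP.
      by apply: (ideal_top I1).
    by rewrite gen_adjs -[x]mulr1; apply: idealM; apply: adjs_in; rewrite inE.
  exists [::]; apply/seteqP; split=> x; rewrite gen_adjs /=.
    by move=> Ix; apply: contrapT => x0; apply: N; exists x.
  by move=> ->; exact: ideal0.
- by move=> a b /eqP; rewrite mulf_eq0 => /orP[] /eqP; [left|right].
Qed.

Definition fzero (K : fieldType) : spec K.
Proof.
exists (izero K) => /=; first by apply/eqP; exact: oner_neq0.
by move=> a b /eqP; rewrite mulf_eq0 => /orP[] /eqP; [left|right].
Defined.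

Section InseparableMinpol.
Variables (E : comNzRingType) (q : spec {poly E}) (F : fieldType) (f : {rmorphism E -> F}).
Hypothesis f0 : forall a, f a = 0 <-> q a%:P.
Hypothesis fr : fracring (range f).
Variable p : nat.
Hypothesis cF : p \in [pchar F].
Hypothesis sF : constants_powers p (range f).
Let p0 := prime_gt0 (pcharf_prime cF).
Let p1 := prime_gt1 (pcharf_prime cF).

(** If the formal derivative fails, the monic multiple [h] of [H] is a polynomial in ['X^p] over
    [F]. Were all its coefficients killed by the bounded derivations, [h] would be a [p]-th power,
    against minimality. A derivation moving some coefficient, cleared of denominators, is applied
    coefficientwise. *)
Lemma constants_powers_deriv H : minpol q H -> exists2 d, deriv_mod (coefI q) d & ~ q (d H).
Proof.
move=> [qH ql qm].
have s1 : (1 < size H)%N.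
  rewrite ltnNge; apply/negP => /size1_polyC E1; apply: ql.
  by rewrite E1 lead_coefC -E1.
have H0 : H != 0 by rewrite -size_poly_gt0 ltnW.
have [qd|nqd] := pselect (q H^`()); last first.
  exists (@deriv (E)) => //; split=> [a a'|a a'|a h i].
  - have -> : (a + a')^`() - a^`() - a'^`() = 0 by rewrite derivD; ring.
    exact: ideal0.
  - have -> : (a * a')^`() - a * a'^`() - a' * a^`() = 0 by rewrite derivM; ring.
    exact: ideal0.
  - by rewrite coef_deriv -mulr_natl rmorphM; apply: idealM; exact: h.
pose l := f (lead_coef H).
have l0 : l != 0 by apply/eqP => /f0.
pose h i := f H`_i / l.
have Hd i : (p %| i)%N \/ h i = 0.
  case di: (p %| i)%N; [by left|right].
  case: i di => [|i] di; first by rewrite dvdn0 in di.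
  have := qm _ qd (lt_size_deriv H0) i.
  rewrite coef_deriv -mulr_natl => /f0; rewrite rmorphM rmorph_nat => /eqP.
  rewrite mulf_eq0 -(dvdn_pcharf cF) di => /eqP Hi0.
  by rewrite /h Hi0 mul0r.
have [i [dl [bd dh]]] : exists i dl, bder (range f) dl /\ dl (h i) <> 0.
  apply: contrapT => N.
  have Hp i : exists v, h i = v ^+ p.
    apply: sF => dl bd; apply: contrapT => dh; apply: N.
    by exists i, dl.
  have [v Hv] := choice Hp.
  have [b [Gc [b0 HG]]] : exists b (G : nat -> E), f b != 0 /\
      forall i, (i < size H)%N -> f (G i) = f b * v (i * p)%N.
    elim: (size H) => [|m [b [G [b0 HG]]]].
      by exists 1, (fun=> 0); rewrite rmorph1 oner_neq0.
    have [_ [_ [[x _ <-] [y _ <-] y0 Ev]]] := fr_frac fr (v (m * p)%N).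
    exists (b * y), (fun i => if (i < m)%N then G i * y else b * x).
    rewrite rmorphM mulf_neq0 //; split => // i; rewrite ltnS leq_eqVlt => /orP[/eqP->|lt].
      by rewrite ltnn rmorphM Ev; field.
    by rewrite lt rmorphM HG //; ring.
  (* A multiple of the [p]-th root of [h]. Its [p]-th power is in [q], hence so is [G], but [G] is
     too short for that. *)
  pose G := \poly_(i < (size H).-1) Gc i.
  have sG : (size G < size H)%N.
    by apply: leq_ltn_trans (size_poly _ _) _; rewrite ltn_predL ltnW.
  have vh i : (size H <= i)%N -> v i = 0.
    move=> le; have /eqP := Hv i; rewrite /h nth_default // rmorph0 mul0r eq_sym.
    by rewrite expf_eq0 p0 => /eqP.
  have fG i : f G`_i = f b * v (i * p)%N.
    rewrite coef_poly; case: ltnP => [lt|le].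
      by apply: HG; apply: leq_trans lt _; exact: leq_pred.
    rewrite vh ?mulr0 ?rmorph0 //; move: s1 le; case: (size H) => [|[|m]] //= _ le.
    have : (m.+1 * 2 <= i * p)%N by apply: leq_mul.
    by lia.
  have qG : q G.
    apply: (@primeX _ _ _ p); apply: (primeMl ql).
    apply: (idealBr (b := (b ^+ p)%:P * H)); last exact: idealM.
    apply: coefI_in => i; apply/f0; rewrite coefB !coefCM rmorphB !rmorphM rmorphXn -/l.
    have -> : f (G ^+ p)`_i = pc (psp (map_poly f G) ^+ p) i.
      by rewrite -rmorphXn -rmorphXn /= coef_map.
    rewrite (pc_Frobenius cF) /=.
    have -> : f H`_i = l * h i by rewrite /h; field.
    case: ifP => di; last by have [|->] := Hd i; [rewrite di|rewrite !mulr0 subrr].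
    have -> : (map_poly f G)`_(i %/ p) = f G`_(i %/ p) by exact: coef_map.
    by rewrite fG divnK // exprMn Hv; ring.
  have := qm _ qG sG.
  have hD : h (size H).-1 = 1 by rewrite /h -/(lead_coef H) -/l divff.
  have [di|h0] := Hd (size H).-1; last by move/eqP: hD; rewrite h0 eq_sym oner_eq0.
  move=> /(_ ((size H).-1 %/ p)%N) /f0; rewrite fG divnK // => /eqP.
  rewrite mulf_eq0 (negPf b0) /= => /eqP v0.
  by move/eqP: hD; rewrite Hv v0 expr0n gtn_eqF // eq_sym oner_eq0.
have [dd [s [_ s0 Hs]]] := bd.
have /choice[D HD] a : exists y, f y = s * dl (f a).
  by have [|y _ Ey] := Hs (f a); [exists a|exists y].
pose d (u : {poly E}) : {poly E} := \poly_(i < size u) D u`_i.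
have fd (u : {poly E}) i' : f (d u)`_i' = s * dl (f u`_i').
  rewrite coef_poly; case: ltnP => [_|le]; first exact: HD.
  by rewrite (nth_default _ le) rmorph0 (der0 dd) mulr0.
exists d.
  split=> [a b|a b|a ha] i'; apply/f0.
  - by rewrite !coefB !rmorphB !fd coefD rmorphD dd.1; ring.
  - rewrite !coefB [b * _]mulrC !coefM !rmorphB !rmorph_sum fd coefM rmorph_sum (der_sum dd).
    rewrite mulr_sumr -!sumrB big1 // => x _.
    by rewrite !rmorphM !fd dd.2; ring.
  - by rewrite fd; have /f0 -> := ha i'; rewrite (der0 dd) mulr0.
(* The leading terms cancel in [W], so all its coefficients would be in [q]; but coefficient [i] is
   a nonzero multiple of [dl (h i)]. *)
move=> qdH; pose W := (lead_coef H)%:P * d H - (D (lead_coef H))%:P * H.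
have qW : q W by apply: idealB; apply: idealM.
have sW : (size W < size H)%N.
  rewrite -(prednK (n := size H)) ?(ltnW s1) // ltnS; apply/leq_sizeP => x.
  rewrite leq_eqVlt => /orP[/eqP <-|lt]; rewrite coefB !coefCM coef_poly.
    by rewrite ltn_predL ltnW // -/(lead_coef H) mulrC subrr.
  have le : (size H <= x)%N by move: lt; case: (size H) s1.
  by rewrite ltnNge le nth_default // !mulr0 subrr.
have := qm _ qW sW i => /f0; rewrite coefB !coefCM rmorphB !rmorphM fd HD -/l.
have -> : f H`_i = l * h i by rewrite /h; field.
rewrite dd.2 => /eqP dE; apply: dh; apply/eqP; move: dE.
have -> : l * (s * (l * dl (h i) + h i * dl l)) - s * dl l * (l * h i) = s * l * l * dl (h i) by ring.
by rewrite !mulf_eq0 (negPf s0) (negPf l0).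
Qed.

End InseparableMinpol.

Section CharP.
Variables (k : fieldType) (p : nat).
Hypothesis cp : p \in [pchar k].
Hypothesis ik : infinite_set [set: k].
Let p0 := prime_gt0 (pcharf_prime cp).
Let T n := PSn k n.
Let cr := field_coefring ik.

Let res0 : @idfun k 0 = 0 := erefl.
Let gen0 (a : k) : @idfun k a = 0 -> exists b, a = 0 * b.
Proof. by move=> /= ->; exists 0; rewrite mul0r. Qed.

Lemma good_field n (Q : spec (PSn k n)) : good Q.
Proof.
move=> c /eqP c0 Qc; apply: (spec_proper (s := Q)).
by rewrite -(rmorph1 (cstn k n)) -(mulVf c0) rmorphM; exact: idealM.
Qed.

(** The factor [b ^+ p] turns [u = a / b] into the ring element [w] and is a constant of every
    derivation. Derivations of the ring extend to bounded ones of the field, so [PSn_const] applies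
    to [w]. *)
Lemma constants_powers_inj n (K : fieldType) (f : {rmorphism T n -> K}) :
  (forall a, f a = 0 -> a = 0) -> fracring (range f) -> constants_powers p (range f).
Proof.
move=> f_inj fr u Hu; have [[a b] /= [b0 Eu]] := frac_repr fr u.
pose w := a * b ^+ p.-1.
have cK : p \in [pchar K].
  rewrite inE (pcharf_prime cp) /=; apply/eqP.
  by rewrite -(rmorph_nat f) (pcharf0 (pchar_PSn cp n)) rmorph0.
have Ew : f w = u * f b ^+ p.
  by rewrite /w rmorphM rmorphXn Eu -{2}(prednK p0) exprS; field.
have [v Ev] : exists v, w = v ^+ p.
  apply: (PSn_const cp) => d dd; apply: (f_inj _).
  have bd := frac_der_bder f_inj fr dd.
  rewrite -(frac_derC f_inj fr dd) Ew bd.1.2 (Hu _ bd) mulr0 addr0.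
  by rewrite (derXp bd.1 _ cK) mulr0.
exists (f v / f b); rewrite expr_div_n -rmorphXn -Ev Ew mulfK //.
by rewrite expf_neq0.
Qed.

Lemma fracset_div (S : comNzRingType) (K : fieldType) (f : {rmorphism S -> K}) :
  divring_closed (fun x => `[< exists a b, f b != 0 /\ x = f a / f b >]).
Proof.
split; first by apply/asboolP; exists 1, 1; rewrite rmorph1 divr1 oner_neq0.
  move=> _ _ /asboolP[a [b [b0 ->]]] /asboolP[c [e [e0 ->]]]; apply/asboolP.
  exists (a * e - c * b), (b * e); rewrite rmorphB !rmorphM mulf_neq0 //.
  by split => //; field; rewrite b0 e0.
move=> _ _ /asboolP[a [b [b0 ->]]] /asboolP[c [e [e0 ->]]]; apply/asboolP.
have [->|c0] := eqVneq (f c) 0.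
  by exists 0, 1; rewrite rmorph0 rmorph1 oner_neq0 !mul0r invr0 mulr0.
by exists (a * e), (b * c); rewrite !rmorphM mulf_neq0 //; split => //; field; rewrite b0 e0 c0.
Qed.

(** If [f] is not injective, its kernel contains, after a change of variables, a series regular in
    the last variable. By Weierstrass division the image is then obtained from the image of the
    series in the other variables by adjoining one algebraic element [z]. *)
Theorem constants_powers_PSn n (K : fieldType) (f : {rmorphism T n -> K}) :
  fracring (range f) -> constants_powers p (range f).
Proof.
elim: n K f => [|n IH] K f fr.
  by apply: constants_powers_inj => // a /eqP; rewrite fmorph_eq0 => /eqP.
pose Q : spec (T n.+1) := pre f (fzero K).
have [Q0|NQ] := pselect (Q `<=` izero _); first by apply: constants_powers_inj => // a; exact: Q0.
have [ti [th [F [s [tiK thK _ [Qf flow fs]]]]]] := good_straight cr res0 gen0 (@good_field _ Q) NQ.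
pose g : {rmorphism ps (T n) -> K} := f \o ti.
have Eg : range f = range g.
  apply/seteqP; split=> _ [a _ <-]; last by exists (ti a).
  by exists (th a) => //=; rewrite thK.
have gF : g F = 0 by exact: Qf.
rewrite Eg in fr *; clearbody g; clear Eg.
pose c : {rmorphism T n -> K} := g \o @psC (T n).
pose L := Subfield (fracset_div c).
have Lc a : L (c a) by exists a, 1; rewrite rmorph1 divr1 oner_neq0.

pose c' : {rmorphism T n -> sft L} := corestr Lc.
pose v : {rmorphism sft L -> K} := val.
have vc a : v (c' a) = c a by [].
have fr' : fracring (range c').
  split; [by exists 1; rewrite ?rmorph1| | |].
  - by move=> _ _ [a _ <-] [b _ <-]; exists (a - b); rewrite ?rmorphB.
  - by move=> _ _ [a _ <-] [b _ <-]; exists (a * b); rewrite ?rmorphM.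
  move=> x; have [a [b [b0 Ex]]] := sftP x; exists (c' a), (c' b); split.
  - by exists a.
  - by exists b.
  - by rewrite -(fmorph_eq0 v) vc.
  - by apply: val_inj; rewrite -[RHS]/(v _) rmorphM fmorphV !vc.
have cF := Fn_compfil cr n.
have uF (a : PSn k n) : ~ Fn (@triv_fil k) (n := n) 1%N a -> isunit a := PSn_unit cr (u := a).
have nF : ~ Fn (@triv_fil k) (n := n) 1%N 1.
  by move=> /(resnP cr)/eqP; rewrite rmorph1 oner_eq0.
pose z := g (psX _).
have gpsp r : g (psp r) = evz v z (map_poly c' r).
  elim/poly_ind: r => [|r a IHr]; first by rewrite !rmorph0.
  rewrite !rmorphD !rmorphM /= IHr map_polyX map_polyC /= evzX evzC -[v _]/(c a).
  by [].
have gz_range : range g = adjoined v z (range c').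
  apply/seteqP; split=> y [u].
    move=> _ <-; have [w [r [_ ->]]] := wei_div cF uF flow fs u.
    exists (map_poly c' r); last by rewrite rmorphD rmorphM gF mul0r add0r gpsp.
    by move=> i; rewrite coef_map; exists r`_i.
  move=> uE ->; have /choice[r Hr] i : exists a, c' a = u`_i.
    by have [a _ Ea] := uE i; exists a.
  exists (psp (\poly_(i < size u) r i)) => //; rewrite gpsp; congr evz.
  apply/polyP => i; rewrite coef_map coef_poly; case: ltnP => [_|le].
    exact: Hr.
  by rewrite nth_default //; exact: (raddf0 c').
have [m mm] : exists m, minimal_poly v z m.
  have [G [w [_ [mG EG _]]]] := wei_poly cF uF nF flow fs.
  have G0 : map_poly c' G != 0.
    apply/eqP => h; have := congr1 (fun r : {poly sft L} => r`_(size G).-1) h.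
    rewrite coef_map coef0 -[G`_ _]/(lead_coef G) (monicP mG) => E.
    by have /eqP := etrans (esym (rmorph1 c')) E; rewrite oner_eq0.
  have [|m mm _] := @minimal_poly_exists _ _ v z _ G0; last by exists m.
  by rewrite -gpsp EG rmorphM gF mul0r.
have gz x : exists q : {poly sft L}, x = evz v z q.
  have [a [b [Ea Eb b0 ->]]] := fr_frac fr x.
  rewrite gz_range in Ea Eb; have [qa _ Ea'] := Ea; have [qb _ Eb'] := Eb.
  have [|r Er] := evz_inv (q := qb) mm; first by rewrite -Eb'.
  exists (qa * r); rewrite rmorphM /= -Ea'; congr (_ * _).
  by apply: (mulIf b0); rewrite mulVf // Eb' Er.
have cL : p \in [pchar sft L].
  rewrite inE (pcharf_prime cp) /=; apply/eqP.
  by rewrite -(rmorph_nat c') (pcharf0 (pchar_PSn cp n)) rmorph0.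
by rewrite gz_range; apply: (constants_powers_alg cL mm gz fr'); exact: IH.
Qed.

Lemma deriv_pchar n (q : spec {poly T n}) H : minpol q H ->
  exists2 d, deriv_mod (coefI q) d & ~ q (d H).
Proof.
set q' := pre (@polyC (T n)) q; pose f : {rmorphism T n -> kappa q'} := kmap q'.
have fr : fracring (range f).
  split; [by exists 1; rewrite ?rmorph1| | |].
  - by move=> _ _ [a _ <-] [b _ <-]; exists (a - b); rewrite ?rmorphB.
  - by move=> _ _ [a _ <-] [b _ <-]; exists (a * b); rewrite ?rmorphM.
  move=> x; have [a [b [Qb E]]] := kmap_frac x; exists (f a), (f b).
  have b0 : f b != 0 by apply/eqP => /kmap_ker.
  by split=> //; rewrite -[f a]E mulrC mulKf.
have cF : p \in [pchar kappa q'].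
  rewrite inE (pcharf_prime cp) /=; apply/eqP.
  by rewrite -(rmorph_nat f) (pcharf0 (pchar_PSn cp n)) rmorph0.
exact: (@constants_powers_deriv _ q _ f (kmap_ker q') fr p cF (constants_powers_PSn fr)).
Qed.
End CharP.

(** * Jacobian rows *)

Section Krull.
Variable R : comPzRingType.
Hypothesis nR : noetherian R.

(** Let [I] be the intersection of the ideals [J + F N], and [L = J + X I]. An ideal [K] over [L]
    that is maximal among those meeting [I] inside [L] contains a power of each [x], hence some
    [F N], hence [I]. So [I] is contained in [L], and Nakayama's lemma concludes. *)
Lemma krull_intersection (J : ideal R) (xs : seq R) (Q : spec R) (F : nat -> ideal R) a :
  (forall x, x \in xs -> Q x) ->
  (forall K : ideal R, (forall x, x \in xs -> exists s, K (x ^+ s)) -> exists N, F N `<=` K) ->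
  (forall N, isum J (F N) a) -> sat Q J a.
Proof.
move=> xQ FK; pose X := adjs (izero R) xs.
pose Iset : set R := [set b | forall N, isum J (F N) b].
have I0 : Iset 0 by move=> N; exact: ideal0.
have ID b c : Iset b -> Iset c -> Iset (b + c) by move=> h h' N; exact: idealD.
have IM b c : Iset c -> Iset (b * c) by move=> h N; exact: idealM.
pose I := Ideal I0 ID IM; pose L := isum J (ideal_mul X I).
have XQ : X `<=` Q by apply: adjs_min => //; exact: izero_sub.
pose Pr (K : ideal R) := L `<=` K /\ forall y, K y -> I y -> L y.
have [|K [_ [LK KI] maxK]] := noeth_max nR (Pr := Pr) (I := L) _; first by split.
move=> Ia; apply: (nakayama nR XQ (M := I)) => // y Iy; apply: sub_sat; apply: (KI y) => //.
have [|N FN] := FK K; last first.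
  have [b [f [Jb Ff ->]]] := Iy N; apply: idealD; last exact: FN.
  by apply: LK; exact: isum_l.
(* [s] is where the colon ideals of [K] by powers of [x] stop growing; then adding [x ^+ s] to [K]
   brings in no element of [I] outside [L]. *)
move=> x xx; pose Pc (J : ideal R) := exists i, J = colon K (x ^+ i).
have [|J1 [_ [s ->] maxs]] := noeth_max nR (Pr := Pc) (I := colon K (x ^+ 0)) _.
  by exists 0%N.
exists s; apply: (maxK (adj K (x ^+ s))); [|exact: sub_adj|exact: adj_in].
split=> [z Lz|z [c _ Kz] Iz]; first by apply: sub_adj; exact: LK.
have Lxz : L (x * z).
  by apply: isum_r; apply: imul_in => //; exact: adjs_in.
apply: (KI z) => //; apply: (idealBr Kz).
have : colon K (x ^+ s.+1) c.
  have -> : (colon K (x ^+ s.+1)) c = K (x * z - x * (z - c * x ^+ s)).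
    by rewrite /=; congr (K _); rewrite exprS; ring.
  by apply: idealB; [exact: LK|exact: idealM].
have Kc : colon K (x ^+ s.+1) `<=` colon K (x ^+ s).
  apply: maxs; first by exists s.+1.
  by move=> e /= he; rewrite exprS -mulrA; exact: idealM.
by move=> /Kc; rewrite /= mulrC.
Qed.
End Krull.

Section Partials.
Variable C : comNzRingType.

Fixpoint varn n (i : nat) : PSn C n :=
  if n is m.+1 then (if i == m then psX (PSn C m) else psC (varn m i)) else 0.

Fixpoint partial n (i : nat) : PSn C n -> PSn C n :=
  if n is m.+1 then fun u : ps (PSn C m) =>
    (if i == m then ps_deriv u else PS (fun l => partial i (pc u l))) else fun=> 0.

Lemma isder_partial n i : isder (@partial n i).
Proof.
elim: n => [|n IH]; first by split=> a b; rewrite ?addr0 ?mulr0 ?addr0.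
by rewrite /=; case: (i == n); [exact: isder_ps_deriv|exact: isder_map_ps].
Qed.

Lemma partial_cst n i c : partial i (cstn C n c) = 0.
Proof.
elim: n => [//|n IH]; rewrite -[cstn _ _ _]/(psC (cstn C n c)) /=.
case: (i == n); apply: psP => l; rewrite pc0.
  by rewrite -[LHS]/(_ * pc (psC (cstn C n c)) l.+1) pc_psC mulr0.
rewrite -[LHS]/(partial i (pc (psC (cstn C n c)) l)) pc_psC.
by case: (l == 0%N); rewrite ?IH // (der0 (isder_partial n i)).
Qed.

Lemma partial_var n i j : (i < n)%N -> (j < n)%N -> partial i (varn n j) = (i == j)%:R.
Proof.
elim: n => [//|n IH] hi hj.
rewrite -[varn _ _]/(if j == n then psX (PSn C n) else psC (varn n j)) /=.
have d1 := der1 (isder_partial n i); have d0 := der0 (isder_partial n i).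
have [Ei|Ni] := eqVneq i n; have [Ej|Nj] := eqVneq j n.
- rewrite Ei Ej eqxx; apply: psP => l; rewrite -[LHS]/(_ * 'X`_l.+1) coefX pc1.
  by case: l => [|l] /=; rewrite ?mulr1 ?mulr0.
- rewrite Ei eq_sym (negPf Nj); apply: psP => l.
  by rewrite -[LHS]/(_ * pc (psC (varn n j)) l.+1) pc_psC mulr0 pc0.
- rewrite Ej (negPf Ni); apply: psP => l; rewrite -[LHS]/(partial i 'X`_l) coefX pc0.
  by case: (l == 1%N) => /=.
- apply: psP => l; rewrite -[LHS]/(partial i (pc (psC (varn n j)) l)) pc_psC.
  have [->|l0] := eqVneq l 0%N.
    have hi' : (i < n)%N by rewrite ltn_neqAle Ni -ltnS.
    have hj' : (j < n)%N by rewrite ltn_neqAle Nj -ltnS.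
    by rewrite IH //; case: (i == j); rewrite ?pc1 ?pc0.
  by rewrite d0; case: (i == j); rewrite ?pc1 ?(negPf l0) ?pc0.
Qed.

(* Multiplies the homogeneous component of degree [e] by [w e]. *)
Fixpoint wop n (w : nat -> C) : PSn C n -> PSn C n :=
  if n is m.+1 then fun u : ps (PSn C m) => PS (fun i => wop (fun e => w (e + i)%N) (pc u i))
  else fun a => w 0%N * a.

Lemma wop_ext n w w' (u : PSn C n) : w =1 w' -> wop w u = wop w' u.
Proof. by move=> h; congr (wop _ u); apply: funext. Qed.

Lemma wopD n w w' (u : PSn C n) : wop (fun e => w e + w' e) u = wop w u + wop w' u.
Proof.
elim: n w w' u => [|n IH] w w' u; first exact: mulrDl.
by apply: psP => i; rewrite -[LHS]/(wop _ (pc u i)) IH.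
Qed.

Lemma wopZ n c w (u : PSn C n) : wop (fun e => c * w e) u = cstn C n c * wop w u.
Proof.
elim: n w u => [|n IH] w u; first by rewrite /= mulrA.
apply: psP => i; rewrite -[cstn _ _ _]/(psC (cstn C n c)) psCM -[LHS]/(wop _ (pc u i)).
by rewrite IH.
Qed.

Lemma wop1 n (u : PSn C n) : wop (fun=> 1) u = u.
Proof.
elim: n u => [|n IH] u; first exact: mul1r.
by apply: psP => i; rewrite -[LHS]/(wop _ (pc u i)) IH.
Qed.

Lemma wopM n w w' (u : PSn C n) : wop w (wop w' u) = wop (fun e => w e * w' e) u.
Proof.
elim: n w w' u => [|n IH] w w' u; first exact: mulrA.
by apply: psP => i; rewrite -[LHS]/(wop _ (wop _ (pc u i))) IH.
Qed.

Lemma wop_euler n (u : PSn C n) :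
  wop (fun e => e%:R) u = \sum_(i < n) varn n i * partial i u.
Proof.
elim: n u => [|n IH] u; first by rewrite big_ord0 /= mul0r.
rewrite big_ord_recr; apply: psP => i; rewrite pcD pc_sum.
rewrite -[LHS]/(wop _ (pc u i)) (wop_ext (w' := fun e => e%:R + i%:R * 1)); last first.
  by move=> e; rewrite natrD mulr1.
rewrite wopD wopZ wop1 IH; congr (_ + _).
  apply: eq_bigr => j _; have Nj : (j == n :> nat) = false by rewrite ltn_eqF.
  have -> : varn n.+1 j = psC (varn n j) by rewrite /= Nj.
  by rewrite psCM /= Nj.
rewrite -[varn _ _]/(if _ == n then psX (PSn C n) else _) eqxx psXM /= eqxx.
by case: i => [|i]; rewrite rmorph_nat ?mul0r.
Qed.

Lemma wop_fil n N w (u : PSn C n) : (forall e, (e < N)%N -> w e = 0) ->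
  Fn (@triv_fil C) (n := n) N (wop w u).
Proof.
elim: n N w u => [|n IH] N w u h.
  by case: N h => [|N] h; [left|right; rewrite /= h // mul0r].
move=> i; apply: IH => e lt; apply: h; lia.
Qed.

Lemma wop_delta n c (u : PSn C n) :
  wop (fun e => if e == 0%N then c else 0) u = cstn C n (c * resn idfun n u).
Proof.
elim: n u => [//|n IH] u; apply: psP => i.
rewrite -[LHS]/(wop _ (pc u i)) -[cstn _ _ _]/(psC (cstn C n _)) pc_psC.
case: i => [|i] /=; first by rewrite -IH; apply: wop_ext => e; rewrite addn0.
rewrite (wop_ext (w' := fun e => 0 * 1)); last by move=> e; rewrite addnS mul0r.
by rewrite wopZ rmorph0 mul0r.
Qed.

Lemma Fn_triv_compfil n : compfil (Fn (@triv_fil C) (n := n)).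
Proof. by elim: n => [|n IH]; [exact: triv_compfil|exact: ps_compfil]. Qed.

Lemma nilp_fil n (K : ideal (PSn C n)) :
  (forall i, (i < n)%N -> exists s, K (varn n i ^+ s)) ->
  exists N, Fn (@triv_fil C) (n := n) N `<=` K.
Proof.
elim: n K => [|n IH] K hK; first by exists 1%N => a [//|->]; exact: ideal0.
have [|N HN] := IH (preim (@psC (PSn C n)) K).
  move=> i lt; have [s Ks] := hK i (ltnW lt); exists s.
  by move: Ks; rewrite /= ltn_eqF // rmorphXn.
have [s Ks] := hK n (ltnSn n); rewrite /= eqxx in Ks.
exists (N + s)%N => u hu; rewrite (ps_split s u) psp_trunc.
apply: idealD; last exact: idealMr.
apply: ideal_sum => i _; apply: idealMr; apply: HN.
by apply: fil_le (hu i); [exact: Fn_triv_compfil|have := ltn_ord i; lia].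
Qed.
End Partials.

Lemma resn_var (C k : comNzRingType) (res : {rmorphism C -> k}) n i :
  resn res n (varn C n i) = 0.
Proof.
elim: n => [|l IH]; first exact: rmorph0.
rewrite /=; case: (i == l); first by rewrite /cst_coef /= coefX rmorph0.
by rewrite /cst_coef -[X in resn _ _ X]/(pc (psC (varn C l i)) 0) pc_psC.
Qed.

Section EulerDerivation.
Variable C : comNzRingType.

(** The binomial coefficient of [e - 1] over [N] as a polynomial in [e], which vanishes from 1 to
    [N] and takes the value [(-1) ^+ N] at 0. *)
Definition euler_weight N e : C := if e is e'.+1 then 'C(e', N)%:R else (-1) ^+ N.

Lemma euler_weightS N e :
  N.+1%:R * euler_weight N.+1 e = (e%:R - N.+1%:R) * euler_weight N e.
Proof.
case: e => [|e] /=; first by rewrite exprS; ring.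
rewrite -natrM mul_bin_left natrM -[e.+1%:R]natr1 -[N.+1%:R]natr1.
have [le|lt] := leqP N e; first by rewrite natrB //; ring.
by rewrite bin_small // !mulr0.
Qed.

Variables (n : nat) (P Q : spec (PSn C n)).
Hypothesis nS : noetherian (PSn C n).
Hypothesis PQ : P `<=` Q.
Hypothesis varQ : forall i, (i < n)%N -> Q (varn C n i).
Hypothesis P0 : forall N, ~ P N.+1%:R.

(* Interpolating in the Euler operator isolates the constant term of an element
   of [P] up to arbitrarily high order. *)
Lemma euler_stable f : P f ->
  (forall u, P u -> P (\sum_(i < n) varn C n i * partial i u)) ->
  P (cstn C n (resn idfun n f)).
Proof.
move=> Pf PE.
(* Up to the factor [N.+1], the operator for [N.+1] is the one for [N] followed by the Euler
   operator minus [N.+1]. *)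
have Pw N : P (wop (euler_weight N) f).
  elim: N => [|N IH].
    by rewrite (wop_ext (w' := fun=> 1)) ?wop1 // => e; case: e => [|e] //=; rewrite bin0.
  apply: (primeMl (a := cstn C n N.+1%:R)); first by rewrite rmorph_nat; exact: P0.
  rewrite -wopZ (wop_ext (w' := fun e => e%:R * euler_weight N e +
     (- N.+1%:R) * euler_weight N e)).
    rewrite wopD wopZ -wopM wop_euler; apply: idealD; last exact: idealM.
    exact: PE.
  by move=> e; rewrite euler_weightS; ring.
have cF := Fn_triv_compfil C n.
pose F N := Ideal (filZ cF N) (@filD _ _ cF N) (@filI _ _ cF N).
apply: (sat_prime PQ).
apply: (krull_intersection nS (xs := [seq varn C n i | i <- iota 0 n]) (F := F)).
- by move=> y /mapP[i]; rewrite mem_iota => /andP[_ lt] ->; exact: varQ.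
- move=> K hK; have [|N FN] := @nilp_fil C n K; last by exists N.
  by move=> i lt; apply: hK; apply: map_f; rewrite mem_iota.
move=> N; set a := cstn _ _ _.
(* Subtracting the constant term leaves weights that vanish in all degrees below [N]. *)
have : isum P (F N) (wop (fun e => if e == 0%N then (-1) ^+ N else 0) f).
  pose w' e := euler_weight N e + -1 * (if e == 0%N then (-1) ^+ N else 0).
  have Ew : wop w' f = wop (euler_weight N) f -
      wop (fun e => if e == 0%N then (-1) ^+ N else 0) f.
    by rewrite wopD wopZ rmorphN1 mulN1r.
  have -> : wop (fun e => if e == 0%N then (-1) ^+ N else 0) f =
    wop (euler_weight N) f - wop w' f by rewrite Ew; ring.
  apply: idealB; first exact: isum_l.
  apply: isum_r; apply: wop_fil => e; case: e => [|e] lt; rewrite /w' /=; first by ring.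
  by rewrite mulr0 addr0 bin_small // ltnW.
rewrite wop_delta rmorphM -/a rmorphXn rmorphN1 => h.
have := idealM ((-1) ^+ N) h; rewrite mulrA -exprD addnn -mul2n exprM sqrrN !expr1n.
by rewrite mul1r.
Qed.
End EulerDerivation.

Section Rows.
Variables (A S : comNzRingType) (n : nat) (dl : 'I_n -> S -> S) (X : 'I_n -> S).
Variable phi : A -> S.
Hypothesis dd : forall i, isder (dl i).
Hypothesis dX : forall i j, dl i (X j) = (i == j)%:R.
Hypothesis dphi : forall i a, dl i (phi a) = 0.
Variables (P : spec S) (s : seq S).
Hypothesis sP : gens_at (izero S) P s.
Variables (K : fieldType) (kap : {rmorphism S -> K}).
Hypothesis kapP : forall a, kap a = 0 <-> P a.
Hypothesis kap_frac : forall x, exists a b, ~ P b /\ kap b * x = kap a.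
Implicit Types (u : 'I_n -> S).

Definition ldiff u f := \sum_i u i * dl i f.

Lemma isder_ldiff u : isder (ldiff u).
Proof.
split=> a b; rewrite /ldiff.
  by rewrite -big_split; apply: eq_bigr => i _; rewrite (dd i).1 mulrDr.
rewrite !mulr_sumr -big_split; apply: eq_bigr => i _ /=.
by rewrite (dd i).2; ring.
Qed.

Let J : 'M[K]_(n, size s) := \matrix_(i, j) kap (dl i (nth 0 s j)).

Lemma jacobian_ker u : (\row_i kap (u i)) *m J = 0 -> forall f, P f -> P (ldiff u f).
Proof.
move=> uJ f Pf; have du := isder_ldiff u.
have Ps g : g \in s -> P (ldiff u g).
  move=> /(nthP 0)[j lt <-]; apply/kapP.
  have := congr1 (fun M : 'rV[K]_(size s) => M 0 (Ordinal lt)) uJ.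
  rewrite !mxE => <-; rewrite rmorph_sum; apply: eq_bigr => i _.
  by rewrite !mxE rmorphM.
have [t Pt Htf] := sP.2 _ Pf.
apply: (primeMl Pt).
have -> : t * ldiff u f = ldiff u (t * f) - f * ldiff u t by rewrite du.2; ring.
apply: idealB; last exact: idealMr.
have [c /eqP] := proj1 (adjs_sumP _ _ _) Htf; rewrite subr_eq0 => /eqP ->.
rewrite (der_sum du); apply: ideal_sum => i _; rewrite du.2.
by apply: idealD; [apply: idealM; apply: Ps|apply: idealMr; apply: sP.1]; exact: mem_nth.
Qed.

(** The derivation [ldiff u] preserves [P] and maps [Q^2] into [Q], hence [x] into [Q]; it kills the
    coefficients [phi (v j)] and sends [X j] to [u j]. *)
Lemma row_property u (Q : spec S) (v : 'I_n -> A) : (forall f, P f -> P (ldiff u f)) ->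
  P `<=` Q -> let x := \sum_j phi (v j) * X j in Q x ->
  sat Q (isum P (ideal_mul Q Q)) x -> Q (\sum_j phi (v j) * u j).
Proof.
move=> uP PQ x Qx [t Qt Hx]; have du := isder_ldiff u.
have -> : \sum_j phi (v j) * u j = ldiff u x.
  rewrite /x (der_sum du); apply: eq_bigr => j _; rewrite du.2.
  have -> : ldiff u (phi (v j)) = 0 by rewrite /ldiff big1 // => i _; rewrite dphi mulr0.
  rewrite mulr0 addr0 /ldiff (bigD1 j) //= dX eqxx mulr1 big1 ?addr0 // => i /negPf ij.
  by rewrite dX ij mulr0.
apply: (primeMl Qt).
have -> : t * ldiff u x = ldiff u (t * x) - x * ldiff u t by rewrite du.2; ring.
apply: idealB; last exact: idealMr.
have W0 : Q 0 /\ Q (ldiff u 0) by rewrite (der0 du); split; exact: ideal0.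
have WD a b : Q a /\ Q (ldiff u a) -> Q b /\ Q (ldiff u b) ->
    Q (a + b) /\ Q (ldiff u (a + b)).
  by move=> [h1 h2] [h3 h4]; rewrite du.1; split; exact: idealD.
have WM a b : Q b /\ Q (ldiff u b) -> Q (a * b) /\ Q (ldiff u (a * b)).
  move=> [h1 h2]; rewrite du.2; split; first exact: idealM.
  by apply: idealD; [exact: idealM|exact: idealMr].
pose W := @Ideal S [set a | Q a /\ Q (ldiff u a)] W0 WD WM.
have : isum P (ideal_mul Q Q) `<=` W.
  apply: isum_min => [a Pa|]; first by split; apply: PQ => //; exact: uP.
  apply: imul_min => a b Qa Qb; split; first exact: idealM.
  by rewrite du.2; apply: idealD; apply: idealMr.
by move=> /(_ _ Hx)[].
Qed.

Lemma common_denominator (I : finType) (w : I -> K) :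
  exists b (u : I -> S), ~ P b /\ forall i, kap b * w i = kap (u i).
Proof.
have /choice[a Ha] i : exists ab : S * S, ~ P ab.2 /\ kap ab.2 * w i = kap ab.1.
  by have [a [b hab]] := kap_frac (w i); exists (a, b).
exists (\prod_i (a i).2), (fun i => (a i).1 * \prod_(j | j != i) (a j).2).
split; first by apply: prime_prod => i _; exact: (Ha i).1.
move=> i; rewrite (bigD1 i) //=; have [_ E] := Ha i; set c := \prod_(_ | _) _.
rewrite !rmorphM -E; ring.
Qed.

Definition has_rows t := exists (M : 'M[S]_(t, n)) (f : 'I_t -> 'I_n),
  ~ P (\det (colsub f M)) /\
  forall (Q : spec S) (v : 'I_n -> A), P `<=` Q -> let x := \sum_j phi (v j) * X j in Q x ->
  sat Q (isum P (ideal_mul Q Q)) x -> forall i, Q (\sum_j phi (v j) * M i j).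

Lemma free_minor t (M : 'M[S]_(t, n)) : row_free (map_mx kap M) ->
  exists f : 'I_t -> 'I_n, ~ P (\det (colsub f M)).
Proof.
move=> fM; have rf : row_full (map_mx kap M)^T by rewrite /row_full mxrank_tr.
exists (fullrankfun rf) => /kapP; rewrite -det_map_mx -det_tr => /eqP.
have := fullrowsub_unit rf; rewrite unitmxE unitfE.
have -> : (map_mx kap (colsub (fullrankfun rf) M))^T =
  rowsub (fullrankfun rf) (map_mx kap M)^T by apply/matrixP => i j; rewrite !mxE.
by move=> /negPf ->.
Qed.

(** The left kernel of the Jacobian matrix over the residue field, with denominators cleared. The
    last clause serves to show that a further row is independent of these. *)
Lemma kernel_rows : exists r (M : 'M[S]_(r, n)), [/\ (n - size s <= r)%N,
  row_free (map_mx kap M), (forall i f, P f -> P (ldiff (M i) f)) &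
  forall w : 'rV[S]_n, (map_mx kap w <= map_mx kap M)%MS ->
    forall f, P f -> P (ldiff (w 0) f)].
Proof.
pose B := row_base (kermx J).
have [b [u [Pb Hu]]] := common_denominator (fun ij : 'I__ * 'I_n => B ij.1 ij.2).
pose M : 'M[S]_(\rank (kermx J), n) := \matrix_(i, j) u (i, j).
have b0 : kap b != 0 by apply/eqP => /kapP.
have EM : map_mx kap M = kap b *: B.
  by apply/matrixP => i j; rewrite [LHS]mxE [M _ _]mxE -Hu [RHS]mxE.
have BJ (w : 'rV[K]_n) : (w <= B)%MS -> w *m J = 0.
  by rewrite eq_row_base => /sub_kermxP.
exists (\rank (kermx J)), M; split.
- by rewrite mxrank_ker; have := rank_leq_col J; lia.
- by rewrite EM /row_free mxrank_scale_nz //; exact: row_base_free.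
- move=> i f; apply: jacobian_ker; apply: BJ.
  have -> : \row_j kap (M i j) = kap b *: row i B.
    by apply/rowP => j; rewrite [LHS]mxE [M _ _]mxE -Hu [RHS]mxE [row _ _ _ _]mxE.
  by apply: scalemx_sub; exact: row_sub.
move=> w wM f; apply: jacobian_ker; apply: BJ.
have -> : \row_j kap (w 0 j) = map_mx kap w by apply/rowP => j; rewrite !mxE.
by move: wM; rewrite EM (eqmx_scale _ b0).
Qed.

Lemma rows_kernel : exists2 r, (n - size s <= r)%N & has_rows r.
Proof.
have [r [M [le fM MP _]]] := kernel_rows; exists r => //.
have [f Pf] := free_minor fM; exists M, f; split => // Q v PQ x Qx Hx i.
exact: (row_property (MP i) PQ).
Qed.

(** The form of the row [X] is [x] itself, which is in [Q] by assumption. If this row depended on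
    the kernel rows at [P], the Euler operator [ldiff X] would preserve [P]. *)
Lemma rows_euler : ~ (forall f, P f -> P (ldiff X f)) ->
  exists2 r, (n.+1 - size s <= r)%N & has_rows r.
Proof.
move=> NX; have [r [M [le fM MP Msub]]] := kernel_rows.
pose w : 'rV[S]_n := \row_j X j.
have NwM : ~~ (map_mx kap w <= map_mx kap M)%MS.
  apply/negP => /Msub h; apply: NX => f /h; congr (P _).
  by apply: eq_bigr => i _; rewrite mxE.
exists (r + 1)%N; first lia.
pose M1 := col_mx M w.
have fM1 : row_free (map_mx kap M1).
  rewrite map_col_mx /row_free eqn_leq rank_leq_row /=.
  apply: leq_trans (_ : (\rank (map_mx kap M)).+1 <= _)%N.
    by rewrite (eqP fM) addn1.
  rewrite -addsmxE; apply: rank_ltmx; rewrite ltmxE addsmxSl /=.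
  by apply: contra NwM; apply: submx_trans; exact: addsmxSr.
have [f Pf] := free_minor fM1; exists M1, f; split => // Q v PQ x Qx Hx i.
rewrite -[i]splitK; case: (split i) => j /=.
  under eq_bigr => l _ do rewrite col_mxEu.
  exact: (row_property (MP j) PQ).
by under eq_bigr => l _ do rewrite col_mxEd mxE.
Qed.
End Rows.

(** * The rows along surjections and over power series rings *)

Section Bertini.
Variables (A : comNzRingType) (n : nat).

Definition generically_regular (R : comPzRingType) (P : spec R) :=
  exists g, ~ P g /\ forall Q : spec R, P `<=` Q -> ~ Q g -> reg P Q.

(* The rows of [M] play the role of derivations of [R/P] along the [X j]; there
   are at least [dim R/P] of them and they are independent at [P]. *)
Definition bertini (R : comNzRingType) (phi : A -> R) (X : 'I_n -> R) (m P : spec R) :=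
  generically_regular P /\
  exists t, has_rows X phi P t /\ forall k, hge P m k -> (k <= t)%N.

Variables (R1 R2 : comNzRingType) (f : {rmorphism R1 -> R2}).
Hypothesis f_surj : forall b, exists a, f a = b.
Variables (phi : A -> R1) (X : 'I_n -> R1) (m : spec R2).

Let lf l : exists s a, isunit (f s) /\ f s * l = f a.
Proof.
by have [a Ea] := f_surj l; exists 1, a; rewrite rmorph1 mul1r; split => //; exists 1; rewrite mulr1.
Qed.

Lemma surj_isum (P Q : spec R2) a : isum P (ideal_mul Q Q) (f a) ->
  isum (pre f P) (ideal_mul (pre f Q) (pre f Q)) a.
Proof.
set N1 := isum (pre f P) _.
have kN b : f b = 0 -> N1 b by move=> fb; apply: isum_l; rewrite /= fb; exact: ideal0.
have N10 : forall b, f b = 0 -> N1 b by [].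
have ND x y : (forall b, f b = x -> N1 b) -> (forall b, f b = y -> N1 b) ->
    forall b, f b = x + y -> N1 b.
  move=> hx hy b fb; have [bx fx] := f_surj x; have [by_ fy] := f_surj y.
  apply: (idealBr (b := bx + by_)); last by apply: idealD; [exact: hx|exact: hy].
  by apply: kN; rewrite rmorphB rmorphD fb fx fy subrr.
have NM c y : (forall b, f b = y -> N1 b) -> forall b, f b = c * y -> N1 b.
  move=> hy b fb; have [bc fc] := f_surj c; have [by_ fy] := f_surj y.
  apply: (idealBr (b := bc * by_)); last by apply: idealM; exact: hy.
  by apply: kN; rewrite rmorphB rmorphM fb fc fy subrr.
pose N2 := @Ideal R2 [set y | forall b, f b = y -> N1 b] N10 ND NM.
have : isum P (ideal_mul Q Q) `<=` N2.
  apply: isum_min => [y Py b fb|]; first by apply: isum_l; rewrite /= fb.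
  apply: imul_min => x y Qx Qy b fb.
  have [bx fx] := f_surj x; have [by_ fy] := f_surj y.
  apply: (idealBr (b := bx * by_)).
    by apply: kN; rewrite rmorphB rmorphM fb fx fy subrr.
  by apply: isum_r; apply: imul_in; rewrite /= ?fx ?fy.
by move=> h /h; exact.
Qed.

Lemma bertini_down P : bertini phi X (pre f m) (pre f P) ->
  bertini (f \o phi) (f \o X) m P.
Proof.
move=> [[g [Pg Hg]] [t [[M [c [Pd HM]]] Ht]]]; split.
  exists (f g); split => // Q PQ Qg; apply/(pre_reg lf).
  by apply: Hg => // a; exact: PQ.
exists t; split; last by move=> k /(pre_hge lf); exact: Ht.
exists (map_mx f M), c; split.
  by move: Pd; rewrite /= -det_map_mx; congr (~ P (\det _)); apply/matrixP => i j; rewrite !mxE.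
move=> Q v PQ x Qx Hx i.
have E (u : 'I_n -> R1) : \sum_j (f \o phi) (v j) * f (u j) = f (\sum_j phi (v j) * u j).
  by rewrite rmorph_sum; apply: eq_bigr => j _; rewrite rmorphM.
have -> : \sum_j (f \o phi) (v j) * (map_mx f M) i j = f (\sum_j phi (v j) * M i j).
  by rewrite -E; apply: eq_bigr => j _; rewrite mxE.
rewrite /x E in Qx Hx; apply: (HM (pre f Q)) => //; first by move=> a; exact: PQ.
by have [s Qs Hs] := proj2 (pre_sat lf _ _ _) Hx; exists s => //; exact: surj_isum.
Qed.

(** Needed for primes containing [p]: the property is proved over [k] and pulled back along the
    reduction of coefficients, while [bertini_down] descends from power series to [R]. *)
Lemma bertini_up P : bertini (f \o phi) (f \o X) m P -> bertini phi X (pre f m) (pre f P).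
Proof.
have over (Q1 : spec R1) : pre f P `<=` Q1 -> exists2 Q, Q1 = pre f Q & P `<=` Q.
  move=> PQ; have kQ a : f a = 0 -> Q1 a by move=> fa; apply: PQ; rewrite /= fa; exact: ideal0.
  have uQ s : isunit (f s) -> ~ Q1 s.
    move=> [u us] Qs; have [w fw] := f_surj u; apply: (spec_proper (s := Q1)).
    apply: (idealBr (b := w * s)); last exact: idealM.
    by apply: kQ; rewrite rmorphB rmorphM fw us rmorph1 subrr.
  exists (img lf kQ uQ); first by rewrite pre_img.
  move=> b; have [a <-] := f_surj b => Pa.
  by have : pre f (img lf kQ uQ) a by rewrite pre_img; exact: PQ.
move=> [[g [Pg Hg]] [t [[M [c [Pd HM]]] Ht]]]; split.
  have [g1 Eg] := f_surj g; exists g1; split; first by rewrite /= Eg.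
  move=> Q1 /over[Q -> PQ] Qg; apply/(pre_reg lf); apply: Hg => //.
  by rewrite -Eg.
exists t; split; last by move=> k /(pre_hge lf); exact: Ht.
have /choice[N HN] (ij : 'I_t * 'I_n) : exists a, f a = M ij.1 ij.2 by exact: f_surj.
exists (\matrix_(i, j) N (i, j)), c; split.
  move: Pd; rewrite /= -det_map_mx; congr (~ P (\det _)).
  by apply/matrixP => i j; rewrite !mxE HN.
move=> Q1 v /over[Q -> PQ] x Qx Hx i.
have E (u : 'I_n -> R1) : \sum_j (f \o phi) (v j) * f (u j) = f (\sum_j phi (v j) * u j).
  by rewrite rmorph_sum; apply: eq_bigr => j _; rewrite rmorphM.
have := HM Q v PQ; rewrite /= E => /(_ Qx) h.
rewrite -E (eq_bigr (fun j => (f \o phi) (v j) * M i j)); last by move=> j _; rewrite mxE HN.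
apply: h; have [s Qs Hs] := Hx; exists (f s) => //; rewrite -rmorphM.
have : isum (pre f P) (ideal_mul (pre f Q) (pre f Q)) `<=` preim f (isum P (ideal_mul Q Q)).
  apply: isum_min => [a Pa|]; first by apply: (@isum_l _ P _ (f a)).
  apply: imul_min => a b Qa Qb; rewrite -[preim _ _ _]/(isum P (ideal_mul Q Q) (f (a * b))).
  by rewrite rmorphM; apply: isum_r; exact: imul_in.
exact.
Qed.
End Bertini.

Section BertiniPSn.
Variables (C : comNzRingType) (k : fieldType) (res : {rmorphism C -> k}).
Variable F : nat -> set C.
Hypothesis cr : coefring res F.
Variable pi : C.
Hypothesis res_pi : res pi = 0.
Hypothesis pi_gen : forall a, res a = 0 -> exists b, a = pi * b.
Variable n : nat.
Let S := PSn C n.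
Let nS : noetherian S := PSn_noeth cr (n := n).

Definition mxs : spec S := pre (resn res n) (fzero k).

Lemma mxs_gen (K : ideal S) u : (forall i, (i < n)%N -> K (varn C n i)) ->
  K (cstn C n pi) -> resn res n u = 0 -> K u.
Proof.
move: K u; rewrite /S; elim: (n) => [|l IH] K u KX Kpi ru.
  by have [b ->] := pi_gen ru; exact: idealMr.
rewrite (ps_split 1 u) psp_trunc big_ord1 expr0 mulr1 expr1.
apply: idealD.
  apply: (IH (preim (@psC (PSn C l)) K)) => // i lt.
  by have := KX i (ltnW lt); rewrite /= ltn_eqF.
by apply: idealMr; have := KX l (ltnSn l); rewrite /= eqxx.
Qed.

Lemma above_mxs (P : spec S) : P `<=` mxs.
Proof.
move=> u Pu; apply: contrapT => Nu; have [|v vu] := PSn_unit cr (u := u).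
  by move=> /(resnP cr).
by apply: (spec_proper (s := P)); rewrite -vu; exact: idealM.
Qed.

Let vars := [seq varn C n i | i <- iota 0 n].

Lemma mxs_minover s : (forall x, x \in vars -> adjs (izero S) s x) ->
  adjs (izero S) s (cstn C n pi) -> (forall x, x \in s -> mxs x) ->
  minover (adjs (izero S) s) mxs.
Proof.
move=> hv hp hs; split; first by apply: adjs_min => //; exact: izero_sub.
move=> Q sQ _ u ru; apply: sQ; apply: mxs_gen => // i lt; apply: hv.
by apply: map_f; rewrite mem_iota.
Qed.

(** Krull's height theorem for the maximal ideal, which is generated by the variables and [pi]. It
    bounds the dimension of [S/P] in terms of the height of [P]. *)
Lemma hge_mxs (P : spec S) h j : hge (izero S) P h -> hge P mxs j ->
  (h + j <= n.+1)%N /\ (pi = 0 -> (h + j <= n)%N).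
Proof.
move=> hP hm; have hh := hge_cat hP hm.
have vm x : x \in vars -> mxs x by move=> /mapP[i _ ->]; exact: resn_var.
split=> [|pi0].
  have mo : minover (adjs (izero S) (cstn C n pi :: vars)) mxs.
    apply: mxs_minover.
    - by move=> x xv; apply: adjs_in; rewrite inE xv orbT.
    - by apply: adjs_in; rewrite inE eqxx.
    - move=> x; rewrite inE => /orP[/eqP->|]; last exact: vm.
      by rewrite /= resn_cst.
  by have := height_le nS mo hh; rewrite /= size_map size_iota.
have mo : minover (adjs (izero S) vars) mxs.
  apply: mxs_minover => //; first by move=> x xv; exact: adjs_in.
  by rewrite pi0 rmorph0; exact: ideal0.
by have := height_le nS mo hh; rewrite size_map size_iota.
Qed.

Hypothesis der : forall l (q : spec {poly PSn C l}) H, good (pre (@polyC _) q) ->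
  minpol q H -> exists2 d, deriv_mod (coefI q) d & ~ q (d H).

Let phi := cstn C n.
Let X (i : 'I_n) : S := varn C n i.

Let dd (i : 'I_n) : isder (@partial C n i). Proof. exact: isder_partial. Qed.
Let dX (i j : 'I_n) : partial i (X j) = (i == j)%:R. Proof. exact: partial_var. Qed.
Let dphi (i : 'I_n) a : partial i (phi a) = 0. Proof. exact: partial_cst. Qed.

Lemma gen_height (P : spec S) : good P -> exists s, gens_at (izero S) P s /\ hge (izero S) P (size s).
Proof.
move=> gP; have [_ [s1 [s2 [g1 r2 E]]]] := PSn_regular cr res_pi pi_gen gP.
by exists s1; split => //; rewrite E; apply: regs_hge => //; exact: izero_sub.
Qed.

Lemma bertini_residual (P : spec S) : pi = 0 -> (forall Q : spec S, good Q) -> bertini phi X mxs P.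
Proof.
move=> pi0 gd; have gP := gd P; split.
  have [g Pg Hg] := PSn_generic_regular cr res_pi pi_gen der gP.
  by exists g; split => // Q PQ Qg; apply: Hg.
have [s [gs hs]] := gen_height gP.
have [r le rw] := rows_kernel dd dX dphi gs (kmap_ker P) (@kmap_frac _ P).
exists r; split => // j hj; have [_ /(_ pi0)/(leq_sub2r (size s))] := hge_mxs hs hj.
by rewrite addKn => h; exact: leq_trans h le.
Qed.

(** Without a derivative along [pi], the Jacobian kernel may be one row short of [n.+1] minus the
    height of [P]; the Euler row makes up for it. The constant term of [f] is nonzero, hence outside
    the good prime [P], which excludes stability under the Euler operator. *)
Lemma bertini_good (P : spec S) f : (forall Q : spec S, ~ Q (phi pi) -> good Q) ->
  ~ P (phi pi) -> (forall N, N.+1%:R <> 0 :> C) ->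
  P f -> resn idfun n f <> 0 -> bertini phi X mxs P.
Proof.
move=> gd Ppi ch Pf f0; have gP := gd P Ppi; split.
  have [g Pg Hg] := PSn_generic_regular cr res_pi pi_gen der gP.
  (* The factor [phi pi] keeps the neighbouring primes good. *)
  exists (g * phi pi); split; first exact: primeNM.
  move=> Q PQ Qg; apply: Hg => //; first by apply: gd => h; apply: Qg; exact: idealM.
  by move=> h; apply: Qg; exact: idealMr.
have [s [gs hs]] := gen_height gP.
have [|r le rw] := rows_euler dd dX dphi gs (kmap_ker P) (@kmap_frac _ P).
  move=> PE; apply: (gP _ f0).
  apply: (euler_stable nS (above_mxs (P := P)) _ _ Pf) => // [i _|N].
    exact: resn_var.
  by rewrite -(rmorph_nat phi); apply: gP; exact: ch.
exists r; split => // j hj; have [/(leq_sub2r (size s)) + _] := hge_mxs hs hj.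
by rewrite addKn => h; exact: leq_trans h le.
Qed.
End BertiniPSn.

(** * Presentation of complete local rings *)

Lemma princP (R : comPzRingType) (a x : R) : princ a x -> exists b, x = a * b.
Proof.
by rewrite princ_adj => -[c _ /eqP]; rewrite subr_eq0 => /eqP ->; exists c; rewrite mulrC.
Qed.

Lemma ideal_exp1 (R : comPzRingType) (I : ideal R) a : ideal_exp I 1 a <-> I a.
Proof.
split; last by move=> Ia; rewrite -[a]mulr1; apply: imul_in => //; exact: sub_gen.
by apply: imul_min => b c Ib _; exact: idealMr.
Qed.

Lemma adic_compfil (R : comNzRingType) (I : ideal R) : adic_complete I ->
  compfil (fun n => ideal_exp I n : set R).
Proof.
move=> [sep comp]; split => //.
- by move=> a; rewrite -[a]mulr1; apply: idealM; exact: sub_gen.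
- by move=> n; exact: ideal0.
- by move=> n a b; exact: idealD.
- by move=> n a b; exact: idealM.
- by move=> n; apply: imul_min => a b _; exact: idealM.
move=> n j a b + hb; elim: n a => [|n IH] a; first by move=> _; exact: idealM.
move=> ha; rewrite mulrC; have : ideal_mul I (ideal_exp I n) `<=`
    colon (ideal_exp I (n.+1 + j)) b; last exact.
apply: imul_min => c e Ic he; rewrite /= mulrCA; apply: imul_in => //.
by rewrite mulrC; exact: IH.
Qed.

Lemma local_unit (R : comPzRingType) (m : ideal R) a : noetherian R -> local_ring m ->
  ~ m a -> isunit a.
Proof.
move=> nR [_ um] Na; apply: contrapT => Nu.
have [|J [aJ J1 maxJ]] := noeth_max nR (Pr := fun J => ~ J 1) (I := princ a) _.
  by move=> /princP[b Eb]; apply: Nu; exists b; rewrite mulrC.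
have EJ : J = m :> set R.
  apply: um; split => // K JK K1; apply/seteqP; split => //; exact: maxJ.
by apply: Na; rewrite -EJ; apply: aJ; exact: sub_gen.
Qed.

Section Mapn.
Variables (C k : comNzRingType) (res : {rmorphism C -> k}).

Lemma mapn_surj n : (forall c, exists a, res a = c) -> forall u, exists v, mapn res n v = u.
Proof.
move=> rs; elim: n => [//|n IH] u.
have /choice[v Hv] i : exists v, mapn res n v = pc u i by exact: IH.
by exists (PS v); apply: psP => i; exact: Hv.
Qed.

Lemma mapn_cst n a : mapn res n (cstn C n a) = cstn k n (res a).
Proof. by elim: n => [//|n IH]; rewrite /= map_psC IH. Qed.

Lemma mapn_var n i : mapn res n (varn C n i) = varn k n i.
Proof.
elim: n => [|n IH]; first exact: rmorph0.
by rewrite /=; case: (i == n); rewrite ?map_psX ?map_psC ?IH.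
Qed.

Lemma resn_mapn n u : resn idfun n (mapn res n u) = resn res n u.
Proof. by elim: n u => [//|n IH] u; exact: IH. Qed.
End Mapn.

Section EvaluationN.
Variables (A R : comNzRingType) (G : nat -> set R) (cG : compfil G).
Variables (psi : {rmorphism A -> R}) (xs : nat -> R).
Hypothesis Gx : forall i, G 1%N (xs i).

Fixpoint evn l : {rmorphism PSn A l -> R} :=
  if l is l'.+1 then ps_ev cG (evn l') (Gx l') else psi.

Lemma evn_cst l c : evn l (cstn A l c) = psi c.
Proof. by elim: l => [//|l IH]; rewrite -IH; exact: ps_evC. Qed.

Lemma evn_var l i : (i < l)%N -> evn l (varn A l i) = xs i.
Proof.
elim: l => [//|l IH] lt /=; have [->|Ni] := eqVneq i l; first exact: ps_evX.
by rewrite -IH; [exact: ps_evC|rewrite ltn_neqAle Ni -ltnS].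
Qed.

Variable F : nat -> set A.
Hypothesis FG : forall n a, F n a -> G n (psi a).

Lemma evn_fil l N u : Fn F (n := l) N u -> G N (evn l u).
Proof.
elim: l N u => [|l IH] N u; first exact: FG.
move=> hu; have /(filN cG) h := ps_evP cG (evn l) (Gx l) u N.
have -> : evn l.+1 u = - (pev (evn l) (xs l) N u - ps_ev cG (evn l) (Gx l) u) +
    pev (evn l) (xs l) N u by rewrite opprB subrK.
apply: (filD cG) => //; rewrite pevE; apply: (fil_sum cG) => i _.
have : G ((N - i) + i)%N (evn l (pc u i) * xs l ^+ i); last by rewrite subnK // ltnW.
apply: (filM cG); last exact: (filX cG).
by apply: IH; exact: hu.
Qed.
End EvaluationN.

Lemma bertini_precomp (A A' : comNzRingType) n (R : comNzRingType) (r : A' -> A) (phi : A -> R)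
    (X : 'I_n -> R) m P : bertini phi X m P -> bertini (phi \o r) X m P.
Proof.
move=> [h [t [[M [c [Pd HM]]] Ht]]]; split => //; exists t; split => //.
by exists M, c; split => // Q v; exact: (HM Q (r \o v)).
Qed.

Section CompleteLocal.
Variables (R : comNzRingType) (m : ideal R) (k : fieldType) (resR : {rmorphism R -> k}) (p : nat).
Variables (A : idomainType) (piA : A) (resA : {rmorphism A -> k}) (phi : {rmorphism A -> R}).
Variables (d : nat) (x : 'I_d.+1 -> R).
Hypothesis mR : residue_map m resR.
Hypothesis cR : adic_complete m.
Hypothesis ck : p \in [pchar k].
Hypothesis ik : infinite_set [set: k].
Hypothesis cA : coefficient_ring resR p piA resA phi.
Hypothesis gx : gen (range x) = m :> set R.

Definition mxR : spec R := pre resR (fzero k).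
Let dvrA : is_dvr piA. Proof. by case: cA => -[]. Qed.
Let compA : adic_complete (princ piA). Proof. by case: cA => -[]. Qed.
Let resAP : residue_map (princ piA) resA. Proof. by case: cA. Qed.
Let F n : set A := ideal_exp (princ piA) n.

Lemma dvr_noetherian : noetherian A.
Proof.
move=> I; have [pid _ _] := dvrA; have [a ->] := pid I.
by exists [:: a]; rewrite gen_adjs princ_adj.
Qed.

Lemma dvr_coefring : coefring resA F.
Proof.
have [pid lA pi0] := dvrA; split => //.
- exact: adic_compfil.
- by move=> a; apply: (iff_trans (resAP.2 a)); apply: iff_sym; exact: ideal_exp1.
- move=> a ra; apply: (local_unit dvr_noetherian lA) => h; apply: ra; exact/(resAP.2 a).
- exact: resAP.1.
- exact: dvr_noetherian.
- by move=> a b /eqP; rewrite mulf_eq0 => /orP[] /eqP; [left|right].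
Qed.
Let cr := dvr_coefring.

Let res_pi : resA piA = 0.
Proof. by apply/(resAP.2 piA); exact: sub_gen. Qed.

Let pi_gen a : resA a = 0 -> exists b, a = piA * b.
Proof. by move=> /(resAP.2 a) /princP. Qed.

Lemma dvr_char n : (0 < n)%N -> n%:R <> 0 :> A.
Proof.
have [_ _ pi0] := dvrA; have [_ _ pip _ _] := cA.
have p0 : p%:R != 0 :> A.
  apply: contraNneq pi0 => p0; have : princ piA piA by exact: sub_gen.
  by rewrite pip => /princP[b ->]; rewrite p0 mul0r.
have p1 := prime_gt1 (pcharf_prime ck).
elim/ltn_ind: n => n IH n0; case dn: (p %| n)%N; last first.
  move=> n0A; have : n%:R = 0 :> k by rewrite -(rmorph_nat resA) n0A rmorph0.
  by move=> /eqP; rewrite -(dvdn_pcharf ck) dn.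
have /dvdnP[q Eq] := dn; rewrite Eq natrM => /eqP; rewrite mulf_eq0 (negPf p0) orbF => /eqP.
have q0 : (0 < q)%N by move: n0; rewrite Eq; case: (q).
by apply: IH => //; rewrite Eq ltn_Pmulr.
Qed.

Lemma dvr_good n (Q : spec (PSn A n)) : ~ Q (cstn A n piA) -> good Q.
Proof.
move=> Qpi c c0 Qc; apply: c0; apply: (fil_sep (cr_fil cr)) => j.
have [b [-> _]] : exists b, c = piA ^+ j * b /\ Q (cstn A n b).
  elim: j => [|j [b [Eb Qb]]]; first by exists c; rewrite mul1r.
  have [rb|rb] := eqVneq (resA b) 0; last first.
    have [|u ub] := cr_unit cr (a := b); first exact/eqP.
    case: (spec_proper (s := Q)); rewrite -(rmorph1 (cstn A n)) -ub rmorphM.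
    exact: idealM.
  have [e Ee] := pi_gen rb; exists e; split; first by rewrite exprSr -mulrA -Ee.
  by apply: (primeMl Qpi); rewrite -rmorphM -Ee.
rewrite mulrC; apply: (filI (cr_fil cr)); apply: (filX (cr_fil cr)).
by apply/(cr_res cr).
Qed.

Let cG := adic_compfil cR.
Let xs i := if insub i is Some j then x j else 0.
Let Gx i : ideal_exp m 1 (xs i).
Proof.
apply/ideal_exp1; rewrite /xs; case: insubP => [j _ _|_]; last exact: ideal0.
by rewrite -gx; apply: sub_gen; exists j.
Qed.
Let ev : {rmorphism PSn A d.+1 -> R} := evn cG phi Gx d.+1.

Let ev_cst c : ev (cstn A d.+1 c) = phi c. Proof. exact: evn_cst. Qed.
Let ev_var (i : 'I_d.+1) : ev (varn A d.+1 i) = x i.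
Proof. by rewrite /ev evn_var // /xs insubT //= => h; congr x; apply: val_inj. Qed.

Let phi_res a : resR (phi a) = resA a. Proof. by case: cA. Qed.

Let phi_fil n a : F n a -> ideal_exp m n (phi a).
Proof.
elim: n a => [|n IH] a; first by move=> _; exact: (fil0 cG).
have : ideal_mul (princ piA) (ideal_exp (princ piA) n) `<=` preim phi (ideal_exp m n.+1).
  apply: imul_min => b c hb hc; rewrite /= rmorphM; apply: imul_in; last exact: IH.
  by apply/(mR.2 _); rewrite phi_res; apply/(resAP.2 b).
exact.
Qed.

Let ev_fil N u : Fn F (n := d.+1) N u -> ideal_exp m N (ev u).
Proof. exact: (@evn_fil _ _ _ cG phi _ Gx F phi_fil). Qed.

Let cF := Fn_compfil cr d.+1.

(** Residues are hit by constants and generators of [m] by variables, so [ev] is surjective on each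
    graded piece; [ev_surj] passes to the limit. *)
Lemma ev_approx N a : ideal_exp m N a ->
  exists2 u, Fn F (n := d.+1) N u & ideal_exp m N.+1 (a - ev u).
Proof.
have red b : exists u, m (b - ev u).
  have [c Ec] := resAP.1 (resR b); exists (cstn A d.+1 c).
  by apply/(mR.2 _); rewrite rmorphB ev_cst phi_res Ec subrr.
have W0 N' : exists2 u, Fn F (n := d.+1) N' u & ideal_exp m N'.+1 (0 - ev u).
  by exists 0; [exact: (filZ cF)|rewrite rmorph0 subrr; exact: ideal0].
have WD N' b c : (exists2 u, Fn F (n := d.+1) N' u & ideal_exp m N'.+1 (b - ev u)) ->
   (exists2 u, Fn F (n := d.+1) N' u & ideal_exp m N'.+1 (c - ev u)) ->
   exists2 u, Fn F (n := d.+1) N' u & ideal_exp m N'.+1 (b + c - ev u).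
  move=> [u hu hb] [v hv hc]; exists (u + v); first exact: (filD cF).
  by rewrite rmorphD; apply: (icast (idealD hb hc)); ring.
have WM N' b c : (exists2 u, Fn F (n := d.+1) N' u & ideal_exp m N'.+1 (c - ev u)) ->
   exists2 u, Fn F (n := d.+1) N' u & ideal_exp m N'.+1 (b * c - ev u).
  move=> [v hv hc]; have [u hu] := red b; exists (u * v); first exact: (filI cF).
  rewrite rmorphM; have -> : b * c - ev u * ev v = b * (c - ev v) + (b - ev u) * ev v by ring.
  by apply: idealD; [exact: idealM|apply: imul_in => //; exact: ev_fil].
(* The approximable elements form an ideal, so it is enough to treat generators. *)
pose W N' := Ideal (W0 N') (WD N') (WM N').
elim: N a => [|N IH] a.
  move=> _; have [u hu] := red a; exists u; first exact: (fil0 cF).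
  exact/ideal_exp1.
have : ideal_mul m (ideal_exp m N) `<=` W N.+1; last exact.
apply: imul_min => b c mb /IH[v hv hc].
have [u hu hb] : W 1%N b.
  have : m `<=` W 1%N; last exact.
  rewrite -gx; apply: gen_min => _ [i _ <-]; exists (varn A d.+1 i).
    by apply/(resnP cr); exact: resn_var.
  by rewrite ev_var subrr; exact: ideal0.
exists (u * v); first exact: (filM cF) hu hv.
rewrite rmorphM; have -> : b * c - ev u * ev v = b * (c - ev v) + (b - ev u) * ev v by ring.
apply: idealD; first by apply: imul_in => //.
by have := filM cG hb (ev_fil hv); rewrite -[(2 + N)%N]/(N.+2).
Qed.

Lemma ev_surj a : exists u, ev u = a.
Proof.
have /choice[st Hst] (vN : {vN : PSn A d.+1 * nat | ideal_exp m vN.2 (a - ev vN.1)}) :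
    exists u, Fn F (n := d.+1) (sval vN).2 u /\
      ideal_exp m (sval vN).2.+1 (a - ev ((sval vN).1 + u)).
  case: vN => -[v N] /= h; have [u hu hv] := ev_approx h; exists u; split => //.
  by rewrite rmorphD opprD addrA.
have h0 : ideal_exp m (0 : PSn A d.+1, 0%N).2 (a - ev (0 : PSn A d.+1, 0%N).1) by exact: (fil0 cG).
pose nxt (vN : {vN : PSn A d.+1 * nat | ideal_exp m vN.2 (a - ev vN.1)}) :
    {vN : PSn A d.+1 * nat | ideal_exp m vN.2 (a - ev vN.1)} :=
  exist _ ((sval vN).1 + st vN, (sval vN).2.+1) (proj2 (Hst vN)).
pose sq N := iter N nxt (exist _ (0, 0%N) h0).
have sq2 N : (sval (sq N)).2 = N by elim: N => //= N ->.
pose v N := (sval (sq N)).1.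
have vS N : v N.+1 = v N + st (sq N) by [].
have [N|l Hl] := fil_comp cF (u := v).
  by rewrite vS addrC addKr; have [+ _] := Hst (sq N); rewrite sq2.
exists l; apply: (fil_eq cG) => N.
have h1 := svalP (sq N); rewrite sq2 -/(v N) in h1.
have h2 := ev_fil (Hl N); rewrite rmorphB in h2.
have -> : ev l - a = - ((a - ev (v N)) + (ev (v N) - ev l)) by ring.
by apply: idealN; exact: idealD.
Qed.

Lemma pre_mxR : pre ev mxR = mxs resA d.+1.
Proof.
have cst u : resR (ev u) = resn resA d.+1 u.
  have [a Ea] := resAP.1 (resn resA d.+1 u).
  have /(resnP cr)/ev_fil/ideal_exp1/(mR.2 _) : resn resA d.+1 (u - cstn A d.+1 a) = 0.
    by rewrite rmorphB resn_cst Ea subrr.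
  by rewrite !rmorphB ev_cst phi_res Ea => /eqP; rewrite subr_eq0 => /eqP.
by apply: spec_eqP => u /=; rewrite cst.
Qed.

Theorem complete_bertini (P0 : spec R) : bertini phi x mxR P0.
Proof.
have -> : (phi : A -> R) = ev \o cstn A d.+1 by apply: funext => a /=; rewrite ev_cst.
have -> : x = ev \o (fun i : 'I_d.+1 => varn A d.+1 i) by apply: funext => i /=; rewrite ev_var.
apply: (bertini_down ev_surj); rewrite pre_mxR.
set P := pre ev P0.
have [Ppi|Ppi] := pselect (P (cstn A d.+1 piA)); last first.
  (* [phi piA] is in [m], so it is also the value of a series without constant term; the difference
     of the two lifts is in [P] and has constant term [piA]. *)
  have [f Pf f0] : exists2 f, P f & resn idfun d.+1 f = piA.
    have : m (phi piA) by apply/(mR.2 _); rewrite phi_res.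
    rewrite -gx => h.
    have V0 : exists f, ev f = 0 /\ resn idfun d.+1 f = 0 by exists 0; rewrite !rmorph0.
    have VD a c : (exists f, ev f = a /\ resn idfun d.+1 f = 0) ->
        (exists f, ev f = c /\ resn idfun d.+1 f = 0) ->
        exists f, ev f = a + c /\ resn idfun d.+1 f = 0.
      by move=> [f [<- f0]] [g [<- g0]]; exists (f + g); rewrite !rmorphD f0 g0 addr0.
    have VM a c : (exists f, ev f = c /\ resn idfun d.+1 f = 0) ->
        exists f, ev f = a * c /\ resn idfun d.+1 f = 0.
      move=> [f [<- f0]]; have [g <-] := ev_surj a.
      by exists (g * f); rewrite !rmorphM f0 mulr0.
    have [|f [Ef f0]] := h (Ideal V0 VD VM).
      move=> _ [i _ <-]; exists (varn A d.+1 i); split; first exact: ev_var.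
      exact: resn_var.
    exists (cstn A d.+1 piA - f).
      by rewrite /P /= rmorphB ev_cst Ef subrr; exact: ideal0.
    by rewrite rmorphB resn_cst f0 subr0.
  have [_ _ /eqP pi0] := dvrA.
  apply: (bertini_good cr res_pi pi_gen _ (f := f)) => //.
  - move=> l q H gq mH; have ch n : (0 < n)%N -> ~ q (n%:R)%:P.
      by move=> n0 qn; apply: (gq _ (dvr_char n0)); rewrite /= rmorph_nat.
    by have [h1 h2] := deriv_char0 ch mH; exists (@deriv (PSn A l)).
  - exact: dvr_good.
  - by move=> N; exact: dvr_char.
  - by rewrite f0.
(* Now [P] contains the kernel of the reduction to power series over [k], so it is the preimage of a
   prime there. *)
have krk := field_coefring ik.
pose g := mapn resA d.+1.
have g_surj : forall u, exists v, g v = u by apply: mapn_surj; exact: resAP.1.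
have glf l : exists s a, isunit (g s) /\ g s * l = g a.
  by have [a Ea] := g_surj l; exists 1, a; rewrite rmorph1 mul1r; split => //; exists 1; rewrite mulr1.
have kP a : g a = 0 -> P a.
  by move=> /(mapn_eq0 pi_gen)[v ->]; exact: idealMr.
have uP s : isunit (g s) -> ~ P s.
  move=> [u us] Ps; have [w gw] := g_surj u; apply: (spec_proper (s := P)).
  apply: (idealBr (b := w * s)); last exact: idealM.
  by apply: kP; rewrite rmorphB rmorphM gw us rmorph1 subrr.
have <- : pre g (img glf kP uP) = P by exact: pre_img.
have <- : pre g (mxs (@idfun k) d.+1) = mxs resA d.+1.
  by apply: spec_eqP => u /=; rewrite resn_mapn.
apply: (bertini_up g_surj).
have -> : g \o cstn A d.+1 = cstn k d.+1 \o resA by apply: funext => a; exact: mapn_cst.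
have -> : g \o (fun i : 'I_d.+1 => varn A d.+1 i) = fun i : 'I_d.+1 => varn k d.+1 i.
  by apply: funext => i; exact: mapn_var.
apply: bertini_precomp; apply: (bertini_residual krk _ _ (pi := 0)) => //.
- by move=> a /= ->; exists 0; rewrite mul0r.
- by move=> l q H _; exact: (deriv_pchar ck ik).
- by move=> Q; exact: good_field.
Qed.
End CompleteLocal.

(** * Generic rows *)

Lemma predn_subK a b : (0 < b)%N -> (b <= a)%N -> (a.-1 - (a - b) = b.-1)%N.
Proof. by lia. Qed.

Section HilbertBasis.
Variable E : comNzRingType.
Hypothesis nE : noetherian E.

(** A list is greedy if no member is longer than an element of [I] that the list fails to generate.
    For a greedy list with maximal ideal of leading coefficients, a shortest missing [g] has its
    leading coefficient in that ideal, and members shifted up to the degree of [g] cancel its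
    leading term. *)
Theorem hilbert_basis : noetherian {poly E}.
Proof.
move=> I; suff [fs Ifs] : exists fs, I = adjs (izero _) fs.
  by exists fs; rewrite gen_adjs -Ifs.
pose greedy fs := (forall f, f \in fs -> I f) /\
  forall g, I g -> ~ adjs (izero _) fs g -> forall f, f \in fs -> (size f <= size g)%N.
pose Pr (K : ideal E) := exists fs : seq {poly E}, greedy fs /\ K = adjs (izero E) (map lead_coef fs).
have [|K [_ [fs [[Ifs gfs] EK]] maxK]] := noeth_max nE (Pr := Pr) (I := izero E) _.
  by exists [::]; split.
exists fs; apply: ideal_eqP; last by apply: adjs_min => //; exact: izero_sub.
apply: contrapT => N.
have ex : exists n, `[< exists2 g, I g & ~ adjs (izero _) fs g /\ size g = n >].
  have [g Ig Ng] : exists2 g, I g & ~ adjs (izero _) fs g.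
    by apply: contrapT => h; apply: N => g Ig; apply: contrapT => Ng; apply: h; exists g.
  by exists (size g); apply/asboolP; exists g.
case: (ex_minnP ex) => n /asboolP[g Ig [Ng sg]] mn.
have ming g' : I g' -> ~ adjs (izero _) fs g' -> (size g <= size g')%N.
  by move=> Ig' Ng'; rewrite sg; apply: mn; apply/asboolP; exists g'.
have : K (lead_coef g).
  apply: (maxK (adj K (lead_coef g))); [|exact: sub_adj|exact: adj_in].
  exists (rcons fs g); split; last by rewrite map_rcons adjs_rcons EK.
  split=> [f|g' Ig' Ng' f]; rewrite mem_rcons inE => /orP[/eqP->|] //; first exact: Ifs.
    by apply: ming => // h; apply: Ng'; rewrite adjs_rcons; exact: sub_adj.
  by apply: gfs => // h; apply: Ng'; rewrite adjs_rcons; exact: sub_adj.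
rewrite EK => /adjs_sumP[c /eqP]; rewrite subr_eq0 size_map => /eqP Ec.
have g0 : g != 0 by apply/eqP => h; apply: Ng; rewrite h; exact: ideal0.
pose u := \sum_(i < size fs) ((c i)%:P * 'X^(size g - size (nth 0 fs i))) * nth 0 fs i.
have Iu : adjs (izero _) fs u.
  by apply: ideal_sum => i _; apply: idealM; apply: adjs_in; exact: mem_nth.
have su : (size u <= size g)%N.
  apply: leq_trans (size_sum _ _ _) _; apply/bigmax_leqP => i _.
  have le := gfs g Ig Ng _ (mem_nth 0 (ltn_ord i)).
  rewrite -mulrA mul_polyC; apply: leq_trans (size_scale_leq _ _) _.
  have [->|f0] := eqVneq (nth 0 fs i) 0; first by rewrite mulr0 size_poly0.
  by rewrite mulrC size_mulXn // subnK.
have lu : u`_(size g).-1 = lead_coef g.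
  rewrite coef_sum Ec; apply: eq_bigr => i _; rewrite -mulrA coefCM coefXnM.
  rewrite (nth_map 0) //; have le := gfs g Ig Ng _ (mem_nth 0 (ltn_ord i)).
  have [f0|f0] := eqVneq (nth 0 fs i) 0.
    by rewrite f0 coef0 lead_coef0 if_same.
  have sf : (0 < size (nth 0%R fs i))%N by rewrite size_poly_gt0.
  have -> : ((size g).-1 < size g - size (nth 0%R fs i))%N = false by lia.
  by rewrite lead_coefE; congr (_ * _`_ _); exact: predn_subK.
apply: Ng; apply: (idealBr (b := u)) => //; apply: contrapT => Ngu.
have /ming /(_ Ngu) : I (g - u).
  by apply: idealB => //; apply: adjs_min Iu => //; exact: izero_sub.
rewrite leqNgt => /negP; apply.
have sg0 : (0 < size g)%N by rewrite size_poly_gt0.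
rewrite -(prednK sg0) ltnS; apply/leq_sizeP => j; rewrite leq_eqVlt => /orP[/eqP <-|lt].
  by rewrite coefB lu lead_coefE subrr.
have le : (size g <= j)%N by rewrite -(prednK sg0).
by rewrite coefB !nth_default ?subrr //; exact: leq_trans su le.
Qed.
End HilbertBasis.

Section PolyExtension.
Variable E : comNzRingType.

Fact poly_field_zero_prime (K : fieldType) : ~ izero {poly K} 1 /\
  forall a b, izero {poly K} (a * b) -> izero _ a \/ izero _ b.
Proof.
split; first by apply/eqP; exact: oner_neq0.
by move=> a b /eqP; rewrite mulf_eq0 => /orP[] /eqP; [left|right].
Qed.

(** Defined as the kernel of the map to polynomials over the residue field, which makes primality
    immediate. *)
Definition pext (P : spec E) : spec {poly E} :=
  pre (map_poly (kmap P))
    (Spec (poly_field_zero_prime (kappa P)).1 (poly_field_zero_prime (kappa P)).2).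

Lemma pextP P (u : {poly E}) : pext P u <-> forall i, P u`_i.
Proof.
split=> [h i|h].
  by apply/kmap_ker; have := congr1 (fun r : {poly kappa P} => r`_i) h; rewrite coef_map coef0.
by apply/polyP => i; rewrite coef_map coef0; exact/kmap_ker.
Qed.

Lemma pext_polyC P a : pext P a%:P <-> P a.
Proof.
split=> [/pextP/(_ 0%N)|Pa]; first by rewrite coefC.
by apply/pextP => i; rewrite coefC; case: (i == 0%N) => //; exact: ideal0.
Qed.

Lemma pext_mono (P Q : spec E) : P `<=` Q -> pext P `<=` pext Q.
Proof. by move=> PQ u /pextP h; apply/pextP => i; exact: PQ. Qed.

Lemma pext_hge (P Q : spec E) h : hge P Q h -> hge (pext P) (pext Q) h.
Proof.
elim: h Q => [|h IH] Q; first exact: pext_mono.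
move=> [Q' [Q'Q NQ hQ]]; exists (pext Q'); split; [exact: pext_mono| |exact: IH].
by move=> h'; apply: NQ => a Qa; apply/pext_polyC; apply: h'; exact/pext_polyC.
Qed.

Lemma pext_pre (q : spec {poly E}) : pext (pre (@polyC E) q) `<=` q.
Proof. by move=> u /pextP h; exact: coefI_in. Qed.
End PolyExtension.

Fixpoint polyN (R : comNzRingType) n : comNzRingType :=
  if n is l.+1 then {poly polyN R l} else R.

Fixpoint cstp (R : comNzRingType) n : {rmorphism R -> polyN R n} :=
  if n is l.+1 then @polyC (polyN R l) \o cstp R l else idfun.

Fixpoint varp (R : comNzRingType) n (i : nat) : polyN R n :=
  if n is l.+1 then (if i == l then 'X : {poly polyN R l} else (varp R l i)%:P) else 0.

Fixpoint extN (R : comNzRingType) n (P : spec R) : spec (polyN R n) :=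
  if n is l.+1 then pext (extN l P) else P.

Section PolyN.
Variable R : comNzRingType.

Lemma polyN_noeth n : noetherian R -> noetherian (polyN R n).
Proof. by move=> nR; elim: n => [//|n IH]; exact: hilbert_basis. Qed.

Lemma extN_cst n (P : spec R) a : extN n P (cstp R n a) <-> P a.
Proof. by elim: n => [//|n IH] /=; apply: (iff_trans (pext_polyC _ _)). Qed.

Lemma extN_mono n (P Q : spec R) : P `<=` Q -> extN n P `<=` extN n Q.
Proof. by move=> PQ; elim: n => [//|n IH]; exact: pext_mono. Qed.

Lemma extN_min n (P : spec R) (q : ideal (polyN R n)) : (forall a, P a -> q (cstp R n a)) ->
  extN n P `<=` q.
Proof.
elim: n q => [//|n IH] q h u /pextP hu; apply: coefI_in => i.
exact: (IH (preim (@polyC (polyN R n)) q)).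
Qed.

Lemma cstp_polyC n a : cstp R n.+1 a = (cstp R n a)%:P. Proof. by []. Qed.
Lemma varp_polyC n i : (i < n)%N -> varp R n.+1 i = (varp R n i)%:P.
Proof. by move=> lt; rewrite /= ltn_eqF. Qed.
Lemma varp_X n : varp R n.+1 n = 'X. Proof. by rewrite /= eqxx. Qed.

Variables (P : spec R) (del : R) (r : nat) (a : nat -> nat -> R).

Definition pivot n i : polyN R n :=
  cstp R n del * varp R n (r + i) + \sum_(j < r) cstp R n (a i j) * varp R n j.

Lemma pivot_polyC n i : (r + i < n)%N -> pivot n.+1 i = (pivot n i)%:P.
Proof.
move=> lt; rewrite /pivot varp_polyC // cstp_polyC polyCD polyCM rmorph_sum.
congr (_ + _); apply: eq_bigr => j _.
have jn : (j < n)%N by have := ltn_ord j; lia.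
by rewrite varp_polyC // cstp_polyC -polyCM.
Qed.

Lemma pivot_X n i : (r + i = n)%N -> pivot n.+1 i =
  (cstp R n del)%:P * 'X + (\sum_(j < r) cstp R n (a i j) * varp R n j)%:P.
Proof.
move=> En; rewrite /pivot En varp_X cstp_polyC rmorph_sum; congr (_ + _); apply: eq_bigr => j _.
have jn : (j < n)%N by have := ltn_ord j; lia.
by rewrite varp_polyC // cstp_polyC -polyCM.
Qed.

(** One variable at a time: the contraction of [q] extends to a strictly smaller prime, because the
    newest pivot form has the coefficient [del], outside [q], at the last variable. *)
Lemma pivot_height n (q : spec (polyN R n)) : (r <= n)%N ->
  (forall b, P b -> q (cstp R n b)) -> ~ q (cstp R n del) ->
  (forall j, (r + j < n)%N -> q (pivot n j)) -> hge (extN n P) q (n - r).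
Proof.
elim: n q => [|n IH] q; first by move=> _ h _ _; exact: extN_min.
rewrite leq_eqVlt => /orP[/eqP->|rn] h Nd hq; first by rewrite subnn; exact: extN_min.
rewrite ltnS in rn; rewrite subSn //; exists (pext (pre (@polyC (polyN R n)) q)); split.
- exact: pext_pre.
- have /hq qz : (r + (n - r) < n.+1)%N by rewrite subnKC.
  move=> /(_ _ qz); rewrite (pivot_X (subnKC rn)) => /pextP/(_ 1%N).
  by rewrite coefD coefMX coefC /= coefC addr0.
apply: pext_hge; apply: IH => // j lt.
by have := hq j (ltnW lt); rewrite pivot_polyC.
Qed.
End PolyN.

Section BasicElement.
Variables (R : comNzRingType) (n t : nat) (m P : spec R).
Hypothesis nR : noetherian R.
Hypothesis Pm : P `<=` m.
Hypothesis ht : forall h, hge P m h -> (h <= t)%N.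
Variables (M : 'M[R]_(t, n)) (c : 'I_t -> 'I_n).
Hypothesis Pdet : ~ P (\det (colsub c M)).
Variable g0 : R.
Hypothesis mg0 : m g0.

Let det := \det (colsub c M).
(** Cramer's rule: the rows of [N] are combinations of those of [M], and its columns selected by [c]
    form [det] times the identity, so each row is a pivot form for one selected variable. *)
Let N := \adj (colsub c M) *m M.

Let NE i l : N i (c l) = det *+ (i == l).
Proof.
have := mul_adj_mx (colsub c M) => /matrixP/(_ i l); rewrite !mxE => <-.
by apply: eq_bigr => j _; rewrite !mxE.
Qed.

Lemma pivot_inj : injective c.
Proof.
move=> i l Ec; apply/eqP; apply: contrapT => /negP il; apply: Pdet.
rewrite -/det; have := NE i l; rewrite -Ec NE eqxx (negPf il) mulr1n mulr0n => ->.
exact: ideal0.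
Qed.

(* The variables are reordered so that those in the range of [c] come last. *)
Let l0 := [seq j <- enum 'I_n | j \notin codom c].
Let ord := l0 ++ codom c.
Let r := size l0.

Let mem_ord j : j \in ord.
Proof. by rewrite mem_cat mem_filter mem_enum andbT; case: (j \in codom c). Qed.

Let uniq_ord : uniq ord.
Proof.
rewrite cat_uniq filter_uniq ?enum_uniq //= andbC; apply/andP; split.
  by rewrite map_inj_uniq ?enum_uniq //; exact: pivot_inj.
by apply/hasPn => j jc; rewrite mem_filter jc.
Qed.

Let size_ord : size ord = n.
Proof.
by rewrite -(card_uniqP uniq_ord) (eq_card (B := 'I_n)) ?card_ord // => j; rewrite mem_ord.
Qed.

Let rt : (r + t = n)%N.
Proof. by rewrite -size_ord size_cat size_codom card_ord. Qed.

Definition xvar j : polyN R n := varp R n (index j ord).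
Definition generic_row i : polyN R n := \sum_j cstp R n (M i j) * xvar j.

Let a (i j : nat) : R :=
  if insub i is Some i' then N i' (nth (c i') l0 j) else 0.

Lemma generic_row_pivot (q : ideal (polyN R n)) (j : nat) : (forall i, q (generic_row i)) ->
  (r + j < n)%N -> q (pivot det r a n j).
Proof.
move=> hq lt; have jt : (j < t)%N by rewrite -(ltn_add2l r) rt.
pose i := Ordinal jt.
have : q (\sum_l cstp R n (N i l) * xvar l).
  have -> : \sum_l cstp R n (N i l) * xvar l =
      \sum_e cstp R n (\adj (colsub c M) i e) * generic_row e.
    rewrite /generic_row; under [RHS]eq_bigr => e _ do rewrite mulr_sumr.
    rewrite exchange_big /=; apply: eq_bigr => l _.
    rewrite mxE rmorph_sum mulr_suml; apply: eq_bigr => e _.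
    by rewrite rmorphM mulrA.
  by apply: ideal_sum => e _; exact: idealM.
congr (q _).
have pe : perm_eq (index_enum 'I_n) ord.
  by apply: uniq_perm => //; [exact: index_enum_uniq|move=> l; rewrite mem_ord mem_index_enum].
rewrite (perm_big _ pe) big_cat /= addrC; congr (_ + _).
  rewrite big_map big_enum (bigD1 i) //= NE eqxx mulr1n big1 ?addr0.
    congr (_ * varp R n _); rewrite index_cat.
    have -> : (c i \in l0) = false by rewrite mem_filter codom_f.
    congr (_ + _)%N; rewrite /codom index_map; last exact: pivot_inj.
    by rewrite index_enum_ord.
  by move=> l /negPf il; rewrite NE eq_sym il mulr0n rmorph0 mul0r.
rewrite (big_nth (c i)) big_mkord; apply: eq_bigr => l _.
rewrite /a (insubT (fun j => j < t)%N jt) /=; congr (_ * varp R n _).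
have lr : (l < size l0)%N by [].
by rewrite index_cat mem_nth // index_uniq // filter_uniq // enum_uniq.
Qed.

Lemma xvarE : exists o : seq 'I_n,
  [/\ uniq o, size o = n, forall j, j \in o & forall j, xvar j = varp R n (index j o)].
Proof. by exists ord. Qed.

(** Parameters of [m] over [P] remain parameters for the extensions, so the extended maximal ideal
    gets no larger height over the extension of [P]. *)
Lemma extN_minover s : minover (adjs P s) m ->
  minover (adjs (extN n P) (map (cstp R n) s)) (extN n m).
Proof.
move=> [sm mm]; split.
  apply: adjs_min; first exact: extN_mono.
  by move=> _ /mapP[x xs ->]; apply/extN_cst; apply: sm; exact: adjs_in.
move=> Q sQ Qm; apply: extN_min => b mb.
have : m `<=` pre (cstp R n) Q; last exact.
apply: mm; last by move=> e /Qm/extN_cst.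
apply: adjs_min => [e Pe|e es]; apply: sQ.
  by apply: sub_adjs; exact/extN_cst.
by apply: adjs_in; exact: map_f.
Qed.

(* A prime that contains the generic rows and avoids [det * g0] has height at
   least [t] over [P], since it contains one pivot equation per column in [c];
   being strictly smaller than the extension of [m], it would give the latter
   height more than [t]. *)
Theorem generic_rows_avoid : exists h e, ~ extN n m h /\
  adjs (extN n P) [seq generic_row i | i <- enum 'I_t] (h * cstp R n (det * g0) ^+ e).
Proof.
set g := det * g0; set ys := map _ _; apply: contrapT => W.
pose A := [set b | exists h e, ~ extN n m h /\ b = h * cstp R n g ^+ e].
have A1 : A 1 by exists 1, 0%N; rewrite expr0 mulr1; split => //; exact: spec_proper.
have AM b b' : A b -> A b' -> A (b * b').
  move=> [h [e [mh ->]]] [h' [e' [mh' ->]]]; exists (h * h'), (e + e')%N.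
  by split; [exact: primeNM|rewrite exprD; ring].
have nB : noetherian (polyN R n) := polyN_noeth nR.
have [|q [Iq Aq]] := prime_avoiding nB (M := Mulset A1 AM) (I := adjs (extN n P) ys).
  by move=> _ [h [e [mh ->]]] hI; apply: W; exists h, e.
have qm : q `<=` extN n m.
  move=> h qh; apply: contrapT => mh; apply: (Aq h) => //.
  by exists h, 0%N; rewrite expr0 mulr1.
have qg : ~ q (cstp R n g).
  apply: Aq; exists 1, 1%N; rewrite expr1 mul1r; split => //; exact: spec_proper.
have hq : hge (extN n P) q t.
  have Ent : (n - r = t)%N by rewrite -[X in (X - _)%N]rt addKn.
  have rn : (r <= n)%N by rewrite -[X in (_ <= X)%N]rt leq_addr.
  rewrite -Ent; apply: (@pivot_height R P det r a n q) => //.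
  - by move=> b Pb; apply: Iq; apply: sub_adjs; exact/extN_cst.
  - by move=> qd; apply: qg; rewrite rmorphM; exact: idealMr.
  move=> j lt; apply: generic_row_pivot => // i.
  by apply: Iq; apply: adjs_in; apply: map_f; rewrite mem_enum.
have hm : hge (extN n P) (extN n m) t.+1.
  exists q; split => // mq; apply: qg; apply: mq; apply/extN_cst; exact: idealM.
have [s [st sm ms]] := sop_exists nR Pm ht.
have := height_le nB (extN_minover ms) hm; rewrite size_map => /leq_trans/(_ st).
by rewrite ltnn.
Qed.
End BasicElement.

Section Evaluation.
Variables (R B : comNzRingType) (psi : {rmorphism R -> B}).

Fixpoint evG (vals : nat -> B) n : {rmorphism polyN R n -> B} :=
  if n is l.+1 then
    @horner_morph (polyN R l) B (evG vals l) (vals l) (fun a => mulrC (vals l) (evG vals l a))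
  else psi.

Lemma evG_S vals n (u : polyN R n.+1) :
  evG vals n.+1 u = (map_poly (evG vals n) u).[vals n].
Proof. by []. Qed.

Lemma evG_cst vals n a : evG vals n (cstp R n a) = psi a.
Proof. by elim: n => [//|n IH]; rewrite evG_S /= map_polyC hornerC. Qed.

Lemma evG_var vals n i : (i < n)%N -> evG vals n (varp R n i) = vals i.
Proof.
elim: n => [//|n IH] lt; have [->|Ni] := eqVneq i n.
  by rewrite varp_X evG_S map_polyX hornerX.
have ltn : (i < n)%N by rewrite ltn_neqAle Ni -ltnS.
by rewrite varp_polyC // evG_S map_polyC hornerC; exact: IH.
Qed.

End Evaluation.

Lemma evG_ext (R B : comNzRingType) (psi psi' : {rmorphism R -> B}) vals vals' n :
  psi =1 psi' -> (forall i, (i < n)%N -> vals i = vals' i) ->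
  evG psi vals n =1 evG psi' vals' n.
Proof.
move=> hp; elim: n => [//|n IH] h u; rewrite !evG_S h //; congr _.[_].
by apply: eq_map_poly => a; apply: IH => i lt; apply: h; exact: ltnW.
Qed.

Lemma evG_comp (R B B' : comNzRingType) (psi : {rmorphism R -> B}) (chi : {rmorphism B -> B'})
    (vals : nat -> B) n u :
  chi (evG psi vals n u) = evG (chi \o psi) (chi \o vals) n u.
Proof.
elim: n u => [//|n IH] u; rewrite !evG_S -horner_map -map_poly_comp; congr _.[_].
by apply: eq_map_poly => a /=; exact: IH.
Qed.

Lemma evG_nonvanishing (R : comNzRingType) (k : fieldType) (res : {rmorphism R -> k}) n h :
  infinite_set [set: k] -> ~ extN n (pre res (fzero k)) h ->
  exists vals, evG res vals n h != 0.
Proof.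
move=> ik; elim: n h => [|n IH] h Nh; first by exists (fun=> 0); apply/eqP.
have [i Ni] : exists i, ~ extN n (pre res (fzero k)) h`_i.
  by apply: contrapT => W; apply: Nh; apply/pextP => i; apply: contrapT => Ni; apply: W; exists i.
have [vals vi] := IH _ Ni.
have [|c hc] := poly_nonroot (field_coefring ik) (p := map_poly (evG res vals n) h).
  by apply: contraNneq vi => E; have := congr1 (fun r : {poly k} => r`_i) E; rewrite coef_map coef0 => ->.
exists (fun i => if i == n then c else vals i); rewrite evG_S eqxx.
have <- : map_poly (evG res vals n) h =
    map_poly (evG res (fun i => if i == n then c else vals i) n) h; last by [].
by apply: eq_map_poly => a; apply: evG_ext => [//|j lt]; rewrite ltn_eqF.
Qed.

Section BasicElementSpecialization.
Variables (R : comNzRingType) (k : fieldType) (resR : {rmorphism R -> k}).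
Hypothesis ik : infinite_set [set: k].
Hypothesis nR : noetherian R.
Variables (A : comNzRingType) (phi : {rmorphism A -> R}) (d : nat) (x : 'I_d.+1 -> R).
Let m := pre resR (fzero k).
Hypothesis below_m : forall Q : spec R, Q `<=` m.
Variable P : spec R.
Hypothesis mP : ~ m `<=` P.
Hypothesis nP : bertini phi x m P.

(** [f] is the reduction to [k] of the polynomial [h] from [generic_rows_avoid]. If [y] were in
    [Q^2 + P] at [Q], the rows would take values in [Q], and so would [h] times a power of [g]. As
    [g] is outside [Q], the value of [h] would be in [Q], so in the maximal ideal, and [f] would
    vanish at the residues of [v]. *)
Theorem basic_element : exists g (f : {mpoly k[d.+1]}), [/\ ~ P g, f != 0 &
  forall v : 'I_d.+1 -> A, f.@[fun i => resR (phi (v i))] != 0 ->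
  forall Q : spec R, P `<=` Q -> ~ Q g -> let y := \sum_j phi (v j) * x j in Q y ->
  ~ sat Q (isum P (ideal_mul Q Q)) y].
Proof.
have [_ [t [[M [c [Pd HM]]] ht]]] := nP.
have [g0 mg0 Pg0] : exists2 g0, m g0 & ~ P g0.
  by apply: contrapT => W; apply: mP => a ma; apply: contrapT => Pa; apply: W; exists a.
have [h [e [mh hh]]] := generic_rows_avoid nR (below_m (Q := P)) ht Pd mg0.
have [o [uo so mo ox]] := xvarE Pd.
pose w i : 'I_d.+1 := nth ord0 o i.
have wj j : w (index j o) = j by exact: nth_index.
have io j : (index j o < d.+1)%N by rewrite -[X in (_ < X)%N]so index_mem.
pose f : {mpoly k[d.+1]} := evG (@mpolyC d.+1 k \o resR) (fun i => 'X_(w i)) d.+1 h.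
have fE (z : 'I_d.+1 -> k) : f.@[z] = evG resR (z \o w) d.+1 h.
  rewrite /f -[LHS]/(meval z _) evG_comp; apply: evG_ext => [a|i _] /=.
    by rewrite mevalC.
  by rewrite mevalXU.
exists (\det (colsub c M) * g0), f; split; first exact: primeNM.
- have [vals vi] := evG_nonvanishing ik mh.
  apply: contraNneq vi => f0; have := fE (fun j => vals (index j o)).
  rewrite f0 meval0 => E; apply/eqP; rewrite [RHS]E; apply: evG_ext => [//|i lt].
  by rewrite /= /w index_uniq // [X in (_ < X)%N]so.
move=> v fv Q PQ Qg y Qy Hy; have Qrow := HM Q v PQ Qy Hy.
pose ev := evG (@idfun R) (phi \o v \o w) d.+1.
have : Q (ev (h * cstp R d.+1 (\det (colsub c M) * g0) ^+ e)).
  have : adjs Q (map ev [seq generic_row M c i | i <- enum 'I_t])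
      (ev (h * cstp R d.+1 (\det (colsub c M) * g0) ^+ e)).
    apply: adjs_map hh => b Pb.
    have : extN d.+1 P `<=` preim ev Q; last exact.
    by apply: extN_min => a Pa; apply: PQ; rewrite evG_cst.
  apply: adjs_min => // _ /mapP[_ /mapP[i _ ->] ->].
  have -> : ev (generic_row M c i) = \sum_j phi (v j) * M i j; last exact: Qrow.
  rewrite rmorph_sum; apply: eq_bigr => j _.
  by rewrite rmorphM ox /ev evG_cst evG_var //= wj mulrC.
rewrite rmorphM rmorphXn /ev evG_cst -/ev => /spec_prime[|/primeX//].
move=> Qh; have mev : m (ev h) by exact: (below_m Qh).
move/eqP: fv; apply; rewrite fE -[RHS]mev /ev evG_comp.
by apply: evG_ext.
Qed.
End BasicElementSpecialization.

(** * Generic hyperplane sections *)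

Section Spreading.
Variable R : comNzRingType.
Hypothesis nR : noetherian R.
Implicit Types (I J : ideal R) (P Q : spec R) (s : seq R).

Lemma regs_spread P I s : regs I P s ->
  exists2 t, ~ P t & forall Q, P `<=` Q -> ~ Q t -> regs I Q s.
Proof.
elim: s I => [|x s IH] I; first by move=> _; exists 1; [exact: spec_proper|].
move=> [Px nx /IH[t Pt Ht]].
have [u Pu Hu] : exists2 u, ~ P u & colon I x `<=` colon I u by exact: (sat_fg nR).
exists (t * u); first exact: primeNM.
move=> Q PQ Qtu; split; first exact: PQ.
- by move=> a /Hu Iua; exists u => // Qu; apply: Qtu; exact: idealM.
- by apply: Ht => // Qt; apply: Qtu; exact: idealMr.
Qed.

(** Each of the finitely many associated primes not inside [P] has an element outside [P]; [g] is
    the product of these. *)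
Lemma ass_spread P I : exists2 g, ~ P g & forall Q, ass I Q -> ~ Q g -> Q `<=` P.
Proof.
have [ps Hps] := ass_finite nR I.
suff [g Pg Hg] : exists2 g, ~ P g & forall Q, Q \in ps -> ~ Q g -> Q `<=` P.
  by exists g => // Q /Hps; exact: Hg.
elim: ps {Hps} => [|Q ps [g Pg Hg]]; first by exists 1; [exact: spec_proper|].
have [QP|QP] := pselect (Q `<=` P).
  by exists g => // Q'; rewrite inE => /orP[/eqP->|/Hg].
have [b Qb Pb] : exists2 b, Q b & ~ P b.
  by apply: contrapT => W; apply: QP => b Qb; apply: contrapT => Pb; apply: W; exists b.
exists (b * g); first exact: primeNM.
move=> Q'; rewrite inE => /orP[/eqP->|/Hg h] Q'g.
  by case: Q'g; exact: idealMr.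
by apply: h => h'; apply: Q'g; exact: idealM.
Qed.

(** Generators of [P] at [P] still generate it nearby. Together with generators of [Q/P] their
    number is the length of a chain through [P]. *)
Lemma regular_spread P s : gens_at (izero R) P s -> hge (izero R) P (size s) ->
  generically_regular P ->
  exists2 g, ~ P g & forall Q, P `<=` Q -> ~ Q g ->
    exists2 s', gens_at (izero R) Q s' & hge (izero R) Q (size s').
Proof.
move=> [sP Ps] hs [g [Pg Hg]]; have [t Pt Ht] := sat_fg nR Ps.
exists (t * g); first exact: primeNM.
move=> Q PQ Qtg; have [|_ [s1 [s2 [[s1Q Qs1] rs2 E]]]] := Hg Q PQ.
  by move=> Qg; apply: Qtg; exact: idealM.
exists (s ++ s1); last by rewrite size_cat E; apply: hge_cat hs _; exact: regs_hge.
split=> [z|a Qa].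
  by rewrite mem_cat => /orP[/sP/PQ|/s1Q].
apply: sat_idem; rewrite adjs_cat; apply: sat_mono (Qs1 a Qa).
have PS : P `<=` sat Q (adjs (izero R) s).
  by move=> b /Ht; exists t => // Qt; apply: Qtg; exact: idealMr.
apply: adjs_min => [b /PS|b bs]; first by apply: sat_mono; exact: sub_adjs.
by apply: sub_sat; exact: adjs_in.
Qed.

(* If the depth of [P] is less than [n], then [P] is minimal over a regular
   sequence [z], and the filtration of [R/(z)] near [P] by copies of [R/P] shows
   that the localizations of [R] near [P] are Cohen-Macaulay. *)
Lemma depth_spread P n h e : is_height (izero R) P h -> is_depth (izero R) P e ->
  (minn n h <= e)%N -> generically_regular P ->
  exists2 g, ~ P g & forall Q, P `<=` Q -> ~ Q `<=` P -> ~ Q g ->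
    exists2 s, regs (izero R) Q s &
      (n < size s)%N \/ forall H, hge (izero R) Q H -> (H <= size s)%N.
Proof.
move=> [hP hmax] [[z [rz Ez]] _] le [g1 [Pg1 Hg1]].
have [t Pt Ht] := regs_spread rz; set J := adjs (izero R) z.
have zP : forall x, x \in z -> P x := regs_in rz.
(* If the depth at [P] is at least [n], a prime [Q] near [P] but not inside it is not associated to
   [J], and one more regular element makes the length exceed [n]. *)
have [ne|en] := leqP n e.
  have [g2 Pg2 Hg2] := ass_spread P J.
  exists (t * g2); first exact: primeNM.
  move=> Q PQ QP Qtg; have [|w Qw nw] := @nzd_avoid R nR [:: J] Q.
    move=> I; rewrite inE => /eqP-> aQ; apply: QP; apply: Hg2 => // Qg.
    by apply: Qtg; exact: idealM.
  exists (z ++ [:: w]); last by left; rewrite size_cat Ez addn1 ltnS.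
  apply/regs_cat; split; first by apply: Ht => // Qt; apply: Qtg; exact: idealMr.
  by split => //; apply: nw; rewrite inE.
have he : (h <= e)%N by move: le; rewrite geq_min leqNgt en.
(* Here the depth is at least the height, so a prime over [J] strictly inside [P] would give [P] too
   large a height. *)
have mJ : minover J P.
  split; first by apply: adjs_min => //; exact: izero_sub.
  move=> Q JQ QP; apply: contrapT => PQ.
  have hQ : hge (izero R) Q e.
    rewrite -Ez; apply: regs_hge => //; first exact: izero_sub.
    by apply: (regs_weak QP) rz => x xz; apply: JQ; exact: adjs_in.
  by have := hmax e.+1 (ex_intro _ Q (And3 QP PQ hQ)); rewrite ltnNge he.
have [s [g [Pg [Jg fs]]]] := filtration nR (or_introl mJ).
exists (t * g1 * g); first by do !apply: primeNM.
move=> Q PQ _ Qtg.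
have Qt : ~ Q t by move=> h'; apply: Qtg; do 2!apply: idealMr.
have Qg1 : ~ Q g1 by move=> h'; apply: Qtg; apply: idealMr; exact: idealM.
have Qg : ~ Q g by move=> h'; apply: Qtg; exact: idealM.
have [_ [s1 [s2 [gs1 rs2 E]]]] := Hg1 Q PQ Qg1.
exists (z ++ s2).
  by apply/regs_cat; split; [exact: Ht|exact: (regs_filtration PQ Qg Jg fs)].
(* [Q] is minimal over [z ++ s1], since near [P] the element [g] forces every prime over [J] inside
   [Q] to contain [P]; so its height is at most this length. *)
right=> H hH; have := height_le nR (s := z ++ s1) _ hH; rewrite !size_cat E; apply.
split.
  apply: adjs_min => [|x]; first exact: izero_sub.
  by rewrite mem_cat => /orP[/zP/PQ|]; last exact: gs1.1.
move=> Q' zQ' Q'Q; rewrite adjs_cat in zQ'.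
have JQ' : J `<=` Q' by move=> a Ja; apply: zQ'; exact: sub_adjs.
have PQ' : P `<=` Q'.
  move=> b Pb; apply: contrapT => Q'b; apply: Qg; apply: Q'Q.
  have sQ' i : (i <= size s)%N -> adjs J (take i s) `<=` Q'.
    elim: i => [|i IHi] lt; first by rewrite take0.
    apply: adjs_min => // x; rewrite (take_nth 0) // mem_rcons inE => /orP[/eqP->|xs].
      by apply: (primeMl Q'b); apply: (IHi (ltnW lt)); exact/fs.
    by apply: (IHi (ltnW lt)); exact: adjs_in.
  by apply: (sQ' (size s)) => //; rewrite take_size.
apply: (gens_minover PQ gs1).2 => //; apply: adjs_min => // x xs.
by apply: zQ'; exact: adjs_in.
Qed.
End Spreading.

Section Generic.
Variables (R : comNzRingType) (k : fieldType) (resR : {rmorphism R -> k}).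
Hypothesis ik : infinite_set [set: k].
Hypothesis nR : noetherian R.
Variables (A : comNzRingType) (phi : {rmorphism A -> R}) (d : nat) (x : 'I_d.+1 -> R).
Let m := pre resR (fzero k).
Hypothesis below_m : forall Q : spec R, Q `<=` m.
Hypothesis all_bertini : forall P : spec R, bertini phi x m P.

Let y (v : 'I_d.+1 -> A) := \sum_j phi (v j) * x j.
Let val_at (f : {mpoly k[d.+1]}) (v : 'I_d.+1 -> A) := f.@[fun i => resR (phi (v i))].

Definition generically (Good : ('I_d.+1 -> A) -> Prop) :=
  exists2 f : {mpoly k[d.+1]}, f != 0 & forall v, val_at f v != 0 -> Good v.

Lemma generically_imp (G1 G2 : ('I_d.+1 -> A) -> Prop) :
  (forall v, G1 v -> G2 v) -> generically G1 -> generically G2.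
Proof. by move=> h [f f0 hf]; exists f => // v /hf; exact: h. Qed.

Lemma generically_and (G1 G2 : ('I_d.+1 -> A) -> Prop) :
  generically G1 -> generically G2 -> generically (fun v => G1 v /\ G2 v).
Proof.
move=> [f f0 hf] [g g0 hg]; exists (f * g); first by rewrite mulf_neq0.
move=> v; rewrite /val_at mevalM mulf_eq0 negb_or => /andP[/hf h1 /hg h2].
by split.
Qed.

Lemma generically_true : generically (fun=> True).
Proof. by exists 1; [exact: oner_neq0|]. Qed.

Lemma generically_seq (T : eqType) (ts : seq T) (G : T -> ('I_d.+1 -> A) -> Prop) :
  (forall t, t \in ts -> generically (G t)) ->
  generically (fun v => forall t, t \in ts -> G t v).
Proof.
elim: ts => [|t ts IH] h; first exact: generically_imp generically_true.
have hts t' : t' \in ts -> generically (G t') by move=> ht; apply: h; rewrite inE ht orbT.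
have := generically_and (h t (mem_head _ _)) (IH hts).
by apply: generically_imp => v [h1 h2] t'; rewrite inE => /orP[/eqP->|/h2].
Qed.

Definition good_above (I : ideal R) (Good : ('I_d.+1 -> A) -> spec R -> Prop) v :=
  forall Q : spec R, I `<=` Q -> ~ m `<=` Q -> Q (y v) -> Good v Q.

Lemma generic_induction (Good : ('I_d.+1 -> A) -> spec R -> Prop) :
  (forall P : spec R, ~ m `<=` P -> exists2 g, ~ P g &
     generically (fun v => forall Q : spec R, P `<=` Q -> ~ m `<=` Q -> ~ Q g -> Q (y v) -> Good v Q)) ->
  generically (fun v => forall Q : spec R, ~ m `<=` Q -> Q (y v) -> Good v Q).
Proof.
move=> step.
suff : forall I, generically (good_above I Good).
  move=> /(_ (izero R)); apply: generically_imp => v h Q; apply: h; exact: izero_sub.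
apply: (noeth_ind nR) => I IH.
have [ps [psI Ips]] := primes_below nR I.
have : generically (fun v => forall P, P \in ps -> good_above P Good v).
  apply: generically_seq => P /psI IP.
  have [mP|mP] := pselect (m `<=` P).
    apply: generically_imp generically_true => v _ Q PQ mQ.
    by case: mQ => a /mP/PQ.
  have [g Pg Hg] := step P mP.
  have : generically (good_above (adj P g) Good).
    apply: IH; first by move=> a /IP; exact: sub_adj.
    by move=> h; apply: Pg; apply: IP; apply: h; exact: adj_in.
  move=> /(generically_and Hg); apply: generically_imp => v [h1 h2] Q PQ mQ Qy.
  have [Qg|Qg] := pselect (Q g); last exact: h1.
  by apply: h2 => //; exact: adj_min.
apply: generically_imp => v h Q IQ; have [P Pps PQ] := Ips Q IQ.
exact: (h P Pps).
Qed.

(** The case [Q = P] of [basic_element]. *)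
Lemma generic_avoid (P : spec R) : ~ m `<=` P -> generically (fun v => ~ P (y v)).
Proof.
move=> mP; have [g [f [Pg f0 H]]] := basic_element ik nR below_m mP (all_bertini P).
exists f => // v fv Py; apply: (H v fv P _ Pg Py) => //.
by apply: sub_sat; exact: isum_l.
Qed.

Lemma generic_step (P : spec R) : ~ m `<=` P -> exists2 g, ~ P g &
  generically (fun v => forall Q : spec R, P `<=` Q -> ~ Q g -> Q (y v) ->
    ~ Q `<=` P /\ ~ sat Q (isum (izero R) (ideal_mul Q Q)) (y v)).
Proof.
move=> mP; have [g [f [Pg f0 H]]] := basic_element ik nR below_m mP (all_bertini P).
exists g => //; exists f => // v fv Q PQ Qg Qy.
have N := H v fv Q PQ Qg Qy; split=> [QP|h]; apply: N.
  by apply: sub_sat; apply: isum_l; exact: QP.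
apply: sat_mono h; apply: isum_min; last exact: isum_r.
exact: izero_sub.
Qed.

Lemma generic_nzd : generically (fun v => forall Q : spec R, ~ m `<=` Q ->
  nzd_at (izero R) Q (y v)).
Proof.
have [ps Hps] := ass_finite nR (izero R).
have : generically (fun v => forall P : spec R, P \in ps -> ~ m `<=` P -> ~ P (y v)).
  apply: generically_seq => P _; have [mP|mP] := pselect (m `<=` P).
    by apply: generically_imp generically_true.
  by apply: generically_imp (generic_avoid mP).
apply: generically_imp => v h Q mQ a ya; apply: contrapT => Na.
have [P [aP PQ cP]] := ass_above nR Na.
apply: (h P (Hps _ aP)); first by move=> mP; apply: mQ => b /mP/PQ.
by apply: cP; rewrite /= mulrC.
Qed.

(** A prime of height [n] modulo [y v] may have height [n.+1] in [R], just beyond the hypothesis.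
    But near [P] the prime [Q] is strictly larger than [P]: either [P] has height at most [n] and
    its regularity spreads to [Q], or the height of [Q] is too large to matter. Then [y v], being
    outside [Q^(2)], replaces a generator. *)
Theorem generic_serreR n :
  (forall Q : spec R, ~ m `<=` Q -> forall h, is_height (izero R) Q h -> (h <= n)%N ->
     exists s, gens_at (izero R) Q s /\ is_height (izero R) Q (size s)) ->
  generically (fun v => forall Q : spec R, ~ m `<=` Q -> Q (y v) ->
    forall h, is_height (adj (izero R) (y v)) Q h -> (h <= n)%N ->
    exists s, gens_at (adj (izero R) (y v)) Q s /\ is_height (adj (izero R) (y v)) Q (size s)).
Proof.
move=> Rn; apply: generic_induction => P mP.
have [h0 [hP hmax]] := height_exists nR (@izero_sub R P).
have [g1 Pg1 Hg1] := generic_step mP.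
have [g2 Pg2 Hg2] : exists2 g, ~ P g & forall Q : spec R, P `<=` Q -> ~ Q `<=` P -> ~ Q g ->
    forall h, is_height (izero R) Q h -> (h <= n.+1)%N -> ~ m `<=` Q ->
    exists2 s, gens_at (izero R) Q s & (size s <= h)%N.
  have [h0n|h0n] := leqP h0 n.
    have [s [gs [hs _]]] := Rn P mP h0 (conj hP hmax) h0n.
    have [g Pg Hg] := regular_spread nR gs hs (all_bertini P).1.
    exists g => // Q PQ _ Qg h [_ hQ] _ _; have [s' gs' hs'] := Hg Q PQ Qg.
    by exists s' => //; exact: hQ.
  exists 1; first exact: spec_proper.
  move=> Q PQ QP _ h [_ hQ] hn _.
  have := hQ h0.+1 (ex_intro _ P (And3 PQ QP hP)).
  by move=> /leq_trans/(_ hn); rewrite ltnS leqNgt h0n.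
exists (g1 * g2); first exact: primeNM.
apply: generically_imp Hg1 => v Hv Q PQ mQ Qg Qy h hQ hn.
have [|QP Ny] := Hv Q PQ _ Qy; first by move=> h'; apply: Qg; exact: idealMr.
have Qg2 : ~ Q g2 by move=> h'; apply: Qg; exact: idealM.
have [H [HQ Hmax]] := height_exists nR (@izero_sub R Q).
have Hh : (H <= h.+1)%N by exact: (height_adj nR Qy hQ).
have [s gs sH] := Hg2 Q PQ QP Qg2 H (conj HQ Hmax) (leq_trans Hh (hn : h.+1 <= n.+1)%N) mQ.
have [s' [Es gs']] := drop_generator_sq gs Qy Ny.
exists s'; split => //; have hs := gens_height nR gs' hQ.1.
have -> : size s' = h; last exact: hQ.
by apply/eqP; rewrite eqn_leq hs andbT -ltnS Es (leq_trans sH).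
Qed.

(** Dividing by [y v] costs one in depth, so in [R] the depth at [Q] has to exceed [n] or to reach
    the height. The gain over the hypothesis comes again from [Q] being strictly larger than [P]. *)
Theorem generic_serreS n :
  (forall Q : spec R, ~ m `<=` Q -> exists h e, [/\ is_height (izero R) Q h,
     is_depth (izero R) Q e & (minn n h <= e)%N]) ->
  generically (fun v => forall Q : spec R, ~ m `<=` Q -> Q (y v) ->
    exists h e, [/\ is_height (adj (izero R) (y v)) Q h,
      is_depth (adj (izero R) (y v)) Q e & (minn n h <= e)%N]).
Proof.
move=> Sn; suff : generically (fun v => forall Q : spec R, ~ m `<=` Q -> Q (y v) ->
    exists2 s, regs (izero R) Q s &
      (n < size s)%N \/ forall H, hge (izero R) Q H -> (H <= size s)%N).
  move=> /(generically_and generic_nzd); apply: generically_imp => v [nz Hv] Q mQ Qy.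
  have [s rs Hs] := Hv Q mQ Qy; have ny := nz Q mQ.
  have yQ : adj (izero R) (y v) `<=` Q by apply: adj_min => //; exact: izero_sub.
  have [h [hQ hmax]] := height_exists nR yQ.
  have [e [[s' [rs' Es']] emax]] : exists e, is_depth (adj (izero R) (y v)) Q e.
    have [b Hb] := height_bounded nR (adj (izero R) (y v)) Q.
    have [||e [he em]] := @max_exists (fun e => exists s, regs (adj (izero R) (y v)) Q s /\ size s = e) b.
    - by exists [::].
    - by move=> e [s' [rs' <-]]; apply: Hb; exact: regs_hge.
    by exists e; split => // s' rs'; apply: em; exists s'.
  exists h, e; split => //; first by split => //; exists s'.
  (* The height in [R] is at least one more than modulo [y v], so in both cases the regular sequence
     is longer than [minn n h]. *)
  have hH := hge_nzd nR (fun _ h => h) ny hQ.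
  have big : (minn n h < size s)%N.
    by case: Hs => [ns|/(_ _ hH) hs]; rewrite gtn_min ?ns ?hs ?orbT.
  case: s rs {Hs} big => [//|z s] rs big.
  have [s'' E rs''] := regs_exchange nR erefl rs Qy ny.
  by apply: leq_trans (emax _ rs''); rewrite E.
apply: generic_induction => P mP.
have [h0 [e0 [hP dP le]]] := Sn P mP.
have [g1 Pg1 Hg1] := generic_step mP.
have [g2 Pg2 Hg2] := depth_spread nR hP dP le (all_bertini P).1.
exists (g1 * g2); first exact: primeNM.
apply: generically_imp Hg1 => v Hv Q PQ mQ Qg Qy.
have [|QP _] := Hv Q PQ _ Qy; first by move=> h'; apply: Qg; exact: idealMr.
by apply: Hg2 => // h'; apply: Qg; exact: idealM.
Qed.
End Generic.

(** * Open subsets of projective space *)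

Lemma mpoly_nonvanishing (k : fieldType) n (f : {mpoly k[n]}) :
  infinite_set [set: k] -> f != 0 -> exists w, f.@[w] != 0.
Proof.
move=> ik f0; pose vals i : {mpoly k[n]} := if insub i is Some j then 'X_j else 0.
pose ev := evG (@mpolyC n k) vals n.
have evX (j : 'I_n) : ev (varp k n j) = 'X_j.
  by rewrite /ev evG_var // /vals valK.
pose D g := exists h, ev h = g.
have [h Eh] : D f.
  rewrite [f]mpolyE; apply: (big_ind D) => [|_ _ [a <-] [b <-]|m _].
  - by exists 0; rewrite rmorph0.
  - by exists (a + b); rewrite rmorphD.
  have [h Eh] : D 'X_[m].
    rewrite mpolyXE_id; apply: (big_ind D) => [|_ _ [a <-] [b <-]|j _].
    - by exists 1; rewrite rmorph1.
    - by exists (a * b); rewrite rmorphM.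
    by exists (varp k n j ^+ m j); rewrite rmorphXn /= evX.
  by exists (cstp k n f@_m * h); rewrite rmorphM Eh /ev evG_cst mul_mpolyC.
have Nh : ~ extN n (pre (@idfun k) (fzero k)) h.
  move=> hh; have : izero (polyN k n) h.
    have sub : extN n (pre (@idfun k) (fzero k)) `<=` izero (polyN k n).
      by apply: (@extN_min k n _ (izero (polyN k n))) => a /= ->; exact: rmorph0.
    exact: sub.
  by move=> /= h0; move/eqP: f0; apply; rewrite -Eh h0 rmorph0.
have [w hw] := evG_nonvanishing ik Nh; exists (fun j : 'I_n => w j).
rewrite -Eh -[X in X != 0]/(meval _ _) evG_comp; apply: contraNneq hw => <-.
apply/eqP; apply: evG_ext => [a|i lt] /=; first by rewrite mevalC.
by rewrite /vals insubT mevalXU.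
Qed.

Lemma meval_homog (k : fieldType) n (f : {mpoly k[n]}) e c (w : 'I_n -> k) :
  f \is e.-homog -> f.@[fun i => c * w i] = c ^+ e * f.@[w].
Proof.
move=> /dhomogP hf; rewrite !mevalE mulr_sumr; apply: eq_big_seq => m mf.
rewrite mulrCA; congr (_ * _); have -> : e = mdeg m by rewrite -(hf m mf).
rewrite mdegE -prodrXr -big_split.
by apply: eq_bigr => i _; rewrite exprMn.
Qed.

Section ZariskiGeneric.
Local Open Scope quotient_scope.
Variables (k : fieldType) (A : comUnitRingType) (res : {rmorphism A -> k}) (d : nat).
Hypothesis ik : infinite_set [set: k].
Hypothesis res_surj : forall c, exists a, res a = c.
Variable Good : ('I_d.+1 -> A) -> Prop.
Hypothesis Good_scale : forall c v, res c != 0 -> Good (fun i => c * v i) -> Good v.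
Variable f : {mpoly k[d.+1]}.
Hypothesis f0 : f != 0.
Hypothesis Good_f : forall v, f.@[fun i => res (v i)] != 0 -> Good v.

Let comp e := pihomog mdeg e f.
Let compH e : comp e \is e.-homog. Proof. exact: pihomogP. Qed.
Let compE : f = \sum_(e < msize f) comp e. Proof. exact: pihomog_partitionE. Qed.

(** [f] need not be homogeneous, so its components are used. A nonzero component at a point only
    makes [f] nonzero at some multiple of the coordinates, which is enough by [Good_scale]. *)
Definition generic_open : set (proj k d) :=
  [set a | exists e : 'I_(msize f), ~ vanishes (comp e) a].

Lemma generic_open_open : zariski_open generic_open.
Proof.
exists [set g | exists e : 'I_(msize f), g = comp e]; split.
  by move=> _ [e ->]; exists e.
apply/seteqP; split=> a; rewrite /generic_open /=.
  by move=> Na _ [e ->]; apply: contrapT => h; apply: Na; exists e.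
by move=> h [e]; apply; apply: h; exists e.
Qed.

Lemma generic_open_dense : zariski_dense generic_open.
Proof.
move=> V [F [_ VF]] [a Va].
have [g Fg ga] : exists2 g, F g & ~ vanishes g a.
  apply: contrapT => W; have : (~` V) a; last by [].
  by rewrite VF => g Fg; apply: contrapT => h; apply: W; exists g.
have g0 : g != 0 by apply/eqP => g0; apply: ga => v _; rewrite g0 meval0.
have [e ce] : exists e : 'I_(msize f), comp e != 0.
  apply: contrapT => W; move/eqP: f0; apply; rewrite compE big1 // => e _.
  by apply/eqP; apply: contrapT => /negP h; apply: W; exists e.
(* The last factor makes the first coordinate nonzero, so that the values are the coordinates of a
   point. *)
have [|w] := @mpoly_nonvanishing k d.+1 (comp e * g * 'X_ord0) ik.
  by rewrite !mulf_neq0 // -msize_poly_eq0 msizeX.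
rewrite !mevalM mevalXU !mulf_eq0 !negb_or => /andP[/andP[cw gw] w0].
have Uw : [exists i, (\row_i w i : 'rV[k]_d.+1) 0 i \is a GRing.unit].
  by apply/existsP; exists ord0; rewrite mxE unitfE.
pose v : plift k d := exist _ (\row_i w i) Uw.
have Ew (h : {mpoly k[d.+1]}) : h.@[fun i => val v 0 i] = h.@[w].
  by apply: meval_eq => i; rewrite mxE.
exists (\pi_(proj k d) v); split.
  apply: contrapT => NV; have : (~` V) (\pi_(proj k d) v) by [].
  by rewrite VF => /(_ g Fg v erefl) /eqP; rewrite Ew (negPf gw).
by exists e => /(_ v erefl) /eqP; rewrite Ew (negPf cw).
Qed.

Lemma generic_open_good (a : proj A d) : generic_open (Sp res a) ->
  forall v : plift A d, lift_of v a -> Good (fun i => val v 0 i).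
Proof.
move=> [e Ne] v va; pose w i := res (val v 0 i).
have [v0 Ev0 ev0] : exists2 v0 : plift k d, \pi_(proj k d) v0 = Sp res a &
    (comp e).@[fun i => val v0 0 i] != 0.
  apply: contrapT => W; apply: Ne => v0 E; apply/eqP; apply: contrapT => /negP h.
  by apply: W; exists v0.
have ew : (comp e).@[w] != 0.
  have : \pi_(proj k d) (lift_res res v) = \pi_(proj k d) v0 by rewrite Ev0 -va Sp_pi.
  move=> /eqmodP/asboolP[u _ Eu]; apply: contraNneq ev0 => cw.
  rewrite (@meval_eq _ _ _ (fun i => u * w i)); last by move=> i; rewrite Eu !mxE.
  by rewrite (meval_homog _ _ (compH e)) cw mulr0.
pose p := \poly_(e < msize f) (comp e).@[w].
have pE c : p.[c] = f.@[fun i => c * w i].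
  rewrite horner_poly [in RHS]compE raddf_sum; apply: eq_bigr => i _ /=.
  by rewrite (meval_homog _ _ (compH i)) mulrC.
(* The factor ['X] excludes the scalar zero. *)
have p0 : p * 'X != 0.
  rewrite mulf_neq0 ?polyX_eq0 //; apply: contraNneq ew => p0.
  by have := congr1 (fun r : {poly k} => r`_e) p0; rewrite coef_poly ltn_ord coef0 => ->.
have [c] := poly_nonroot (field_coefring ik) p0.
rewrite hornerM hornerX mulf_eq0 negb_or pE => /andP[fc c0].
have [b Eb] := res_surj c; apply: (Good_scale (c := b)); first by rewrite Eb.
apply: Good_f; rewrite (@meval_eq _ _ _ (fun i => c * w i)) // => i.
by rewrite rmorphM Eb.
Qed.
End ZariskiGeneric.

Section Specialized.
Variables (R : comNzRingType) (m : ideal R) (k : fieldType) (resR : {rmorphism R -> k}) (p : nat).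
Variables (A : idomainType) (piA : A) (resA : {rmorphism A -> k}) (phi : {rmorphism A -> R}).
Variables (d : nat) (x : 'I_d.+1 -> R).
Hypothesis nR : noetherian R.
Hypothesis lR : local_ring m.
Hypothesis mR : residue_map m resR.
Hypothesis ik : infinite_set [set: k].
Hypothesis cA : coefficient_ring resR p piA resA phi.

Let mx := pre resR (fzero k).

Lemma below_max (Q : spec R) : Q `<=` mx.
Proof.
move=> a Qa; apply/(mR.2 a); apply: contrapT => Na.
have [u ua] := local_unit nR lR Na.
by apply: (spec_proper (s := Q)); rewrite -ua; exact: idealM.
Qed.

Lemma punctured_max (P : spec R) : punctured_spec m P <-> ~ mx `<=` P.
Proof.
split=> [Pm mP|mP Pm].
  by apply: Pm; apply/seteqP; split=> a; [move/below_max/(mR.2 a)|move/(mR.2 a)/mP].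
by apply: mP => a /(mR.2 a); rewrite -Pm.
Qed.

(** The property is a statement about the ideal generated by the linear combination, which does not
    change when the lift is scaled by a unit; this is what [Good_scale] asks for. *)
Lemma zariski_specialize (G : spec R -> ideal R -> Prop) :
  generically resR phi (fun v => forall Q : spec R, ~ mx `<=` Q ->
    Q (\sum_j phi (v j) * x j) -> G Q (adj (izero R) (\sum_j phi (v j) * x j))) ->
  exists U : set (proj k d), [/\ zariski_open U, zariski_dense U
    & forall a : proj A d, (Sp resA @^-1` U) a ->
      forall v : plift A d, lift_of v a -> forall Q : spec R,
      punctured_spec m Q -> Q (lincomb phi x (val v)) ->
      G Q (adj (izero R) (lincomb phi x (val v)))].
Proof.
move=> [f f0 Hf]; exists (generic_open f); split.
- exact: generic_open_open.
- exact: generic_open_dense.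
have [_ rA _ _ phi_res] := cA.
have cr := dvr_coefring ik cA.
move=> a Ua v va Q /punctured_max mQ Qv.
pose Good (v : 'I_d.+1 -> A) := forall Q : spec R, ~ mx `<=` Q ->
    Q (\sum_j phi (v j) * x j) -> G Q (adj (izero R) (\sum_j phi (v j) * x j)).
apply: (generic_open_good ik rA.1 (Good := Good) _ _ Ua va) => // [c w c0 Gw Q' mQ' Qw|w fw].
  have Ec : \sum_j phi (c * w j) * x j = phi c * \sum_j phi (w j) * x j.
    by rewrite mulr_sumr; apply: eq_bigr => j _; rewrite rmorphM mulrA.
  have uc : isunit (phi c).
    have [|u uc] := cr_unit cr (a := c); first exact/eqP.
    by exists (phi u); rewrite -rmorphM uc rmorph1.
  have := Gw Q' mQ'; rewrite Ec adj_unit //; apply.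
  exact: idealM.
apply: Hf; rewrite (@meval_eq _ _ _ (fun i => resA (w i))); first exact: fw.
by move=> i; exact: phi_res.
Qed.

End Specialized.

Theorem corollary6p1
    (R : comNzRingType) (m : ideal R) (k : fieldType)
    (resR : {rmorphism R -> k}) (p : nat)
    (A : idomainType) (piA : A) (resA : {rmorphism A -> k})
    (phi : {rmorphism A -> R}) (d : nat) (x : 'I_d.+1 -> R) (n : nat) :
  noetherian R -> local_ring m -> residue_map m resR -> adic_complete m ->
  mixed_characteristic R k p -> infinite_set [set: k] ->
  coefficient_ring resR p piA resA phi ->
  minimal_generators m x ->
  ((forall P : spec R, punctured_spec m P -> serreR (loc_at P) n) ->
   exists U : set (proj k d),
     [/\ zariski_open U, zariski_dense U
       & forall a : proj A d, (Sp resA @^-1` U) a ->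
         forall v : plift A d, lift_of v a ->
         forall P : spec R,
           (punctured_spec m `&` primes_over (lincomb phi x (val v))) P ->
           serreR (loc_quo P (lincomb phi x (val v))) n]) /\
  ((forall P : spec R, punctured_spec m P -> serreS (loc_at P) n) ->
   exists U : set (proj k d),
     [/\ zariski_open U, zariski_dense U
       & forall a : proj A d, (Sp resA @^-1` U) a ->
         forall v : plift A d, lift_of v a ->
         forall P : spec R,
           (punctured_spec m `&` primes_over (lincomb phi x (val v))) P ->
           serreS (loc_quo P (lincomb phi x (val v))) n]).
Proof.
move=> nR lR mR cR [_ _ ck] ik cA [gx _].
have below := below_max nR lR mR.
have bertinix P : bertini phi x (pre resR (fzero k)) P := complete_bertini mR cR ck ik cA gx P.
have punc := punctured_max nR lR mR.
have spec_sub (P Q : spec R) : punctured_spec m P -> Q `<=` P -> punctured_spec m Q.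
  by move=> /punc mP QP; apply/punc => mQ; apply: mP => a /mQ/QP.
split=> Serre.
  have gen : forall Q : spec R, ~ pre resR (fzero k) `<=` Q -> forall h,
      is_height (izero R) Q h -> (h <= n)%N ->
      exists s, gens_at (izero R) Q s /\ is_height (izero R) Q (size s).
    by move=> Q /punc mQ h; apply: (serreR_at nR); exact: Serre.
  have [U [oU dU HU]] := zariski_specialize nR lR mR ik cA
    (G := fun Q I => forall h, is_height I Q h -> (h <= n)%N ->
       exists s, gens_at I Q s /\ is_height I Q (size s))
    (generic_serreR ik nR below bertinix gen).
  exists U; split=> // a Ua v va P [mP Px]; apply: (serreR_quo nR) => Q h QP Qx.
  exact: (HU a Ua v va Q (spec_sub _ _ mP QP) Qx).
have gen : forall Q : spec R, ~ pre resR (fzero k) `<=` Q -> exists h e,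
    [/\ is_height (izero R) Q h, is_depth (izero R) Q e & (minn n h <= e)%N].
  by move=> Q /punc mQ; apply: serreS_at; exact: Serre.
have [U [oU dU HU]] := zariski_specialize nR lR mR ik cA
  (G := fun Q I => exists h e, [/\ is_height I Q h, is_depth I Q e & (minn n h <= e)%N])
  (generic_serreS ik nR below bertinix gen).
exists U; split=> // a Ua v va P [mP Px]; apply: serreS_quo => Q QP Qx.
exact: (HU a Ua v va Q (spec_sub _ _ mP QP) Qx).
Qed.
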